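(* Let $L\ge0$ be an integer and let $\beta\in\mathbb{C}$ with $\operatorname{Re}\beta>0$, $\beta\notin\mathbb{Z}$. Let $\widetilde{\Phi}^{(\beta)}_L(z,\bar z;0)$ be the two-dimensional conformal $L$-loop ladder function defined in the context. Then for all $z\in\mathbb{C}$ with $0<|z|<1$, $$\widetilde{\Phi}^{(\beta)}_L(z,\bar z;0)=4^{-\beta(L+1)}\sum_{n\in\mathbb{Z}}\int d\nu\,\frac{\Gamma^{L+1}\left(\frac{n+1}{2}-\beta+i\nu\right)\Gamma^{L+1}\left(\frac{n+1}{2}-i\nu\right)}{\Gamma^{L+1}\left(\frac{n+1}{2}+\beta-i\nu\right)\Gamma^{L+1}\left(\frac{n+1}{2}+i\nu\right)}\,z^{i\nu+\frac n2}\,\bar z^{\,i\nu-\frac n2}$$ $$=\frac{2\pi}{L!}\,4^{-\beta(L+1)}\,\partial_\varepsilon^{L}\Big|_{\varepsilon=0}\;\varepsilon^{L+1}\,(z\bar z)^{\frac12-\varepsilon}\,\frac{\sin^{L+1}\left(\pi(\beta+\varepsilon)\right)}{\sin^{L+1}(\pi\varepsilon)}\,F_L(\beta,\varepsilon|z)\,F_L(\beta,\varepsilon|\bar z),$$ where $$F_L(\beta,\varepsilon|z)=\sum_{k=0}^\infty\frac{\Gamma^{L+1}(1-\beta+k-\varepsilon)}{\Gamma^{L+1}(1+k-\varepsilon)}\,z^k .$$ In the first expression the integral in the $n$-th term is taken over the contour $\mathcal{C}_{|n|}$ described in the context.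
   Context: $\bar z$ is the complex conjugate of $z$, and $z^{i\nu+n/2}\bar z^{\,i\nu-n/2}:=(z\bar z)^{i\nu-n/2}z^{n}$ with $(z\bar z)^{a}=e^{a\log|z|^2}$. The operator $\partial_\varepsilon^L|_{\varepsilon=0}$ acts on the entire product to its right (with $\varepsilon/\sin(\pi\varepsilon)$ extended by $1/\pi$ at $\varepsilon=0$). For integers $n$ put $$\tau_{n,\nu}(\beta;0)=4^\beta\,\frac{\Gamma\left(\frac{n+1}{2}+\beta-i\nu\right)}{\Gamma\left(\frac{n+1}{2}-\beta+i\nu\right)}\,\frac{\Gamma\left(\frac{n+1}{2}+i\nu\right)}{\Gamma\left(\frac{n+1}{2}-i\nu\right)} .$$ The two-dimensional ladder function is $$\widetilde{\Phi}^{(\beta)}_L(z,\bar z;0)=\int_{\mathcal{C}_0}d\nu\,\frac{(z\bar z)^{i\nu}}{[\tau_{0,\nu}(\beta;0)]^{L+1}}+\sum_{n=1}^\infty(z^n+\bar z^n)\int_{\mathcal{C}_n}d\nu\,\frac{(z\bar z)^{i\nu-n/2}}{[\tau_{n,\nu}(\beta;0)]^{L+1}} .$$ For $n\ge0$ the contour $\mathcal{C}_n$ runs from $-\infty$ to $+\infty$, coincides with the real axis outside a compact set, and separates the two series of points $\nu=i\left(\frac{n+1}{2}-\beta\right)+ik$ (above it) and $\nu=-i\,\frac{n+1}{2}-ik$ (below it), $k=0,1,2,\dots$ (for $0<\operatorname{Re}\beta<\frac12$ it is the real line). Integrals that are not absolutely convergent are understood as improper integrals. *)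

(* Defs.v *)
From Stdlib Require Export Reals ZArith.
From Coquelicot Require Export Coquelicot.

Open Scope R_scope.
Open Scope C_scope.

Definition Cexp (z : C) : C :=
  (exp (Re z) * cos (Im z), exp (Re z) * sin (Im z))%R.

Definition Csin (z : C) : C := (Cexp (Ci * z) - Cexp (- (Ci * z))) / (2 * Ci).

(* [x ^ a = e ^ (a ln x)] for [0 < x]. *)
Definition Rcpow (x : R) (a : C) : C := Cexp (a * RtoC (ln x)).

(* [(z \bar z) ^ a] for [z <> 0]. *)
Definition abs2_pow (z a : C) : C := Rcpow (Cmod z ^ 2)%R a.

Definition Cpow_Z (z : C) (n : Z) : C :=
  match n with
  | Z0 => 1
  | Zpos p => z ^ Pos.to_nat p
  | Zneg p => / z ^ Pos.to_nat p
  end.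

(* [z ^ (i nu + n/2) \bar z ^ (i nu - n/2)]. *)
Definition conj_pow (z : C) (n : Z) (nu : C) : C :=
  abs2_pow z (Ci * nu - RtoC (IZR n / 2)) * Cpow_Z z n.

Definition Clim_seq (u : nat -> C) : C :=
  iota (T := C_CompleteNormedModule)
    (fun l => filterlim u eventually (locally l)).

Definition CSeries (a : nat -> C) : C :=
  iota (T := C_CompleteNormedModule) (fun l => is_series a l).

Definition CSeries_Z (a : Z -> C) : C :=
  CSeries (fun n => a (Z.of_nat n)) + CSeries (fun n => a (- Z.of_nat (S n))%Z).

Definition ex_CSeries_Z (a : Z -> C) : Prop :=
  ex_series (fun n => a (Z.of_nat n)) /\
  ex_series (fun n => a (- Z.of_nat (S n))%Z).

Fixpoint rising (z : C) (m : nat) : C :=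
  match m with
  | O => 1
  | S k => rising z k * (z + INR k)
  end.

(* Gauss's limit  m! m^z / (z (z+1) ... (z+m)).  Since [/ 0 = 0], at a pole
   both [Gamma] and [/ Gamma] take the value 0; for [/ Gamma] this is the value
   of the entire function. *)
Definition Gamma (z : C) : C :=
  Clim_seq (fun m => INR (fact m) * Rcpow (INR m) z / rising z (S m)).

Fixpoint C_derive_n (f : C -> C) (n : nat) : C -> C :=
  match n with
  | O => f
  | S k => C_derive (C_derive_n f k)
  end.

Definition C_differentiable_n (f : C -> C) (n : nat) (x : C) : Prop :=
  forall k : nat, (k < n)%nat -> locally x (fun y => ex_derive (C_derive_n f k) y).

Definition velocity (gam : R -> C) (t : R) : C :=
  (Derive (fun s => Re (gam s)) t, Derive (fun s => Im (gam s)) t).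

(* The velocity may vanish, so contours with corners are not excluded: they have
   such parametrizations as well. *)
Definition C1_path (gam : R -> C) : Prop :=
  forall t : R,
    ex_derive (fun s => Re (gam s)) t /\ ex_derive (fun s => Im (gam s)) t /\
    continuous (velocity gam) t.

(* [p] lies in the component of the complement of the curve that contains
   [i y] for all large [y], resp. [- i y]. *)
Definition above (gam : R -> C) (p : C) : Prop :=
  exists sigma : R -> C,
    (forall s : R, continuous sigma s) /\ sigma 0%R = p /\
    (forall s t : R, (0 <= s)%R -> sigma s <> gam t) /\
    is_lim (fun s => Im (sigma s)) p_infty p_infty.

Definition below (gam : R -> C) (p : C) : Prop :=
  exists sigma : R -> C,
    (forall s : R, continuous sigma s) /\ sigma 0%R = p /\
    (forall s t : R, (0 <= s)%R -> sigma s <> gam t) /\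
    is_lim (fun s => Im (sigma s)) p_infty m_infty.

Definition half_succ (n : Z) : C := RtoC ((IZR n + 1) / 2).

Definition is_ladder_contour (beta : C) (n : nat) (gam : R -> C) : Prop :=
  C1_path gam /\
  (exists T : R, forall t : R, (T <= Rabs t)%R -> gam t = RtoC t) /\
  (forall k : nat,
     above gam (Ci * (half_succ (Z.of_nat n) - beta) + Ci * INR k)) /\
  (forall k : nat,
     below gam (- (Ci * half_succ (Z.of_nat n)) - Ci * INR k)).

Definition contour_integrable (gam : R -> C) (f : C -> C) : Prop :=
  ex_RInt_gen (V := C_R_NormedModule) (fun t => f (gam t) * velocity gam t)
    (Rbar_locally m_infty) (Rbar_locally p_infty).

Definition contour_integral (gam : R -> C) (f : C -> C) : C :=
  RInt_gen (V := C_R_CompleteNormedModule)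
    (fun t => f (gam t) * velocity gam t)
    (Rbar_locally m_infty) (Rbar_locally p_infty).

Definition tau (n : Z) (nu beta : C) : C :=
  Rcpow 4 beta *
  (Gamma (half_succ n + beta - Ci * nu) / Gamma (half_succ n - beta + Ci * nu)) *
  (Gamma (half_succ n + Ci * nu) / Gamma (half_succ n - Ci * nu)).

Definition ladder_integrand (L : nat) (beta z : C) (n : nat) (nu : C) : C :=
  abs2_pow z (Ci * nu - RtoC (INR n / 2)) / tau (Z.of_nat n) nu beta ^ S L.

Definition ladder_term
    (L : nat) (beta : C) (gam : nat -> R -> C) (z : C) (n : nat) : C :=
  (z ^ n + Cconj z ^ n) * contour_integral (gam n) (ladder_integrand L beta z n).

Definition ladder (L : nat) (beta : C) (gam : nat -> R -> C) (z : C) : C :=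
  contour_integral (gam O) (ladder_integrand L beta z 0) +
  CSeries (fun n => ladder_term L beta gam z (S n)).

Definition ladder_converges
    (L : nat) (beta : C) (gam : nat -> R -> C) (z : C) : Prop :=
  (forall n : nat, contour_integrable (gam n) (ladder_integrand L beta z n)) /\
  ex_series (fun n => ladder_term L beta gam z (S n)).

Definition gamma_quotient (L : nat) (beta : C) (n : Z) (nu : C) : C :=
  Gamma (half_succ n - beta + Ci * nu) ^ S L * Gamma (half_succ n - Ci * nu) ^ S L /
  (Gamma (half_succ n + beta - Ci * nu) ^ S L * Gamma (half_succ n + Ci * nu) ^ S L).

(* For [n < 0] poles of the numerator and of the denominator of [gamma_quotient]
   can coincide; [C_lim] fills in these removable singularities. *)
Definition mellin_integrand (L : nat) (beta z : C) (n : Z) (nu : C) : C :=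
  C_lim (gamma_quotient L beta n) nu * conj_pow z n nu.

Definition mellin_term
    (L : nat) (beta : C) (gam : nat -> R -> C) (z : C) (n : Z) : C :=
  contour_integral (gam (Z.abs_nat n)) (mellin_integrand L beta z n).

Definition F_coef (L : nat) (beta eps z : C) (k : nat) : C :=
  Gamma (1 - beta + INR k - eps) ^ S L / Gamma (1 + INR k - eps) ^ S L * z ^ k.

Definition F (L : nat) (beta eps z : C) : C := CSeries (F_coef L beta eps z).

Definition div_sin (eps : C) : C :=
  if Ceq_dec eps 0 then / PI else eps / Csin (PI * eps).

Definition residue_function (L : nat) (beta z eps : C) : C :=
  div_sin eps ^ S L * abs2_pow z (1 / 2 - eps) * Csin (PI * (beta + eps)) ^ S L *
  F L beta eps z * F L beta eps (Cconj z).

(* Main.v *)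
(* Near its k-th lower pole, nu = -i((n+1)/2 + k) + i eps, Euler's reflection
   formula turns the n-th integrand into Phi(eps) c_{n+k}(eps) c_k(eps) (z z~)^k, where
   c_k(eps) z^k is the k-th term of F_L and Phi(eps) carries the sines and the power
   (z z~)^(1/2 - eps).  The bound |Gamma(u - beta) / Gamma(u)| = O(|u|^(- Re beta)) in
   the right half-plane allows the contour to be closed downwards, first by the bottom
   of a rectangle at depth K -> oo, where |z| < 1 gives the decay, then by its sides,
   so that the n-th integral is
     -i oint_{|eps|=r} Phi(eps) sum_k c_{n+k}(eps) c_k(eps) (z z~)^k d eps.
   Weighting by z^n (n >= 0) and by z~^|n| (n < 0) and summing over n completes the
   sum over k to the double series F_L(beta, eps | z) F_L(beta, eps | z~), and
   Cauchy's formula turns the circle integral into the L-th derivative at 0.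

   A contour is only known topologically: it separates the two series of poles.
   Since exp of the integral of dnu / (nu - p) along the contour is an elementary
   function of p, that integral is determined by continuity along a path from p to
   infinity that avoids the contour; the residue theorem is then obtained by closing
   the contour to a cycle with explicit winding numbers. *)

Require Import Defs.
From Stdlib Require Import Lra Lia Classical ClassicalEpsilon FunctionalExtensionality List.
From Stdlib Require FinFun.
Import ListNotations.

(** * Complex derivatives and integrals along real intervals *)

(** All computations use the entire function [1 / Gamma]: since [/ 0 = 0], it has its true value 0
    at the poles of [Gamma], and inverting needs no side condition. As only Re beta > 0 is given,
    the integrals need not converge absolutely, and the estimates are made for finite ends - R1 and
    R2. The bottom of the rectangle costs a multiple of (R1 + R2) |z|^(2K), which is not uniform in
    the width; the sides cost a multiple of R1^(- Re beta (L+1)) + R2^(- Re beta (L+1)), uniformly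
    in the depth. Hence K tends to infinity at fixed R1 and R2, and a rate in each end separately
    remains, as an improper integral demands. That beta is not an integer enters through the
    distances between upper and lower poles, which are |beta - m| with integers m: one radius of the
    small circles serves all n and k. Residues at the poles of higher order are never computed. The
    small circles stay in the cycle, whose winding number about each pole must then vanish, and
    since all circles share the variable eps, the sums over k and n move under a single circle
    integral. *)

Notation is_Cderive f z l :=
  (@is_derive C_AbsRing C_NormedModule (f : C -> C) (z : C) (l : C)).
Notation Ccont f z := (@continuous C_UniformSpace C_UniformSpace f z).

(** The two module structures of [C] over itself have the same operations and norm, so only the
    linearity record has to be rebuilt. The product rule lives in the structure on the right. *)
Lemma is_Cderive_absring (f : C -> C) (z l : C) :
  is_Cderive f z l <-> @is_derive C_AbsRing (AbsRing_NormedModule C_AbsRing) f z l.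
Proof.
split; intros [H1 H2]; split.
- destruct H1 as [a b c]. split; [exact a|exact b|exact c].
- exact H2.
- destruct H1 as [a b c]. split; [exact a|exact b|exact c].
- exact H2.
Qed.

Lemma is_Cderive_mult (f g : C -> C) (z df dg : C) :
  is_Cderive f z df -> is_Cderive g z dg ->
  is_Cderive (fun w => f w * g w) z (df * g z + f z * dg).
Proof.
intros Hf Hg. apply is_Cderive_absring.
apply (@is_derive_mult C_AbsRing f g z df dg).
- now apply is_Cderive_absring.
- now apply is_Cderive_absring.
- exact Cmult_comm.
Qed.

Lemma is_Cderive_comp (f g : C -> C) (z df dg : C) :
  is_Cderive f (g z) df -> is_Cderive g z dg ->
  is_Cderive (fun w => f (g w)) z (df * dg).
Proof.
intros Hf Hg. rewrite Cmult_comm.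
apply (@is_derive_comp C_AbsRing C_NormedModule f g z df dg); [exact Hf|].
now apply is_Cderive_absring.
Qed.

Lemma is_Cderive_plus (f g : C -> C) (z df dg : C) :
  is_Cderive f z df -> is_Cderive g z dg ->
  is_Cderive (fun w => f w + g w) z (df + dg).
Proof. apply (@is_derive_plus C_AbsRing C_NormedModule). Qed.

(** The uniform structure of [C] is that of pairs, with boxes as balls; [locally_C] passes to the
    discs of [Cmod]. *)
Lemma Ccont_eps (f : C -> C) (z : C) :
  Ccont f z <-> (forall eps : R, (0 < eps)%R -> exists d : R, (0 < d)%R /\
     forall w : C, (Cmod (w - z) < d)%R -> (Cmod (f w - f z) < eps)%R).
Proof.
split.
- intros H eps Heps.
  assert (H1 : @locally (AbsRing_UniformSpace C_AbsRing) z
     (fun w => @ball (AbsRing_UniformSpace C_AbsRing) (f z) eps (f w))).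
  { apply locally_C. apply (H (fun y => @ball (AbsRing_UniformSpace C_AbsRing) (f z) eps y)).
    apply locally_C. exists (mkposreal _ Heps). intros y Hy. exact Hy. }
  destruct H1 as [d Hd]. exists d. split; [apply cond_pos|]. intros w Hw. apply (Hd w). exact Hw.
- intros H P HP. apply locally_C in HP. destruct HP as [e He].
  destruct (H e (cond_pos e)) as [d [Hd H1]].
  apply locally_C. exists (mkposreal d Hd). intros w Hw. apply He. apply H1. exact Hw.
Qed.

Lemma is_Cderive_eps (f : C -> C) (z l : C) :
  is_Cderive f z l <-> (forall eps : R, (0 < eps)%R -> exists d : R, (0 < d)%R /\
     forall w : C, (Cmod (w - z) < d)%R ->
       (Cmod (f w - f z - l * (w - z)) <= eps * Cmod (w - z))%R).
Proof.
split.
- intros [_ H] eps Heps.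
  destruct (H z (fun P HP => HP) (mkposreal _ Heps)) as [d Hd].
  exists d. split; [apply cond_pos|]. intros w Hw. rewrite (Cmult_comm l).
  apply (Hd w). exact Hw.
- intros H. split.
  + apply (@is_linear_scal_l C_AbsRing C_NormedModule).
  + intros x Hx. assert (E : z = x).
    { apply (@is_filter_lim_locally_unique C_AbsRing (AbsRing_NormedModule C_AbsRing)). exact Hx. }
    subst x. intros eps. destruct (H eps (cond_pos eps)) as [d [Hd H1]].
    exists (mkposreal d Hd). intros w Hw. specialize (H1 w Hw).
    rewrite (Cmult_comm l) in H1. exact H1.
Qed.

Notation is_Rderive g t l :=
  (@is_derive R_AbsRing C_R_NormedModule (g : R -> C) (t : R) (l : C)).
Notation continuous_C T f x := (@continuous T C_UniformSpace f x).
Notation RxC := (prod_UniformSpace R_UniformSpace C_UniformSpace).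

Lemma continuous_absring (T : UniformSpace) (f : T -> C) (x : T) :
  continuous_C T f x <-> @continuous T (AbsRing_UniformSpace C_AbsRing) f x.
Proof.
split; intros H P HP; apply H; now apply locally_C.
Qed.

Lemma continuous_Cmult (T : UniformSpace) (f g : T -> C) (x : T) :
  continuous_C T f x -> continuous_C T g x -> continuous_C T (fun t => f t * g t) x.
Proof.
intros Hf Hg. apply continuous_absring.
apply (@continuous_mult T C_AbsRing); now apply continuous_absring.
Qed.

Lemma continuous_Cplus (T : UniformSpace) (f g : T -> C) (x : T) :
  continuous_C T f x -> continuous_C T g x -> continuous_C T (fun t => f t + g t) x.
Proof. apply (@continuous_plus T C_AbsRing C_NormedModule). Qed.

Lemma continuous_Copp (T : UniformSpace) (f : T -> C) (x : T) :
  continuous_C T f x -> continuous_C T (fun t => - f t) x.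
Proof. apply (@continuous_opp T C_AbsRing C_NormedModule). Qed.

Lemma continuous_Cminus (T : UniformSpace) (f g : T -> C) (x : T) :
  continuous_C T f x -> continuous_C T g x -> continuous_C T (fun t => f t - g t) x.
Proof. intros Hf Hg. apply continuous_Cplus; [exact Hf|]. now apply continuous_Copp. Qed.

Lemma continuous_Cconst (T : UniformSpace) (c : C) (x : T) : continuous_C T (fun _ => c) x.
Proof. apply continuous_const. Qed.

Lemma continuous_Ccomp (T : UniformSpace) (f : T -> C) (h : C -> C) (x : T) :
  continuous_C T f x -> Ccont h (f x) -> continuous_C T (fun t => h (f t)) x.
Proof. intros Hf Hh. apply (continuous_comp f h); assumption. Qed.

Lemma Cmod_sub_sym (x y : C) : Cmod (x - y) = Cmod (y - x).
Proof. rewrite <- Cmod_opp. f_equal. ring. Qed.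

Lemma Cmod_triangle_sub (x y : C) : (Cmod x - Cmod y <= Cmod (x - y))%R.
Proof.
generalize (Cmod_triangle (x - y) y). replace (x - y + y) with x by ring. lra.
Qed.

Lemma is_Cderive_continuous (f : C -> C) (z l : C) : is_Cderive f z l -> Ccont f z.
Proof.
intros H.
apply Ccont_eps. intros eps Heps.
destruct (proj1 (is_Cderive_eps f z l) H 1%R Rlt_0_1) as [d [Hd H1]].
pose (K := (2 + Cmod l)%R).
assert (HK : (0 < K)%R) by (unfold K; generalize (Cmod_ge_0 l); lra).
exists (Rmin d (eps / K)). split.
{ apply Rmin_pos; [exact Hd|]. now apply Rdiv_lt_0_compat. }
intros w Hw. specialize (H1 w (Rlt_le_trans _ _ _ Hw (Rmin_l _ _))).
assert (Hw2 : (Cmod (w - z) < eps / K)%R) by exact (Rlt_le_trans _ _ _ Hw (Rmin_r _ _)).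
replace (f w - f z) with ((f w - f z - l * (w - z)) + l * (w - z)) by ring.
eapply Rle_lt_trans; [apply Cmod_triangle|]. rewrite Cmod_mult.
assert (E : (K * Cmod (w - z) < eps)%R).
{ apply (Rmult_lt_compat_l K) in Hw2; [|exact HK].
  replace (K * (eps / K))%R with eps in Hw2 by (field; lra). exact Hw2. }
unfold K in E. generalize (Cmod_ge_0 (w - z)). lra.
Qed.

Lemma is_Cderive_const (c z : C) : is_Cderive (fun _ => c) z 0.
Proof. apply (@is_derive_const C_AbsRing C_NormedModule). Qed.

Lemma is_Cderive_id (z : C) : is_Cderive (fun w => w) z 1.
Proof. apply is_Cderive_absring. apply (@is_derive_id C_AbsRing). Qed.

Lemma is_Cderive_opp (f : C -> C) (z l : C) : is_Cderive f z l -> is_Cderive (fun w => - f w) z (- l).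
Proof. apply (@is_derive_opp C_AbsRing C_NormedModule). Qed.

Lemma is_Cderive_minus (f g : C -> C) (z df dg : C) :
  is_Cderive f z df -> is_Cderive g z dg ->
  is_Cderive (fun w => f w - g w) z (df - dg).
Proof. intros Hf Hg. apply is_Cderive_plus; [exact Hf|]. now apply is_Cderive_opp. Qed.

Lemma is_Cderive_eq (f : C -> C) (z l l' : C) : is_Cderive f z l -> l = l' -> is_Cderive f z l'.
Proof. intros H <-. exact H. Qed.

Lemma is_Cderive_ext_loc (f g : C -> C) (z l : C) (d : R) :
  (0 < d)%R -> (forall w, (Cmod (w - z) < d)%R -> f w = g w) ->
  is_Cderive f z l -> is_Cderive g z l.
Proof.
intros Hd E H. apply (@is_derive_ext_loc C_AbsRing C_NormedModule f g z l); [|exact H].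
exists (mkposreal d Hd). intros y Hy. apply E. exact Hy.
Qed.

Lemma Ccont_ext_loc (f g : C -> C) (z : C) (d : R) :
  (0 < d)%R -> (forall w, (Cmod (w - z) < d)%R -> f w = g w) -> Ccont f z -> Ccont g z.
Proof.
intros Hd E H. apply (continuous_ext_loc g f z); [|exact H].
apply locally_C. exists (mkposreal d Hd). intros y Hy. apply E. exact Hy.
Qed.

(** The first-order remainder of inversion is exactly quadratic in [w - z], so a lower bound for
    [Cmod w] is all that the derivative requires. *)
Lemma Cdiff_quot_inv (z w : C) : z <> 0 -> w <> 0 ->
  / w - / z - - / (z * z) * (w - z) = (w - z) * (w - z) * / (w * z * z).
Proof. intros Hz Hw. field. split; assumption. Qed.

Lemma is_Cderive_inv (z : C) : z <> 0 -> is_Cderive Cinv z (- / (z * z)).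
Proof.
intros Hz. assert (Mz : (0 < Cmod z)%R) by now apply Cmod_gt_0.
apply is_Cderive_eps. intros eps Heps.
exists (Rmin (Cmod z / 2) (eps * (Cmod z * Cmod z * Cmod z) / 2)). split.
{ apply Rmin_pos; [lra|]. apply Rdiv_lt_0_compat; [|lra].
  repeat apply Rmult_lt_0_compat; assumption. }
intros w Hw.
assert (H1 := Rlt_le_trans _ _ _ Hw (Rmin_l _ _)).
assert (H2 := Rlt_le_trans _ _ _ Hw (Rmin_r _ _)).
assert (Mw : (Cmod z / 2 < Cmod w)%R).
{ generalize (Cmod_triangle_sub z w). rewrite Cmod_sub_sym. lra. }
assert (Hw0 : w <> 0) by (apply Cmod_gt_0; lra).
rewrite Cdiff_quot_inv by assumption.
assert (N : w * z * z <> 0) by (repeat apply Cmult_neq_0; assumption).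
rewrite !Cmod_mult, Cmod_inv by exact N. rewrite !Cmod_mult.
set (m := Cmod z) in *. set (v := Cmod w) in *. set (h := Cmod (w - z)) in *.
assert (Hh : (0 <= h)%R) by apply Cmod_ge_0.
rewrite Rmult_assoc, (Rmult_comm eps). apply Rmult_le_compat_l; [exact Hh|].
apply (Rmult_le_reg_r (v * m * m)).
{ repeat apply Rmult_lt_0_compat; lra. }
rewrite Rmult_assoc, Rinv_l, Rmult_1_r by (repeat apply Rmult_integral_contrapositive_currified; lra).
apply Rle_trans with (eps * (m * m * m) / 2)%R; [lra|].
replace (eps * (v * m * m))%R with ((eps * m * m) * v)%R by ring.
replace (eps * (m * m * m) / 2)%R with ((eps * m * m) * (m / 2))%R by field.
apply Rmult_le_compat_l; [|lra]. repeat apply Rmult_le_pos; lra.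
Qed.

Lemma Ccont_inv (z : C) : z <> 0 -> Ccont Cinv z.
Proof. intros Hz. apply (is_Cderive_continuous _ _ _ (is_Cderive_inv z Hz)). Qed.

Lemma continuous_Cinv (T : UniformSpace) (f : T -> C) (x : T) :
  continuous_C T f x -> f x <> 0 -> continuous_C T (fun t => / f t) x.
Proof. intros Hf Hx. apply (continuous_Ccomp T f Cinv); [exact Hf|]. now apply Ccont_inv. Qed.

Lemma continuous_Cdiv (T : UniformSpace) (f g : T -> C) (x : T) :
  continuous_C T f x -> continuous_C T g x -> g x <> 0 -> continuous_C T (fun t => f t / g t) x.
Proof. intros Hf Hg Hx. apply continuous_Cmult; [exact Hf|]. now apply continuous_Cinv. Qed.

Lemma continuous_Cpow (T : UniformSpace) (f : T -> C) (x : T) (n : nat) :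
  continuous_C T f x -> continuous_C T (fun t => f t ^ n) x.
Proof.
intros Hf. induction n as [|n IH]; simpl; [apply continuous_Cconst|].
now apply continuous_Cmult.
Qed.

Lemma Cmod_le_Re_Im (z : C) : (Cmod z <= Rabs (Re z) + Rabs (Im z))%R.
Proof.
replace z with (RtoC (Re z) + RtoC (Im z) * Ci) at 1.
- eapply Rle_trans; [apply Cmod_triangle|]. rewrite Cmod_mult, Cmod_Ci, !Cmod_R. lra.
- destruct z as [a b]. unfold RtoC, Ci, Cplus, Cmult, Re, Im; simpl. f_equal; ring.
Qed.

Lemma im_le_Cmod (z : C) : (Rabs (Im z) <= Cmod z)%R.
Proof. exact (Rle_trans _ _ _ (Rmax_r _ _) (Rmax_Cmod z)). Qed.

Lemma continuous_pair_C (T : UniformSpace) (f : T -> C) (x : T) :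
  @continuous T R_UniformSpace (fun t => Re (f t)) x ->
  @continuous T R_UniformSpace (fun t => Im (f t)) x -> continuous_C T f x.
Proof.
intros H1 H2 P [e He].
assert (A := H1 (ball (Re (f x)) e) (locally_ball _ e)).
assert (B := H2 (ball (Im (f x)) e) (locally_ball _ e)).
unfold filtermap in *. apply (filter_imp (fun t => ball (Re (f x)) e (Re (f t)) /\ ball (Im (f x)) e (Im (f t)))).
- intros t [Ha Hb]. apply He. split; assumption.
- now apply filter_and.
Qed.

Lemma continuous_Re (T : UniformSpace) (f : T -> C) (x : T) :
  continuous_C T f x -> @continuous T R_UniformSpace (fun t => Re (f t)) x.
Proof. intros H. apply (continuous_comp f fst); [exact H|]. apply continuous_fst. Qed.

Lemma continuous_Im (T : UniformSpace) (f : T -> C) (x : T) :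
  continuous_C T f x -> @continuous T R_UniformSpace (fun t => Im (f t)) x.
Proof. intros H. apply (continuous_comp f snd); [exact H|]. apply continuous_snd. Qed.

Lemma continuous_RtoC (T : UniformSpace) (f : T -> R) (x : T) :
  @continuous T R_UniformSpace f x -> continuous_C T (fun t => RtoC (f t)) x.
Proof.
intros H. apply continuous_pair_C; simpl; [exact H|]. apply continuous_const.
Qed.

Lemma continuous_Cmod (T : UniformSpace) (f : T -> C) (x : T) :
  continuous_C T f x -> @continuous T R_UniformSpace (fun t => Cmod (f t)) x.
Proof.
intros H. apply (continuous_ext (fun t : T => @norm R_AbsRing C_R_NormedModule (f t))).
- intros t. symmetry. apply Cmod_norm.
- apply (continuous_comp f (@norm R_AbsRing C_R_NormedModule)); [exact H|].
  apply (@filterlim_norm R_AbsRing C_R_NormedModule).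
Qed.

Lemma is_Rderive_eps (g : R -> C) (t : R) (l : C) :
  is_Rderive g t l <-> (forall eps : R, (0 < eps)%R -> exists d : R, (0 < d)%R /\
     forall s : R, (Rabs (s - t) < d)%R ->
       (Cmod (g s - g t - RtoC (s - t) * l) <= eps * Rabs (s - t))%R).
Proof.
split.
- intros [_ H] eps Heps.
  destruct (H t (fun P HP => HP) (mkposreal _ Heps)) as [d Hd].
  exists d. split; [apply cond_pos|]. intros w Hw. rewrite Cmod_norm, <- scal_R_Cmult.
  apply (Hd w). exact Hw.
- intros H. split.
  + apply (@is_linear_scal_l R_AbsRing C_R_NormedModule).
  + intros x Hx. assert (E : t = x).
    { apply (@is_filter_lim_locally_unique R_AbsRing (AbsRing_NormedModule R_AbsRing)). exact Hx. }
    subst x. intros eps. destruct (H eps (cond_pos eps)) as [d [Hd H1]].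
    exists (mkposreal d Hd). intros w Hw. specialize (H1 w Hw).
    rewrite Cmod_norm, <- scal_R_Cmult in H1. exact H1.
Qed.

Lemma is_derive_eps_R (g : R -> R) (t l : R) :
  @is_derive R_AbsRing R_NormedModule g t l <->
  (forall eps : R, (0 < eps)%R -> exists d : R, (0 < d)%R /\
     forall s : R, (Rabs (s - t) < d)%R ->
       (Rabs (g s - g t - (s - t) * l) <= eps * Rabs (s - t))%R).
Proof.
split.
- intros [_ H] eps Heps.
  destruct (H t (fun P HP => HP) (mkposreal _ Heps)) as [d Hd].
  exists d. split; [apply cond_pos|]. intros w Hw. apply (Hd w). exact Hw.
- intros H. split.
  + apply (@is_linear_scal_l R_AbsRing R_NormedModule).
  + intros x Hx. assert (E : t = x).
    { apply (@is_filter_lim_locally_unique R_AbsRing (AbsRing_NormedModule R_AbsRing)). exact Hx. }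
    subst x. intros eps. destruct (H eps (cond_pos eps)) as [d [Hd H1]].
    exists (mkposreal d Hd). intros w Hw. exact (H1 w Hw).
Qed.

Lemma is_Rderive_pair (g : R -> C) (t : R) (l : C) :
  @is_derive R_AbsRing R_NormedModule (fun s => Re (g s)) t (Re l) ->
  @is_derive R_AbsRing R_NormedModule (fun s => Im (g s)) t (Im l) -> is_Rderive g t l.
Proof.
intros H1 H2. apply is_Rderive_eps. intros eps Heps.
destruct (proj1 (is_derive_eps_R _ _ _) H1 (eps / 2)%R ltac:(lra)) as [d1 [Hd1 A1]].
destruct (proj1 (is_derive_eps_R _ _ _) H2 (eps / 2)%R ltac:(lra)) as [d2 [Hd2 A2]].
exists (Rmin d1 d2). split; [now apply Rmin_pos|]. intros s Hs.
specialize (A1 s (Rlt_le_trans _ _ _ Hs (Rmin_l _ _))).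
specialize (A2 s (Rlt_le_trans _ _ _ Hs (Rmin_r _ _))).
eapply Rle_trans; [apply Cmod_le_Re_Im|].
unfold Cminus. rewrite !re_plus, !im_plus, !re_opp, !im_opp, re_scal_l, im_scal_l. unfold Rminus in *. lra.
Qed.

(** The outer derivative is complex and the inner one real, so the two errors are estimated by hand.
    Each gets [eps / 2]: that of [F] through the Lipschitz constant [M] of [g] near [t], that of [g]
    after multiplication by [l]. *)
Lemma is_Cderive_comp_path (F : C -> C) (g : R -> C) (t : R) (l m : C) :
  is_Cderive F (g t) l -> is_Rderive g t m -> is_Rderive (fun s => F (g s)) t (l * m).
Proof.
intros HF Hg. apply is_Rderive_eps. intros eps Heps.
pose (M := (Cmod m + 1)%R). pose (L := (Cmod l + 1)%R).
assert (HM : (0 < M)%R) by (unfold M; generalize (Cmod_ge_0 m); lra).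
assert (HL : (0 < L)%R) by (unfold L; generalize (Cmod_ge_0 l); lra).
destruct (proj1 (is_Cderive_eps F (g t) l) HF (eps / (2 * M))%R) as [d1 [Hd1 A1]].
{ apply Rdiv_lt_0_compat; lra. }
assert (He2 : (0 < Rmin 1 (eps / (2 * L)))%R).
{ apply Rmin_pos; [lra|]. apply Rdiv_lt_0_compat; lra. }
destruct (proj1 (is_Rderive_eps g t m) Hg _ He2) as [d2 [Hd2 A2]].
exists (Rmin d2 (d1 / M)). split.
{ apply Rmin_pos; [exact Hd2|]. now apply Rdiv_lt_0_compat. }
intros s Hs. specialize (A2 s (Rlt_le_trans _ _ _ Hs (Rmin_l _ _))).
assert (Hs2 := Rlt_le_trans _ _ _ Hs (Rmin_r _ _)).
assert (Hp := Rabs_pos (s - t)).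
assert (G : (Cmod (g s - g t) <= M * Rabs (s - t))%R).
{ replace (g s - g t) with ((g s - g t - RtoC (s - t) * m) + RtoC (s - t) * m) by ring.
  eapply Rle_trans; [apply Cmod_triangle|]. rewrite Cmod_mult, Cmod_R. unfold M.
  assert ((Rmin 1 (eps / (2 * L)) * Rabs (s - t) <= 1 * Rabs (s - t))%R)
    by (apply Rmult_le_compat_r; [exact Hp|apply Rmin_l]). lra. }
assert (G1 : (Cmod (g s - g t) < d1)%R).
{ eapply Rle_lt_trans; [exact G|]. apply (Rmult_lt_compat_l M) in Hs2; [|exact HM].
  replace (M * (d1 / M))%R with d1 in Hs2 by (field; lra). exact Hs2. }
specialize (A1 _ G1).
replace (F (g s) - F (g t) - RtoC (s - t) * (l * m))
  with ((F (g s) - F (g t) - l * (g s - g t)) + l * (g s - g t - RtoC (s - t) * m)) by ring.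
eapply Rle_trans; [apply Cmod_triangle|]. rewrite Cmod_mult.
assert (B1 : (Cmod (F (g s) - F (g t) - l * (g s - g t)) <= eps / 2 * Rabs (s - t))%R).
{ eapply Rle_trans; [exact A1|]. apply Rle_trans with (eps / (2 * M) * (M * Rabs (s - t)))%R.
  - apply Rmult_le_compat_l; [|exact G]. apply Rlt_le, Rdiv_lt_0_compat; lra.
  - right. field. lra. }
assert (B2 : (Cmod l * Cmod (g s - g t - RtoC (s - t) * m) <= eps / 2 * Rabs (s - t))%R).
{ apply Rle_trans with (L * (eps / (2 * L) * Rabs (s - t)))%R.
  - apply Rmult_le_compat; [apply Cmod_ge_0|apply Cmod_ge_0|unfold L; lra|].
    eapply Rle_trans; [exact A2|]. apply Rmult_le_compat_r; [exact Hp|apply Rmin_r].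
  - right. field. lra. }
lra.
Qed.

Lemma is_Rderive_continuous (g : R -> C) (t : R) (l : C) :
  is_Rderive g t l -> continuous_C R_UniformSpace g t.
Proof.
intros H. apply (@ex_derive_continuous R_AbsRing C_R_NormedModule g t). now exists l.
Qed.

(** * Integrals of complex-valued functions over real intervals *)

Definition CInt (f : R -> C) (a b : R) : C := RInt (V := C_R_CompleteNormedModule) f a b.

Definition cont_on (f : R -> C) (a b : R) : Prop :=
  forall t : R, (Rmin a b <= t <= Rmax a b)%R -> continuous_C R_UniformSpace f t.

Lemma ex_CInt (f : R -> C) (a b : R) :
  cont_on f a b -> @ex_RInt C_R_NormedModule f a b.
Proof. intros H. apply (@ex_RInt_continuous C_R_CompleteNormedModule). exact H. Qed.

Lemma is_CInt (f : R -> C) (a b : R) :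
  cont_on f a b -> @is_RInt C_R_NormedModule f a b (CInt f a b).
Proof. intros H. apply (@RInt_correct C_R_CompleteNormedModule). now apply ex_CInt. Qed.

Lemma CInt_unique (f : R -> C) (a b : R) (l : C) :
  @is_RInt C_R_NormedModule f a b l -> CInt f a b = l.
Proof. intros H. now apply (@is_RInt_unique C_R_CompleteNormedModule). Qed.

Lemma CInt_ext (f g : R -> C) (a b : R) :
  (forall t, (Rmin a b < t < Rmax a b)%R -> f t = g t) -> CInt f a b = CInt g a b.
Proof. intros H. now apply (@RInt_ext C_R_CompleteNormedModule). Qed.

Lemma CInt_plus (f g : R -> C) (a b : R) :
  cont_on f a b -> cont_on g a b -> CInt (fun t => f t + g t) a b = CInt f a b + CInt g a b.
Proof.
intros Hf Hg. apply CInt_unique.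
apply (@is_RInt_plus C_R_NormedModule); now apply is_CInt.
Qed.

Lemma CInt_swap (f : R -> C) (a b : R) : cont_on f a b -> CInt f b a = - CInt f a b.
Proof.
intros H. apply CInt_unique. apply (@is_RInt_swap C_R_NormedModule). now apply is_CInt.
Qed.

Lemma is_CInt_parts (f : R -> C) (a b : R) (l : C) :
  @is_RInt C_R_NormedModule f a b l <->
  (@is_RInt R_NormedModule (fun t => Re (f t)) a b (Re l) /\
   @is_RInt R_NormedModule (fun t => Im (f t)) a b (Im l)).
Proof.
split.
- intros H. split.
  + exact (@is_RInt_fct_extend_fst R_NormedModule R_NormedModule f a b l H).
  + exact (@is_RInt_fct_extend_snd R_NormedModule R_NormedModule f a b l H).
- intros [H1 H2]. destruct l as [l1 l2].
  exact (@is_RInt_fct_extend_pair R_NormedModule R_NormedModule f a b l1 l2 H1 H2).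
Qed.

(** The integral is taken in a real vector space, so a complex scalar is handled through real and
    imaginary parts. *)
Lemma is_CInt_scal (f : R -> C) (a b : R) (c l : C) :
  @is_RInt C_R_NormedModule f a b l -> @is_RInt C_R_NormedModule (fun t => c * f t) a b (c * l).
Proof.
intros H. apply is_CInt_parts in H. destruct H as [H1 H2]. apply is_CInt_parts. split.
- apply (is_RInt_ext (fun t => minus (scal (Re c) (Re (f t))) (scal (Im c) (Im (f t))))).
  { intros t _. symmetry. apply re_mult. }
  rewrite re_mult. apply (@is_RInt_minus R_NormedModule); now apply (@is_RInt_scal R_NormedModule).
- apply (is_RInt_ext (fun t => plus (scal (Re c) (Im (f t))) (scal (Im c) (Re (f t))))).
  { intros t _. symmetry. apply im_mult. }
  rewrite im_mult. apply (@is_RInt_plus R_NormedModule); now apply (@is_RInt_scal R_NormedModule).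
Qed.

Lemma CInt_scal (f : R -> C) (a b : R) (c : C) :
  cont_on f a b -> CInt (fun t => c * f t) a b = c * CInt f a b.
Proof. intros H. apply CInt_unique, is_CInt_scal. now apply is_CInt. Qed.

Lemma cont_on_scal (f : R -> C) (a b : R) (c : C) : cont_on f a b -> cont_on (fun t => c * f t) a b.
Proof. intros H t Ht. apply continuous_Cmult; [apply continuous_Cconst|now apply H]. Qed.

Lemma CInt_minus (f g : R -> C) (a b : R) :
  cont_on f a b -> cont_on g a b -> CInt (fun t => f t - g t) a b = CInt f a b - CInt g a b.
Proof.
intros Hf Hg. apply CInt_unique.
apply (@is_RInt_minus C_R_NormedModule); now apply is_CInt.
Qed.

Lemma Cmod_CInt_le (f : R -> C) (g : R -> R) (a b lg : R) :
  (a <= b)%R -> cont_on f a b ->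
  (forall t, (a <= t <= b)%R -> (Cmod (f t) <= g t)%R) ->
  @is_RInt R_NormedModule g a b lg -> (Cmod (CInt f a b) <= lg)%R.
Proof.
intros Hab Hf Hle Hg. rewrite Cmod_norm.
apply (@norm_RInt_le C_R_NormedModule f g a b); try assumption.
- intros t Ht. rewrite <- Cmod_norm. now apply Hle.
- now apply is_CInt.
Qed.

Lemma Cmod_CInt_le_const (f : R -> C) (a b M : R) :
  (a <= b)%R -> cont_on f a b ->
  (forall t, (a <= t <= b)%R -> (Cmod (f t) <= M)%R) ->
  (Cmod (CInt f a b) <= (b - a) * M)%R.
Proof.
intros Hab Hf Hle. apply (Cmod_CInt_le f (fun _ => M)); try assumption.
apply (@is_RInt_const R_NormedModule).
Qed.

Lemma CInt_derive (f df : R -> C) (a b : R) :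
  (forall t, (Rmin a b <= t <= Rmax a b)%R -> is_Rderive f t (df t)) ->
  cont_on df a b -> CInt df a b = f b - f a.
Proof.
intros H1 H2. apply CInt_unique.
apply (@is_RInt_derive C_R_CompleteNormedModule); assumption.
Qed.

Lemma bounded_on (f : R -> C) (a b : R) : (a <= b)%R -> cont_on f a b ->
  exists M : R, (0 < M)%R /\ forall t, (a <= t <= b)%R -> (Cmod (f t) <= M)%R.
Proof.
intros Hab Hf.
destruct (continuity_ab_maj (fun t => Cmod (f t)) a b Hab) as [m [Hm _]].
- intros t Ht. apply continuity_pt_filterlim. apply (continuous_Cmod R_UniformSpace f t).
  apply Hf. rewrite Rmin_left, Rmax_right by lra. exact Ht.
- exists (Cmod (f m) + 1)%R. split; [generalize (Cmod_ge_0 (f m)); lra|].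
  intros t Ht. specialize (Hm t Ht). simpl in Hm. lra.
Qed.

Lemma is_Cderive_scal (c : C) (f : C -> C) (z l : C) :
  is_Cderive f z l -> is_Cderive (fun w => c * f w) z (c * l).
Proof.
intros H. eapply is_Cderive_eq; [apply is_Cderive_mult; [apply is_Cderive_const|exact H]|].
cbv beta. ring.
Qed.

Lemma is_Cderive_affine (c m z : C) : is_Cderive (fun w => c + m * w) z m.
Proof.
eapply is_Cderive_eq.
- apply is_Cderive_plus; [apply is_Cderive_const|apply is_Cderive_scal, is_Cderive_id].
- ring.
Qed.

Lemma continuous_RxC_eps (G : R * C -> C) (t : R) (z : C) :
  continuous_C RxC G (t, z) -> forall eps : R, (0 < eps)%R ->
  exists d : posreal, forall s w, (Rabs (s - t) < d)%R -> (Cmod (w - z) < d)%R ->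
    (Cmod (G (s, w) - G (t, z)) < eps)%R.
Proof.
intros H eps Heps.
assert (A : locally (T := C_UniformSpace) (G (t, z)) (fun y => (Cmod (y - G (t, z)) < eps)%R)).
{ apply locally_C. exists (mkposreal _ Heps). intros y Hy. exact Hy. }
destruct (H _ A) as [d Hd]. exists d. intros s w Hs Hw. apply (Hd (s, w)).
split; [exact Hs|]. apply C_NormedModule_mixin_compat1. exact Hw.
Qed.

(** Compactness of [[a, b]]: the local moduli at the points [(t, z0)] form a gauge, and a single [d]
    works for a tube around [[a, b]] times [z0]. The halves of [eps] compare both values with a
    common centre [x]. *)
Lemma continuous_param_unif (G : R * C -> C) (a b : R) (z0 : C) :
  (forall t, (a <= t <= b)%R -> continuous_C RxC G (t, z0)) ->
  forall eps : R, (0 < eps)%R -> exists d : R, (0 < d)%R /\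
    forall t w, (a <= t <= b)%R -> (Cmod (w - z0) < d)%R ->
      (Cmod (G (t, w) - G (t, z0)) < eps)%R.
Proof.
intros H eps Heps.
assert (Hd : forall t : R, exists d : posreal, (a <= t <= b)%R ->
   forall s w, (Rabs (s - t) < d)%R -> (Cmod (w - z0) < d)%R ->
    (Cmod (G (s, w) - G (t, z0)) < eps / 2)%R).
{ intros t. destruct (classic (a <= t <= b)%R) as [Ht|Ht].
  - destruct (continuous_RxC_eps G t z0 (H t Ht) (eps / 2)%R ltac:(lra)) as [d Hd].
    exists d. intros _. exact Hd.
  - exists (mkposreal 1 Rlt_0_1). intros Ht'. contradiction. }
pose (delta := fun t => proj1_sig (constructive_indefinite_description _ (Hd t))).
destruct (compactness_value_1d a b delta) as [d Hc].
exists d. split; [apply cond_pos|]. intros t w Ht Hw.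
(* The covering statement [Hc] provides the centre [x] only under a double negation. *)
apply NNPP. intros N. apply (Hc t Ht). intros [x [Hx [Hxt Hdx]]]. apply N.
assert (P := proj2_sig (constructive_indefinite_description _ (Hd x)) Hx).
fold (delta x) in P.
assert (P1 := P t w Hxt (Rlt_le_trans _ _ _ Hw Hdx)).
assert (P2 : (Cmod (G (t, z0) - G (x, z0)) < eps / 2)%R).
{ apply P; [exact Hxt|]. replace (z0 - z0) with (RtoC 0) by ring. rewrite Cmod_0. apply cond_pos. }
replace (G (t, w) - G (t, z0)) with ((G (t, w) - G (x, z0)) - (G (t, z0) - G (x, z0))) by ring.
eapply Rle_lt_trans; [apply Cmod_triangle|]. rewrite Cmod_opp. lra.
Qed.

Definition seg (z w : C) (s : R) : C := z + RtoC s * (w - z).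

Lemma is_Rderive_affine (z m : C) (t : R) : is_Rderive (fun s => z + RtoC s * m) t m.
Proof.
apply is_Rderive_eps. intros eps Heps. exists 1%R. split; [lra|]. intros s _.
rewrite RtoC_minus.
replace (z + s * m - (z + t * m) - (s - t) * m) with (RtoC 0) by ring.
rewrite Cmod_0. apply Rmult_le_pos; [lra|apply Rabs_pos].
Qed.

Lemma is_Rderive_seg (z w : C) (t : R) : is_Rderive (seg z w) t (w - z).
Proof. apply is_Rderive_affine. Qed.

Lemma seg_0 (z w : C) : seg z w 0 = z.
Proof. unfold seg. ring. Qed.

Lemma seg_1 (z w : C) : seg z w 1 = w.
Proof. unfold seg. ring. Qed.

Lemma continuous_seg (z w : C) (t : R) : continuous_C R_UniformSpace (seg z w) t.
Proof. apply (is_Rderive_continuous _ _ _ (is_Rderive_seg z w t)). Qed.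

Lemma Cmod_RtoC_nonneg (s : R) : (0 <= s)%R -> Cmod s = s.
Proof. intros H. rewrite Cmod_R. now apply Rabs_pos_eq. Qed.

Lemma Cmod_seg_sub (z w : C) (s : R) : (0 <= s <= 1)%R -> (Cmod (seg z w s - z) <= Cmod (w - z))%R.
Proof.
intros Hs. unfold seg. replace (z + s * (w - z) - z) with (s * (w - z)) by ring.
rewrite Cmod_mult, Cmod_RtoC_nonneg by lra.
rewrite <- (Rmult_1_l (Cmod (w - z))) at 2. apply Rmult_le_compat_r; [apply Cmod_ge_0|lra].
Qed.

(** The left side is the integral of [f' - A] along the segment from [z] to [w]. This replaces the
    mean value theorem for complex functions. *)
Lemma C_mean_value (f f' : C -> C) (z w A : C) (eps : R) :
  (forall s, (0 <= s <= 1)%R -> is_Cderive f (seg z w s) (f' (seg z w s))) ->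
  (forall s, (0 <= s <= 1)%R -> Ccont f' (seg z w s)) ->
  (forall s, (0 <= s <= 1)%R -> (Cmod (f' (seg z w s) - A) <= eps)%R) ->
  (Cmod (f w - f z - A * (w - z)) <= eps * Cmod (w - z))%R.
Proof.
intros H1 H2 H3.
assert (E : CInt (fun s => (f' (seg z w s) - A) * (w - z)) 0 1 = f w - f z - A * (w - z)).
{ rewrite (CInt_derive (fun s => f (seg z w s) - A * seg z w s)).
  - rewrite seg_0, seg_1. ring.
  - intros s Hs. rewrite Rmin_left, Rmax_right in Hs by lra.
    apply (is_Cderive_comp_path (fun u => f u - A * u) (seg z w) s); [|apply is_Rderive_seg].
    apply is_Cderive_minus; [now apply H1|].
    eapply is_Cderive_eq; [apply is_Cderive_scal, is_Cderive_id|ring].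
  - intros s Hs. rewrite Rmin_left, Rmax_right in Hs by lra.
    apply continuous_Cmult; [|apply continuous_Cconst].
    apply continuous_Cminus; [|apply continuous_Cconst].
    apply (continuous_Ccomp _ (seg z w) f'); [apply continuous_seg|now apply H2]. }
rewrite <- E.
replace (eps * Cmod (w - z))%R with ((1 - 0) * (eps * Cmod (w - z)))%R by ring.
apply Cmod_CInt_le_const; [lra| |].
- intros s Hs. rewrite Rmin_left, Rmax_right in Hs by lra.
  apply continuous_Cmult; [|apply continuous_Cconst].
  apply continuous_Cminus; [|apply continuous_Cconst].
  apply (continuous_Ccomp _ (seg z w) f'); [apply continuous_seg|now apply H2].
- intros s Hs. rewrite Cmod_mult. apply Rmult_le_compat_r; [apply Cmod_ge_0|now apply H3].
Qed.

Lemma continuous_RxC_pair (T : UniformSpace) (f : T -> R) (g : T -> C) (x : T) :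
  @continuous T R_UniformSpace f x -> continuous_C T g x ->
  @continuous T RxC (fun y => (f y, g y)) x.
Proof.
intros Hf Hg P [e He].
assert (A := Hf _ (locally_ball (f x) e)).
assert (B := Hg _ (locally_ball (g x) e)).
unfold filtermap in *.
apply (filter_imp (fun y => ball (f x) e (f y) /\ ball (g x) e (g y))).
- intros y Hy. apply He. exact Hy.
- now apply filter_and.
Qed.

Lemma continuous_RxC_slice_l (k : R -> C -> C) (t : R) (z : C) :
  continuous_C RxC (fun p => k (fst p) (snd p)) (t, z) ->
  continuous_C R_UniformSpace (fun s => k s z) t.
Proof.
intros H. apply (continuous_comp (fun s => (s, z)) (fun p : R * C => k (fst p) (snd p))).
- apply (continuous_RxC_pair _ (fun s => s) (fun _ => z)); [apply continuous_id|apply continuous_const].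
- exact H.
Qed.

Lemma continuous_RxC_slice_r (k : R -> C -> C) (t : R) (z : C) :
  continuous_C RxC (fun p => k (fst p) (snd p)) (t, z) -> Ccont (k t) z.
Proof.
intros H. apply (continuous_comp (fun w => (t, w)) (fun p : R * C => k (fst p) (snd p))).
- apply (continuous_RxC_pair _ (fun _ => t) (fun w => w)); [apply continuous_const|apply continuous_id].
- exact H.
Qed.

Lemma Ccont_CInt_param (k : R -> C -> C) (a b : R) (z0 : C) (r : R) :
  (a <= b)%R -> (0 < r)%R ->
  (forall t z, (a <= t <= b)%R -> (Cmod (z - z0) < r)%R ->
     continuous_C RxC (fun p => k (fst p) (snd p)) (t, z)) ->
  Ccont (fun z => CInt (fun t => k t z) a b) z0.
Proof.
intros Hab Hr Hc.
assert (C0 : forall z, (Cmod (z - z0) < r)%R -> cont_on (fun t => k t z) a b).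
{ intros z Hz t Ht. rewrite Rmin_left, Rmax_right in Ht by lra.
  apply continuous_RxC_slice_l. now apply Hc. }
assert (Z0 : (Cmod (z0 - z0) < r)%R).
{ replace (z0 - z0) with (RtoC 0) by ring. now rewrite Cmod_0. }
apply Ccont_eps. intros eps Heps.
assert (He : (0 < eps / (2 * (b - a + 1)))%R) by (apply Rdiv_lt_0_compat; lra).
destruct (continuous_param_unif (fun p => k (fst p) (snd p)) a b z0
   (fun t Ht => Hc t z0 Ht Z0) _ He) as [d [Hd H]].
exists (Rmin d r). split; [now apply Rmin_pos|]. intros w Hw.
assert (Hw1 := Rlt_le_trans _ _ _ Hw (Rmin_l _ _)).
assert (Hw2 := Rlt_le_trans _ _ _ Hw (Rmin_r _ _)).
rewrite <- CInt_minus by (now apply C0).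
eapply Rle_lt_trans.
- apply (Cmod_CInt_le_const _ a b (eps / (2 * (b - a + 1)))); [exact Hab| |].
  + intros t Ht. apply continuous_Cminus; now apply C0.
  + intros t Ht. left. exact (H t w Ht Hw1).
- apply Rle_lt_trans with ((b - a + 1) * (eps / (2 * (b - a + 1))))%R.
  + apply Rmult_le_compat_r; lra.
  + replace ((b - a + 1) * (eps / (2 * (b - a + 1))))%R with (eps / 2)%R by (field; lra). lra.
Qed.

(** For each [t] the linearization error is bounded by [C_mean_value] with [A = k' t z0]; uniform
    continuity of [k'] in the parameter makes this bound uniform in [t], so it can be integrated. *)
Lemma is_Cderive_CInt_param (k k' : R -> C -> C) (a b : R) (z0 : C) (r : R) :
  (a <= b)%R -> (0 < r)%R ->
  (forall t z, (a <= t <= b)%R -> (Cmod (z - z0) < r)%R -> is_Cderive (k t) z (k' t z)) ->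
  (forall t z, (a <= t <= b)%R -> (Cmod (z - z0) < r)%R ->
     continuous_C RxC (fun p => k (fst p) (snd p)) (t, z)) ->
  (forall t z, (a <= t <= b)%R -> (Cmod (z - z0) < r)%R ->
     continuous_C RxC (fun p => k' (fst p) (snd p)) (t, z)) ->
  is_Cderive (fun z => CInt (fun t => k t z) a b) z0 (CInt (fun t => k' t z0) a b).
Proof.
intros Hab Hr Hd Hc Hc'.
assert (C0 : forall z, (Cmod (z - z0) < r)%R -> cont_on (fun t => k t z) a b).
{ intros z Hz t Ht. rewrite Rmin_left, Rmax_right in Ht by lra.
  apply continuous_RxC_slice_l. now apply Hc. }
assert (C1 : forall z, (Cmod (z - z0) < r)%R -> cont_on (fun t => k' t z) a b).
{ intros z Hz t Ht. rewrite Rmin_left, Rmax_right in Ht by lra.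
  apply continuous_RxC_slice_l. now apply Hc'. }
assert (Z0 : (Cmod (z0 - z0) < r)%R).
{ replace (z0 - z0) with (RtoC 0) by ring. now rewrite Cmod_0. }
apply is_Cderive_eps. intros eps Heps.
assert (He : (0 < eps / (b - a + 1))%R) by (apply Rdiv_lt_0_compat; lra).
destruct (continuous_param_unif (fun p => k' (fst p) (snd p)) a b z0
   (fun t Ht => Hc' t z0 Ht Z0) _ He) as [d [Hd0 H]].
exists (Rmin d r). split; [now apply Rmin_pos|]. intros w Hw.
assert (Hw1 := Rlt_le_trans _ _ _ Hw (Rmin_l _ _)).
assert (Hw2 := Rlt_le_trans _ _ _ Hw (Rmin_r _ _)).
assert (CC : cont_on (fun t => k t w - k t z0) a b).
{ intros t Ht. apply continuous_Cminus; [exact (C0 w Hw2 t Ht)|exact (C0 z0 Z0 t Ht)]. }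
assert (CC' : cont_on (fun t => (w - z0) * k' t z0) a b) by (apply cont_on_scal; now apply C1).
rewrite <- CInt_minus by (now apply C0).
rewrite (Cmult_comm _ (w - z0)), <- CInt_scal by (now apply C1).
rewrite <- CInt_minus by assumption.
eapply Rle_trans.
- apply (Cmod_CInt_le_const _ a b (eps / (b - a + 1) * Cmod (w - z0))); [exact Hab| |].
  + intros t Ht. apply continuous_Cminus; [now apply CC|now apply CC'].
  + intros t Ht. rewrite (Cmult_comm (w - z0)).
    assert (S0 : forall s, (0 <= s <= 1)%R -> (Cmod (seg z0 w s - z0) < Rmin d r)%R).
    { intros s Hs. eapply Rle_lt_trans; [now apply Cmod_seg_sub|exact Hw]. }
    apply (C_mean_value (k t) (k' t)).
    * intros s Hs. apply Hd; [exact Ht|]. eapply Rlt_le_trans; [now apply S0|apply Rmin_r].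
    * intros s Hs. apply continuous_RxC_slice_r. apply Hc'; [exact Ht|].
      eapply Rlt_le_trans; [now apply S0|apply Rmin_r].
    * intros s Hs. left. apply (H t (seg z0 w s) Ht).
      eapply Rlt_le_trans; [now apply S0|apply Rmin_l].
- assert (Hp := Cmod_ge_0 (w - z0)).
  apply Rle_trans with ((b - a + 1) * (eps / (b - a + 1) * Cmod (w - z0)))%R.
  + apply Rmult_le_compat_r; [|lra]. apply Rmult_le_pos; lra.
  + right. field. lra.
Qed.

Lemma is_Rderive_eq (f : R -> C) (t : R) (l l' : C) : is_Rderive f t l -> l = l' -> is_Rderive f t l'.
Proof. intros H <-. exact H. Qed.

Lemma is_Rderive_plus (f g : R -> C) (t : R) (df dg : C) :
  is_Rderive f t df -> is_Rderive g t dg -> is_Rderive (fun s => f s + g s) t (df + dg).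
Proof. apply (@is_derive_plus R_AbsRing C_R_NormedModule). Qed.

Lemma is_Rderive_RtoC (t : R) : is_Rderive RtoC t 1.
Proof.
apply (is_derive_ext (fun s : R => 0 + RtoC s * 1)); [intros s; change (0 + RtoC s * 1 = RtoC s); ring|]. apply is_Rderive_affine.
Qed.

(* Polarization: [f g = ((f + g)^2 - f^2 - g^2) / 2], and squares are covered by the chain rule. *)
Lemma is_Rderive_mult (f g : R -> C) (t : R) (df dg : C) :
  is_Rderive f t df -> is_Rderive g t dg ->
  is_Rderive (fun s => f s * g s) t (df * g t + f t * dg).
Proof.
intros Hf Hg.
assert (S : forall c z, is_Cderive (fun w => c * (w * w)) z (c * (2 * z))).
{ intros c z. apply is_Cderive_scal. eapply is_Cderive_eq.
  - apply is_Cderive_mult; apply is_Cderive_id.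
  - cbv beta. ring. }
apply (is_derive_ext (fun s : R => / 2 * ((f s + g s) * (f s + g s)) +
   (- / 2 * (f s * f s) + - / 2 * (g s * g s)))).
{ intros s.
  change (/ 2 * ((f s + g s) * (f s + g s)) + (- / 2 * (f s * f s) + - / 2 * (g s * g s)) = f s * g s).
  field. }
eapply is_Rderive_eq.
- apply is_Rderive_plus; [|apply is_Rderive_plus].
  + apply (is_Cderive_comp_path (fun w => / 2 * (w * w)) (fun s => f s + g s)); [apply S|].
    apply is_Rderive_plus; [exact Hf|exact Hg].
  + apply (is_Cderive_comp_path (fun w => - / 2 * (w * w)) f); [apply S|exact Hf].
  + apply (is_Cderive_comp_path (fun w => - / 2 * (w * w)) g); [apply S|exact Hg].
- cbv beta. field.
Qed.

(** * The exponential and holomorphic functions *)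

Lemma Cexp_plus (z w : C) : Cexp (z + w) = Cexp z * Cexp w.
Proof.
unfold Cexp. rewrite re_plus, im_plus, exp_plus, cos_plus, sin_plus.
unfold Cmult; simpl. f_equal; ring.
Qed.

Lemma Cexp_0 : Cexp 0 = 1.
Proof. unfold Cexp, RtoC; simpl. rewrite exp_0, cos_0, sin_0. f_equal; ring. Qed.

Lemma Cexp_opp_l (z : C) : Cexp (- z) * Cexp z = 1.
Proof. rewrite <- Cexp_plus. replace (- z + z) with (RtoC 0) by ring. apply Cexp_0. Qed.

Lemma Cexp_neq_0 (z : C) : Cexp z <> 0.
Proof. intros H. apply C1_nz. rewrite <- (Cexp_opp_l z), H. ring. Qed.

Lemma Cexp_opp (z : C) : Cexp (- z) = / Cexp z.
Proof.
rewrite <- (Cmult_1_r (Cexp (- z))), <- (Cinv_r (Cexp z)) by apply Cexp_neq_0.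
rewrite Cmult_assoc, Cexp_opp_l. ring.
Qed.

Lemma Cmod_Cexp (z : C) : Cmod (Cexp z) = exp (Re z).
Proof.
unfold Cexp, Cmod; simpl.
replace (exp (Re z) * cos (Im z) * (exp (Re z) * cos (Im z) * 1) +
  exp (Re z) * sin (Im z) * (exp (Re z) * sin (Im z) * 1))%R
  with (exp (Re z) * exp (Re z))%R.
- apply sqrt_square. left. apply exp_pos.
- generalize (sin2_cos2 (Im z)). unfold Rsqr. intros E.
  transitivity (exp (Re z) * exp (Re z) * (sin (Im z) * sin (Im z) + cos (Im z) * cos (Im z)))%R;
    [rewrite E|]; ring.
Qed.

Lemma Cexp_RtoC (x : R) : Cexp x = exp x.
Proof. unfold Cexp, RtoC; simpl. rewrite cos_0, sin_0. f_equal; ring. Qed.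

Lemma Cexp_pow (z : C) (n : nat) : Cexp z ^ n = Cexp (INR n * z).
Proof.
induction n as [|n IH].
- replace (INR 0 * z) with (RtoC 0) by (simpl; ring). now rewrite Cexp_0.
- rewrite Cpow_S, IH, <- Cexp_plus. apply (f_equal Cexp). rewrite S_INR, RtoC_plus. ring.
Qed.

Lemma is_Rderive_Cexp_line (h : C) (s : R) :
  is_Rderive (fun s => Cexp (RtoC s * h)) s (h * Cexp (RtoC s * h)).
Proof.
destruct h as [a b]. apply is_Rderive_pair; unfold Cexp, Cmult, RtoC, Re, Im; simpl.
- auto_derive; [exact I|]. unfold Rminus. ring.
- auto_derive; [exact I|]. unfold Rminus. ring.
Qed.

Lemma continuous_Cexp_line (h : C) (s : R) :
  continuous_C R_UniformSpace (fun s => Cexp (RtoC s * h)) s.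
Proof. apply (is_Rderive_continuous _ _ _ (is_Rderive_Cexp_line h s)). Qed.

Lemma Cmod_Cexp_line_le (h : C) (s : R) : (0 <= s <= 1)%R ->
  (Cmod (Cexp (RtoC s * h)) <= exp (Cmod h))%R.
Proof.
intros Hs. rewrite Cmod_Cexp, re_scal_l.
assert (H : (s * Re h <= Cmod h)%R).
{ assert (H0 := re_le_Cmod h). assert (H1 := Rle_abs (Re h)). assert (H2 := Cmod_ge_0 h).
  apply Rle_trans with (s * Cmod h)%R.
  - apply Rmult_le_compat_l; lra.
  - rewrite <- (Rmult_1_l (Cmod h)) at 2. apply Rmult_le_compat_r; lra. }
destruct H as [H|H]; [left; now apply exp_increasing|right; now rewrite H].
Qed.

(** [Cexp h - 1] is the integral of [h * Cexp (s h)] over [s] in [0, 1]. Integrating this bound once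
    more gives the quadratic remainder, and with it the complex derivative of [Cexp]. *)
Lemma Cmod_Cexp_sub_1 (h : C) : (Cmod (Cexp h - 1) <= Cmod h * exp (Cmod h))%R.
Proof.
replace (Cexp h - 1) with (CInt (fun s => h * Cexp (RtoC s * h)) 0 1).
- replace (Cmod h * exp (Cmod h))%R with ((1 - 0) * (Cmod h * exp (Cmod h)))%R by ring.
  apply Cmod_CInt_le_const; [lra| |].
  + intros t _. apply continuous_Cmult; [apply continuous_Cconst|apply continuous_Cexp_line].
  + intros t Ht. rewrite Cmod_mult. apply Rmult_le_compat_l; [apply Cmod_ge_0|].
    now apply Cmod_Cexp_line_le.
- rewrite (CInt_derive (fun s => Cexp (RtoC s * h))).
  + rewrite Cmult_1_l, Cmult_0_l, Cexp_0. reflexivity.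
  + intros s _. apply is_Rderive_Cexp_line.
  + intros t _. apply continuous_Cmult; [apply continuous_Cconst|apply continuous_Cexp_line].
Qed.

Lemma Cmod_Cexp_sub_1_sub (h : C) : (Cmod (Cexp h - 1 - h) <= Cmod h * Cmod h * exp (Cmod h))%R.
Proof.
assert (Hc : forall t, continuous_C R_UniformSpace (fun s => h * (Cexp (RtoC s * h) - 1)) t).
{ intros t. apply continuous_Cmult; [apply continuous_Cconst|].
  apply continuous_Cminus; [apply continuous_Cexp_line|apply continuous_Cconst]. }
replace (Cexp h - 1 - h) with (CInt (fun s => h * (Cexp (RtoC s * h) - 1)) 0 1).
- replace (Cmod h * Cmod h * exp (Cmod h))%R
    with ((1 - 0) * (Cmod h * (Cmod h * exp (Cmod h))))%R by ring.
  apply Cmod_CInt_le_const; [lra| |].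
  + intros t _. apply Hc.
  + intros t Ht. rewrite Cmod_mult. apply Rmult_le_compat_l; [apply Cmod_ge_0|].
    eapply Rle_trans; [apply Cmod_Cexp_sub_1|]. rewrite Cmod_mult, Cmod_RtoC_nonneg by lra.
    assert (E : (t * Cmod h <= Cmod h)%R).
    { rewrite <- (Rmult_1_l (Cmod h)) at 2. apply Rmult_le_compat_r; [apply Cmod_ge_0|lra]. }
    apply Rmult_le_compat; [|left; apply exp_pos|exact E|].
    * apply Rmult_le_pos; [lra|apply Cmod_ge_0].
    * destruct E as [E|E]; [left; now apply exp_increasing|right; now rewrite E].
- rewrite (CInt_derive (fun s => Cexp (RtoC s * h) - RtoC s * h)).
  + rewrite !Cmult_1_l, !Cmult_0_l, Cexp_0. ring.
  + intros s _. replace (h * (Cexp (s * h) - 1)) with (h * Cexp (s * h) - h) by ring.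
    apply (@is_derive_minus R_AbsRing C_R_NormedModule); [apply is_Rderive_Cexp_line|].
    apply (is_derive_ext (fun s : R => 0 + RtoC s * h)); [intros t; apply Cplus_0_l|].
    apply is_Rderive_affine.
  + intros t _. apply Hc.
Qed.

Lemma is_Cderive_Cexp (z : C) : is_Cderive Cexp z (Cexp z).
Proof.
assert (M0 : (0 < Cmod (Cexp z))%R) by (apply Cmod_gt_0, Cexp_neq_0).
apply is_Cderive_eps. intros eps Heps.
(* The 3 bounds [exp (Cmod h)] for [Cmod h < 1]. *)
exists (Rmin 1 (eps / (Cmod (Cexp z) * 3))). split.
{ apply Rmin_pos; [lra|]. apply Rdiv_lt_0_compat; lra. }
intros w Hw. set (h := w - z) in *.
assert (H1 := Rlt_le_trans _ _ _ Hw (Rmin_l _ _)).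
assert (H2 := Rlt_le_trans _ _ _ Hw (Rmin_r _ _)).
replace w with (z + h) by (unfold h; ring). rewrite Cexp_plus.
replace (Cexp z * Cexp h - Cexp z - Cexp z * h) with (Cexp z * (Cexp h - 1 - h)) by ring.
rewrite Cmod_mult.
assert (Hh := Cmod_ge_0 h).
apply Rle_trans with (Cmod (Cexp z) * (Cmod h * Cmod h * 3))%R.
- apply Rmult_le_compat_l; [lra|]. eapply Rle_trans; [apply Cmod_Cexp_sub_1_sub|].
  apply Rmult_le_compat_l; [now apply Rmult_le_pos|].
  apply Rle_trans with (exp 1); [|apply exp_le_3]. left. now apply exp_increasing.
- replace (Cmod (Cexp z) * (Cmod h * Cmod h * 3))%R
    with (Cmod (Cexp z) * 3 * Cmod h * Cmod h)%R by ring.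
  apply Rmult_le_compat_r; [exact Hh|].
  apply (Rmult_lt_compat_l (Cmod (Cexp z) * 3)) in H2; [|lra].
  replace (Cmod (Cexp z) * 3 * (eps / (Cmod (Cexp z) * 3)))%R with eps in H2 by (field; lra). lra.
Qed.

Lemma Ccont_Cexp (z : C) : Ccont Cexp z.
Proof. apply (is_Cderive_continuous _ _ _ (is_Cderive_Cexp z)). Qed.

Lemma continuous_Cexp (T : UniformSpace) (f : T -> C) (x : T) :
  continuous_C T f x -> continuous_C T (fun t => Cexp (f t)) x.
Proof. intros Hf. apply (continuous_Ccomp T f Cexp); [exact Hf|apply Ccont_Cexp]. Qed.

Lemma is_Cderive_pow (f : C -> C) (z l : C) (n : nat) :
  is_Cderive f z l -> is_Cderive (fun w => f w ^ n) z (INR n * f z ^ pred n * l).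
Proof.
intros H. induction n as [|n IH].
- simpl. eapply is_Cderive_eq; [apply is_Cderive_const|]. ring.
- eapply is_Cderive_eq; [apply (is_Cderive_mult f (fun w => f w ^ n)); [exact H|exact IH]|].
  rewrite S_INR, RtoC_plus. simpl pred. destruct n as [|n].
  + simpl. ring.
  + simpl pred. rewrite Cpow_S. ring.
Qed.

Lemma is_Cderive_inv_comp (f : C -> C) (z l : C) :
  is_Cderive f z l -> f z <> 0 -> is_Cderive (fun w => / f w) z (- l * / (f z * f z)).
Proof.
intros H H0. eapply is_Cderive_eq.
- apply (is_Cderive_comp Cinv f); [now apply is_Cderive_inv|exact H].
- ring.
Qed.

Lemma is_Cderive_inv_pow (f : C -> C) (z l : C) (n : nat) :
  is_Cderive f z l -> f z <> 0 ->
  is_Cderive (fun w => / f w ^ n) z (- (INR n * l * / f z ^ S n)).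
Proof.
intros H H0. eapply is_Cderive_eq.
- apply (is_Cderive_inv_comp (fun w => f w ^ n)); [apply is_Cderive_pow; exact H|apply Cpow_nz; exact H0].
- cbv beta. destruct n as [|n].
  + simpl. field. exact H0.
  + simpl pred. rewrite !Cpow_S. assert (Hn := Cpow_nz _ n H0). field. repeat split; assumption.
Qed.

(** * Holomorphic functions on a set *)

Definition Copen (D : C -> Prop) : Prop :=
  forall z, D z -> exists d : R, (0 < d)%R /\ forall w, (Cmod (w - z) < d)%R -> D w.

(** A continuous derivative is part of the notion, so that Cauchy's theorem can be proved by
    differentiating under the integral sign. *)
Definition holomorphic (D : C -> Prop) (f : C -> C) : Prop :=
  exists f' : C -> C, forall z, D z -> is_Cderive f z (f' z) /\ Ccont f' z.

Lemma holomorphic_sub (D E : C -> Prop) (f : C -> C) :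
  (forall z, E z -> D z) -> holomorphic D f -> holomorphic E f.
Proof. intros H [f' Hf]. exists f'. intros z Hz. now apply Hf, H. Qed.

Lemma holomorphic_cont (D : C -> Prop) (f : C -> C) (z : C) :
  holomorphic D f -> D z -> Ccont f z.
Proof. intros [f' Hf] Hz. apply (is_Cderive_continuous f z (f' z)). now apply Hf. Qed.

Lemma holomorphic_const (D : C -> Prop) (c : C) : holomorphic D (fun _ => c).
Proof.
exists (fun _ => RtoC 0). intros z _. split; [apply is_Cderive_const|apply continuous_Cconst].
Qed.

Lemma holomorphic_affine (D : C -> Prop) (c m : C) : holomorphic D (fun w => c + m * w).
Proof.
exists (fun _ => m). intros z _. split; [apply is_Cderive_affine|apply continuous_Cconst].
Qed.

Lemma holomorphic_plus (D : C -> Prop) (f g : C -> C) :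
  holomorphic D f -> holomorphic D g -> holomorphic D (fun w => f w + g w).
Proof.
intros [f' Hf] [g' Hg]. exists (fun w => f' w + g' w). intros z Hz.
destruct (Hf z Hz), (Hg z Hz). split; [now apply is_Cderive_plus|now apply continuous_Cplus].
Qed.

Lemma holomorphic_mult (D : C -> Prop) (f g : C -> C) :
  holomorphic D f -> holomorphic D g -> holomorphic D (fun w => f w * g w).
Proof.
intros [f' Hf] [g' Hg]. exists (fun w => f' w * g w + f w * g' w). intros z Hz.
assert (Cf := is_Cderive_continuous _ _ _ (proj1 (Hf z Hz))).
assert (Cg := is_Cderive_continuous _ _ _ (proj1 (Hg z Hz))).
destruct (Hf z Hz), (Hg z Hz). split; [now apply is_Cderive_mult|].
apply continuous_Cplus; now apply continuous_Cmult.
Qed.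

Lemma holomorphic_pow (D : C -> Prop) (f : C -> C) (n : nat) :
  holomorphic D f -> holomorphic D (fun w => f w ^ n).
Proof.
intros H. induction n as [|n IH]; simpl; [apply holomorphic_const|].
now apply (holomorphic_mult D f (fun w => f w ^ n)).
Qed.

Lemma holomorphic_inv (D : C -> Prop) (f : C -> C) :
  holomorphic D f -> (forall z, D z -> f z <> 0) -> holomorphic D (fun w => / f w).
Proof.
intros [f' Hf] H0. exists (fun w => - f' w * / (f w * f w)). intros z Hz.
assert (Cf := is_Cderive_continuous _ _ _ (proj1 (Hf z Hz))).
destruct (Hf z Hz). split; [apply is_Cderive_inv_comp; auto|].
apply continuous_Cmult; [now apply continuous_Copp|].
apply continuous_Cinv; [now apply continuous_Cmult|]. apply Cmult_neq_0; auto.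
Qed.

Lemma holomorphic_comp_affine (D E : C -> Prop) (f : C -> C) (c m : C) :
  holomorphic D f -> (forall w, E w -> D (c + m * w)) -> holomorphic E (fun w => f (c + m * w)).
Proof.
intros [f' Hf] H. exists (fun w => f' (c + m * w) * m). intros z Hz.
destruct (Hf _ (H z Hz)) as [H1 H2]. split.
- apply (is_Cderive_comp f (fun w => c + m * w)); [exact H1|apply is_Cderive_affine].
- apply continuous_Cmult; [|apply continuous_Cconst].
  apply (continuous_Ccomp _ (fun w => c + m * w) f'); [|exact H2].
  apply (is_Cderive_continuous _ _ _ (is_Cderive_affine c m z)).
Qed.

Lemma holomorphic_Cexp (D : C -> Prop) : holomorphic D Cexp.
Proof. exists Cexp. intros z _. split; [apply is_Cderive_Cexp|apply Ccont_Cexp]. Qed.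

Lemma holomorphic_ext (D : C -> Prop) (f g : C -> C) : Copen D ->
  (forall z, D z -> f z = g z) -> holomorphic D f -> holomorphic D g.
Proof.
intros HD E [f' Hf]. exists f'. intros z Hz. destruct (HD z Hz) as [d [Hd H]].
destruct (Hf z Hz) as [H1 H2]. split; [|exact H2].
apply (is_Cderive_ext_loc f g z (f' z) d Hd); [|exact H1]. intros w Hw. now apply E, H.
Qed.

Definition disc (c : C) (r : R) (z : C) : Prop := (Cmod (z - c) < r)%R.

Lemma Copen_disc (c : C) (r : R) : Copen (disc c r).
Proof.
intros z Hz. unfold disc in *. exists (r - Cmod (z - c))%R. split; [lra|].
intros w Hw. replace (w - c) with ((w - z) + (z - c)) by ring.
eapply Rle_lt_trans; [apply Cmod_triangle|]. lra.
Qed.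

Definition cir (t : R) : C := Cexp (RtoC t * Ci).

Lemma Cmod_cir (t : R) : Cmod (cir t) = 1%R.
Proof.
unfold cir. rewrite Cmod_Cexp, re_scal_l. unfold Ci; simpl. rewrite Rmult_0_r. apply exp_0.
Qed.

Lemma cir_neq_0 (t : R) : cir t <> 0.
Proof. apply Cexp_neq_0. Qed.

Lemma cir_2PI : cir (2 * PI) = cir 0.
Proof.
unfold cir, Cexp, Cmult, RtoC, Ci; simpl.
replace (2 * PI * 0 - 0 * 1)%R with 0%R by ring.
replace (2 * PI * 1 + 0 * 0)%R with (2 * PI)%R by ring.
replace (0 * 0 - 0 * 1)%R with 0%R by ring.
replace (0 * 1 + 0 * 0)%R with 0%R by ring.
now rewrite cos_2PI, sin_2PI, cos_0, sin_0.
Qed.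

Definition circle (c : C) (r : R) (t : R) : C := c + r * cir t.
Definition circle' (r : R) (t : R) : C := r * (Ci * cir t).

Lemma is_Rderive_circle (c : C) (r t : R) : is_Rderive (circle c r) t (circle' r t).
Proof.
apply (is_Cderive_comp_path (fun w => c + r * w) cir).
- apply is_Cderive_affine.
- apply is_Rderive_Cexp_line.
Qed.

Lemma continuous_cir (t : R) : continuous_C R_UniformSpace cir t.
Proof. apply continuous_Cexp_line. Qed.

Lemma continuous_circle (c : C) (r t : R) : continuous_C R_UniformSpace (circle c r) t.
Proof. apply (is_Rderive_continuous _ _ _ (is_Rderive_circle c r t)). Qed.

Lemma continuous_circle' (r t : R) : continuous_C R_UniformSpace (circle' r) t.
Proof.
apply continuous_Cmult; [apply continuous_Cconst|].
apply continuous_Cmult; [apply continuous_Cconst|apply continuous_cir].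
Qed.

Lemma circle_closed (c : C) (r : R) : circle c r (2 * PI) = circle c r 0.
Proof. unfold circle. now rewrite cir_2PI. Qed.

Lemma Cmod_circle_sub (c : C) (r t : R) : (0 <= r)%R -> Cmod (circle c r t - c) = r.
Proof.
intros Hr. unfold circle. replace (c + r * cir t - c) with (r * cir t) by ring.
rewrite Cmod_mult, Cmod_cir, Cmod_RtoC_nonneg by exact Hr. ring.
Qed.

Lemma circle_neq (c : C) (r t : R) (z : C) : (0 <= r)%R -> disc c r z -> circle c r t - z <> 0.
Proof.
intros Hr Hz E. unfold disc in Hz. assert (H := Cmod_circle_sub c r t Hr).
replace (circle c r t - c) with ((circle c r t - z) + (z - c)) in H by ring.
rewrite E, Cplus_0_l in H. lra.
Qed.

Lemma zero_le_2PI : (0 <= 2 * PI)%R.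
Proof. generalize PI_RGT_0. lra. Qed.

Lemma continuous_RxC_fst (g : R -> C) (t : R) (z : C) :
  continuous_C R_UniformSpace g t -> continuous_C RxC (fun p => g (fst p)) (t, z).
Proof.
intros H. apply (continuous_comp (fun p : RxC => fst p) g); [apply continuous_fst|exact H].
Qed.

Lemma continuous_RxC_snd (t : R) (z : C) : continuous_C RxC (fun p => snd p) (t, z).
Proof. apply continuous_snd. Qed.

(* The integral of [f (w) / (w - z)] is unchanged when [f] is contracted towards [z]. *)
Lemma Cauchy_contraction (f : C -> C) (c z : C) (r r' : R) :
  (0 < r < r')%R -> holomorphic (disc c r') f -> disc c r z ->
  CInt (fun t => f (circle c r t) * (circle' r t / (circle c r t - z))) 0 (2 * PI) =
  f z * CInt (fun t => circle' r t / (circle c r t - z)) 0 (2 * PI).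
Proof.
intros Hr [f' Hf] Hz. set (w := circle c r). set (w' := circle' r).
pose (arg := fun t lam => z + lam * (w t - z)).
pose (k := fun t lam => f (arg t lam) * (w' t / (w t - z))).
pose (k' := fun t lam => f' (arg t lam) * w' t).
assert (W0 : forall t, w t - z <> 0) by (intros t; apply circle_neq; [lra|exact Hz]).
(* For [lam] within [rho] of [0, 1], the point [arg t lam] is less than [2 r rho = r' - r] away from
   a point of the closed disc of radius [r], because [Cmod (w t - z) <= 2 r]. *)
pose (rho := ((r' - r) / (2 * r))%R).
assert (Hrho : (0 < rho)%R) by (apply Rdiv_lt_0_compat; lra).
assert (Wz : forall t, (Cmod (w t - z) <= 2 * r)%R).
{ intros t. replace (w t - z) with ((w t - c) - (z - c)) by ring.
  eapply Rle_trans; [apply Cmod_triangle|]. unfold w at 1.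
  rewrite Cmod_circle_sub, Cmod_opp by lra. unfold disc in Hz. lra. }
assert (In : forall s t lam, (0 <= s <= 1)%R -> (Cmod (lam - RtoC s) < rho)%R -> disc c r' (arg t lam)).
{ intros s t lam Hs Hl. unfold disc, arg.
  replace (z + lam * (w t - z) - c)
    with ((RtoC (1 - s) * (z - c) + RtoC s * (w t - c)) + (lam - RtoC s) * (w t - z))
    by (rewrite RtoC_minus; ring).
  eapply Rle_lt_trans; [apply Cmod_triangle|].
  assert (A1 : (Cmod (RtoC (1 - s) * (z - c) + RtoC s * (w t - c)) <= r)%R).
  { eapply Rle_trans; [apply Cmod_triangle|]. rewrite !Cmod_mult, !Cmod_RtoC_nonneg by lra.
    unfold w. rewrite Cmod_circle_sub by lra. unfold disc in Hz.
    assert (((1 - s) * Cmod (z - c) <= (1 - s) * r)%R) by (apply Rmult_le_compat_l; lra). lra. }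
  assert (A2 : (Cmod ((lam - RtoC s) * (w t - z)) < r' - r)%R).
  { rewrite Cmod_mult. apply Rle_lt_trans with (Cmod (lam - RtoC s) * (2 * r))%R.
    - apply Rmult_le_compat_l; [apply Cmod_ge_0|apply Wz].
    - apply (Rmult_lt_compat_r (2 * r)) in Hl; [|lra]. unfold rho in Hl.
      replace ((r' - r) / (2 * r) * (2 * r))%R with (r' - r)%R in Hl by (field; lra). exact Hl. }
  lra. }
assert (Carg : forall t lam, continuous_C RxC (fun p => arg (fst p) (snd p)) (t, lam)).
{ intros t lam. unfold arg. apply continuous_Cplus; [apply continuous_Cconst|].
  apply continuous_Cmult; [apply continuous_RxC_snd|].
  apply (continuous_RxC_fst (fun t => w t - z)).
  apply continuous_Cminus; [apply continuous_circle|apply continuous_Cconst]. }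
assert (Cw' : forall t, continuous_C R_UniformSpace (fun t => w' t / (w t - z)) t).
{ intros t. apply continuous_Cdiv; [apply continuous_circle'| |apply W0].
  apply continuous_Cminus; [apply continuous_circle|apply continuous_Cconst]. }
assert (Cdk' : forall s t lam, (0 <= s <= 1)%R -> (Cmod (lam - RtoC s) < rho)%R ->
   continuous_C RxC (fun p => k' (fst p) (snd p)) (t, lam)).
{ intros s t lam Hs Hl. unfold k'. apply continuous_Cmult.
  - apply (continuous_Ccomp _ (fun p : RxC => arg (fst p) (snd p)) f'); [apply Carg|].
    apply Hf. now apply (In s).
  - apply (continuous_RxC_fst w'). apply continuous_circle'. }
assert (HD : forall s, (0 <= s <= 1)%R ->
  is_Cderive (fun lam => CInt (fun t => k t lam) 0 (2 * PI)) (RtoC s) 0).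
{ intros s Hs. eapply is_Cderive_eq.
  - apply (is_Cderive_CInt_param k k' 0 (2 * PI) (RtoC s) rho); [apply zero_le_2PI|exact Hrho| | |].
    + intros t lam _ Hl. unfold k. eapply is_Cderive_eq.
      * apply is_Cderive_mult; [|apply is_Cderive_const].
        apply (is_Cderive_comp f (arg t)); [apply Hf; now apply (In s)|].
        unfold arg. apply (is_Cderive_plus (fun _ => z) (fun lam => lam * (w t - z)));
          [apply is_Cderive_const|].
        apply (is_Cderive_mult (fun lam => lam) (fun _ => w t - z));
          [apply is_Cderive_id|apply is_Cderive_const].
      * unfold k'. cbv beta. field. apply W0.
    + intros t lam _ Hl. unfold k. apply continuous_Cmult.
      * apply (continuous_Ccomp _ (fun p : RxC => arg (fst p) (snd p)) f); [apply Carg|].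
        apply (is_Cderive_continuous f _ (f' (arg t lam))). apply Hf. now apply (In s).
      * apply (continuous_RxC_fst (fun t => w' t / (w t - z))). apply Cw'.
    + intros t lam _ Hl. now apply (Cdk' s).
  - assert (S0 : (Cmod (RtoC s - RtoC s) < rho)%R).
    { replace (RtoC s - RtoC s) with (RtoC 0) by ring. now rewrite Cmod_0. }
    assert (Ck : cont_on (fun t => k' t (RtoC s)) 0 (2 * PI)).
    { intros t _. apply continuous_RxC_slice_l. now apply (Cdk' s). }
    (* The derivative in [lam] is the integral of [k'] over a closed curve. For nonzero [s],
       [s * k'] is the [t]-derivative of [f (arg t s)]; at [s = 0] the integrand is simply
       [f' z * w']. *)
    destruct (Req_dec s 0) as [->|Hs0].
    + rewrite (CInt_derive (fun t => f' z * w t)).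
      * unfold w. rewrite circle_closed. ring.
      * intros t _. unfold k', arg. rewrite Cmult_0_l, Cplus_0_r.
        apply (is_Cderive_comp_path (fun u => f' z * u) w); [|apply is_Rderive_circle].
        eapply is_Cderive_eq; [apply is_Cderive_scal, is_Cderive_id|ring].
      * exact Ck.
    + assert (E : RtoC s * CInt (fun t => k' t (RtoC s)) 0 (2 * PI) = 0).
      { rewrite <- CInt_scal by exact Ck.
        rewrite (CInt_derive (fun t => f (arg t (RtoC s)))).
        - unfold arg, w. rewrite circle_closed. ring.
        - intros t _. unfold k'. replace (RtoC s * (f' (arg t (RtoC s)) * w' t))
            with (f' (arg t (RtoC s)) * (RtoC s * w' t)) by ring.
          apply (is_Cderive_comp_path f (fun t => arg t (RtoC s))).
          + apply Hf. now apply (In s).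
          + unfold arg.
            apply (is_Cderive_comp_path (fun u => z + RtoC s * (u - z)) w); [|apply is_Rderive_circle].
            apply (is_Cderive_ext_loc (fun u => (z - RtoC s * z) + RtoC s * u) _ _ _ 1 Rlt_0_1).
            * intros u _. ring.
            * apply is_Cderive_affine.
        - now apply cont_on_scal. }
      assert (Hs1 : RtoC s <> 0) by (intros Q; apply Hs0; now apply RtoC_inj).
      rewrite <- (Cmult_1_l (CInt _ _ _)), <- (Cinv_l _ Hs1), <- Cmult_assoc, E. ring. }
assert (K : (Cmod (CInt (fun t => k t 1) 0 (2 * PI) - CInt (fun t => k t 0) 0 (2 * PI) - 0 * (1 - 0)) <=
   0 * Cmod (1 - 0))%R).
{ assert (Sg : forall s, seg 0 1 s = RtoC s) by (intros s; unfold seg; ring).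
  apply (C_mean_value (fun lam => CInt (fun t => k t lam) 0 (2 * PI)) (fun _ => RtoC 0)).
  - intros s Hs. rewrite Sg. now apply HD.
  - intros s _. apply continuous_Cconst.
  - intros s _. replace (0 - 0) with (RtoC 0) by ring. rewrite Cmod_0. lra. }
rewrite Rmult_0_l in K.
assert (K1 : CInt (fun t => k t 1) 0 (2 * PI) = CInt (fun t => k t 0) 0 (2 * PI)).
{ apply Ceq_minus. apply Cmod_eq_0. apply Rle_antisym; [|apply Cmod_ge_0].
  eapply Rle_trans; [|exact K]. right. f_equal. ring. }
rewrite <- CInt_scal by (intros t _; apply Cw').
transitivity (CInt (fun t => k t 1) 0 (2 * PI)); [|rewrite K1]; apply CInt_ext; intros t _; unfold k, arg.
- do 2 f_equal. ring.
- do 2 f_equal. ring.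
Qed.

(** * Cauchy's formula *)

(** [phi] is the density with respect to the parameter and already contains the velocity of the
    circle. It is an arbitrary continuous function, so the integral is holomorphic in [z] even when
    [phi] is not made from a holomorphic function. *)
Definition Cauchy_int (phi : R -> C) (c : C) (r : R) (m : nat) (z : C) : C :=
  CInt (fun t => phi t * / (circle c r t - z) ^ m) 0 (2 * PI).

Lemma continuous_Cauchy_kernel (phi : R -> C) (c : C) (r : R) (m : nat) (t : R) (z : C) :
  (0 <= r)%R -> (forall t, continuous_C R_UniformSpace phi t) -> disc c r z ->
  continuous_C RxC (fun p => phi (fst p) * / (circle c r (fst p) - snd p) ^ m) (t, z).
Proof.
intros Hr Hphi Hz. apply continuous_Cmult; [now apply (continuous_RxC_fst phi)|].
apply continuous_Cinv.
- apply continuous_Cpow. apply continuous_Cminus; [|apply continuous_RxC_snd].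
  apply (continuous_RxC_fst (circle c r)). apply continuous_circle.
- apply Cpow_nz. now apply circle_neq.
Qed.

Lemma cont_on_Cauchy_kernel (phi : R -> C) (c : C) (r : R) (m : nat) (z : C) (a b : R) :
  (0 <= r)%R -> (forall t, continuous_C R_UniformSpace phi t) -> disc c r z ->
  cont_on (fun t => phi t * / (circle c r t - z) ^ m) a b.
Proof.
intros Hr Hphi Hz t _.
apply (continuous_RxC_slice_l (fun t z => phi t * / (circle c r t - z) ^ m)).
now apply continuous_Cauchy_kernel.
Qed.

Lemma is_Cderive_Cauchy_int (phi : R -> C) (c : C) (r : R) (m : nat) (z : C) :
  (0 < r)%R -> (forall t, continuous_C R_UniformSpace phi t) -> disc c r z ->
  is_Cderive (Cauchy_int phi c r m) z (INR m * Cauchy_int phi c r (S m) z).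
Proof.
intros Hr Hphi Hz. destruct (Copen_disc c r z Hz) as [d [Hd Hin]].
unfold Cauchy_int. rewrite <- CInt_scal by (apply cont_on_Cauchy_kernel; try assumption; lra).
apply (is_Cderive_CInt_param (fun t z => phi t * / (circle c r t - z) ^ m)
  (fun t z => INR m * (phi t * / (circle c r t - z) ^ S m)) 0 (2 * PI) z d);
  [apply zero_le_2PI|exact Hd| | |].
- intros t w _ Hw. eapply is_Cderive_eq.
  + apply (is_Cderive_scal (phi t) (fun z => / (circle c r t - z) ^ m)).
    apply (is_Cderive_inv_pow (fun z => circle c r t - z)).
    * apply (is_Cderive_minus (fun _ => circle c r t) (fun z => z));
        [apply is_Cderive_const|apply is_Cderive_id].
    * apply circle_neq; [lra|now apply Hin].
  + cbv beta. ring.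
- intros t w _ Hw. apply continuous_Cauchy_kernel; [lra|exact Hphi|now apply Hin].
- intros t w _ Hw. apply continuous_Cmult; [apply continuous_Cconst|].
  apply continuous_Cauchy_kernel; [lra|exact Hphi|now apply Hin].
Qed.

Lemma holomorphic_Cauchy_int (phi : R -> C) (c : C) (r : R) (m : nat) :
  (0 < r)%R -> (forall t, continuous_C R_UniformSpace phi t) ->
  holomorphic (disc c r) (Cauchy_int phi c r m).
Proof.
intros Hr Hphi. exists (fun z => INR m * Cauchy_int phi c r (S m) z). intros z Hz. split.
- now apply is_Cderive_Cauchy_int.
- apply continuous_Cmult; [apply continuous_Cconst|].
  eapply is_Cderive_continuous. now apply is_Cderive_Cauchy_int.
Qed.

Lemma CInt_inv_pow_path (g g' : R -> C) (a b : R) (p : C) (m : nat) :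
  (forall t, (Rmin a b <= t <= Rmax a b)%R ->
     is_Rderive g t (g' t) /\ continuous_C R_UniformSpace g' t /\ g t - p <> 0) ->
  CInt (fun t => / (g t - p) ^ S (S m) * g' t) a b =
  / INR (S m) * (/ (g a - p) ^ S m - / (g b - p) ^ S m).
Proof.
intros H. assert (Hm : RtoC (INR (S m)) <> 0).
{ intros E. apply RtoC_inj in E. revert E. apply not_0_INR. lia. }
rewrite (CInt_derive (fun t => - / INR (S m) * / (g t - p) ^ S m)).
- ring.
- intros t Ht. destruct (H t Ht) as [H1 [H2 H3]].
  apply (is_Cderive_comp_path (fun w => - / INR (S m) * / (w - p) ^ S m) g); [|exact H1].
  eapply is_Cderive_eq.
  + apply is_Cderive_scal. apply (is_Cderive_inv_pow (fun w => w - p)); [|exact H3].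
    apply is_Cderive_minus; [apply is_Cderive_id|apply is_Cderive_const].
  + cbv beta. assert (Hp := Cpow_nz _ (S (S m)) H3). field. split; assumption.
- intros t Ht. destruct (H t Ht) as [H1 [H2 H3]].
  apply continuous_Cmult; [|exact H2]. apply continuous_Cinv; [|now apply Cpow_nz].
  apply continuous_Cpow, continuous_Cminus; [|apply continuous_Cconst].
  exact (is_Rderive_continuous _ _ _ H1).
Qed.

Lemma Ceq_of_small (x y : C) : (forall eps : R, (0 < eps)%R -> (Cmod (x - y) <= eps)%R) -> x = y.
Proof.
intros H. apply Ceq_minus, Cmod_eq_0.
destruct (Rle_lt_or_eq_dec _ _ (Cmod_ge_0 (x - y))) as [P|P]; [|now symmetry].
specialize (H (Cmod (x - y) / 2)%R ltac:(lra)). lra.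
Qed.

Lemma constant_of_Cderive_0 (f : C -> C) (z w : C) :
  (forall s, (0 <= s <= 1)%R -> is_Cderive f (seg z w s) 0) -> f w = f z.
Proof.
intros H. apply Ceq_of_small. intros eps Heps.
assert (K := C_mean_value f (fun _ => RtoC 0) z w 0 0 H (fun s _ => continuous_Cconst _ _ _)).
replace (f w - f z - 0 * (w - z)) with (f w - f z) in K by ring.
rewrite Rmult_0_l in K. eapply Rle_trans; [apply K|lra].
intros s _. replace (0 - 0) with (RtoC 0) by ring. rewrite Cmod_0. lra.
Qed.

Lemma disc_center (c : C) (r : R) : (0 < r)%R -> disc c r c.
Proof. intros Hr. unfold disc. replace (c - c) with (RtoC 0) by ring. now rewrite Cmod_0. Qed.

(** The derivative in [z] is the integral of [1 / (w - z)^2], which has a primitive and vanishes on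
    a closed curve. So the value is that at the centre, where the integrand is the constant [Ci]. *)
Lemma circle_winding (c : C) (r : R) (z : C) : (0 < r)%R -> disc c r z ->
  Cauchy_int (circle' r) c r 1 z = 2 * PI * Ci.
Proof.
intros Hr Hz.
rewrite (constant_of_Cderive_0 (Cauchy_int (circle' r) c r 1) c z).
- unfold Cauchy_int. rewrite (CInt_ext _ (fun _ => Ci)).
  + apply CInt_unique. replace (2 * PI * Ci) with (RtoC (2 * PI - 0) * Ci).
    * rewrite <- scal_R_Cmult. apply (@is_RInt_const C_R_NormedModule).
    * rewrite RtoC_minus, RtoC_mult. ring.
  + intros t _. unfold circle, circle'. rewrite Cpow_1_r. field.
    replace (c + r * cir t - c) with (r * cir t) by ring. apply Cmult_neq_0.
    * intros E. apply RtoC_inj in E. lra.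
    * apply cir_neq_0.
- intros s Hs.
  assert (Hd : disc c r (seg c z s)).
  { unfold disc. eapply Rle_lt_trans; [apply Cmod_seg_sub; exact Hs|exact Hz]. }
  eapply is_Cderive_eq.
  + apply is_Cderive_Cauchy_int; [exact Hr| |exact Hd]. apply continuous_circle'.
  + unfold Cauchy_int. rewrite (CInt_ext _ (fun t => / (circle c r t - seg c z s) ^ 2 * circle' r t)).
    * rewrite CInt_inv_pow_path.
      { rewrite circle_closed. ring. }
      intros t _. split; [apply is_Rderive_circle|]. split; [apply continuous_circle'|].
      apply circle_neq; [lra|exact Hd].
    * intros t _. ring.
Qed.

Lemma two_PI_Ci_neq_0 : 2 * PI * Ci <> 0.
Proof.
apply Cmult_neq_0; [|apply Ci_nz]. rewrite <- RtoC_mult. intros E. apply RtoC_inj in E.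
generalize PI_RGT_0. lra.
Qed.

Lemma cont_circle_comp (f : C -> C) (c : C) (r r' : R) (t : R) :
  (0 <= r < r')%R -> holomorphic (disc c r') f -> continuous_C R_UniformSpace (fun t => f (circle c r t)) t.
Proof.
intros Hr Hf. apply (continuous_Ccomp _ (circle c r) f); [apply continuous_circle|].
apply (holomorphic_cont _ _ _ Hf). unfold disc. rewrite Cmod_circle_sub; lra.
Qed.

Lemma Cauchy_formula (f : C -> C) (c z : C) (r r' : R) :
  (0 < r < r')%R -> holomorphic (disc c r') f -> disc c r z ->
  Cauchy_int (fun t => f (circle c r t) * circle' r t) c r 1 z = 2 * PI * Ci * f z.
Proof.
intros Hr Hf Hz. rewrite <- (circle_winding c r z) by (assumption || lra).
unfold Cauchy_int. rewrite (Cmult_comm _ (f z)).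
assert (E := Cauchy_contraction f c z r r' Hr Hf Hz).
transitivity (CInt (fun t => f (circle c r t) * (circle' r t / (circle c r t - z))) 0 (2 * PI)).
- apply CInt_ext. intros t _. rewrite Cpow_1_r. unfold Cdiv. ring.
- rewrite E. f_equal. apply CInt_ext. intros t _. now rewrite Cpow_1_r.
Qed.

Lemma continuous_circle_form (f : C -> C) (c : C) (r r' : R) (t : R) :
  (0 <= r < r')%R -> holomorphic (disc c r') f ->
  continuous_C R_UniformSpace (fun t => f (circle c r t) * circle' r t) t.
Proof.
intros Hr Hf. apply continuous_Cmult; [now apply (cont_circle_comp f c r r')|apply continuous_circle'].
Qed.

(** Cauchy's formula is differentiated [n] times. The induction runs over all [z] of the disc at
    once, because the next derivative needs the formula in a neighbourhood. *)
Lemma Cauchy_derive_n (f : C -> C) (c : C) (r r' : R) : (0 < r < r')%R -> holomorphic (disc c r') f ->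
  forall n z, disc c r z ->
  C_derive_n f n z =
    INR (fact n) * / (2 * PI * Ci) * Cauchy_int (fun t => f (circle c r t) * circle' r t) c r (S n) z /\
  exists l, is_Cderive (C_derive_n f n) z l.
Proof.
intros Hr Hf.
set (phi := fun t => f (circle c r t) * circle' r t).
assert (Hphi : forall t, continuous_C R_UniformSpace phi t).
{ intros t. now apply (continuous_circle_form f c r r'); [lra|]. }
assert (G : forall n, (forall z, disc c r z -> C_derive_n f n z =
    INR (fact n) * / (2 * PI * Ci) * Cauchy_int phi c r (S n) z) ->
  forall z, disc c r z -> is_Cderive (C_derive_n f n) z
    (INR (fact n) * / (2 * PI * Ci) * (INR (S n) * Cauchy_int phi c r (S (S n)) z))).
{ intros n H z Hz. destruct (Copen_disc c r z Hz) as [d [Hd Hin]].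
  apply (is_Cderive_ext_loc (fun z => INR (fact n) * / (2 * PI * Ci) * Cauchy_int phi c r (S n) z)
     _ z _ d Hd).
  - intros w Hw. symmetry. apply H. now apply Hin.
  - apply is_Cderive_scal. apply is_Cderive_Cauchy_int; [lra|exact Hphi|exact Hz]. }
assert (E : forall n z, disc c r z -> C_derive_n f n z =
    INR (fact n) * / (2 * PI * Ci) * Cauchy_int phi c r (S n) z).
{ induction n as [|n IH]; intros z Hz.
  - simpl. unfold phi. rewrite (Cauchy_formula f c z r r') by assumption.
    field. split; [apply Ci_nz|]. intros Q. apply two_PI_Ci_neq_0. rewrite Q. ring.
  - simpl C_derive_n. rewrite (is_C_derive_unique _ _ _ (G n IH z Hz)).
    rewrite fact_simpl, mult_INR, RtoC_mult. ring. }
intros n z Hz. split; [now apply E|]. eexists. apply G; [apply E|exact Hz].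
Qed.

(** The local derivatives glue because each of them agrees with the canonical choice
    [C_derive f]. *)
Lemma holomorphic_local (D : C -> Prop) (f : C -> C) :
  (forall z, D z -> exists r : R, (0 < r)%R /\ holomorphic (disc z r) f) -> holomorphic D f.
Proof.
intros H. exists (C_derive f). intros z Hz. destruct (H z Hz) as [r [Hr [f' Hf]]].
assert (E : forall w, disc z r w -> C_derive f w = f' w).
{ intros w Hw. apply is_C_derive_unique. now apply Hf. }
assert (Z := disc_center z r Hr). split.
- rewrite E by exact Z. now apply Hf.
- apply (Ccont_ext_loc f' _ z r Hr); [|now apply Hf]. intros w Hw. symmetry. now apply E.
Qed.

(** * Uniform limits and division by a linear factor *)

Definition unif_lim (P : C -> Prop) (f : nat -> C -> C) (g : C -> C) : Prop :=
  forall eps : R, (0 < eps)%R -> exists N : nat, forall n z, (N <= n)%nat -> P z ->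
    (Cmod (f n z - g z) <= eps)%R.

Lemma unif_lim_cont (P : C -> Prop) (f : nat -> C -> C) (g : C -> C) (z : C) :
  Copen P -> P z -> unif_lim P f g -> (forall n, Ccont (f n) z) -> Ccont g z.
Proof.
intros HP Hz Hu Hc. apply Ccont_eps. intros eps Heps.
destruct (Hu (eps / 4)%R ltac:(lra)) as [N HN].
destruct (proj1 (Ccont_eps (f N) z) (Hc N) (eps / 4)%R ltac:(lra)) as [d [Hd H1]].
destruct (HP z Hz) as [d' [Hd' Hin]].
exists (Rmin d d'). split; [now apply Rmin_pos|]. intros w Hw.
assert (Hw1 := Rlt_le_trans _ _ _ Hw (Rmin_l _ _)).
assert (Hw2 := Rlt_le_trans _ _ _ Hw (Rmin_r _ _)).
replace (g w - g z) with ((f N w - f N z) + (f N z - g z) - (f N w - g w)) by ring.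
eapply Rle_lt_trans; [apply Cmod_triangle|]. rewrite Cmod_opp.
assert (A1 := HN N w (le_n N) (Hin w Hw2)). assert (A2 := HN N z (le_n N) Hz).
assert (A3 := Cmod_triangle (f N w - f N z) (f N z - g z)). assert (A4 := H1 w Hw1). lra.
Qed.

(** Weierstrass's theorem: the limit is continuous, Cauchy's formula on the circle of radius [r]
    passes to it, and a Cauchy integral is holomorphic whatever its continuous density. *)
Lemma holomorphic_limit_disc (f : nat -> C -> C) (g : C -> C) (c : C) (r r' : R) :
  (0 < r < r')%R -> (forall n, holomorphic (disc c r') (f n)) -> unif_lim (disc c r') f g ->
  holomorphic (disc c r) g.
Proof.
intros Hr Hf Hu.
assert (Cg : forall z, disc c r' z -> Ccont g z).
{ intros z Hz. apply (unif_lim_cont (disc c r') f g z (Copen_disc c r') Hz Hu).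
  intros n. now apply (holomorphic_cont (disc c r')). }
assert (Hin : forall t, disc c r' (circle c r t)).
{ intros t. unfold disc. rewrite Cmod_circle_sub; lra. }
pose (phi := fun t => g (circle c r t) * circle' r t).
assert (Hphi : forall t, continuous_C R_UniformSpace phi t).
{ intros t. apply continuous_Cmult; [|apply continuous_circle'].
  apply (continuous_Ccomp _ (circle c r) g); [apply continuous_circle|now apply Cg]. }
apply (holomorphic_ext _ (fun z => / (2 * PI * Ci) * Cauchy_int phi c r 1 z)).
- apply Copen_disc.
- intros z Hz. assert (Hz' : disc c r' z) by (unfold disc in *; lra).
  assert (Nz := two_PI_Ci_neq_0).
  enough (E : Cauchy_int phi c r 1 z = 2 * PI * Ci * g z).
  { rewrite E. rewrite Cmult_assoc, Cinv_l by exact Nz. ring. }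
  apply Ceq_of_small. intros eps Heps.
  pose (dl := (r - Cmod (z - c))%R). assert (Hdl : (0 < dl)%R) by (unfold dl, disc in *; lra).
  (* The first summand comes from the kernel, at most [r / dl] on the circle, the second from the
     value of [f N - g] at [z]. *)
  pose (M := (2 * PI * (r / dl) + 2 * PI)%R).
  assert (P0 := PI_RGT_0).
  assert (Q0 : (0 < r / dl)%R) by (apply Rdiv_lt_0_compat; lra).
  assert (Q1 : (0 < 2 * PI * (r / dl))%R) by (apply Rmult_lt_0_compat; lra).
  assert (HM : (0 < M)%R) by (unfold M; lra).
  destruct (Hu (eps / M)%R) as [N HN]; [now apply Rdiv_lt_0_compat|].
  assert (He : (0 < eps / M)%R) by now apply Rdiv_lt_0_compat.
  pose (phiN := fun t => f N (circle c r t) * circle' r t).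
  assert (F := Cauchy_formula (f N) c z r r' Hr (Hf N) Hz). fold phiN in F.
  replace (Cauchy_int phi c r 1 z - 2 * PI * Ci * g z) with
    ((Cauchy_int phi c r 1 z - Cauchy_int phiN c r 1 z)
     + 2 * PI * Ci * (f N z - g z)) by (rewrite F; ring).
  eapply Rle_trans; [apply Cmod_triangle|].
  assert (B1 : (Cmod (2 * PI * Ci * (f N z - g z)) <= 2 * PI * (eps / M))%R).
  { rewrite !Cmod_mult, Cmod_Ci, !Cmod_RtoC_nonneg by lra. rewrite Rmult_1_r.
    apply Rmult_le_compat_l; [lra|]. now apply HN. }
  assert (K1 := cont_on_Cauchy_kernel phi c r 1 z 0 (2 * PI) ltac:(lra) Hphi Hz).
  assert (K2 := cont_on_Cauchy_kernel phiN c r 1 z 0 (2 * PI)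
     ltac:(lra) (fun t => continuous_circle_form (f N) c r r' t ltac:(lra) (Hf N)) Hz).
  assert (B2 : (Cmod (Cauchy_int phi c r 1 z - Cauchy_int phiN c r 1 z)
     <= (2 * PI - 0) * (eps / M * (r / dl)))%R).
  { unfold Cauchy_int. rewrite <- CInt_minus by assumption.
    apply Cmod_CInt_le_const; [lra| |].
    - intros t Ht. apply continuous_Cminus; [now apply K1|now apply K2].
    - intros t _. unfold phi, phiN. rewrite Cpow_1_r.
      replace (g (circle c r t) * circle' r t * / (circle c r t - z) -
        f N (circle c r t) * circle' r t * / (circle c r t - z))%C
        with (- (f N (circle c r t) - g (circle c r t)) * (circle' r t * / (circle c r t - z)))%C by ring.
      rewrite Cmod_mult, Cmod_opp. apply Rmult_le_compat; try apply Cmod_ge_0.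
      + now apply HN.
      + rewrite Cmod_mult, Cmod_inv by (apply circle_neq; [lra|exact Hz]).
        unfold circle'. rewrite !Cmod_mult, Cmod_Ci, Cmod_cir, Cmod_RtoC_nonneg by lra.
        rewrite !Rmult_1_r. apply Rmult_le_compat_l; [lra|]. apply Rinv_le_contravar; [exact Hdl|].
        unfold dl. assert (T := Cmod_circle_sub c r t ltac:(lra)).
        replace (circle c r t - c) with ((circle c r t - z) + (z - c)) in T by ring.
        assert (T2 := Cmod_triangle (circle c r t - z) (z - c)). lra. }
  apply Rle_trans with (M * (eps / M))%R; [|right; field; lra].
  unfold M at 1. lra.
- apply (holomorphic_mult _ (fun _ => / (2 * PI * Ci))); [apply holomorphic_const|].
  apply holomorphic_Cauchy_int; [lra|exact Hphi].
Qed.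

Lemma holomorphic_limit (D : C -> Prop) (f : nat -> C -> C) (g : C -> C) :
  (forall z, D z -> exists r : R, (0 < r)%R /\
     (forall n, holomorphic (disc z r) (f n)) /\ unif_lim (disc z r) f g) -> holomorphic D g.
Proof.
intros H. apply holomorphic_local. intros z Hz. destruct (H z Hz) as [r [Hr [H1 H2]]].
exists (r / 2)%R. split; [lra|]. apply (holomorphic_limit_disc f g z (r / 2) r); [lra|exact H1|exact H2].
Qed.

(** Off [p] the quotient is explicit. Near [p] Cauchy's formula is used at [w] and at [p]: the
    difference of the kernels [1/(u-w)] and [1/(u-p)] contains the factor [w - p], and the other
    factor [1/((u-w)(u-p))] yields a Cauchy integral with density [psi]. *)
Lemma divided_difference (D : C -> Prop) (H : C -> C) (p : C) :
  Copen D -> holomorphic D H -> D p ->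
  exists q : C -> C, holomorphic D q /\ forall w, D w -> H w = H p + (w - p) * q w.
Proof.
intros HD HH Hp. destruct (HD p Hp) as [r' [Hr' Hin]].
pose (r := (r' / 2)%R). assert (Hr : (0 < r < r')%R) by (unfold r; lra).
assert (HH' : holomorphic (disc p r') H) by (apply (holomorphic_sub D); [exact Hin|exact HH]).
pose (phi := fun t => H (circle p r t) * circle' r t).
assert (Hphi : forall t, continuous_C R_UniformSpace phi t).
{ intros t. apply (continuous_circle_form H p r r'); [lra|exact HH']. }
assert (Zp := disc_center p r (proj1 Hr)).
assert (Np : forall t, circle p r t - p <> 0) by (intros t; apply circle_neq; [lra|exact Zp]).
pose (psi := fun t => phi t * / (circle p r t - p)).
assert (Hpsi : forall t, continuous_C R_UniformSpace psi t).
{ intros t. apply continuous_Cmult; [apply Hphi|]. apply continuous_Cinv; [|apply Np].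
  apply continuous_Cminus; [apply continuous_circle|apply continuous_Cconst]. }
pose (Q := fun w => / (2 * PI * Ci) * Cauchy_int psi p r 1 w).
pose (q := fun w => if Ceq_dec w p then Q p else (H w - H p) * / (w - p)).
assert (Nz := two_PI_Ci_neq_0).
assert (EQ : forall w, disc p r w -> H w - H p = (w - p) * Q w).
{ intros w Hw. unfold Q.
  assert (F1 := Cauchy_formula H p w r r' Hr HH' Hw).
  assert (F2 := Cauchy_formula H p p r r' Hr HH' Zp).
  fold phi in F1, F2.
  enough (E : Cauchy_int phi p r 1 w - Cauchy_int phi p r 1 p = (w - p) * Cauchy_int psi p r 1 w).
  { replace ((w - p) * (/ (2 * PI * Ci) * Cauchy_int psi p r 1 w))
      with (/ (2 * PI * Ci) * ((w - p) * Cauchy_int psi p r 1 w)) by ring.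
    rewrite <- E, F1, F2. field. split; [apply Ci_nz|]. intros E0. apply Nz. rewrite E0. ring. }
  unfold Cauchy_int.
  rewrite <- CInt_minus by (apply cont_on_Cauchy_kernel; try assumption; lra).
  rewrite <- CInt_scal by (apply cont_on_Cauchy_kernel; try assumption; lra).
  apply CInt_ext. intros t _. rewrite !Cpow_1_r. unfold psi.
  assert (N1 := Np t). assert (N2 := circle_neq p r t w ltac:(lra) Hw).
  field. split; assumption. }
exists q. split.
- apply holomorphic_local. intros z Hz. destruct (Ceq_dec z p) as [->|Hzp].
  + exists r. split; [lra|]. apply (holomorphic_ext _ Q); [apply Copen_disc| |].
    * intros w Hw. unfold q. destruct (Ceq_dec w p) as [->|Hwp]; [reflexivity|].
      rewrite (EQ w Hw). field. now apply Cminus_eq_contra.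
    * apply (holomorphic_mult _ (fun _ => / (2 * PI * Ci))); [apply holomorphic_const|].
      apply holomorphic_Cauchy_int; [lra|exact Hpsi].
  + destruct (HD z Hz) as [d [Hd Hin2]].
    assert (Hm : (0 < Cmod (z - p))%R) by (apply Cmod_gt_0; now apply Cminus_eq_contra).
    exists (Rmin d (Cmod (z - p))). split; [now apply Rmin_pos|].
    assert (W : forall w, disc z (Rmin d (Cmod (z - p))) w -> w <> p).
    { intros w Hw ->. unfold disc in Hw. rewrite Cmod_sub_sym in Hw.
      generalize (Rmin_r d (Cmod (z - p))). lra. }
    apply (holomorphic_ext _ (fun w => (H w + - H p) * / (- p + 1 * w))); [apply Copen_disc| |].
    * intros w Hw. unfold q. destruct (Ceq_dec w p) as [E|Hwp]; [now elim (W w Hw)|].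
      replace (- p + 1 * w) with (w - p) by ring. reflexivity.
    * apply (holomorphic_mult _ (fun w => H w + - H p)).
      { apply (holomorphic_plus _ H); [|apply holomorphic_const].
        apply (holomorphic_sub D); [|exact HH]. intros w Hw. apply Hin2.
        eapply Rlt_le_trans; [exact Hw|apply Rmin_l]. }
      apply (holomorphic_inv _ (fun w => - p + 1 * w)); [apply holomorphic_affine|].
      intros w Hw. replace (- p + 1 * w) with (w - p) by ring.
      apply Cminus_eq_contra. now apply W.
- intros w Hw. unfold q. destruct (Ceq_dec w p) as [->|Hwp]; [ring|].
  field. now apply Cminus_eq_contra.
Qed.

(** * Cycles and meromorphic functions *)

Definition Cconvex (D : C -> Prop) : Prop :=
  forall z w s, D z -> D w -> (0 <= s <= 1)%R -> D (seg z w s).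

Lemma Cconvex_disc (c : C) (r : R) : Cconvex (disc c r).
Proof.
intros z w s Hz Hw Hs. unfold disc, seg in *.
replace (z + s * (w - z) - c) with (RtoC (1 - s) * (z - c) + RtoC s * (w - c))
  by (rewrite RtoC_minus; ring).
eapply Rle_lt_trans; [apply Cmod_triangle|]. rewrite !Cmod_mult, !Cmod_RtoC_nonneg by lra.
destruct (Req_dec s 0) as [->|Hs0]; [lra|].
assert (((1 - s) * Cmod (z - c) <= (1 - s) * r)%R) by (apply Rmult_le_compat_l; lra).
assert ((s * Cmod (w - c) < s * r)%R) by (apply Rmult_lt_compat_l; lra). lra.
Qed.

(** The primitive is the integral of [f] along the segment from [c] to [z]. Its derivative under the
    integral sign is the [t]-derivative of [t * f (c + t (z - c))], which integrates to [f z]. *)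
Lemma holomorphic_primitive (D : C -> Prop) (f : C -> C) (c : C) :
  Copen D -> Cconvex D -> D c -> holomorphic D f ->
  exists P : C -> C, forall z, D z -> is_Cderive P z (f z).
Proof.
intros HD HC Hc [f' Hf].
exists (fun z => CInt (fun t => f (seg c z t) * (z - c)) 0 1).
intros z Hz. destruct (HD z Hz) as [d [Hd Hin]].
assert (Cs : forall t w, continuous_C RxC (fun p => seg c (snd p) (fst p)) (t, w)).
{ intros t w. unfold seg. apply continuous_Cplus; [apply continuous_Cconst|].
  apply continuous_Cmult.
  - apply (continuous_RxC_fst RtoC). apply (continuous_RtoC _ (fun t => t)). apply continuous_id.
  - apply continuous_Cminus; [apply continuous_RxC_snd|apply continuous_Cconst]. }
assert (Ct : forall t w, continuous_C RxC (fun p => RtoC (fst p)) (t, w)).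
{ intros t w. apply (continuous_RxC_fst RtoC). apply (continuous_RtoC _ (fun t => t)). apply continuous_id. }
assert (Cd : forall t w, continuous_C RxC (fun p => snd p - c) (t, w)).
{ intros t w. apply continuous_Cminus; [apply continuous_RxC_snd|apply continuous_Cconst]. }
assert (Is : forall t w, (0 <= t <= 1)%R -> (Cmod (w - z) < d)%R -> D (seg c w t)).
{ intros t w Ht Hw. apply HC; [exact Hc|now apply Hin|exact Ht]. }
assert (Ck' : forall t w, (0 <= t <= 1)%R -> (Cmod (w - z) < d)%R -> continuous_C RxC
  (fun p => f' (seg c (snd p) (fst p)) * RtoC (fst p) * (snd p - c) + f (seg c (snd p) (fst p))) (t, w)).
{ intros t w Ht Hw. destruct (Hf _ (Is t w Ht Hw)) as [F1 F2]. apply continuous_Cplus.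
  - apply continuous_Cmult; [|apply Cd]. apply continuous_Cmult; [|apply Ct].
    apply (continuous_Ccomp _ (fun p : RxC => seg c (snd p) (fst p)) f'); [apply Cs|exact F2].
  - apply (continuous_Ccomp _ (fun p : RxC => seg c (snd p) (fst p)) f); [apply Cs|].
    exact (is_Cderive_continuous _ _ _ F1). }
eapply is_Cderive_eq.
- apply (is_Cderive_CInt_param (fun t z => f (seg c z t) * (z - c))
    (fun t z => f' (seg c z t) * RtoC t * (z - c) + f (seg c z t)) 0 1 z d); [lra|exact Hd| | |].
  + intros t w Ht Hw. eapply is_Cderive_eq.
    * apply is_Cderive_mult.
      { apply (is_Cderive_comp f (fun w => seg c w t)); [apply Hf; now apply Is|].
        apply (is_Cderive_ext_loc (fun u => (c - RtoC t * c) + RtoC t * u) _ _ _ 1 Rlt_0_1).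
        - intros u _. unfold seg. ring.
        - apply is_Cderive_affine. }
      { apply is_Cderive_minus; [apply is_Cderive_id|apply is_Cderive_const]. }
    * cbv beta. ring.
  + intros t w Ht Hw. apply continuous_Cmult; [|apply Cd].
    apply (continuous_Ccomp _ (fun p : RxC => seg c (snd p) (fst p)) f); [apply Cs|].
    destruct (Hf _ (Is t w Ht Hw)) as [F1 F2]. exact (is_Cderive_continuous _ _ _ F1).
  + intros t w Ht Hw. now apply Ck'.
- assert (Z : (Cmod (z - z) < d)%R) by exact (disc_center z d Hd).
  rewrite (CInt_derive (fun t => RtoC t * f (seg c z t))).
  + rewrite seg_1. ring.
  + intros t Ht. rewrite Rmin_left, Rmax_right in Ht by lra.
    eapply is_Rderive_eq.
    * apply (is_Rderive_mult RtoC (fun t => f (seg c z t))); [apply is_Rderive_RtoC|].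
      apply (is_Cderive_comp_path f (seg c z)); [apply Hf; now apply Is|apply is_Rderive_seg].
    * cbv beta. ring.
  + intros t Ht. rewrite Rmin_left, Rmax_right in Ht by lra.
    apply (continuous_RxC_slice_l (fun t z => f' (seg c z t) * RtoC t * (z - c) + f (seg c z t))).
    now apply Ck'.
Qed.

(** The ends are not ordered, so an arc is reversed by exchanging them, with the same path and
    velocity. *)
Record arc : Type := Arc { apath : R -> C; avel : R -> C; abeg : R; aend : R }.

Definition on_arc (A : arc) (t : R) : Prop := (Rmin (abeg A) (aend A) <= t <= Rmax (abeg A) (aend A))%R.

Definition arc_ok (A : arc) : Prop := forall t, on_arc A t ->
  is_Rderive (apath A) t (avel A t) /\ continuous_C R_UniformSpace (avel A) t.

Definition arc_in (D : C -> Prop) (A : arc) : Prop := forall t, on_arc A t -> D (apath A t).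

Definition arc_int (A : arc) (f : C -> C) : C :=
  CInt (fun t => f (apath A t) * avel A t) (abeg A) (aend A).

Definition arc_bd (A : arc) (F : C -> C) : C := F (apath A (aend A)) - F (apath A (abeg A)).

Definition chain_sum (phi : arc -> C) (L : list arc) : C :=
  fold_right (fun A s => phi A + s) (RtoC 0) L.

Definition chain_int (L : list arc) (f : C -> C) : C := chain_sum (fun A => arc_int A f) L.

Definition chain_in (D : C -> Prop) (L : list arc) : Prop := forall A, In A L -> arc_in D A.

(** The boundary vanishes as a formal sum of points, expressed by testing it against every function
    [F]. The arcs need not be listed in an order in which they join. *)
Definition cycle (L : list arc) : Prop :=
  (forall A, In A L -> arc_ok A) /\ forall F, chain_sum (fun A => arc_bd A F) L = 0.

Lemma chain_sum_ext (phi psi : arc -> C) (L : list arc) :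
  (forall A, In A L -> phi A = psi A) -> chain_sum phi L = chain_sum psi L.
Proof.
induction L as [|A L IH]; intros H; [reflexivity|].
simpl. rewrite (H A) by now left. f_equal. apply IH. intros B HB. apply H. now right.
Qed.

Lemma arc_cont (A : arc) (f : C -> C) :
  arc_ok A -> arc_in (fun z => Ccont f z) A ->
  cont_on (fun t => f (apath A t) * avel A t) (abeg A) (aend A).
Proof.
intros HA Hf t Ht. destruct (HA t Ht) as [H1 H2].
apply continuous_Cmult; [|exact H2].
apply (continuous_Ccomp _ (apath A) f); [exact (is_Rderive_continuous _ _ _ H1)|now apply Hf].
Qed.

Lemma on_arc_between (A : arc) (t : R) :
  (Rmin (abeg A) (aend A) < t < Rmax (abeg A) (aend A))%R -> on_arc A t.
Proof. unfold on_arc. lra. Qed.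

Lemma on_arc_beg (A : arc) : on_arc A (abeg A).
Proof. split; [apply Rmin_l|apply Rmax_l]. Qed.

Lemma on_arc_end (A : arc) : on_arc A (aend A).
Proof. split; [apply Rmin_r|apply Rmax_r]. Qed.

Lemma arc_int_derive (A : arc) (F f : C -> C) :
  arc_ok A -> arc_in (fun z => is_Cderive F z (f z) /\ Ccont f z) A ->
  arc_int A f = arc_bd A F.
Proof.
intros HA Hf. unfold arc_int, arc_bd.
apply (CInt_derive (fun t => F (apath A t))).
- intros t Ht. destruct (HA t Ht) as [H1 H2]. apply is_Cderive_comp_path; [|exact H1]. now apply Hf.
- apply arc_cont; [exact HA|]. intros t Ht. now apply Hf.
Qed.

Lemma arc_int_ext (A : arc) (f g : C -> C) :
  arc_in (fun z => f z = g z) A -> arc_int A f = arc_int A g.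
Proof.
intros H. apply CInt_ext. intros t Ht. rewrite (H t); [reflexivity|]. now apply on_arc_between.
Qed.

Lemma chain_int_ext (L : list arc) (f g : C -> C) :
  chain_in (fun z => f z = g z) L -> chain_int L f = chain_int L g.
Proof. intros H. apply chain_sum_ext. intros A HA. apply arc_int_ext. now apply H. Qed.

Lemma chain_int_lin (L : list arc) (f g : C -> C) (a b : C) :
  (forall A, In A L -> arc_ok A) ->
  chain_in (fun z => Ccont f z) L -> chain_in (fun z => Ccont g z) L ->
  chain_int L (fun z => a * f z + b * g z) = a * chain_int L f + b * chain_int L g.
Proof.
induction L as [|A L IH]; intros HL Hf Hg; [unfold chain_int; simpl; ring|].
unfold chain_int in *. simpl. rewrite IH.
- assert (Cf := arc_cont A f (HL A (or_introl eq_refl)) (Hf A (or_introl eq_refl))).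
  assert (Cg := arc_cont A g (HL A (or_introl eq_refl)) (Hg A (or_introl eq_refl))).
  unfold arc_int. set (u := fun t => f (apath A t) * avel A t) in *. set (v := fun t => g (apath A t) * avel A t) in *.
  rewrite (CInt_ext _ (fun t => a * u t + b * v t)) by (intros t _; unfold u, v; ring).
  rewrite (CInt_plus (fun t => a * u t) (fun t => b * v t)) by now apply cont_on_scal.
  rewrite (CInt_scal u _ _ a Cf), (CInt_scal v _ _ b Cg). ring.
- intros B HB. apply HL. now right.
- intros B HB. apply Hf. now right.
- intros B HB. apply Hg. now right.
Qed.

Lemma cycle_int_derive (L : list arc) (F f : C -> C) :
  cycle L -> chain_in (fun z => is_Cderive F z (f z) /\ Ccont f z) L -> chain_int L f = 0.
Proof.
intros [H1 H2] Hf. rewrite <- (H2 F). apply chain_sum_ext. intros A HA.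
apply arc_int_derive; [now apply H1|now apply Hf].
Qed.

Lemma cycle_int_holomorphic (D : C -> Prop) (L : list arc) (f : C -> C) :
  Copen D -> Cconvex D -> cycle L -> chain_in D L -> holomorphic D f -> chain_int L f = 0.
Proof.
intros HD HC HL Hin Hf.
destruct L as [|A L]; [reflexivity|].
assert (Hc : D (apath A (abeg A))).
{ apply (Hin A (or_introl eq_refl)). apply on_arc_beg. }
destruct (holomorphic_primitive D f _ HD HC Hc Hf) as [P HP].
apply (cycle_int_derive _ P); [exact HL|]. intros B HB t Ht.
assert (DB := Hin B HB t Ht). split; [now apply HP|]. now apply (holomorphic_cont D).
Qed.

Fixpoint prod_sub (l : list C) (z : C) : C :=
  match l with nil => 1 | p :: l' => (z - p) * prod_sub l' z end.

Lemma prod_sub_neq_0 (l : list C) (z : C) : ~ In z l -> prod_sub l z <> 0.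
Proof.
induction l as [|p l IH]; intros H; simpl; [apply C1_nz|].
apply Cmult_neq_0.
- apply Cminus_eq_contra. intros ->. apply H. now left.
- apply IH. intros H'. apply H. now right.
Qed.

Lemma Ccont_prod_sub (l : list C) (z : C) : Ccont (prod_sub l) z.
Proof.
induction l as [|p l IH]; simpl; [apply continuous_Cconst|].
apply continuous_Cmult; [|exact IH]. apply continuous_Cminus; [apply continuous_id|apply continuous_Cconst].
Qed.

Lemma prod_sub_app (l m : list C) (z : C) : prod_sub (l ++ m) z = prod_sub l z * prod_sub m z.
Proof. induction l as [|p l IH]; simpl; [ring|]. rewrite IH. ring. Qed.

(** For a cycle: winding number 0 about a point off the cycle. *)
Definition no_residue (L : list arc) (p : C) : Prop :=
  chain_in (fun z => z <> p) L /\ chain_int L (fun z => / (z - p)) = 0.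

(** Only the first power calls on the winding number; all other powers have a single-valued
    primitive. *)
Lemma chain_int_pow_zero (L : list arc) (p : C) (m : nat) :
  cycle L -> no_residue L p -> chain_int L (fun z => / (z - p) ^ m) = 0.
Proof.
intros HL [Hp H1]. destruct m as [|[|m]].
- apply (cycle_int_derive _ (fun z => z)); [exact HL|]. intros A HA t Ht. split.
  + eapply is_Cderive_eq; [apply is_Cderive_id|]. simpl. field.
  + apply continuous_Cinv; [apply continuous_Cconst|apply C1_nz].
- rewrite <- H1. apply chain_int_ext. intros A HA t Ht. now rewrite Cpow_1_r.
- assert (Hm : RtoC (INR (S m)) <> 0).
  { intros E. apply RtoC_inj in E. revert E. apply not_0_INR. lia. }
  apply (cycle_int_derive _ (fun w => - / INR (S m) * / (w - p) ^ S m)); [exact HL|].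
  intros A HA t Ht. assert (H3 := Cminus_eq_contra _ _ (Hp A HA t Ht)). split.
  + eapply is_Cderive_eq.
    * apply is_Cderive_scal. apply (is_Cderive_inv_pow (fun w => w - p)); [|exact H3].
      apply is_Cderive_minus; [apply is_Cderive_id|apply is_Cderive_const].
    * cbv beta. assert (Hq := Cpow_nz _ (S (S m)) H3). field. split; assumption.
  + apply continuous_Cinv; [|now apply Cpow_nz].
    apply continuous_Cpow, continuous_Cminus; [apply continuous_id|apply continuous_Cconst].
Qed.

(* Partial fractions: the lemma for [q :: l] reduces to shorter products by
   [1/((z-p)(z-q)) = (1/(z-p) - 1/(z-q)) / (p-q)]. *)
Lemma chain_int_rational_zero (L : list arc) (l : list C) :
  cycle L -> (forall p, In p l -> no_residue L p) ->
  forall p m, no_residue L p -> chain_int L (fun z => / ((z - p) ^ m * prod_sub l z)) = 0.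
Proof.
intros HL. induction l as [|q l IH]; intros Hl p m Hp.
- rewrite <- (chain_int_pow_zero L p m HL Hp). apply chain_int_ext. intros A HA t Ht.
  simpl. now rewrite Cmult_1_r.
- assert (Hq := Hl q (or_introl eq_refl)).
  assert (Hl' : forall p, In p l -> no_residue L p) by (intros u Hu; apply Hl; now right).
  assert (Nl : forall A, In A L -> forall t, on_arc A t -> prod_sub l (apath A t) <> 0).
  { intros A HA t Ht. apply prod_sub_neq_0. intros Hin. now apply (proj1 (Hl' _ Hin) A HA t Ht). }
  destruct (Ceq_dec q p) as [->|Hqp].
  + rewrite <- (IH Hl' p (S m) Hp). apply chain_int_ext. intros A HA t Ht.
    rewrite Cpow_S. simpl. f_equal. ring.
  + assert (Hpq : p - q <> 0) by (apply Cminus_eq_contra; now apply not_eq_sym).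
    induction m as [|m IHm].
    * rewrite <- (IH Hl' q 1%nat Hq). apply chain_int_ext. intros A HA t Ht. simpl. f_equal. ring.
    * rewrite (chain_int_ext _ _ (fun z => / (p - q) * / ((z - p) ^ S m * prod_sub l z) +
         - / (p - q) * / ((z - p) ^ m * prod_sub (q :: l) z))).
      { rewrite chain_int_lin.
        - rewrite IHm, (IH Hl' p (S m) Hp). ring.
        - apply HL.
        - intros A HA t Ht. apply continuous_Cinv.
          + apply continuous_Cmult; [|apply Ccont_prod_sub].
            apply continuous_Cpow, continuous_Cminus; [apply continuous_id|apply continuous_Cconst].
          + apply Cmult_neq_0; [|now apply Nl]. apply Cpow_nz, Cminus_eq_contra. now apply Hp.
        - intros A HA t Ht. apply continuous_Cinv.
          + apply continuous_Cmult; [|apply Ccont_prod_sub].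
            apply continuous_Cpow, continuous_Cminus; [apply continuous_id|apply continuous_Cconst].
          + apply Cmult_neq_0.
            * apply Cpow_nz, Cminus_eq_contra. now apply Hp.
            * simpl. apply Cmult_neq_0; [|now apply Nl]. apply Cminus_eq_contra. now apply Hq. }
      intros A HA t Ht. assert (N1 := Nl A HA t Ht).
      assert (N2 := Cminus_eq_contra _ _ (proj1 Hp A HA t Ht)).
      assert (N3 := Cminus_eq_contra _ _ (proj1 Hq A HA t Ht)).
      assert (N4 := Cpow_nz _ m N2).
      rewrite Cpow_S. simpl. field. repeat split; assumption.
Qed.

(** Induction on the poles, listed with multiplicity: dividing [H - H p] by [z - p] leaves a form of
    the same kind with one factor fewer, plus a constant over the full product, which is a rational
    function. *)
Lemma cycle_int_meromorphic_zero (D : C -> Prop) (L : list arc) (l : list C) (H : C -> C) :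
  Copen D -> Cconvex D -> cycle L -> chain_in D L ->
  (forall p, In p l -> D p /\ no_residue L p) -> holomorphic D H ->
  chain_int L (fun z => H z * / prod_sub l z) = 0.
Proof.
intros HD HC HL Hin. revert H. induction l as [|p l IH]; intros H Hl HH.
- rewrite <- (cycle_int_holomorphic D L H HD HC HL Hin HH). apply chain_int_ext.
  intros A HA t Ht. simpl. field.
- destruct (Hl p (or_introl eq_refl)) as [Dp Hp].
  assert (Hl' : forall p, In p l -> D p /\ no_residue L p) by (intros u Hu; apply Hl; now right).
  destruct (divided_difference D H p HD HH Dp) as [q [Hq E]].
  assert (Nl : forall A, In A L -> forall t, on_arc A t -> prod_sub l (apath A t) <> 0).
  { intros A HA t Ht. apply prod_sub_neq_0. intros Hin'. now apply (proj1 (proj2 (Hl' _ Hin')) A HA t Ht). }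
  rewrite (chain_int_ext _ _ (fun z => 1 * (q z * / prod_sub l z) +
      H p * / ((z - p) ^ 1 * prod_sub l z))).
  + rewrite chain_int_lin.
    * rewrite (IH q Hl' Hq), (chain_int_rational_zero L l HL (fun u Hu => proj2 (Hl' u Hu)) p 1%nat Hp). ring.
    * apply HL.
    * intros A HA t Ht. apply continuous_Cmult.
      { apply (holomorphic_cont D); [exact Hq|now apply Hin]. }
      apply continuous_Cinv; [apply Ccont_prod_sub|now apply Nl].
    * intros A HA t Ht. apply continuous_Cinv.
      { apply continuous_Cmult; [|apply Ccont_prod_sub].
        apply continuous_Cpow, continuous_Cminus; [apply continuous_id|apply continuous_Cconst]. }
      apply Cmult_neq_0; [|now apply Nl]. apply Cpow_nz, Cminus_eq_contra. now apply Hp.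
  + intros A HA t Ht. rewrite (E _ (Hin A HA t Ht)). simpl.
    assert (N1 := Nl A HA t Ht).
    assert (N2 := Cminus_eq_contra _ _ (proj1 Hp A HA t Ht)).
    field. split; assumption.
Qed.

(** * Convergence of Gauss's limit *)

Definition Clim (u : nat -> C) (l : C) : Prop :=
  forall eps : R, (0 < eps)%R -> exists N : nat, forall n, (N <= n)%nat -> (Cmod (u n - l) < eps)%R.

Lemma Clim_filterlim (u : nat -> C) (l : C) :
  Clim u l <-> filterlim u eventually (locally (T := C_UniformSpace) l).
Proof.
split.
- intros H P HP. apply locally_C in HP. destruct HP as [e He].
  destruct (H e (cond_pos e)) as [N HN]. exists N. intros n Hn. apply He. now apply HN.
- intros H eps Heps.
  assert (HP : locally (T := C_UniformSpace) l (fun y => (Cmod (y - l) < eps)%R)).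
  { apply locally_C. exists (mkposreal _ Heps). intros y Hy. exact Hy. }
  destruct (H _ HP) as [N HN]. exists N. exact HN.
Qed.

Lemma Clim_seq_unique (u : nat -> C) (l : C) : Clim u l -> Clim_seq u = l.
Proof.
intros H. apply Clim_filterlim in H. unfold Clim_seq.
apply (@iota_unique C_AbsRing C_CompleteNormedModule); [|exact H].
intros y Hy. exact (@filterlim_locally_unique nat C_AbsRing C_NormedModule eventually _ u y l Hy H).
Qed.

Lemma Clim_is_unique (u : nat -> C) (l l' : C) : Clim u l -> Clim u l' -> l = l'.
Proof. intros H H'. now rewrite <- (Clim_seq_unique u l H), (Clim_seq_unique u l' H'). Qed.

Lemma Clim_const (c : C) : Clim (fun _ => c) c.
Proof.
intros eps Heps. exists 0%nat. intros n _. replace (c - c) with (RtoC 0) by ring. now rewrite Cmod_0.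
Qed.

Lemma Clim_ext_from (N : nat) (u v : nat -> C) (l : C) :
  (forall n, (N <= n)%nat -> u n = v n) -> Clim u l -> Clim v l.
Proof.
intros E H eps Heps. destruct (H eps Heps) as [M HM]. exists (max N M). intros n Hn.
rewrite <- E by lia. apply HM. lia.
Qed.

Lemma Clim_comp (f : C -> C) (u : nat -> C) (l : C) : Clim u l -> Ccont f l -> Clim (fun n => f (u n)) (f l).
Proof.
intros Hu Hf eps Heps. destruct (proj1 (Ccont_eps f l) Hf eps Heps) as [d [Hd H1]].
destruct (Hu d Hd) as [N HN]. exists N. intros n Hn. apply H1. now apply HN.
Qed.

Lemma Clim_plus (u v : nat -> C) (l m : C) : Clim u l -> Clim v m -> Clim (fun n => u n + v n) (l + m).
Proof.
intros Hu Hv eps Heps.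
destruct (Hu (eps / 2)%R ltac:(lra)) as [N HN]. destruct (Hv (eps / 2)%R ltac:(lra)) as [M HM].
exists (max N M). intros n Hn.
replace (u n + v n - (l + m)) with ((u n - l) + (v n - m)) by ring.
eapply Rle_lt_trans; [apply Cmod_triangle|].
assert (H1 := HN n ltac:(lia)). assert (H2 := HM n ltac:(lia)). lra.
Qed.

Lemma Clim_scal (c : C) (u : nat -> C) (l : C) : Clim u l -> Clim (fun n => c * u n) (c * l).
Proof.
intros H. apply (Clim_comp (fun w => c * w)); [exact H|].
apply continuous_Cmult; [apply continuous_Cconst|apply continuous_id].
Qed.

(* Polarization reduces products to squares. *)
Lemma Clim_mult (u v : nat -> C) (l m : C) : Clim u l -> Clim v m -> Clim (fun n => u n * v n) (l * m).
Proof.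
intros Hu Hv.
assert (S : forall (c : C) (w : nat -> C) (k : C), Clim w k -> Clim (fun n => c * (w n * w n)) (c * (k * k))).
{ intros c w k H. apply (Clim_comp (fun x => c * (x * x))); [exact H|].
  apply continuous_Cmult; [apply continuous_Cconst|]. apply continuous_Cmult; apply continuous_id. }
replace (l * m) with (/ 2 * ((l + m) * (l + m)) + (- / 2 * (l * l) + - / 2 * (m * m))) by field.
apply (Clim_ext_from 0 (fun n => / 2 * ((u n + v n) * (u n + v n)) +
   (- / 2 * (u n * u n) + - / 2 * (v n * v n)))).
- intros n _. field.
- apply Clim_plus; [apply (S (/ 2) (fun n => u n + v n)); now apply Clim_plus|].
  apply Clim_plus; now apply S.
Qed.

Lemma Clim_Cmod_le (u : nat -> C) (l : C) (b : R) (N : nat) :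
  Clim u l -> (forall n, (N <= n)%nat -> (Cmod (u n) <= b)%R) -> (Cmod l <= b)%R.
Proof.
intros Hu Hb. apply Rnot_lt_le. intros H.
destruct (Hu (Cmod l - b)%R ltac:(lra)) as [M HM].
assert (H1 := HM (max N M) ltac:(lia)). assert (H2 := Hb (max N M) ltac:(lia)).
rewrite Cmod_sub_sym in H1. assert (H3 := Cmod_triangle_sub l (u (max N M))). lra.
Qed.

Lemma Clim_Cmod_ge (u : nat -> C) (l : C) (b : R) (N : nat) :
  Clim u l -> (forall n, (N <= n)%nat -> (b <= Cmod (u n))%R) -> (b <= Cmod l)%R.
Proof.
intros Hu Hb. apply Rnot_lt_le. intros H.
destruct (Hu (b - Cmod l)%R ltac:(lra)) as [M HM].
assert (H1 := HM (max N M) ltac:(lia)). assert (H2 := Hb (max N M) ltac:(lia)).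
assert (H3 := Cmod_triangle_sub (u (max N M)) l). lra.
Qed.

Lemma C_complete (u : nat -> C) :
  (forall eps : R, (0 < eps)%R -> exists N : nat, forall n m, (N <= n)%nat -> (N <= m)%nat ->
     (Cmod (u n - u m) < eps)%R) -> exists l : C, Clim u l.
Proof.
intros H.
assert (H1 : Cauchy_crit (fun n => Re (u n))).
{ intros eps Heps. destruct (H eps Heps) as [N HN]. exists N. intros n m Hn Hm. unfold R_dist.
  eapply Rle_lt_trans; [|apply (HN n m Hn Hm)]. eapply Rle_trans; [|apply re_le_Cmod].
  right. unfold Cminus. now rewrite re_plus, re_opp. }
assert (H2 : Cauchy_crit (fun n => Im (u n))).
{ intros eps Heps. destruct (H eps Heps) as [N HN]. exists N. intros n m Hn Hm. unfold R_dist.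
  eapply Rle_lt_trans; [|apply (HN n m Hn Hm)]. eapply Rle_trans; [|apply im_le_Cmod].
  right. unfold Cminus. now rewrite im_plus, im_opp. }
destruct (Rcomplete.R_complete _ H1) as [a Ha]. destruct (Rcomplete.R_complete _ H2) as [b Hb].
exists (a, b). intros eps Heps.
destruct (Ha (eps / 2)%R ltac:(lra)) as [N HN]. destruct (Hb (eps / 2)%R ltac:(lra)) as [M HM].
exists (max N M). intros n Hn.
eapply Rle_lt_trans; [apply Cmod_le_Re_Im|].
assert (A1 := HN n ltac:(lia)). assert (A2 := HM n ltac:(lia)). unfold R_dist in *.
unfold Cminus. rewrite re_plus, re_opp, im_plus, im_opp. unfold Re at 2, Im at 2; simpl fst; simpl snd.
unfold Rminus in *. lra.
Qed.

Lemma C_complete_rate (u : nat -> C) (e : nat -> R) (M : nat) :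
  (forall n m, (M <= m <= n)%nat -> (Cmod (u n - u m) <= e m)%R) ->
  (forall eps : R, (0 < eps)%R -> exists N : nat, forall n, (N <= n)%nat -> (e n < eps)%R) ->
  exists l, Clim u l /\ forall m, (M <= m)%nat -> (Cmod (u m - l) <= e m)%R.
Proof.
intros H He. destruct (C_complete u) as [l Hl].
- intros eps Heps. destruct (He eps Heps) as [N HN]. exists (max N M). intros n m Hn Hm.
  destruct (Nat.le_ge_cases m n) as [L|L].
  + eapply Rle_lt_trans; [apply H; lia|]. apply HN. lia.
  + rewrite Cmod_sub_sym. eapply Rle_lt_trans; [apply H; lia|]. apply HN. lia.
- exists l. split; [exact Hl|]. intros m Hm. rewrite Cmod_sub_sym.
  apply (Clim_Cmod_le (fun n => u n + - u m) (l - u m) (e m) m).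
  + apply Clim_plus; [exact Hl|apply Clim_const].
  + intros n Hn. apply H. lia.
Qed.

(** By this convention inversion is involutive and multiplicative without side conditions, so
    [Gamma] and its reciprocal may be exchanged even at poles. *)
Lemma Cinv_0 : / RtoC 0 = 0.
Proof. unfold Cinv, RtoC; simpl. f_equal; unfold Rdiv; ring. Qed.

Lemma Cinv_inv (z : C) : / / z = z.
Proof.
destruct (Ceq_dec z 0) as [->|H]; [now rewrite !Cinv_0|]. field. exact H.
Qed.

Lemma Cinv_mult (z w : C) : / (z * w) = / z * / w.
Proof.
destruct (Ceq_dec z 0) as [->|H]; [now rewrite Cmult_0_l, Cinv_0, Cmult_0_l|].
destruct (Ceq_dec w 0) as [->|H']; [now rewrite Cmult_0_r, Cinv_0, Cmult_0_r|].
field. now split.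
Qed.

Lemma Cinv_pow (z : C) (n : nat) : / z ^ n = (/ z) ^ n.
Proof.
induction n as [|n IH]; simpl; [field|]. now rewrite Cinv_mult, IH.
Qed.

Lemma Cmod_Rcpow (x : R) (a : C) : Cmod (Rcpow x a) = exp (Re a * ln x).
Proof. unfold Rcpow. now rewrite Cmod_Cexp, re_scal_r. Qed.

Lemma Rcpow_plus (x : R) (a b : C) : Rcpow x (a + b) = Rcpow x a * Rcpow x b.
Proof. unfold Rcpow. rewrite <- Cexp_plus. apply f_equal. ring. Qed.

Lemma Rcpow_neq_0 (x : R) (a : C) : Rcpow x a <> 0.
Proof. apply Cexp_neq_0. Qed.

Lemma Rcpow_opp (x : R) (a : C) : Rcpow x (- a) = / Rcpow x a.
Proof. unfold Rcpow. rewrite <- Cexp_opp. apply f_equal. ring. Qed.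

Lemma Rcpow_1 (x : R) : (0 < x)%R -> Rcpow x 1 = x.
Proof. intros H. unfold Rcpow. rewrite Cmult_1_l, Cexp_RtoC, exp_ln by exact H. reflexivity. Qed.

Lemma ln_le_sub_1 (x : R) : (0 < x)%R -> (ln x <= x - 1)%R.
Proof.
intros H. generalize (exp_ineq1_le (ln x)). rewrite exp_ln by exact H. lra.
Qed.

Lemma ln_succ_bounds (m : nat) : (1 <= m)%nat ->
  (/ (INR m + 1) <= ln (INR m + 1) - ln (INR m) <= / INR m)%R.
Proof.
intros Hm. assert (H : (1 <= INR m)%R) by (apply (le_INR 1); exact Hm). split.
- assert (A := ln_le_sub_1 (INR m / (INR m + 1)) ltac:(apply Rdiv_lt_0_compat; lra)).
  rewrite ln_div in A by lra.
  replace (INR m / (INR m + 1) - 1)%R with (- / (INR m + 1))%R in A by (field; lra). lra.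
- assert (A := ln_le_sub_1 ((INR m + 1) / INR m) ltac:(apply Rdiv_lt_0_compat; lra)).
  rewrite ln_div in A by lra.
  replace ((INR m + 1) / INR m - 1)%R with (/ INR m)%R in A by (field; lra). lra.
Qed.

(* The reciprocal of the [m]-th term of Gauss's limit. *)
Definition rgauss (m : nat) (z : C) : C :=
  rising z (S m) * (Rcpow (INR m) (- z) * / INR (fact m)).

Definition rgauss_ratio (m : nat) (z : C) : C :=
  (1 + z * / (INR m + 1)) * Cexp (- (z * RtoC (ln (INR m + 1) - ln (INR m)))).

Lemma INR_C_neq_0 (m : nat) : RtoC (INR m + 1) <> 0.
Proof. intros E. apply RtoC_inj in E. generalize (pos_INR m). lra. Qed.

Lemma fact_C_neq_0 (m : nat) : RtoC (INR (fact m)) <> 0.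
Proof. intros E. apply RtoC_inj in E. exact (INR_fact_neq_0 m E). Qed.

Lemma rgauss_succ (m : nat) (z : C) : rgauss (S m) z = rgauss m z * rgauss_ratio m z.
Proof.
unfold rgauss, rgauss_ratio. change (rising z (S (S m))) with (rising z (S m) * (z + INR (S m))).
unfold Rcpow.
replace (- z * RtoC (ln (INR (S m)))) with
  (- z * RtoC (ln (INR m)) + - (z * RtoC (ln (INR m + 1) - ln (INR m))))
  by (rewrite S_INR, RtoC_minus; ring).
rewrite Cexp_plus, fact_simpl, mult_INR, RtoC_mult, S_INR.
assert (H1 := INR_C_neq_0 m). assert (H2 := fact_C_neq_0 m). rewrite RtoC_plus in *.
field. split; assumption.
Qed.

(** The ratio is [(1 + x) exp (- y)] with [x = z / (m+1)] and [y = z ln ((m+1)/m)]. The logarithm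
    lies between [1/(m+1)] and [1/m], so the first-order terms cancel up to [K / m^2]. The 8 is 1
    for [x - y], 1 for [x y], and 2 times 3 for the remainder of the exponential. *)
Lemma rgauss_ratio_bound (K : R) (m : nat) (z : C) :
  (1 <= K)%R -> (Cmod z <= K)%R -> (1 <= m)%nat -> (K <= INR m)%R ->
  (Cmod (rgauss_ratio m z - 1) <= 8 * (K * K) / (INR m * INR m))%R.
Proof.
intros HK Hz Hm HKm. destruct (ln_succ_bounds m Hm) as [L1 L2].
set (l := (ln (INR m + 1) - ln (INR m))%R) in *. set (M := INR m) in *.
assert (HM : (1 <= M)%R) by lra.
set (x := z * RtoC (/ (M + 1))). set (y := z * RtoC l).
assert (I1 : (/ (M + 1) <= / M)%R) by (apply Rinv_le_contravar; lra).
assert (I0 : (0 < / (M + 1))%R) by (apply Rinv_0_lt_compat; lra).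
assert (IM : (0 < / M)%R) by (apply Rinv_0_lt_compat; lra).
assert (Z0 := Cmod_ge_0 z).
assert (KM : (K * / M <= 1)%R).
{ apply (Rmult_le_reg_r M); [lra|]. rewrite Rmult_assoc, Rinv_l by lra. lra. }
assert (Hx : (Cmod x <= K * / M)%R).
{ unfold x. rewrite Cmod_mult, Cmod_RtoC_nonneg by lra. apply Rmult_le_compat; lra. }
assert (Hy : (Cmod y <= K * / M)%R).
{ unfold y. rewrite Cmod_mult, Cmod_RtoC_nonneg by lra. apply Rmult_le_compat; lra. }
assert (Hxy : (Cmod (x - y) <= K * (/ M * / M))%R).
{ unfold x, y. replace (z * RtoC (/ (M + 1)) - z * RtoC l) with (- (z * RtoC (l - / (M + 1))))
    by (rewrite RtoC_minus; ring).
  rewrite Cmod_opp, Cmod_mult, Cmod_RtoC_nonneg by lra. apply Rmult_le_compat; try lra.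
  apply Rle_trans with (/ M - / (M + 1))%R; [lra|].
  replace (/ M - / (M + 1))%R with (/ M * / (M + 1))%R by (field; lra).
  apply Rmult_le_compat_l; lra. }
set (r := Cexp (- y) - 1 - - y).
assert (Hr : (Cmod r <= K * / M * (K * / M) * 3)%R).
{ unfold r. eapply Rle_trans; [apply Cmod_Cexp_sub_1_sub|]. rewrite Cmod_opp.
  assert (Y0 := Cmod_ge_0 y).
  apply Rmult_le_compat; [now apply Rmult_le_pos|left; apply exp_pos|now apply Rmult_le_compat|].
  apply Rle_trans with (exp 1); [|apply exp_le_3].
  destruct (Rle_lt_or_eq_dec (Cmod y) 1 ltac:(lra)) as [E|E]; [left; now apply exp_increasing|rewrite E; lra]. }
assert (E : rgauss_ratio m z - 1 = (x - y) + (- (x * y) + (1 + x) * r)).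
{ unfold rgauss_ratio. fold M. fold l. fold y.
  replace (/ (RtoC M + 1)) with (RtoC (/ (M + 1))) by (rewrite RtoC_inv, RtoC_plus by lra; reflexivity).
  fold x. unfold r. ring. }
rewrite E. eapply Rle_trans; [apply Cmod_triangle|].
assert (E2 := Cmod_triangle (- (x * y)) ((1 + x) * r)).
rewrite Cmod_opp, !Cmod_mult in E2.
assert (E3 := Cmod_triangle 1 x). rewrite Cmod_1 in E3.
assert (X0 := Cmod_ge_0 x). assert (Y0 := Cmod_ge_0 y). assert (R0 := Cmod_ge_0 r).
assert (F1 : (Cmod x * Cmod y <= K * / M * (K * / M))%R) by now apply Rmult_le_compat.
assert (F2 : (Cmod (1 + x) * Cmod r <= 2 * (K * / M * (K * / M) * 3))%R).
{ apply Rmult_le_compat; [apply Cmod_ge_0|exact R0|lra|exact Hr]. }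
replace (8 * (K * K) / (M * M))%R with (8 * (K * / M * (K * / M)))%R by (field; lra).
assert (F3 : (K * (/ M * / M) <= K * / M * (K * / M))%R).
{ replace (K * / M * (K * / M))%R with (K * (K * (/ M * / M)))%R by ring.
  assert (P : (0 <= K * (/ M * / M))%R) by (apply Rmult_le_pos; [lra|apply Rmult_le_pos; lra]).
  rewrite <- (Rmult_1_l (K * (/ M * / M))) at 1. apply Rmult_le_compat_r; lra. }
lra.
Qed.

Lemma exp_le_mono (x y : R) : (x <= y)%R -> (exp x <= exp y)%R.
Proof. intros [H| ->]; [left; now apply exp_increasing|lra]. Qed.

Lemma exp_ge_1 (x : R) : (0 <= x)%R -> (1 <= exp x)%R.
Proof. intros H. generalize (exp_ineq1_le x). lra. Qed.

Lemma inv_sq_telescope (j : nat) : (2 <= j)%nat ->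
  (/ (INR j * INR j) <= / (INR j - 1) - / (INR (S j) - 1))%R.
Proof.
intros Hj. assert (H : (2 <= INR j)%R) by (apply (le_INR 2); exact Hj). rewrite S_INR.
replace (INR j + 1 - 1)%R with (INR j) by ring.
replace (/ (INR j - 1) - / INR j)%R with (/ ((INR j - 1) * INR j))%R by (field; lra).
apply Rinv_le_contravar.
- apply Rmult_lt_0_compat; lra.
- apply Rmult_le_compat_r; lra.
Qed.

Section RGaussLimit.

Variables (K : R) (M : nat).
Hypotheses (HK : (1 <= K)%R) (HM2 : (2 <= M)%nat) (HMK : (16 * (K * K) <= INR M - 1)%R).

Let c : R := (8 * (K * K))%R.
(** A telescoping majorant of the sum of [c / j^2] over [M <= j < m]; the hypothesis on [M] keeps it
    below 1/2. *)
Let s (m : nat) : R := (c * (/ (INR M - 1) - / (INR m - 1)))%R.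

Lemma rg_M_large : (K <= INR M)%R.
Proof.
assert (K * 1 <= K * K)%R by (apply Rmult_le_compat_l; lra). lra.
Qed.

Lemma rg_s_step (m : nat) : (M <= m)%nat -> (s m + c / (INR m * INR m) <= s (S m))%R.
Proof.
intros Hm. unfold s. assert (T := inv_sq_telescope m ltac:(lia)).
assert (Hc : (0 <= c)%R) by (unfold c; apply Rmult_le_pos; [lra|apply Rmult_le_pos; lra]).
apply (Rmult_le_compat_l c) in T; [|exact Hc]. unfold Rdiv. lra.
Qed.

Lemma rg_inv_bounds (m : nat) : (M <= m)%nat -> (0 < / (INR m - 1) <= / (INR M - 1))%R.
Proof.
intros Hm. assert (H1 := le_INR _ _ Hm). assert (H2 := le_INR _ _ HM2). simpl in H2.
split; [apply Rinv_0_lt_compat; lra|apply Rinv_le_contravar; lra].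
Qed.

Lemma rg_s_le (m : nat) : (M <= m)%nat -> (0 <= s m <= 1 / 2)%R.
Proof.
intros Hm. destruct (rg_inv_bounds m Hm) as [I1 I2]. unfold s.
assert (Hc : (0 <= c)%R) by (unfold c; apply Rmult_le_pos; [lra|apply Rmult_le_pos; lra]).
split; [apply Rmult_le_pos; lra|].
apply Rle_trans with (c * / (INR M - 1))%R; [apply Rmult_le_compat_l; lra|].
assert (P : (0 < INR M - 1)%R) by (assert (1 * 1 <= K * K)%R by (apply Rmult_le_compat; lra); lra).
apply (Rmult_le_reg_r (INR M - 1)); [exact P|].
rewrite Rmult_assoc, Rinv_l by lra. unfold c. lra.
Qed.

Lemma rgauss_step (m : nat) (z : C) : (M <= m)%nat -> (Cmod z <= K)%R ->
  (Cmod (rgauss_ratio m z - 1) <= c / (INR m * INR m))%R.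
Proof.
intros Hm Hz. apply rgauss_ratio_bound; try assumption; try lia.
apply Rle_trans with (INR M); [apply rg_M_large|now apply le_INR].
Qed.

Lemma rgauss_upper (m : nat) (z : C) : (M <= m)%nat -> (Cmod z <= K)%R ->
  (Cmod (rgauss m z) <= Cmod (rgauss M z) * exp (s m))%R.
Proof.
intros Hm Hz. induction Hm as [|m Hm IH].
- unfold s. rewrite Rminus_diag, Rmult_0_r, exp_0. lra.
- rewrite rgauss_succ, Cmod_mult.
  assert (E : (Cmod (rgauss_ratio m z) <= exp (c / (INR m * INR m)))%R).
  { assert (A := rgauss_step m z Hm Hz). assert (B := exp_ineq1_le (c / (INR m * INR m))).
    assert (T := Cmod_triangle_sub (rgauss_ratio m z) 1). rewrite Cmod_1 in T. lra. }
  apply Rle_trans with (Cmod (rgauss M z) * exp (s m) * exp (c / (INR m * INR m)))%R.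
  + apply Rmult_le_compat; try apply Cmod_ge_0; assumption.
  + rewrite Rmult_assoc, <- exp_plus. apply Rmult_le_compat_l; [apply Cmod_ge_0|].
    apply exp_le_mono. now apply rg_s_step.
Qed.

(** Since [s m <= 1/2], later factors leave at least half of the [M]-th term. Thus the limit
    vanishes only where a finite product does, which locates the zeros of [1 / Gamma]. *)
Lemma rgauss_lower (m : nat) (z : C) : (M <= m)%nat -> (Cmod z <= K)%R ->
  (Cmod (rgauss M z) * (1 - s m) <= Cmod (rgauss m z))%R.
Proof.
intros Hm Hz. induction Hm as [|m Hm IH].
- unfold s. rewrite Rminus_diag, Rmult_0_r. lra.
- rewrite rgauss_succ, Cmod_mult.
  assert (A := rgauss_step m z Hm Hz).
  assert (T := Cmod_triangle_sub 1 (rgauss_ratio m z)). rewrite Cmod_1, Cmod_sub_sym in T.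
  assert (S1 := rg_s_step m Hm). assert (S2 := rg_s_le m Hm).
  assert (S3 := rg_s_le (S m) ltac:(lia)).
  set (d := (c / (INR m * INR m))%R) in *.
  assert (D0 : (0 <= d)%R) by (eapply Rle_trans; [apply Cmod_ge_0|exact A]).
  apply Rle_trans with (Cmod (rgauss M z) * (1 - s m) * (1 - d))%R.
  + rewrite Rmult_assoc. apply Rmult_le_compat_l; [apply Cmod_ge_0|].
    assert (0 <= s m * d)%R by (apply Rmult_le_pos; lra). lra.
  + apply Rmult_le_compat; try lra. apply Rmult_le_pos; [apply Cmod_ge_0|lra].
Qed.

Lemma rgauss_cauchy (m n : nat) (z : C) : (M <= m <= n)%nat -> (Cmod z <= K)%R ->
  (Cmod (rgauss n z - rgauss m z) <= Cmod (rgauss M z) * 2 * (s n - s m))%R.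
Proof.
intros [Hm Hn] Hz. induction Hn as [|n Hn IH].
- replace (rgauss m z - rgauss m z) with (RtoC 0) by ring. rewrite Cmod_0, Rminus_diag. lra.
- rewrite rgauss_succ.
  replace (rgauss n z * rgauss_ratio n z - rgauss m z)
    with (rgauss n z * (rgauss_ratio n z - 1) + (rgauss n z - rgauss m z)) by ring.
  eapply Rle_trans; [apply Cmod_triangle|]. rewrite Cmod_mult.
  assert (A := rgauss_step n z ltac:(lia) Hz). assert (S1 := rg_s_step n ltac:(lia)).
  assert (U := rgauss_upper n z ltac:(lia) Hz). assert (S2 := rg_s_le n ltac:(lia)).
  assert (E : (exp (s n) <= 2)%R).
  { assert (P : (exp (s n) <= exp (/ 2))%R) by (apply exp_le_mono; lra).
    assert (Q : (exp (/ 2) * exp (/ 2) <= 3)%R).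
    { rewrite <- exp_plus. replace (/ 2 + / 2)%R with 1%R by field. apply exp_le_3. }
    assert (Q0 := exp_pos (/ 2)). nra. }
  assert (B : (Cmod (rgauss n z) * Cmod (rgauss_ratio n z - 1) <=
     Cmod (rgauss M z) * 2 * (s (S n) - s n))%R).
  { apply Rmult_le_compat; try apply Cmod_ge_0; [|lra].
    eapply Rle_trans; [exact U|]. apply Rmult_le_compat_l; [apply Cmod_ge_0|exact E]. }
  lra.
Qed.

Lemma rgauss_lim (z : C) : (Cmod z <= K)%R ->
  exists l, Clim (fun m => rgauss m z) l /\
    (forall m, (M <= m)%nat -> (Cmod (rgauss m z - l) <= Cmod (rgauss M z) * 2 * (c * / (INR m - 1)))%R) /\
    (Cmod (rgauss M z) * / 2 <= Cmod l)%R.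
Proof.
intros Hz.
assert (Hc : (0 <= c)%R) by (unfold c; apply Rmult_le_pos; [lra|apply Rmult_le_pos; lra]).
assert (P0 := Cmod_ge_0 (rgauss M z)).
destruct (C_complete_rate (fun m => rgauss m z)
   (fun m => Cmod (rgauss M z) * 2 * (c * / (INR m - 1)))%R M) as [l [Hl1 Hl2]].
- intros n m Hmn. eapply Rle_trans; [apply rgauss_cauchy; assumption|].
  apply Rmult_le_compat_l; [lra|]. destruct (rg_inv_bounds n ltac:(lia)) as [I1 I2].
  unfold s. assert (0 <= c * / (INR n - 1))%R by (apply Rmult_le_pos; lra). lra.
- intros eps Heps. set (B := (Cmod (rgauss M z) * 2 * c)%R).
  assert (HB : (0 <= B)%R) by (unfold B; apply Rmult_le_pos; lra).
  destruct (nfloor_ex (B / eps + 2)) as [N [_ HN]].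
  { assert (0 <= B / eps)%R by (apply Rdiv_le_0_compat; lra). lra. }
  exists (S N). intros n Hn. assert (Hn' := le_INR _ _ Hn). rewrite S_INR in Hn'.
  assert (Q : (0 <= B / eps)%R) by (apply Rdiv_le_0_compat; lra).
  replace (Cmod (rgauss M z) * 2 * (c * / (INR n - 1)))%R with (B / (INR n - 1))%R
    by (unfold B; field; lra).
  apply (Rmult_lt_reg_r (INR n - 1)); [lra|]. unfold Rdiv at 1. rewrite Rmult_assoc, Rinv_l by lra.
  apply Rlt_le_trans with (eps * (B / eps + 1))%R.
  + replace (eps * (B / eps + 1))%R with (B + eps)%R by (field; lra). lra.
  + apply Rmult_le_compat_l; lra.
- exists l. split; [exact Hl1|]. split; [exact Hl2|].
  apply (Clim_Cmod_ge (fun m => rgauss m z) l _ M Hl1).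
  intros n Hn. eapply Rle_trans; [|now apply rgauss_lower].
  apply Rmult_le_compat_l; [exact P0|]. assert (S2 := rg_s_le n Hn). lra.
Qed.

End RGaussLimit.

(** * The reciprocal Gamma function *)

Lemma rgauss_threshold (K : R) : exists M : nat, (2 <= M)%nat /\ (16 * (K * K) <= INR M - 1)%R.
Proof.
destruct (nfloor_ex (16 * (K * K) + 1)) as [N [_ HN]].
{ assert (0 <= K * K)%R by apply Rle_0_sqr. lra. }
exists (N + 2)%nat. split; [lia|]. rewrite plus_INR. simpl. lra.
Qed.

(** The entire function [1 / Gamma], in which all later arguments are phrased. *)
Definition rGamma (z : C) : C := / Gamma z.

Lemma rising_zero (z : C) (m : nat) : rising z m = 0 <-> exists k, (k < m)%nat /\ z = - INR k.
Proof.
induction m as [|m [IH1 IH2]].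
- split; [intros E; now elim C1_nz|]. intros [k [Hk _]]. lia.
- simpl. split.
  + intros E. destruct (Ceq_dec (rising z m) 0) as [E0|E0].
    * destruct (IH1 E0) as [k [Hk Ek]]. exists k. split; [lia|exact Ek].
    * exists m. split; [lia|]. destruct (Ceq_dec (z + INR m) 0) as [E1|E1].
      { apply Ceq_minus. rewrite <- E1. ring. }
      { elim (Cmult_neq_0 _ _ E0 E1 E). }
  + intros [k [Hk Ek]]. destruct (Nat.eq_dec k m) as [->|Hkm].
    * rewrite Ek. ring.
    * rewrite IH2; [ring|]. exists k. split; [lia|exact Ek].
Qed.

Lemma rgauss_gauss (m : nat) (z : C) :
  / (INR (fact m) * Rcpow (INR m) z / rising z (S m)) = rgauss m z.
Proof.
unfold rgauss, Cdiv. rewrite !Cinv_mult, Cinv_inv, Rcpow_opp. ring.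
Qed.

(** If the limit is nonzero, inversion is continuous there. If it is 0, then by the lower bound
    [rgauss M z] is 0 and so are all later terms; Gauss's terms are then [/ 0 = 0], whence
    [Gamma z = 0] and again [/ Gamma z = 0]. *)
Lemma Clim_rGamma (z : C) : Clim (fun m => rgauss m z) (rGamma z).
Proof.
destruct (rgauss_threshold (Cmod z + 1)) as [M [HM1 HM2]].
assert (Z0 := Cmod_ge_0 z).
destruct (rgauss_lim (Cmod z + 1) M ltac:(lra) HM1 HM2 z ltac:(lra)) as [l [Hl [_ Hl2]]].
assert (E : forall m, INR (fact m) * Rcpow (INR m) z / rising z (S m) = / rgauss m z).
{ intros m. now rewrite <- rgauss_gauss, Cinv_inv. }
destruct (Ceq_dec l 0) as [->|Nl].
- rewrite Cmod_0 in Hl2. assert (P0 := Cmod_ge_0 (rgauss M z)).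
  assert (Z : rgauss M z = 0) by (apply Cmod_eq_0; lra).
  assert (Zm : forall m, (M <= m)%nat -> rgauss m z = 0).
  { intros m Hm. induction Hm as [|m Hm IH]; [exact Z|]. rewrite rgauss_succ, IH. ring. }
  assert (G : Gamma z = 0).
  { apply Clim_seq_unique. apply (Clim_ext_from M (fun _ => RtoC 0)); [|apply Clim_const].
    intros n Hn. rewrite E, Zm by exact Hn. symmetry. apply Cinv_0. }
  unfold rGamma. rewrite G, Cinv_0. exact Hl.
- assert (G : Gamma z = / l).
  { apply Clim_seq_unique. apply (Clim_ext_from 0 (fun m => / rgauss m z)).
    - intros n _. symmetry. apply E.
    - apply (Clim_comp Cinv); [exact Hl|now apply Ccont_inv]. }
  unfold rGamma. rewrite G, Cinv_inv. exact Hl.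
Qed.

Lemma Gamma_rGamma (z : C) : Gamma z = / rGamma z.
Proof. unfold rGamma. now rewrite Cinv_inv. Qed.

Lemma rGamma_neq_0 (z : C) : (forall k : nat, z <> - INR k) -> rGamma z <> 0.
Proof.
intros H. destruct (rgauss_threshold (Cmod z + 1)) as [M [HM1 HM2]].
assert (Z0 := Cmod_ge_0 z).
destruct (rgauss_lim (Cmod z + 1) M ltac:(lra) HM1 HM2 z ltac:(lra)) as [l [Hl [_ Hl2]]].
rewrite (Clim_is_unique _ _ _ (Clim_rGamma z) Hl).
assert (N : rgauss M z <> 0).
{ unfold rgauss. apply Cmult_neq_0.
  - intros E. apply rising_zero in E. destruct E as [k [_ Ek]]. now apply (H k).
  - apply Cmult_neq_0; [apply Rcpow_neq_0|]. intros E. apply C1_nz.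
    rewrite <- (Cinv_r _ (fact_C_neq_0 M)), E. ring. }
apply Cmod_gt_0. apply Cmod_gt_0 in N. lra.
Qed.

Lemma holomorphic_rising (D : C -> Prop) (m : nat) : holomorphic D (fun z => rising z m).
Proof.
induction m as [|m IH]; simpl; [apply holomorphic_const|].
apply (holomorphic_mult D (fun z => rising z m)); [exact IH|].
destruct (holomorphic_affine D (INR m) 1) as [f' Hf]. exists f'. intros z Hz.
destruct (Hf z Hz) as [H1 H2]. split; [|exact H2].
apply (is_Cderive_ext_loc (fun w => INR m + 1 * w) _ z _ 1 Rlt_0_1); [|exact H1].
intros w _. ring.
Qed.

Lemma holomorphic_rgauss (D : C -> Prop) (m : nat) : Copen D -> holomorphic D (rgauss m).
Proof.
intros HD. unfold rgauss. apply holomorphic_mult; [apply holomorphic_rising|].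
apply (holomorphic_mult D (fun z => Rcpow (INR m) (- z))); [|apply holomorphic_const].
apply (holomorphic_ext D (fun z => Cexp (0 + - RtoC (ln (INR m)) * z)) _ HD).
- intros z _. unfold Rcpow. apply f_equal. ring.
- apply (holomorphic_comp_affine (fun _ => True)); [apply holomorphic_Cexp|trivial].
Qed.

Lemma Ccont_bounded_disc (f : C -> C) (z : C) : Ccont f z ->
  exists r B : R, (0 < r)%R /\ forall w, disc z r w -> (Cmod (f w) <= B)%R.
Proof.
intros H. destruct (proj1 (Ccont_eps f z) H 1%R Rlt_0_1) as [d [Hd H1]].
exists d, (Cmod (f z) + 1)%R. split; [exact Hd|]. intros w Hw.
specialize (H1 w Hw). assert (T := Cmod_triangle_sub (f w) (f z)). lra.
Qed.

(** The rate of convergence is uniform on a small disc: its constant is a bound of the single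
    function [rgauss M] there, with one threshold [M] for [Cmod z + 1]. *)
Lemma holomorphic_rGamma (D : C -> Prop) : holomorphic D rGamma.
Proof.
apply (holomorphic_limit D rgauss). intros z _.
destruct (rgauss_threshold (Cmod z + 1)) as [M [HM1 HM2]].
assert (Z0 := Cmod_ge_0 z).
assert (HM : Ccont (rgauss M) z).
{ apply (holomorphic_cont (fun _ => True)); [|trivial]. apply holomorphic_rgauss.
  intros w _. exists 1%R. split; [lra|trivial]. }
destruct (Ccont_bounded_disc _ _ HM) as [r [B [Hr HB]]].
exists (Rmin r 1). split; [apply Rmin_pos; lra|]. split.
- intros n. apply holomorphic_rgauss, Copen_disc.
- intros eps Heps. set (c := (8 * ((Cmod z + 1) * (Cmod z + 1)))%R).
  assert (Hc : (0 <= c)%R) by (unfold c; apply Rmult_le_pos; [lra|apply Rmult_le_pos; lra]).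
  assert (HB0 : (0 <= B)%R).
  { eapply Rle_trans; [apply Cmod_ge_0|apply (HB z)]. now apply disc_center. }
  destruct (nfloor_ex (B * 2 * c / eps + 2)) as [N [_ HN]].
  { assert (0 <= B * 2 * c / eps)%R by (apply Rdiv_le_0_compat; [apply Rmult_le_pos; lra|lra]). lra. }
  exists (max M (S N)). intros n w Hn Hw.
  assert (Q : (0 <= B * 2 * c / eps)%R) by (apply Rdiv_le_0_compat; [apply Rmult_le_pos; lra|lra]).
  assert (Hw1 : disc z r w) by (eapply Rlt_le_trans; [exact Hw|apply Rmin_l]).
  assert (Hw2 : (Cmod w <= Cmod z + 1)%R).
  { unfold disc in Hw. assert (W := Rlt_le_trans _ _ _ Hw (Rmin_r _ _)).
    assert (T := Cmod_triangle_sub w z). lra. }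
  destruct (rgauss_lim (Cmod z + 1) M ltac:(lra) HM1 HM2 w Hw2) as [l [Hl [Hl1 _]]].
  rewrite (Clim_is_unique _ _ _ (Clim_rGamma w) Hl).
  eapply Rle_trans; [apply Hl1; lia|]. fold c.
  assert (Hn' : (INR (S N) <= INR n)%R) by (apply le_INR; lia). rewrite S_INR in Hn'.
  assert (Hi : (0 < / (INR n - 1))%R) by (apply Rinv_0_lt_compat; lra).
  apply Rle_trans with (B * 2 * (c * / (INR n - 1)))%R.
  + apply Rmult_le_compat_r; [apply Rmult_le_pos; lra|]. specialize (HB w Hw1). lra.
  + replace (B * 2 * (c * / (INR n - 1)))%R with (B * 2 * c / (INR n - 1))%R by (field; lra).
    apply (Rmult_le_reg_r (INR n - 1)); [lra|]. unfold Rdiv at 1. rewrite Rmult_assoc, Rinv_l by lra.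
    apply Rle_trans with (eps * (B * 2 * c / eps + 1))%R.
    * replace (eps * (B * 2 * c / eps + 1))%R with (B * 2 * c + eps)%R by (field; lra). lra.
    * apply Rmult_le_compat_l; lra.
Qed.

Lemma Ccont_rGamma (z : C) : Ccont rGamma z.
Proof. apply (holomorphic_cont (fun _ => True)); [apply holomorphic_rGamma|trivial]. Qed.

Lemma Clim_INR_inv : Clim (fun m => / RtoC (INR m)) 0.
Proof.
intros eps Heps. destruct (nfloor_ex (/ eps)) as [N [_ HN]].
{ left. now apply Rinv_0_lt_compat. }
exists (S N). intros n Hn. assert (H := le_INR _ _ Hn). rewrite S_INR in H.
assert (P : (0 < / eps)%R) by now apply Rinv_0_lt_compat.
replace (/ RtoC (INR n) - 0) with (/ RtoC (INR n)) by ring.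
rewrite <- RtoC_inv by lra. rewrite Cmod_RtoC_nonneg by (left; apply Rinv_0_lt_compat; lra).
rewrite <- (Rinv_inv eps). apply Rinv_lt_contravar; [apply Rmult_lt_0_compat|]; lra.
Qed.

Lemma rising_shift (z : C) (m : nat) : rising z (S m) = z * rising (z + 1) m.
Proof.
induction m as [|m IH]; [simpl; ring|].
change (rising z (S (S m))) with (rising z (S m) * (z + INR (S m))). rewrite IH.
simpl rising. rewrite S_INR, RtoC_plus. ring.
Qed.

Lemma INR_pos_C (m : nat) : (1 <= m)%nat -> RtoC (INR m) <> 0.
Proof. intros H E. apply RtoC_inj in E. assert (A := le_INR _ _ H). simpl in A. lra. Qed.

(** Gauss's terms satisfy the equation up to the factor [1 + (z + 1) / m]. *)
Lemma rGamma_succ (z : C) : rGamma z = z * rGamma (z + 1).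
Proof.
apply (Clim_is_unique (fun m => rgauss m z * ((z + 1) * / INR m + 1))).
- replace (rGamma z) with (rGamma z * ((z + 1) * 0 + 1)) by ring.
  apply Clim_mult; [apply Clim_rGamma|]. apply Clim_plus; [|apply Clim_const].
  apply Clim_scal, Clim_INR_inv.
- apply (Clim_ext_from 1 (fun m => z * rgauss m (z + 1))).
  + intros m Hm. unfold rgauss. rewrite (rising_shift z m).
    change (rising (z + 1) (S m)) with (rising (z + 1) m * (z + 1 + INR m)).
    replace (- (z + 1)) with (- z + - (1)) by ring.
    rewrite Rcpow_plus, (Rcpow_opp (INR m) 1), Rcpow_1 by (apply (lt_INR 0); lia).
    assert (N := INR_pos_C m Hm). assert (N2 := fact_C_neq_0 m). field. split; assumption.
  + apply Clim_scal, Clim_rGamma.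
Qed.

Lemma rGamma_1 : rGamma 1 = 1.
Proof.
apply (Clim_is_unique (fun m => rgauss m 1)); [apply Clim_rGamma|].
apply (Clim_ext_from 1 (fun m => 1 + / INR m)).
- assert (F : forall m, rising 1 m = INR (fact m)).
  { induction m as [|m IH]; [reflexivity|]. simpl rising.
    rewrite IH, fact_simpl, mult_INR, RtoC_mult, S_INR, RtoC_plus. ring. }
  intros m Hm. unfold rgauss. rewrite F, fact_simpl, mult_INR, RtoC_mult, S_INR, RtoC_plus.
  rewrite Rcpow_opp, Rcpow_1 by (apply (lt_INR 0); lia).
  assert (N := INR_pos_C m Hm). assert (N2 := fact_C_neq_0 m). field. split; assumption.
- assert (E : Clim (fun m => 1 + / INR m) (1 + 0)).
  2: now rewrite Cplus_0_r in E.
  apply (Clim_plus (fun _ => RtoC 1) (fun m => / INR m)); [apply Clim_const|apply Clim_INR_inv].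
Qed.

(** Partial products of Euler's product for [sin (pi z) / (pi z)]. *)
Fixpoint sin_prod (m : nat) (z : C) : C :=
  match m with
  | O => 1
  | S k => sin_prod k z * (1 - z * z * / (INR (S k) * INR (S k)))
  end.

(** * The reflection formula *)

Lemma rising_reflection (m : nat) (z : C) :
  rising z (S m) * rising (1 - z) (S m) =
  z * (INR m + 1 - z) * sin_prod m z * (INR (fact m) * INR (fact m)).
Proof.
induction m as [|m IH]; [simpl; ring|].
change (rising z (S (S m))) with (rising z (S m) * (z + INR (S m))).
change (rising (1 - z) (S (S m))) with (rising (1 - z) (S m) * (1 - z + INR (S m))).
replace (rising z (S m) * (z + INR (S m)) * (rising (1 - z) (S m) * (1 - z + INR (S m))))
  with (rising z (S m) * rising (1 - z) (S m) * ((z + INR (S m)) * (1 - z + INR (S m)))) by ring.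
rewrite IH. change (sin_prod (S m) z) with (sin_prod m z * (1 - z * z * / (INR (S m) * INR (S m)))).
rewrite fact_simpl, mult_INR, RtoC_mult. assert (N := INR_pos_C (S m) ltac:(lia)).
replace (INR m + 1 - z) with (INR (S m) - z) by (rewrite S_INR, RtoC_plus; ring).
field. exact N.
Qed.

Lemma rgauss_reflection (m : nat) (z : C) : (1 <= m)%nat ->
  rgauss m z * rgauss m (1 - z) = z * sin_prod m z * (1 + (1 - z) * / INR m).
Proof.
intros Hm. unfold rgauss.
replace (rising z (S m) * (Rcpow (INR m) (- z) * / INR (fact m)) *
  (rising (1 - z) (S m) * (Rcpow (INR m) (- (1 - z)) * / INR (fact m))))
  with (rising z (S m) * rising (1 - z) (S m) *
   ((Rcpow (INR m) (- z) * Rcpow (INR m) (- (1 - z))) * / INR (fact m) * / INR (fact m))) by ring.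
rewrite rising_reflection, <- Rcpow_plus.
replace (- z + - (1 - z)) with (- (1)) by ring.
rewrite Rcpow_opp, Rcpow_1 by (apply (lt_INR 0); lia).
assert (N := INR_pos_C m Hm). assert (N2 := fact_C_neq_0 m). field. split; assumption.
Qed.

Definition Ccos (z : C) : C := (Cexp (Ci * z) + Cexp (- (Ci * z))) / 2.

Lemma Ci_sq : Ci * Ci = - (1).
Proof. unfold Ci, Cmult, Copp, RtoC; simpl. f_equal; ring. Qed.

Lemma is_Cderive_Csin (z : C) : is_Cderive Csin z (Ccos z).
Proof.
unfold Csin.
apply (is_Cderive_ext_loc (fun z => / (2 * Ci) * (Cexp (0 + Ci * z) - Cexp (0 + - Ci * z))) _ z _ 1 Rlt_0_1).
- intros w _. unfold Cdiv. rewrite Cmult_comm, !Cplus_0_l. do 2 f_equal. apply f_equal. ring.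
- eapply is_Cderive_eq.
  + apply is_Cderive_scal. apply is_Cderive_minus.
    * apply (is_Cderive_comp Cexp (fun w => 0 + Ci * w)); [apply is_Cderive_Cexp|apply is_Cderive_affine].
    * apply (is_Cderive_comp Cexp (fun w => 0 + - Ci * w)); [apply is_Cderive_Cexp|apply is_Cderive_affine].
  + unfold Ccos. rewrite !Cplus_0_l. replace (- Ci * z) with (- (Ci * z)) by ring.
    field. exact Ci_nz.
Qed.

Lemma is_Cderive_Ccos (z : C) : is_Cderive Ccos z (- Csin z).
Proof.
unfold Ccos.
apply (is_Cderive_ext_loc (fun z => / 2 * (Cexp (0 + Ci * z) + Cexp (0 + - Ci * z))) _ z _ 1 Rlt_0_1).
- intros w _. unfold Cdiv. rewrite Cmult_comm, !Cplus_0_l. do 2 f_equal. apply f_equal. ring.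
- eapply is_Cderive_eq.
  + apply is_Cderive_scal. apply is_Cderive_plus.
    * apply (is_Cderive_comp Cexp (fun w => 0 + Ci * w)); [apply is_Cderive_Cexp|apply is_Cderive_affine].
    * apply (is_Cderive_comp Cexp (fun w => 0 + - Ci * w)); [apply is_Cderive_Cexp|apply is_Cderive_affine].
  + unfold Csin. rewrite !Cplus_0_l. replace (- Ci * z) with (- (Ci * z)) by ring.
    replace (- ((Cexp (Ci * z) - Cexp (- (Ci * z))) / (2 * Ci)))
      with ((Ci * Ci) * ((Cexp (Ci * z) - Cexp (- (Ci * z))) / (2 * Ci))) by (rewrite Ci_sq; ring).
    field. exact Ci_nz.
Qed.

Lemma Csin_0 : Csin 0 = 0.
Proof.
unfold Csin. rewrite Cmult_0_r. replace (- RtoC 0) with (RtoC 0) by ring.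
unfold Cdiv. ring.
Qed.

Lemma Ccos_0 : Ccos 0 = 1.
Proof.
unfold Ccos. rewrite Cmult_0_r. replace (- RtoC 0) with (RtoC 0) by ring. rewrite Cexp_0. field.
Qed.

Lemma Cmod_Ccos_sub_1 (w : C) : (Cmod (Ccos w - 1) <= Cmod w * Cmod w * exp (Cmod w))%R.
Proof.
unfold Ccos. set (h := Ci * w).
assert (Hh : Cmod h = Cmod w) by (unfold h; rewrite Cmod_mult, Cmod_Ci; ring).
replace ((Cexp h + Cexp (- h)) / 2 - 1)
  with (/ 2 * ((Cexp h - 1 - h) + (Cexp (- h) - 1 - - h))) by field.
rewrite Cmod_mult. replace (Cmod (/ 2)) with (/ 2)%R.
2: { rewrite <- RtoC_inv by lra. rewrite Cmod_RtoC_nonneg; lra. }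
assert (T := Cmod_triangle (Cexp h - 1 - h) (Cexp (- h) - 1 - - h)).
assert (A := Cmod_Cexp_sub_1_sub h). assert (B := Cmod_Cexp_sub_1_sub (- h)).
rewrite Cmod_opp, Hh in B. rewrite Hh in A. lra.
Qed.

(* Wallis-type integrals with a complex frequency: they interpolate between
   [sin (pi z) / (2 z)] at [n = 0] and a limit with ratio [J n z / J n 0 -> 1]. *)
Definition wallis_fun (n : nat) (z : C) (t : R) : C := Ccos (2 * z * t) * RtoC (cos t) ^ (2 * n).

Definition wallis (n : nat) (z : C) : C := CInt (wallis_fun n z) 0 (PI / 2).

Lemma is_Rderive_lin (c : C) (t : R) : is_Rderive (fun s => c * RtoC s) t c.
Proof.
apply (is_derive_ext (fun s : R => 0 + RtoC s * c)); [intros s; change (0 + RtoC s * c = c * RtoC s); ring|].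
apply is_Rderive_affine.
Qed.

Lemma is_Rderive_RtoC_comp (f : R -> R) (t l : R) : is_derive f t l ->
  is_Rderive (fun s => RtoC (f s)) t (RtoC l).
Proof.
intros H. apply is_Rderive_pair; simpl; [exact H|]. apply (@is_derive_const R_AbsRing R_NormedModule).
Qed.

Lemma is_Rderive_cos (t : R) : is_Rderive (fun s => RtoC (cos s)) t (- RtoC (sin t)).
Proof. rewrite <- RtoC_opp. apply (is_Rderive_RtoC_comp cos). apply is_derive_cos. Qed.

Lemma is_Rderive_sin (t : R) : is_Rderive (fun s => RtoC (sin s)) t (RtoC (cos t)).
Proof. apply (is_Rderive_RtoC_comp sin). apply is_derive_sin. Qed.

Lemma is_Rderive_Ccos_lin (c : C) (t : R) :
  is_Rderive (fun s => Ccos (c * RtoC s)) t (- Csin (c * RtoC t) * c).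
Proof. apply (is_Cderive_comp_path Ccos (fun s => c * RtoC s)); [apply is_Cderive_Ccos|apply is_Rderive_lin]. Qed.

Lemma is_Rderive_Csin_lin (c : C) (t : R) :
  is_Rderive (fun s => Csin (c * RtoC s)) t (Ccos (c * RtoC t) * c).
Proof. apply (is_Cderive_comp_path Csin (fun s => c * RtoC s)); [apply is_Cderive_Csin|apply is_Rderive_lin]. Qed.

Lemma is_Rderive_cos_pow (n : nat) (t : R) :
  is_Rderive (fun s => RtoC (cos s) ^ n) t (INR n * RtoC (cos t) ^ pred n * - RtoC (sin t)).
Proof.
apply (is_Cderive_comp_path (fun w => w ^ n) (fun s => RtoC (cos s))); [|apply is_Rderive_cos].
eapply is_Cderive_eq; [apply (is_Cderive_pow (fun w => w)); apply is_Cderive_id|]. cbv beta. ring.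
Qed.

Lemma continuous_wallis (n : nat) (z : C) (t : R) : continuous_C R_UniformSpace (wallis_fun n z) t.
Proof.
apply continuous_Cmult.
- exact (is_Rderive_continuous _ _ _ (is_Rderive_Ccos_lin (2 * z) t)).
- exact (is_Rderive_continuous _ _ _ (is_Rderive_cos_pow (2 * n) t)).
Qed.

Lemma wallis_0 (z : C) : 2 * z * wallis 0 z = Csin (PI * z).
Proof.
unfold wallis. rewrite <- CInt_scal by (intros t _; apply continuous_wallis).
rewrite (CInt_derive (fun t => Csin (2 * z * RtoC t))).
- rewrite Cmult_0_r, Csin_0. replace (2 * z * RtoC (PI / 2)) with (PI * z); [ring|].
  rewrite RtoC_div by lra. field.
- intros t _. unfold wallis_fun. eapply is_Rderive_eq; [apply is_Rderive_Csin_lin|]. simpl. ring.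
- intros t _. apply continuous_Cmult; [apply continuous_Cconst|apply continuous_wallis].
Qed.

Lemma wallis_succ (n : nat) (z : C) :
  4 * (INR (S n) * INR (S n) - z * z) * wallis (S n) z = 2 * INR (S n) * (2 * INR n + 1) * wallis n z.
Proof.
apply Ceq_minus.
(* [- G] is a primitive of [a * wallis_fun (S n) z - b * wallis_fun n z], as found by integrating by
   parts twice. It vanishes at both ends, by [cos (PI / 2) = 0] and by [sin 0 = 0]. *)
pose (G := fun t : R => - (Ccos (2 * z * RtoC t) *
     (2 * INR (S n) * (RtoC (cos t) ^ (2 * n + 1) * RtoC (sin t)))) +
     2 * z * (Csin (2 * z * RtoC t) * RtoC (cos t) ^ (2 * n + 2))).
pose (a := 4 * (INR (S n) * INR (S n) - z * z)). pose (b := 2 * INR (S n) * (2 * INR n + 1)).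
fold a b.
assert (Ca : cont_on (fun t => a * wallis_fun (S n) z t) 0 (PI / 2)).
{ intros t _. apply continuous_Cmult; [apply continuous_Cconst|apply continuous_wallis]. }
assert (Cb : cont_on (fun t => b * wallis_fun n z t) 0 (PI / 2)).
{ intros t _. apply continuous_Cmult; [apply continuous_Cconst|apply continuous_wallis]. }
unfold wallis. rewrite <- !CInt_scal by (intros t _; apply continuous_wallis).
rewrite <- CInt_minus by assumption.
rewrite (CInt_derive (fun t => - G t)).
- unfold G. rewrite cos_PI2, sin_0, Cmult_0_r, Csin_0.
  rewrite !Cpow_add_r, Cpow_1_r. rewrite Cpow_S, Cpow_1_r. ring.
- intros t _. unfold G.
  apply (is_derive_ext (fun t : R => (Ccos (2 * z * RtoC t) *
     (2 * INR (S n) * (RtoC (cos t) ^ (2 * n + 1) * RtoC (sin t)))) +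
     - (2 * z) * (Csin (2 * z * RtoC t) * RtoC (cos t) ^ (2 * n + 2)))).
  { intros s. match goal with |- @eq _ ?x ?y => change (@eq C x y) end. ring. }
  eapply is_Rderive_eq.
  + apply is_Rderive_plus.
    * apply is_Rderive_mult; [apply is_Rderive_Ccos_lin|].
      apply is_Rderive_mult; [apply (@is_derive_const R_AbsRing C_R_NormedModule)|].
      apply is_Rderive_mult; [apply is_Rderive_cos_pow|apply is_Rderive_sin].
    * apply is_Rderive_mult; [apply (@is_derive_const R_AbsRing C_R_NormedModule)|].
      apply is_Rderive_mult; [apply is_Rderive_Csin_lin|apply is_Rderive_cos_pow].
  + change (zero : C_R_NormedModule) with (RtoC 0). unfold wallis_fun, a, b.
    replace (pred (2 * n + 1)) with (2 * n)%nat by lia.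
    replace (pred (2 * n + 2)) with (2 * n + 1)%nat by lia.
    replace (2 * S n)%nat with (2 * n + 2)%nat by lia.
    rewrite !Cpow_add_r, Cpow_1_r, (Cpow_S _ 1), Cpow_1_r.
    rewrite !plus_INR, !mult_INR, S_INR. simpl (INR 1). simpl (INR 2).
    rewrite !RtoC_plus, !RtoC_mult, !RtoC_plus.
    set (k := RtoC (cos t)). set (s := RtoC (sin t)).
    assert (P : s * s = 1 - k * k).
    { unfold s, k. rewrite <- !RtoC_mult, <- RtoC_minus. apply f_equal.
      generalize (sin2_cos2 t). unfold Rsqr. lra. }
    set (u := Ccos _). set (v := Csin _). set (N := RtoC (INR n)). set (q := k ^ (2 * n)).
    apply Ceq_minus.
    match goal with |- ?x = _ => replace x with
      (- (2 * (N + 1)) * (2 * N + 1) * u * q * (s * s - (1 - k * k))) by ring end.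
    rewrite P. ring.
- intros t Ht. apply continuous_Cminus; [now apply Ca|now apply Cb].
Qed.

(** Dividing the recursion at [z] by the one at 0 produces exactly the factor [1 - z^2 / (m+1)^2] of
    the sine product; the case [m = 0] is the evaluation of [wallis 0]. *)
Lemma Csin_wallis (m : nat) (z : C) :
  Csin (PI * z) * wallis m 0 = PI * z * sin_prod m z * wallis m z.
Proof.
assert (W0 : 2 * wallis 0 0 = PI).
{ unfold wallis. rewrite <- CInt_scal by (intros t _; apply continuous_wallis).
  rewrite (CInt_derive (fun t => 2 * RtoC t)).
  - rewrite RtoC_div by lra. field.
  - intros t _. unfold wallis_fun. rewrite Cmult_0_r, Cmult_0_l, Ccos_0. simpl.
    eapply is_Rderive_eq; [apply is_Rderive_lin|ring].
  - intros t _. apply continuous_Cmult; [apply continuous_Cconst|apply continuous_wallis]. }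
induction m as [|m IH].
- rewrite <- wallis_0, <- W0. simpl. ring.
- assert (R1 := wallis_succ m z). assert (R0 := wallis_succ m 0).
  assert (N := INR_pos_C (S m) ltac:(lia)).
  assert (N2 : 2 * INR m + 1 <> 0).
  { rewrite <- RtoC_mult, <- RtoC_plus. intros E. apply RtoC_inj in E. generalize (pos_INR m). lra. }
  change (sin_prod (S m) z) with (sin_prod m z * (1 - z * z * / (INR (S m) * INR (S m)))).
  set (n := RtoC (INR (S m))) in *. set (d := 2 * INR m + 1) in *.
  assert (E1 : wallis m z = 2 * (n * n - z * z) * wallis (S m) z * / (n * d)).
  { transitivity (2 * n * d * wallis m z * / (2 * n * d)); [field; now split|]. rewrite <- R1. field. now split. }
  assert (E0 : wallis m 0 = 2 * (n * n) * wallis (S m) 0 * / (n * d)).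
  { transitivity (2 * n * d * wallis m 0 * / (2 * n * d)); [field; now split|]. rewrite <- R0. field. now split. }
  rewrite E0, E1 in IH.
  transitivity (Csin (PI * z) * (2 * (n * n) * wallis (S m) 0 * / (n * d)) * (d * / (2 * n))); [field; now split|].
  rewrite IH. fold n. field. now split.
Qed.

(** A crude form of Jordan's inequality, obtained from [cos >= 1/2] on the half interval and the
    doubling formula. It turns [t^2] into a multiple of [1 - cos^2]. *)
Lemma sin_ge_quarter (t : R) : (0 <= t <= PI / 2)%R -> (t <= 4 * sin t)%R.
Proof.
intros Ht. assert (P := PI_RGT_0). assert (P4 := PI_4).
assert (Hc : forall x, (0 <= x <= t / 2)%R -> (1 / 2 <= cos x)%R).
{ intros x Hx. rewrite <- cos_PI3. apply cos_decr_1; lra. }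
assert (Hs : (t / 4 <= sin (t / 2))%R).
{ destruct (MVT_gen sin 0 (t / 2) cos) as [x [Hx E]].
  - intros x _. apply is_derive_sin.
  - intros x _. apply continuity_sin.
  - rewrite Rmin_left, Rmax_right in Hx by lra. rewrite sin_0 in E.
    specialize (Hc x Hx). assert (1 / 2 * (t / 2) <= cos x * (t / 2))%R by (apply Rmult_le_compat_r; lra). lra. }
assert (C2 := Hc (t / 2)%R ltac:(lra)).
replace t with (2 * (t / 2))%R at 2 by field. rewrite sin_2a.
assert (t / 4 * (1 / 2) <= sin (t / 2) * cos (t / 2))%R by (apply Rmult_le_compat; lra). lra.
Qed.

Lemma wallis_real (n : nat) : exists W : R, is_RInt (fun t => (cos t ^ (2 * n))%R) 0 (PI / 2) W /\
  wallis n 0 = RtoC W.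
Proof.
assert (H := is_CInt (wallis_fun n 0) 0 (PI / 2) (fun t _ => continuous_wallis n 0 t)).
assert (E : forall t, wallis_fun n 0 t = RtoC (cos t ^ (2 * n))).
{ intros t. unfold wallis_fun. rewrite Cmult_0_r, Cmult_0_l, Ccos_0, RtoC_pow. ring. }
apply is_CInt_parts in H. destruct H as [H1 H2].
exists (Re (wallis n 0)). split.
- apply (is_RInt_ext (fun t => Re (wallis_fun n 0 t))); [|exact H1]. intros t _. now rewrite E.
- assert (I0 : Im (wallis n 0) = 0).
  { apply (is_RInt_unique (V := R_CompleteNormedModule)) in H2. unfold wallis. rewrite <- H2.
    rewrite (RInt_ext _ (fun _ => 0%R)).
    - rewrite (RInt_const (V := R_CompleteNormedModule)). apply Rmult_0_r.
    - intros t _. now rewrite E. }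
  destruct (wallis n 0) as [a b]. unfold Re, Im, RtoC in *. simpl in *. now rewrite I0.
Qed.

(** [cos (2 z t) - 1] is at most [B sin^2 t], and [sin^2 t cos^(2n) t] integrates to the difference
    of two consecutive Wallis integrals, which is [1 / (2n+2)] of the first. *)
Lemma wallis_ratio (z : C) : exists B : R, (0 <= B)%R /\ forall n,
  (Cmod (wallis n z - wallis n 0) <= B * / INR (S n) * Cmod (wallis n 0))%R.
Proof.
(* [4 |z|^2] is the square of the frequency, 16 comes from [t <= 4 sin t], and the exponential uses
   [t <= PI / 2 <= 2]. *)
set (B := (4 * (Cmod z * Cmod z) * exp (4 * Cmod z) * 16)%R).
assert (Z0 := Cmod_ge_0 z). assert (E0 := exp_pos (4 * Cmod z)).
assert (HB : (0 <= B)%R).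
{ unfold B. apply Rmult_le_pos; [|lra]. apply Rmult_le_pos; [|lra].
  apply Rmult_le_pos; [lra|]. now apply Rmult_le_pos. }
exists B. split; [exact HB|]. intros n.
destruct (wallis_real n) as [W [HW EW]]. destruct (wallis_real (S n)) as [W' [HW' EW']].
assert (Pi4 := PI_4). assert (Pi0 := PI_RGT_0).
assert (HI : is_RInt (fun t => (B * (cos t ^ (2 * n) - cos t ^ (2 * S n)))%R) 0 (PI / 2) (B * (W - W'))%R).
{ apply (is_RInt_scal (V := R_NormedModule)). now apply (is_RInt_minus (V := R_NormedModule)). }
assert (Rec : (W - W' = W * / (2 * INR (S n)))%R).
{ assert (R0 := wallis_succ n 0). rewrite EW, EW' in R0.
  assert (Hn : (0 < INR (S n))%R) by (apply (lt_INR 0); lia).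
  assert (R1 : (4 * (INR (S n) * INR (S n)) * W' = 2 * INR (S n) * (2 * INR n + 1) * W)%R).
  { apply RtoC_inj. rewrite !RtoC_mult, RtoC_plus, RtoC_mult. rewrite <- R0. ring. }
  assert (R2 : (2 * INR (S n) * W' = (2 * INR n + 1) * W)%R).
  { apply (Rmult_eq_reg_l (2 * INR (S n))); [|lra]. lra. }
  apply (Rmult_eq_reg_l (2 * INR (S n))); [|lra].
  replace (2 * INR (S n) * (W * / (2 * INR (S n))))%R with W by (field; lra).
  rewrite Rmult_minus_distr_l, R2, S_INR. ring. }
assert (W0 : (0 <= W)%R).
{ apply (is_RInt_ge_0 (fun t => (cos t ^ (2 * n))%R) 0 (PI / 2)); [lra|exact HW|].
  intros t _. rewrite pow_mult. apply pow_le. apply pow2_ge_0. }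
rewrite EW. rewrite Cmod_RtoC_nonneg by exact W0. rewrite <- EW.
apply Rle_trans with (B * (W - W'))%R.
- unfold wallis. rewrite <- CInt_minus by (intros t _; apply continuous_wallis).
  apply (Cmod_CInt_le _ (fun t => (B * (cos t ^ (2 * n) - cos t ^ (2 * S n)))%R)); [lra| |  |exact HI].
  + intros t _. apply continuous_Cminus; apply continuous_wallis.
  + intros t Ht. unfold wallis_fun. rewrite Cmult_0_r, Cmult_0_l, Ccos_0.
    replace (Ccos (2 * z * t) * RtoC (cos t) ^ (2 * n) - 1 * RtoC (cos t) ^ (2 * n))
      with ((Ccos (2 * z * t) - 1) * RtoC (cos t) ^ (2 * n)) by ring.
    assert (Hc : (0 <= cos t ^ (2 * n))%R).
    { rewrite pow_mult. apply pow_le. apply pow2_ge_0. }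
    rewrite Cmod_mult, <- RtoC_pow, (Cmod_RtoC_nonneg (cos t ^ (2 * n))) by exact Hc.
    replace (2 * S n)%nat with (2 * n + 2)%nat by lia. rewrite pow_add.
    replace (B * (cos t ^ (2 * n) - cos t ^ (2 * n) * cos t ^ 2))%R
      with (B * (sin t * sin t) * cos t ^ (2 * n))%R.
    2: { assert (S2 := sin2_cos2 t). unfold Rsqr in S2.
         replace (sin t * sin t)%R with (1 - cos t * cos t)%R by lra. ring. }
    apply Rmult_le_compat_r; [exact Hc|].
    eapply Rle_trans; [apply Cmod_Ccos_sub_1|].
    rewrite !Cmod_mult, !Cmod_RtoC_nonneg by lra.
    assert (S4 := sin_ge_quarter t Ht).
    unfold B. replace (4 * (Cmod z * Cmod z) * exp (4 * Cmod z) * 16 * (sin t * sin t))%R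
      with (2 * Cmod z * (4 * sin t) * (2 * Cmod z * (4 * sin t)) * exp (4 * Cmod z))%R by ring.
    assert (Q : (2 * Cmod z * t <= 2 * Cmod z * (4 * sin t))%R) by (apply Rmult_le_compat_l; lra).
    assert (Q0 : (0 <= 2 * Cmod z * t)%R) by (apply Rmult_le_pos; lra).
    apply Rmult_le_compat; [now apply Rmult_le_pos|left; apply exp_pos|now apply Rmult_le_compat|].
    apply exp_le_mono. assert (Cmod z * t <= Cmod z * 2)%R by (apply Rmult_le_compat_l; lra). lra.
- rewrite Rec. assert (Hn : (0 < INR (S n))%R) by (apply (lt_INR 0); lia).
  rewrite Rmult_assoc. apply Rmult_le_compat_l; [exact HB|].
  rewrite Rmult_comm. apply Rmult_le_compat_r; [exact W0|]. apply Rinv_le_contravar; lra.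
Qed.

Lemma wallis_neq_0 (n : nat) : wallis n 0 <> 0.
Proof.
induction n as [|n IH].
- intros E. assert (H := Csin_wallis 0 (/ 2)). assert (A := wallis_0 (/ 2)).
  destruct (wallis_real 0) as [W [HW EW]]. rewrite EW in E. apply RtoC_inj in E. rewrite E in HW.
  apply (is_RInt_unique (V := R_CompleteNormedModule)) in HW. simpl in HW.
  rewrite (RInt_const (V := R_CompleteNormedModule)) in HW.
  unfold scal in HW; simpl in HW. unfold mult in HW; simpl in HW. generalize PI_RGT_0. lra.
- intros E. assert (R0 := wallis_succ n 0). rewrite E, Cmult_0_r in R0. symmetry in R0.
  revert R0. apply Cmult_neq_0; [|exact IH].
  apply Cmult_neq_0.
  + apply Cmult_neq_0; [intros Q; apply RtoC_inj in Q; lra|apply INR_pos_C; lia].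
  + rewrite <- RtoC_mult, <- RtoC_plus. intros Q. apply RtoC_inj in Q. generalize (pos_INR n). lra.
Qed.

Lemma Clim_of_bound (u : nat -> C) (l : C) (B : R) :
  (0 <= B)%R -> (forall n, (Cmod (u n - l) <= B * / INR (S n))%R) -> Clim u l.
Proof.
intros HB H eps Heps. destruct (nfloor_ex (B / eps)) as [N [_ HN]].
{ apply Rdiv_le_0_compat; lra. }
exists N. intros n Hn. assert (A := le_INR _ _ Hn).
assert (Hn0 : (0 < INR (S n))%R) by (apply (lt_INR 0); lia).
eapply Rle_lt_trans; [apply H|]. apply (Rmult_lt_reg_r (INR (S n))); [exact Hn0|].
rewrite Rmult_assoc, Rinv_l by lra. rewrite S_INR in *.
assert (L : (B / eps < INR n + 1)%R) by lra.
apply (Rmult_lt_compat_l eps) in L; [|exact Heps].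
replace (eps * (B / eps))%R with B in L by (field; lra). lra.
Qed.

(** For Gauss's terms the left side is [PI z sin_prod m z] times a factor tending to 1, and by
    [Csin_wallis] this is the sine times a ratio of Wallis integrals, which also tends to 1.
    Multiplying by that ratio makes the two sequences equal. *)
Lemma rGamma_reflection (z : C) : PI * (rGamma z * rGamma (1 - z)) = Csin (PI * z).
Proof.
destruct (wallis_ratio z) as [B [HB HW]].
assert (LW : Clim (fun n => wallis n z / wallis n 0) 1).
{ apply (Clim_of_bound _ _ B HB). intros n. assert (N := wallis_neq_0 n).
  replace (wallis n z / wallis n 0 - 1) with ((wallis n z - wallis n 0) / wallis n 0) by (field; exact N).
  rewrite Cmod_div by exact N. assert (M : (0 < Cmod (wallis n 0))%R) by now apply Cmod_gt_0.
  apply (Rmult_le_reg_r (Cmod (wallis n 0))); [exact M|].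
  unfold Rdiv. rewrite Rmult_assoc, Rinv_l by lra. rewrite Rmult_1_r. apply HW. }
apply (Clim_is_unique (fun m => PI * (rgauss m z * rgauss m (1 - z)) * (wallis m z / wallis m 0))).
- replace (PI * (rGamma z * rGamma (1 - z))) with (PI * (rGamma z * rGamma (1 - z)) * 1) by ring.
  apply Clim_mult; [|exact LW]. apply Clim_scal. apply Clim_mult; apply Clim_rGamma.
- apply (Clim_ext_from 1 (fun m => Csin (PI * z) * ((1 - z) * / INR m + 1))).
  + intros m Hm. rewrite rgauss_reflection by exact Hm. assert (N := wallis_neq_0 m).
    assert (E := Csin_wallis m z).
    assert (E' : Csin (PI * z) = PI * z * sin_prod m z * wallis m z / wallis m 0).
    { rewrite <- E. field. exact N. }
    rewrite E'. assert (N' := INR_pos_C m Hm). field. now split.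
  + assert (E : Csin (PI * z) * ((1 - z) * 0 + 1) = Csin (PI * z)) by ring.
    revert E. generalize (Csin (PI * z)). intros c E.
    enough (H : Clim (fun m => c * ((1 - z) * / INR m + 1)) (c * ((1 - z) * 0 + 1)))
      by (rewrite E in H; exact H).
    apply (Clim_scal c (fun m => (1 - z) * / INR m + 1)). apply Clim_plus; [|apply Clim_const]. apply Clim_scal, Clim_INR_inv.
Qed.

(** * Ratios of Gamma functions *)

Lemma ln_1_plus_ge (t : R) : (0 <= t)%R -> (t - t * t <= ln (1 + t))%R.
Proof.
intros Ht. assert (A := ln_le_sub_1 (/ (1 + t)) ltac:(apply Rinv_0_lt_compat; lra)).
rewrite ln_Rinv in A by lra.
assert (E : (/ (1 + t) = 1 - t + t * t * / (1 + t))%R) by (field; lra).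
assert (I : (/ (1 + t) <= 1)%R) by (rewrite <- Rinv_1; apply Rinv_le_contravar; lra).
assert (t * t * / (1 + t) <= t * t * 1)%R by (apply Rmult_le_compat_l; [apply Rle_0_sqr|exact I]). lra.
Qed.

Lemma ln_1_minus_ge (t : R) : (t <= 1 / 2)%R -> (- t - 2 * (t * t) <= ln (1 - t))%R.
Proof.
intros Ht. assert (A := ln_le_sub_1 (/ (1 - t)) ltac:(apply Rinv_0_lt_compat; lra)).
rewrite ln_Rinv in A by lra.
assert (E : (/ (1 - t) = 1 + t + t * t * / (1 - t))%R) by (field; lra).
assert (I : (/ (1 - t) <= 2)%R).
{ rewrite <- (Rinv_inv 2). apply Rinv_le_contravar; lra. }
assert (t * t * / (1 - t) <= t * t * 2)%R by (apply Rmult_le_compat_l; [apply Rle_0_sqr|exact I]). lra.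
Qed.

Lemma ln_Cmod (u : C) : u <> 0 -> ln (Cmod u) = (ln (Re u ^ 2 + Im u ^ 2) / 2)%R.
Proof.
intros Hu. assert (M : (0 < Cmod u)%R) by now apply Cmod_gt_0.
rewrite <- Cmod2_alt. rewrite <- Rsqr_pow2. unfold Rsqr. rewrite ln_mult by exact M. field.
Qed.

Lemma Re_le_Cmod (u : C) : (Re u <= Cmod u)%R.
Proof. eapply Rle_trans; [apply Rle_abs|apply re_le_Cmod]. Qed.

(* One factor of the telescoping comparison of [|Gamma (u - beta) / Gamma u|] with [|u| ^ (- Re beta)]. *)
Lemma ratio_step (beta u : C) : (0 < Re beta)%R -> (8 * Cmod beta + 8 <= Re u)%R ->
  (Cmod u * exp (Re beta * ln (Cmod u)) <=
   exp ((Cmod beta * Rabs (Im u) + (5 * Re beta + 9 * (Cmod beta * Cmod beta))) / (Cmod u * Cmod u)) *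
   exp (Re beta * ln (Cmod (u + 1))) * Cmod (u - beta))%R.
Proof.
intros Hb Hu. set (b := Re beta) in *. set (B := Cmod beta) in *.
assert (B0 : (0 <= B)%R) by apply Cmod_ge_0.
assert (Hrho := Re_le_Cmod u). set (rho := Cmod u) in *.
assert (Nu : u <> 0) by (apply Cmod_gt_0; fold rho; lra).
assert (Nu1 : u + 1 <> 0).
{ intros E. assert (Q : Re (u + 1) = 0%R) by (now rewrite E). rewrite re_plus, re_RtoC in Q. lra. }
assert (Nub : u - beta <> 0).
{ intros E. assert (Q : Re (u - beta) = 0%R) by (now rewrite E). unfold Cminus in Q. rewrite re_plus, re_opp in Q.
  assert (R1 := Re_le_Cmod beta). fold B in R1. lra. }
assert (M1 : (0 < Cmod (u - beta))%R) by now apply Cmod_gt_0.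
rewrite <- (exp_ln rho) at 1 by lra. rewrite <- (exp_ln (Cmod (u - beta))) by exact M1.
rewrite <- !exp_plus. apply exp_le_mono.
assert (R2 : (rho * rho = Re u ^ 2 + Im u ^ 2)%R).
{ unfold rho. rewrite <- Cmod2_alt. ring. }
assert (R3 : (B * B = Re beta ^ 2 + Im beta ^ 2)%R).
{ unfold B. rewrite <- Cmod2_alt. ring. }
set (X := Re u) in *. set (Y := Im u) in *. set (S := (rho * rho)%R) in *.
assert (HS : (0 < S)%R) by (unfold S; apply Rmult_lt_0_compat; lra).
(* These are the relative changes of the squared modulus: [|u + 1|^2 = S (1 + t)] and
   [|u - beta|^2 = S (1 - tau)]. Both are of order [1 / rho], so second-order bounds of the
   logarithm suffice. *)
set (t := ((2 * X + 1) * / S)%R).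
set (tau := ((2 * (b * X + Im beta * Y) - B * B) * / S)%R).
assert (L1 : ln (Cmod (u + 1)) = (ln rho + ln (1 + t) / 2)%R).
{ rewrite (ln_Cmod (u + 1) Nu1). unfold rho. rewrite (ln_Cmod u Nu).
  rewrite re_plus, im_plus, re_RtoC, im_RtoC. fold X Y.
  replace ((X + 1) ^ 2 + (Y + 0) ^ 2)%R with (S * (1 + t))%R.
  - rewrite ln_mult; [rewrite R2; field|exact HS|].
    assert (0 <= t)%R; [|lra]. unfold t. apply Rmult_le_pos; [lra|left; now apply Rinv_0_lt_compat].
  - unfold t. replace (S * (1 + (2 * X + 1) * / S))%R with (S + 2 * X + 1)%R by (field; lra).
    rewrite R2. ring. }
assert (I0 : (0 < / S)%R) by now apply Rinv_0_lt_compat.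
assert (t0 : (0 <= t)%R) by (unfold t; apply Rmult_le_pos; lra).
assert (tb : (t * t <= 9 * / S)%R).
{ unfold t. replace ((2 * X + 1) * / S * ((2 * X + 1) * / S))%R
    with ((2 * X + 1) * (2 * X + 1) * / S * / S)%R by ring.
  apply Rmult_le_compat_r; [lra|]. apply (Rmult_le_reg_r S); [exact HS|].
  rewrite Rmult_assoc, Rinv_l, Rmult_1_r by lra. unfold S.
  replace (9 * (rho * rho))%R with ((3 * rho) * (3 * rho))%R by ring. apply Rmult_le_compat; lra. }
assert (Habs : (Rabs (2 * (b * X + Im beta * Y) - B * B) <= 3 * B * rho)%R).
{ assert (E : (b * X + Im beta * Y)%R = Re (Cconj beta * u)).
  { rewrite re_mult, re_conj, im_conj. unfold b, X, Y. ring. }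
  rewrite E. assert (A := re_le_Cmod (Cconj beta * u)). rewrite Cmod_mult, Cmod_conj in A. fold B rho in A.
  assert (B * B <= B * rho)%R by (apply Rmult_le_compat_l; lra).
  assert (P : (0 <= B * B)%R) by (apply Rmult_le_pos; lra).
  apply Rabs_le. apply Rabs_le_between in A. lra. }
assert (taub : (tau * tau <= 9 * (B * B) * / S)%R).
{ unfold tau. set (q := (2 * (b * X + Im beta * Y) - B * B)%R) in *.
  replace (q * / S * (q * / S))%R with (q * q * / S * / S)%R by ring.
  apply Rmult_le_compat_r; [lra|]. apply (Rmult_le_reg_r S); [exact HS|].
  rewrite Rmult_assoc, Rinv_l, Rmult_1_r by lra. unfold S.
  replace (9 * (B * B) * (rho * rho))%R with ((3 * B * rho) * (3 * B * rho))%R by ring.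
  replace (q * q)%R with (Rabs q * Rabs q)%R by (rewrite <- Rabs_mult; apply Rabs_pos_eq, Rle_0_sqr).
  apply Rmult_le_compat; try apply Rabs_pos; exact Habs. }
assert (tauh : (tau <= 1 / 2)%R).
{ unfold tau. set (q := (2 * (b * X + Im beta * Y) - B * B)%R) in *.
  apply (Rmult_le_reg_r S); [exact HS|]. rewrite Rmult_assoc, Rinv_l, Rmult_1_r by lra.
  assert (Q := Rle_abs q). unfold S. assert (3 * B * rho <= 1 / 2 * rho * rho)%R; [|lra].
  apply Rmult_le_compat_r; lra. }
assert (L2 : ln (Cmod (u - beta)) = (ln rho + ln (1 - tau) / 2)%R).
{ rewrite (ln_Cmod (u - beta) Nub). unfold rho. rewrite (ln_Cmod u Nu).
  unfold Cminus. rewrite re_plus, im_plus, re_opp, im_opp. fold X Y b.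
  replace ((X + - b) ^ 2 + (Y + - Im beta) ^ 2)%R with (S * (1 - tau))%R.
  - rewrite ln_mult; [rewrite R2; field|exact HS|lra].
  - unfold tau. replace (S * (1 - (2 * (b * X + Im beta * Y) - B * B) * / S))%R
      with (S - (2 * (b * X + Im beta * Y) - B * B))%R by (field; lra).
    rewrite R2, R3. fold b. ring. }
rewrite L1, L2.
assert (G1 := ln_1_plus_ge t t0). assert (G2 := ln_1_minus_ge tau tauh).
assert (G3 : (b * (t - t * t) <= b * ln (1 + t))%R) by (apply Rmult_le_compat_l; lra).
assert (G4 : (Im beta * Y <= B * Rabs Y)%R).
{ eapply Rle_trans; [apply Rle_abs|]. rewrite Rabs_mult. apply Rmult_le_compat_r; [apply Rabs_pos|apply im_le_Cmod]. }
assert (G5 : (b * (t * t) <= b * (9 * / S))%R) by (apply Rmult_le_compat_l; lra).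
assert (G6 : (tau <= (2 * (b * X + B * Rabs Y)) * / S)%R).
{ unfold tau. apply Rmult_le_compat_r; [lra|].
  assert (P : (0 <= B * B)%R) by (apply Rmult_le_pos; lra). lra. }
assert (G7 : (b * t = (2 * (b * X) + b) * / S)%R) by (unfold t; ring).
assert (G8 : (0 <= b * / S)%R) by (apply Rmult_le_pos; lra).
(* The terms [b X / S] of [b t / 2] and [tau / 2] cancel. What survives is [Im beta * Y / S] and
   terms of order [1 / S]; the former explains why [Rabs (Im u)] stands in the exponent. *)
unfold Rdiv. fold S. lra.
Qed.

(** Because [x^2 + y^2 >= (x + y)^2 / 2]. The telescoped sum is of order [1 / (Re s + |Im s|)],
    which compensates the [|Im s|] in the exponent of [ratio_step] uniformly in [s]. *)
Lemma inv_Cmod_sq_telescope (s : C) (j : nat) : (8 <= Re s)%R ->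
  (/ (Cmod (s + INR j) * Cmod (s + INR j)) <=
   2 * (/ (Re s + INR j - 1 + Rabs (Im s)) - / (Re s + INR (S j) - 1 + Rabs (Im s))))%R.
Proof.
intros Hs. assert (J := pos_INR j). assert (Y := Rabs_pos (Im s)). rewrite S_INR.
assert (E : (Cmod (s + INR j) * Cmod (s + INR j) = (Re s + INR j) ^ 2 + Rabs (Im s) ^ 2)%R).
{ transitivity (Cmod (s + INR j) ^ 2)%R; [ring|]. rewrite Cmod2_alt, re_plus, im_plus, re_RtoC, im_RtoC.
  rewrite pow2_abs. ring. }
rewrite E. set (x := (Re s + INR j)%R) in *. set (y := Rabs (Im s)) in *.
assert (Hx : (8 <= x)%R) by (unfold x; lra).
replace (Re s + (INR j + 1) - 1 + y)%R with (x + y)%R by (unfold x; ring).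
replace (2 * (/ (x - 1 + y) - / (x + y)))%R with (/ ((x - 1 + y) * (x + y) / 2))%R by (field; lra).
apply Rinv_le_contravar.
- apply Rdiv_lt_0_compat; [apply Rmult_lt_0_compat|]; lra.
- assert (Q := Rle_0_sqr (x - y)). unfold Rsqr in Q. simpl pow. lra.
Qed.

Lemma rising_ratio_bound (beta s : C) : (0 < Re beta)%R -> (8 * Cmod beta + 8 <= Re s)%R -> forall j,
  (Cmod (rising s j) * exp (Re beta * ln (Cmod s)) <=
   exp ((Cmod beta * Rabs (Im s) + (5 * Re beta + 9 * (Cmod beta * Cmod beta))) *
     (2 * (/ (Re s - 1 + Rabs (Im s)) - / (Re s + INR j - 1 + Rabs (Im s))))) *
   exp (Re beta * ln (Cmod (s + INR j))) * Cmod (rising (s - beta) j))%R.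
Proof.
intros Hb Hs. set (A := (Cmod beta * Rabs (Im s) + (5 * Re beta + 9 * (Cmod beta * Cmod beta)))%R).
assert (B0 := Cmod_ge_0 beta).
assert (A0 : (0 <= A)%R).
{ unfold A. assert (0 <= Cmod beta * Rabs (Im s))%R by (apply Rmult_le_pos; [lra|apply Rabs_pos]).
  assert (0 <= Cmod beta * Cmod beta)%R by (apply Rmult_le_pos; lra). lra. }
induction j as [|j IH].
- simpl. rewrite Rplus_0_r, Rminus_diag, !Rmult_0_r, exp_0, Cplus_0_r. lra.
- change (rising s (S j)) with (rising s j * (s + INR j)).
  change (rising (s - beta) (S j)) with (rising (s - beta) j * (s - beta + INR j)).
  rewrite !Cmod_mult. assert (J := pos_INR j).
  assert (R1 : Re (s + INR j) = (Re s + INR j)%R) by (rewrite re_plus, re_RtoC; reflexivity).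
  assert (I1 : Im (s + INR j) = Im s) by (rewrite im_plus, im_RtoC; ring).
  assert (St := ratio_step beta (s + INR j) Hb ltac:(rewrite R1; lra)).
  rewrite I1 in St. fold A in St.
  replace (s + INR j + 1) with (s + INR (S j)) in St by (rewrite S_INR, RtoC_plus; ring).
  replace (s + INR j - beta) with (s - beta + INR j) in St by ring.
  assert (T := inv_Cmod_sq_telescope s j ltac:(lra)).
  apply (Rmult_le_compat_l A) in T; [|exact A0].
  set (u := Cmod (s + INR j)) in *.
  assert (P1 := Cmod_ge_0 (rising s j)). assert (U0 : (0 <= u)%R) by apply Cmod_ge_0.
  set (q0 := exp (Re beta * ln (Cmod s))) in *.
  set (a := (A * (2 * (/ (Re s - 1 + Rabs (Im s)) - / (Re s + INR j - 1 + Rabs (Im s)))))%R) in *.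
  set (v := exp (Re beta * ln u)) in *.
  assert (V0 : (0 < v)%R) by apply exp_pos.
  (* Both sides are multiplied by the power of [|s + j|], so that the induction hypothesis and
     [ratio_step] can be chained without dividing. *)
  apply (Rmult_le_reg_r v); [exact V0|].
  apply Rle_trans with ((exp a * v * Cmod (rising (s - beta) j)) * (u * v))%R.
  + replace (Cmod (rising s j) * u * q0 * v)%R with ((Cmod (rising s j) * q0) * (u * v))%R by ring.
    apply Rmult_le_compat_r; [apply Rmult_le_pos; lra|exact IH].
  + apply Rle_trans with ((exp a * v * Cmod (rising (s - beta) j)) *
      (exp (A / (u * u)) * exp (Re beta * ln (Cmod (s + INR (S j)))) * Cmod (s - beta + INR j)))%R.
    * apply Rmult_le_compat_l; [|exact St].
      apply Rmult_le_pos; [|apply Cmod_ge_0]. apply Rmult_le_pos; left; [apply exp_pos|exact V0].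
    * set (w := exp (Re beta * ln (Cmod (s + INR (S j))))).
      match goal with |- (_ <= exp ?x * _ * _ * _)%R => set (a' := x) end.
      replace (exp a * v * Cmod (rising (s - beta) j) *
        (exp (A / (u * u)) * w * Cmod (s - beta + INR j)))%R
        with ((exp a * exp (A / (u * u))) * (w * (Cmod (rising (s - beta) j) * Cmod (s - beta + INR j)) * v))%R by ring.
      replace (exp a' * w * (Cmod (rising (s - beta) j) * Cmod (s - beta + INR j)) * v)%R
        with (exp a' * (w * (Cmod (rising (s - beta) j) * Cmod (s - beta + INR j)) * v))%R by ring.
      apply Rmult_le_compat_r.
      { apply Rmult_le_pos; [|lra]. apply Rmult_le_pos; [left; apply exp_pos|].
        apply Rmult_le_pos; apply Cmod_ge_0. }
      rewrite <- exp_plus. apply exp_le_mono. unfold a, a', Rdiv. lra.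
Qed.

(** The first factor bounds the telescoped exponent for all [s] in the half-plane; the second is
    [2 ^ Re beta], from [|s + m + 1| <= 2 m] for large [m]. *)
Definition ratio_const (beta : C) : R :=
  (exp (4 * (Cmod beta + 5 * Re beta + 9 * (Cmod beta * Cmod beta))) * exp (Re beta * ln 2))%R.

(** The bound [|Gamma (s - beta) / Gamma s| = O(|s|^(- Re beta))] in multiplied-out form. It holds
    for Gauss's terms of large index, where the powers of [m] on the two sides combine, and passes
    to the limit. *)
Lemma rGamma_ratio_bound (beta s : C) : (0 < Re beta)%R -> (8 * Cmod beta + 8 <= Re s)%R ->
  (Cmod (rGamma s) * exp (Re beta * ln (Cmod s)) <= ratio_const beta * Cmod (rGamma (s - beta)))%R.
Proof.
intros Hb Hs. assert (B0 := Cmod_ge_0 beta).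
destruct (nfloor_ex (Cmod s + 1)) as [N [_ HN]]; [generalize (Cmod_ge_0 s); lra|].
assert (Rs := Re_le_Cmod s).
assert (Fin : forall m, (S N <= m)%nat ->
  (Cmod (rgauss m s) * exp (Re beta * ln (Cmod s)) <= ratio_const beta * Cmod (rgauss m (s - beta)))%R).
{ intros m Hm. unfold rgauss. rewrite !Cmod_mult, !Cmod_Rcpow.
  assert (Hm' := le_INR _ _ Hm). rewrite S_INR in Hm'.
  assert (H := rising_ratio_bound beta s Hb Hs (S m)).
  set (F := Cmod (/ INR (fact m))). assert (F0 : (0 <= F)%R) by apply Cmod_ge_0.
  set (A := (Cmod beta * Rabs (Im s) + (5 * Re beta + 9 * (Cmod beta * Cmod beta)))%R) in *.
  assert (BB : (0 <= Cmod beta * Cmod beta)%R) by (apply Rmult_le_pos; lra).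
  assert (Y0 := Rabs_pos (Im s)).
  assert (A0 : (0 <= A)%R).
  { unfold A. assert (0 <= Cmod beta * Rabs (Im s))%R by (apply Rmult_le_pos; lra). lra. }
  assert (Hi : (0 < / (Re s + INR (S m) - 1 + Rabs (Im s)))%R).
  { apply Rinv_0_lt_compat. generalize (pos_INR (S m)). lra. }
  assert (E1 : (A * (2 * (/ (Re s - 1 + Rabs (Im s)) - / (Re s + INR (S m) - 1 + Rabs (Im s)))) <=
     4 * (Cmod beta + 5 * Re beta + 9 * (Cmod beta * Cmod beta)))%R).
  { apply Rle_trans with (A * (2 * / (Re s - 1 + Rabs (Im s))))%R; [apply Rmult_le_compat_l; lra|].
    assert (D0 : (0 < Re s - 1 + Rabs (Im s))%R) by lra.
    apply (Rmult_le_reg_r (Re s - 1 + Rabs (Im s))); [exact D0|].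
    replace (A * (2 * / (Re s - 1 + Rabs (Im s))) * (Re s - 1 + Rabs (Im s)))%R with (2 * A)%R by (field; lra).
    set (K := (5 * Re beta + 9 * (Cmod beta * Cmod beta))%R) in *.
    assert (K0 : (0 <= K)%R) by (unfold K; lra).
    replace (4 * (Cmod beta + 5 * Re beta + 9 * (Cmod beta * Cmod beta)))%R with (4 * Cmod beta + 4 * K)%R
      by (unfold K; ring).
    set (D := (Re s - 1 + Rabs (Im s))%R) in *.
    assert (Cmod beta * Rabs (Im s) <= Cmod beta * D)%R by (apply Rmult_le_compat_l; unfold D; lra).
    assert (K * 1 <= K * D)%R by (apply Rmult_le_compat_l; unfold D; lra).
    assert (0 <= Cmod beta * D)%R by (apply Rmult_le_pos; lra). unfold A. lra. }
  assert (E2 : (exp (Re beta * ln (Cmod (s + INR (S m)))) <=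
     exp (Re beta * ln 2) * exp (Re beta * ln (INR m)))%R).
  { rewrite <- exp_plus. apply exp_le_mono. rewrite <- Rmult_plus_distr_l.
    apply Rmult_le_compat_l; [lra|]. rewrite <- ln_mult by lra. 
    assert (T := Cmod_triangle s (INR (S m))). rewrite (Cmod_RtoC_nonneg (INR (S m))) in T by apply pos_INR.
    rewrite S_INR in T.
    assert (P : (0 < Cmod (s + INR (S m)))%R).
    { eapply Rlt_le_trans; [|apply Re_le_Cmod]. rewrite re_plus, re_RtoC. generalize (pos_INR (S m)). lra. }
    rewrite S_INR in *. apply ln_le; [exact P|]. lra. }
  unfold ratio_const.
  assert (P3 := Cmod_ge_0 (rising (s - beta) (S m))).
  assert (H2 : (Cmod (rising s (S m)) * exp (Re beta * ln (Cmod s)) <=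
    exp (4 * (Cmod beta + 5 * Re beta + 9 * (Cmod beta * Cmod beta))) *
     (exp (Re beta * ln 2) * exp (Re beta * ln (INR m))) * Cmod (rising (s - beta) (S m)))%R).
  { eapply Rle_trans; [exact H|]. apply Rmult_le_compat_r; [exact P3|].
    apply Rmult_le_compat; try (left; apply exp_pos); [|exact E2]. now apply exp_le_mono. }
  replace (exp (Re (- (s - beta)) * ln (INR m)))%R
    with (exp (Re (- s) * ln (INR m)) * exp (Re beta * ln (INR m)))%R.
  2: { rewrite <- exp_plus. f_equal. unfold Cminus. rewrite !re_opp, re_plus, re_opp. ring. }
  set (e0 := exp (Re (- s) * ln (INR m))). assert (e0p : (0 < e0)%R) by apply exp_pos.
  apply (Rmult_le_compat_r (e0 * F)) in H2; [|apply Rmult_le_pos; lra].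
  match goal with |- (?l <= ?r)%R => match type of H2 with (?l' <= ?r')%R =>
    replace l with l' by ring; replace r with r' by ring end end.
  exact H2. }
set (c := exp (Re beta * ln (Cmod s))) in *.
assert (L1 : Clim (fun m => c * rgauss m s) (c * rGamma s)) by apply Clim_scal, Clim_rGamma.
assert (c0 : (0 < c)%R) by apply exp_pos.
assert (K0 : (0 < ratio_const beta)%R) by (apply Rmult_lt_0_compat; apply exp_pos).
apply le_epsilon. intros eps Heps.
replace (Cmod (rGamma s) * c)%R with (Cmod (c * rGamma s)) by (rewrite Cmod_mult, Cmod_RtoC_nonneg by lra; ring).
destruct (Clim_rGamma (s - beta) (eps / ratio_const beta)%R) as [N2 H2]; [now apply Rdiv_lt_0_compat|].
apply (Clim_Cmod_le _ _ _ (max (S N) N2) L1). intros n Hn.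
rewrite Cmod_mult, Cmod_RtoC_nonneg, Rmult_comm by lra.
eapply Rle_trans; [apply Fin; lia|].
assert (T := Cmod_triangle_sub (rgauss n (s - beta)) (rGamma (s - beta))).
assert (Q := H2 n ltac:(lia)).
apply Rle_trans with (ratio_const beta * (Cmod (rGamma (s - beta)) + eps / ratio_const beta))%R.
- apply Rmult_le_compat_l; lra.
- right. field. lra.
Qed.

Lemma rGamma_rising (s : C) (N : nat) : rGamma s = rising s N * rGamma (s + INR N).
Proof.
induction N as [|N IH].
- simpl. rewrite Cplus_0_r. ring.
- rewrite IH. simpl rising. rewrite (rGamma_succ (s + INR N)), S_INR, RtoC_plus.
  replace (s + (INR N + 1)) with (s + INR N + 1) by ring. ring.
Qed.

(** Extends the bound to the left by [N] applications of the functional equation. With distance at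
    least [d] from the relevant poles, each step costs a factor
    [|v + beta| / |v| <= 1 + |beta| / d]. *)
Lemma rGamma_ratio_shift (beta s : C) (N : nat) (d : R) : (0 < Re beta)%R -> (0 < d)%R ->
  (forall j, (j < N)%nat -> (d <= Cmod (s + INR j - beta))%R) ->
  (8 * Cmod beta + 8 <= Re s + INR N)%R ->
  (Cmod (rGamma s) * exp (Re beta * ln (Cmod (s + INR N))) <=
   ratio_const beta * (1 + Cmod beta / d) ^ N * Cmod (rGamma (s - beta)))%R.
Proof.
intros Hb Hd Hj Hs. assert (B0 := Cmod_ge_0 beta).
set (q := (1 + Cmod beta / d)%R).
assert (Q0 : (0 <= Cmod beta / d)%R) by (apply Rdiv_le_0_compat; lra).
assert (Rr : (Cmod (rising s N) <= q ^ N * Cmod (rising (s - beta) N))%R).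
{ clear Hs. induction N as [|N IH]; [simpl; lra|].
  simpl rising. rewrite !Cmod_mult. simpl pow.
  replace (q * q ^ N * (Cmod (rising (s - beta) N) * Cmod (s - beta + INR N)))%R
    with ((q ^ N * Cmod (rising (s - beta) N)) * (q * Cmod (s - beta + INR N)))%R by ring.
  apply Rmult_le_compat; try apply Cmod_ge_0.
  - apply IH. intros j Hj'. apply Hj. lia.
  - assert (D := Hj N ltac:(lia)). replace (s - beta + INR N) with (s + INR N - beta) by ring.
    set (v := s + INR N - beta) in *. replace (s + INR N) with (v + beta) by (unfold v; ring).
    eapply Rle_trans; [apply Cmod_triangle|]. unfold q.
    assert (Cmod beta / d * d <= Cmod beta / d * Cmod v)%R by (apply Rmult_le_compat_l; lra).
    replace (Cmod beta / d * d)%R with (Cmod beta) in * by (field; lra). lra. }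
rewrite (rGamma_rising s N), (rGamma_rising (s - beta) N), !Cmod_mult.
assert (M := rGamma_ratio_bound beta (s + INR N) Hb ltac:(rewrite re_plus, re_RtoC; exact Hs)).
replace (s - beta + INR N) with (s + INR N - beta) by ring.
rewrite Rmult_assoc.
apply Rle_trans with ((q ^ N * Cmod (rising (s - beta) N)) * (ratio_const beta * Cmod (rGamma (s + INR N - beta))))%R.
- apply Rmult_le_compat; try assumption; [apply Cmod_ge_0|].
  apply Rmult_le_pos; [apply Cmod_ge_0|left; apply exp_pos].
- right. ring.
Qed.

(** * Winding numbers *)

(** Composition with it extends a function continuous on [[a, b]] to one continuous everywhere, so
    that primitives are differentiable at the end points and the intermediate value theorem
    applies. *)
Definition clamp (a b t : R) : R := Rmax a (Rmin t b).

Lemma clamp_in (a b t : R) : (a <= b)%R -> (a <= clamp a b t <= b)%R.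
Proof.
intros H. unfold clamp. split; [apply Rmax_l|]. apply Rmax_lub; [exact H|apply Rmin_r].
Qed.

Lemma clamp_id (a b t : R) : (a <= t <= b)%R -> clamp a b t = t.
Proof. intros H. unfold clamp. rewrite Rmin_left by lra. apply Rmax_right. lra. Qed.

Lemma clamp_lipschitz (a b s t : R) : (Rabs (clamp a b s - clamp a b t) <= Rabs (s - t))%R.
Proof.
unfold clamp, Rmax, Rmin, Rabs.
repeat (destruct Rle_dec || destruct Rcase_abs); lra.
Qed.

Lemma continuous_clamp (a b t : R) : @continuous R_UniformSpace R_UniformSpace (clamp a b) t.
Proof.
intros P [e He]. exists e. intros s Hs. apply He.
eapply Rle_lt_trans; [apply clamp_lipschitz|exact Hs].
Qed.

Lemma continuous_comp_clamp (f : R -> C) (a b t : R) : (a <= b)%R -> cont_on f a b ->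
  continuous_C R_UniformSpace (fun s => f (clamp a b s)) t.
Proof.
intros H Hf. apply (continuous_comp (clamp a b) f); [apply continuous_clamp|].
apply Hf. rewrite Rmin_left, Rmax_right by lra. now apply clamp_in.
Qed.

(** With [Psi] the integral up to [x], the function [exp (- Psi) (g - p)] has derivative 0. No
    branch of the logarithm has to be chosen. *)
Lemma Cexp_log_integral (g g' : R -> C) (a b : R) (p : C) : (a <= b)%R ->
  (forall t, (a <= t <= b)%R -> is_Rderive g t (g' t) /\ continuous_C R_UniformSpace g' t /\ g t <> p) ->
  Cexp (CInt (fun t => / (g t - p) * g' t) a b) = (g b - p) / (g a - p).
Proof.
intros Hab H.
set (f := fun t => / (g t - p) * g' t).
assert (Hn : forall t, (a <= t <= b)%R -> g t - p <> 0).
{ intros t Ht. apply Cminus_eq_contra. now apply H. }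
assert (Cf : cont_on f a b).
{ intros t Ht. rewrite Rmin_left, Rmax_right in Ht by lra. destruct (H t Ht) as [H1 [H2 _]].
  apply continuous_Cmult; [|exact H2]. apply continuous_Cinv; [|now apply Hn].
  apply continuous_Cminus; [exact (is_Rderive_continuous _ _ _ H1)|apply continuous_Cconst]. }
pose (h := fun t => f (clamp a b t)).
assert (Ch : forall t, continuous_C R_UniformSpace h t) by (intros t; now apply continuous_comp_clamp).
pose (Psi := fun x => CInt h a x).
assert (DPsi : forall x, is_Rderive Psi x (h x)).
{ intros x. apply (@is_derive_RInt C_R_NormedModule h Psi a x); [|apply Ch].
  exists (mkposreal 1 Rlt_0_1). intros y _. apply is_CInt. intros t _. apply Ch. }
assert (Eab : CInt f a b = Psi b).
{ apply CInt_ext. intros t Ht. rewrite Rmin_left, Rmax_right in Ht by lra. unfold h.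
  rewrite clamp_id by lra. reflexivity. }
assert (Pa : Psi a = 0).
{ apply CInt_unique. apply (@is_RInt_point C_R_NormedModule). }
pose (Phi := fun x => Cexp (- Psi x) * (g x - p)).
assert (E : Phi b - Phi a = 0).
{ rewrite <- (CInt_derive Phi (fun _ => RtoC 0) a b).
  - rewrite (CInt_ext _ (fun _ => RtoC 0 * RtoC 0)) by (intros; ring).
    rewrite (CInt_scal (fun _ => RtoC 0)); [ring|]. intros t _. apply continuous_Cconst.
  - intros t Ht. rewrite Rmin_left, Rmax_right in Ht by lra. destruct (H t Ht) as [H1 [H2 _]].
    unfold Phi. eapply is_Rderive_eq.
    + apply is_Rderive_mult.
      * apply (is_derive_ext (fun x : R => Cexp (0 + - (1) * Psi x))).
        { intros s. match goal with |- @eq _ ?x ?y => change (@eq C x y) end. apply f_equal. ring. }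
        apply (is_Cderive_comp_path (fun w => Cexp (0 + - (1) * w)) Psi); [|apply DPsi].
        apply (is_Cderive_comp Cexp (fun w => 0 + - (1) * w)); [apply is_Cderive_Cexp|apply is_Cderive_affine].
      * apply (is_derive_ext (fun x : R => - p + 1 * g x)).
        { intros s. match goal with |- @eq _ ?x ?y => change (@eq C x y) end. ring. }
        apply (is_Cderive_comp_path (fun w => - p + 1 * w) g); [|exact H1]. apply is_Cderive_affine.
    + cbv beta. unfold h, f. rewrite clamp_id by exact Ht.
      replace (0 + - (1) * Psi t) with (- Psi t) by ring. field. now apply Hn.
  - intros t _. apply continuous_Cconst. }
rewrite Eab. unfold Phi in E. rewrite Pa in E.
replace (- RtoC 0) with (RtoC 0) in E by ring. rewrite Cexp_0, Cmult_1_l in E.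
assert (Na := Hn a ltac:(lra)). assert (Nb := Hn b ltac:(lra)).
rewrite Cexp_opp in E. assert (NP := Cexp_neq_0 (Psi b)).
assert (E' : (g b - p) = Cexp (Psi b) * (g a - p)).
{ apply Ceq_minus. replace (g b - p - Cexp (Psi b) * (g a - p))
    with (Cexp (Psi b) * (/ Cexp (Psi b) * (g b - p) - (g a - p))) by (field; exact NP). rewrite E. ring. }
rewrite E'. field. exact Na.
Qed.

Lemma cos_eq_1_small (x : R) : cos x = 1%R -> (- (2 * PI) < x < 2 * PI)%R -> x = 0%R.
Proof.
intros E H. replace x with (2 * (x / 2))%R in E by field. rewrite cos_2a_sin in E.
assert (S0 : sin (x / 2) = 0%R).
{ destruct (Req_dec (sin (x / 2)) 0) as [Q|Q]; [exact Q|]. assert (0 < Rsqr (sin (x / 2)))%R by now apply Rlt_0_sqr.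
  unfold Rsqr in *. lra. }
destruct (Rtotal_order x 0) as [L|[L|L]]; [|exact L|].
- assert (P := sin_gt_0 (- (x / 2)) ltac:(lra) ltac:(lra)). rewrite sin_neg in P. lra.
- assert (P := sin_gt_0 (x / 2) ltac:(lra) ltac:(lra)). lra.
Qed.

Lemma Cexp_eq_1 (w : C) : Cexp w = 1 -> Re w = 0%R /\ cos (Im w) = 1%R.
Proof.
intros E. assert (M := Cmod_Cexp w). rewrite E, Cmod_1 in M.
assert (R0 : Re w = 0%R).
{ apply exp_inv. now rewrite exp_0. }
split; [exact R0|]. unfold Cexp in E. rewrite R0, exp_0 in E.
assert (E1 := f_equal fst E). simpl in E1. lra.
Qed.

(** [phi - phi 0] takes values among the multiples of [2 pi i]. If it ended at a nonzero one, its
    imaginary part would pass through [PI] or [- PI], where the exponential is not 1. *)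
Lemma Cexp_const_path (phi : R -> C) (b : R) : (0 <= b)%R -> cont_on phi 0 b ->
  (forall t, (0 <= t <= b)%R -> Cexp (phi t) = Cexp (phi 0)) -> phi b = phi 0.
Proof.
intros Hb Hc HE.
pose (d := fun t => phi (clamp 0 b t) - phi 0).
assert (Ed : forall t, Cexp (d t) = 1).
{ intros t. unfold d, Cminus. rewrite Cexp_plus, (HE (clamp 0 b t)) by now apply clamp_in.
  rewrite Cmult_comm. apply Cexp_opp_l. }
assert (Cd : forall t, continuous_C R_UniformSpace d t).
{ intros t. apply continuous_Cminus; [now apply continuous_comp_clamp|apply continuous_Cconst]. }
assert (D0 : d 0%R = 0).
{ unfold d. rewrite clamp_id by lra. ring. }
assert (I0 : Im (d b) = 0%R).
{ destruct (Req_dec (Im (d b)) 0) as [Q|Q]; [exact Q|]. exfalso.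
  pose (f := fun t => Im (d t)).
  assert (Cf : continuity f).
  { intros t. apply continuity_pt_filterlim. apply (continuous_Im R_UniformSpace d). apply Cd. }
  assert (P := PI_RGT_0).
  assert (Big : (PI < Rabs (Im (d b)))%R).
  { apply Rnot_le_lt. intros L. apply Q. apply cos_eq_1_small; [apply Cexp_eq_1, Ed|].
    apply Rabs_le_between in L. lra. }
  destruct (IVT_gen f 0 b (if Rle_dec 0 (Im (d b)) then PI else - PI)%R Cf) as [x [_ Hx]].
  - unfold f. rewrite D0. simpl (Im 0). destruct (Rle_dec 0 (Im (d b))) as [L|L].
    + rewrite Rabs_pos_eq in Big by exact L. rewrite Rmin_left, Rmax_right by lra. lra.
    + rewrite Rabs_left in Big by lra. rewrite Rmin_right, Rmax_left by lra. lra.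
  - destruct (Cexp_eq_1 _ (Ed x)) as [_ Cx]. unfold f in Hx. rewrite Hx in Cx.
    destruct (Rle_dec 0 (Im (d b))) in Cx; rewrite ?cos_neg, cos_PI in Cx; lra. }
assert (Db : d b = 0).
{ destruct (Cexp_eq_1 _ (Ed b)) as [R0 _]. destruct (d b) as [u v]. simpl in *. unfold Re, Im in *.
  simpl in *. now rewrite R0, I0. }
unfold d in Db. rewrite clamp_id in Db by lra. now apply Ceq_minus.
Qed.

(* The part of the real line that belongs to the contour outside a compact set. *)
Definition slit (R1 R2 : R) (p : C) : Prop := Im p = 0%R /\ ((Re p <= - R1)%R \/ (R2 <= Re p)%R).

Lemma not_slit_line (R1 R2 : R) (p : C) (u : R) : (0 < R1)%R -> (0 < R2)%R -> ~ slit R1 R2 p ->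
  (0 <= u <= 1)%R -> p * u + R1 <> 0 /\ p * u - R2 <> 0.
Proof.
intros H1 H2 Hp Hu. split; intros E; apply Hp.
- assert (ER := f_equal Re E). assert (EI := f_equal Im E).
  rewrite re_plus, re_scal_r, !re_RtoC in ER. rewrite im_plus, im_scal_r, !im_RtoC in EI.
  assert (u <> 0)%R by (intros ->; lra). split.
  + apply (Rmult_eq_reg_r u); lra.
  + left. apply Rnot_lt_le. intros L. assert (- R1 * u < Re p * u)%R by (apply Rmult_lt_compat_r; lra).
    assert (R1 * u <= R1 * 1)%R by (apply Rmult_le_compat_l; lra). lra.
- unfold Cminus in E. assert (ER := f_equal Re E). assert (EI := f_equal Im E).
  rewrite re_plus, re_opp, re_scal_r, !re_RtoC in ER. rewrite im_plus, im_opp, im_scal_r, !im_RtoC in EI.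
  assert (u <> 0)%R by (intros ->; lra). split.
  + apply (Rmult_eq_reg_r u); lra.
  + right. apply Rnot_lt_le. intros L. assert (Re p * u < R2 * u)%R by (apply Rmult_lt_compat_r; lra).
    assert (R2 * u <= R2 * 1)%R by (apply Rmult_le_compat_l; lra). lra.
Qed.

Lemma not_slit_open (R1 R2 : R) : Copen (fun p => ~ slit R1 R2 p).
Proof.
intros p Hp. destruct (Req_dec (Im p) 0) as [I0|I0].
- assert (HR : (- R1 < Re p < R2)%R).
  { split; apply Rnot_le_lt; intros L; apply Hp; split; try exact I0; [left|right]; lra. }
  exists (Rmin (Re p + R1) (R2 - Re p))%R. split; [apply Rmin_pos; lra|]. intros w Hw [_ Q].
  assert (A := Rlt_le_trans _ _ _ Hw (Rmin_l _ _)). assert (B := Rlt_le_trans _ _ _ Hw (Rmin_r _ _)).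
  assert (T := re_le_Cmod (w - p)). unfold Cminus in T. rewrite re_plus, re_opp in T.
  apply Rabs_le_between in T. unfold Cminus in A, B. lra.
- exists (Rabs (Im p)). split; [now apply Rabs_pos_lt|]. intros w Hw [Q _].
  assert (T := im_le_Cmod (w - p)). unfold Cminus in T. rewrite im_plus, im_opp, Q, Rplus_0_l, Rabs_Ropp in T.
  unfold Cminus in Hw. lra.
Qed.

(* The principal value of [1 / (x - p)] over the real line outside [- R1, R2]
   (for [R1 = R2]), written as an integral over the segment from [0] to [p]. *)
Definition tail_kernel (R1 R2 u : R) (p : C) : C := p / (p * u + R1) - p / (p * u - R2).
Definition tail (R1 R2 : R) (p : C) : C := CInt (fun u => tail_kernel R1 R2 u p) 0 1.

Lemma continuous_tail_kernel (R1 R2 u : R) (p : C) : (0 < R1)%R -> (0 < R2)%R -> ~ slit R1 R2 p ->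
  (0 <= u <= 1)%R -> continuous_C RxC (fun q => tail_kernel R1 R2 (fst q) (snd q)) (u, p).
Proof.
intros H1 H2 Hp Hu. destruct (not_slit_line R1 R2 p u H1 H2 Hp Hu) as [N1 N2].
assert (Cu : continuous_C RxC (fun q => snd q * RtoC (fst q)) (u, p)).
{ apply continuous_Cmult; [apply continuous_RxC_snd|]. apply (continuous_RxC_fst RtoC).
  apply (continuous_RtoC _ (fun t => t)). apply continuous_id. }
apply continuous_Cminus; apply continuous_Cdiv; try apply continuous_RxC_snd.
- apply continuous_Cplus; [exact Cu|apply continuous_Cconst].
- exact N1.
- apply continuous_Cminus; [exact Cu|apply continuous_Cconst].
- exact N2.
Qed.

Lemma Ccont_tail (R1 R2 : R) (p : C) : (0 < R1)%R -> (0 < R2)%R -> ~ slit R1 R2 p -> Ccont (tail R1 R2) p.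
Proof.
intros H1 H2 Hp. destruct (not_slit_open R1 R2 p Hp) as [r [Hr Hin]].
apply (Ccont_CInt_param (fun u p => tail_kernel R1 R2 u p) 0 1 p r); [lra|exact Hr|].
intros t z Ht Hz. apply continuous_tail_kernel; try assumption. now apply Hin.
Qed.

Lemma cont_on_tail_kernel (R1 R2 : R) (p : C) : (0 < R1)%R -> (0 < R2)%R -> ~ slit R1 R2 p ->
  cont_on (fun u => tail_kernel R1 R2 u p) 0 1.
Proof.
intros H1 H2 Hp t Ht. rewrite Rmin_left, Rmax_right in Ht by lra.
apply (continuous_RxC_slice_l (tail_kernel R1 R2)). now apply continuous_tail_kernel.
Qed.

Lemma Cexp_tail (R1 R2 : R) (p : C) : (0 < R1)%R -> (0 < R2)%R -> ~ slit R1 R2 p ->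
  Cexp (tail R1 R2 p) = (p + R1) / R1 * (- R2 / (p - R2)).
Proof.
intros H1 H2 Hp.
assert (N1 : forall u, (0 <= u <= 1)%R -> p * RtoC u + R1 <> 0) by (intros u Hu; now apply (not_slit_line R1 R2)).
assert (N2 : forall u, (0 <= u <= 1)%R -> p * RtoC u - R2 <> 0) by (intros u Hu; now apply (not_slit_line R1 R2)).
assert (Dl : forall t, is_Rderive (fun u => 0 + RtoC u * p) t p) by (intros t; apply is_Rderive_affine).
assert (X1 := Cexp_log_integral (fun u => 0 + RtoC u * p) (fun _ => p) 0 1 (- R1) ltac:(lra)).
assert (X2 := Cexp_log_integral (fun u => 0 + RtoC u * p) (fun _ => p) 0 1 R2 ltac:(lra)).
assert (C1 : cont_on (fun t => / (0 + RtoC t * p - - R1) * p) 0 1).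
{ intros t Ht. rewrite Rmin_left, Rmax_right in Ht by lra. apply continuous_Cmult; [|apply continuous_Cconst].
  apply continuous_Cinv.
  - apply continuous_Cminus; [|apply continuous_Cconst]. exact (is_Rderive_continuous _ _ _ (Dl t)).
  - replace (0 + t * p - - R1) with (p * t + R1) by ring. now apply N1. }
assert (C2 : cont_on (fun t => / (0 + RtoC t * p - R2) * p) 0 1).
{ intros t Ht. rewrite Rmin_left, Rmax_right in Ht by lra. apply continuous_Cmult; [|apply continuous_Cconst].
  apply continuous_Cinv.
  - apply continuous_Cminus; [|apply continuous_Cconst]. exact (is_Rderive_continuous _ _ _ (Dl t)).
  - replace (0 + t * p - R2) with (p * t - R2) by ring. now apply N2. }
assert (E : tail R1 R2 p = CInt (fun t => / (0 + RtoC t * p - - R1) * p) 0 1 +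
   - CInt (fun t => / (0 + RtoC t * p - R2) * p) 0 1).
{ unfold tail. change (?x + - ?y) with (x - y). rewrite <- CInt_minus by assumption.
  apply CInt_ext. intros t _. unfold tail_kernel, Cdiv.
  replace (0 + t * p - - R1) with (p * t + R1) by ring.
  replace (0 + t * p - R2) with (p * t - R2) by ring. ring. }
assert (R1n : RtoC R1 <> 0) by (intros Q; apply RtoC_inj in Q; lra).
assert (R2n : RtoC R2 <> 0) by (intros Q; apply RtoC_inj in Q; lra).
rewrite E, Cexp_plus, Cexp_opp, X1, X2.
- assert (M1 := N1 1%R ltac:(lra)). assert (M2 := N2 1%R ltac:(lra)).
  replace (p * 1 + R1) with (p + R1) in M1 by ring. replace (p * 1 - R2) with (p - R2) in M2 by ring.
  replace (0 + 1 * p - - R1) with (p + R1) by ring.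
  replace (0 + 0 * p - - R1) with (RtoC R1) by ring.
  replace (0 + 1 * p - R2) with (p - R2) by ring.
  replace (0 + 0 * p - R2) with (- RtoC R2) by ring. field. repeat split; try assumption.
- intros t Ht. split; [apply Dl|]. split; [apply continuous_Cconst|]. intros Q. apply (N2 t Ht).
  apply (f_equal (fun w => w - R2)) in Q. replace (0 + t * p - R2) with (p * t - R2) in Q by ring. rewrite Q. ring.
- intros t Ht. split; [apply Dl|]. split; [apply continuous_Cconst|]. intros Q. apply (N1 t Ht).
  apply (f_equal (fun w => w + R1)) in Q. replace (0 + t * p + R1) with (p * t + R1) in Q by ring. rewrite Q. ring.
Qed.

(** On the imaginary axis the imaginary part is [atan (y / R1) + atan (y / R2)]. This range singles
    out the multiple of [2 pi i] that the exponential leaves open. *)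
Lemma Im_tail_imaginary (R1 R2 y : R) : (0 < R1)%R -> (0 < R2)%R -> (0 < y)%R ->
  (0 <= Im (tail R1 R2 (Ci * y)) < PI)%R.
Proof.
intros H1 H2 Hy.
assert (Hp : ~ slit R1 R2 (Ci * y)).
{ intros [I _]. rewrite im_scal_r in I. unfold Ci in I; simpl in I. lra. }
assert (HI := is_CInt _ _ _ (cont_on_tail_kernel R1 R2 (Ci * y) H1 H2 Hp)).
fold (tail R1 R2 (Ci * y)) in HI. apply is_CInt_parts in HI. destruct HI as [_ HI].
assert (Ek : forall t, Im (tail_kernel R1 R2 t (Ci * y)) =
   (y * R1 / (R1 ^ 2 + (y * t) ^ 2) + y * R2 / (R2 ^ 2 + (y * t) ^ 2))%R).
{ intros t. assert (P : (0 <= (y * t) ^ 2)%R) by apply pow2_ge_0.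
  assert (P1 : (0 < R1 ^ 2)%R) by now apply pow_lt. assert (P2 : (0 < R2 ^ 2)%R) by now apply pow_lt.
  unfold tail_kernel, Cdiv, Cminus, Cinv, Ci, Cmult, Cplus, Copp, Im, RtoC; simpl fst; simpl snd.
  field. repeat split; nra. }
assert (HD : is_RInt (fun t => Im (tail_kernel R1 R2 t (Ci * y))) 0 1
   (minus (atan (y * 1 / R1) + atan (y * 1 / R2))%R (atan (y * 0 / R1) + atan (y * 0 / R2))%R)).
{ apply (is_RInt_derive (V := R_CompleteNormedModule) (fun t => (atan (y * t / R1) + atan (y * t / R2))%R)).
  - intros t _. rewrite Ek.
    assert (P : (0 <= (y * t) ^ 2)%R) by apply pow2_ge_0.
    assert (P1 : (0 < R1 ^ 2)%R) by now apply pow_lt. assert (P2 : (0 < R2 ^ 2)%R) by now apply pow_lt.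
    auto_derive; [trivial|]. field. repeat split; nra.
  - intros t Ht. apply (continuous_Im R_UniformSpace (fun t => tail_kernel R1 R2 t (Ci * y))).
    now apply cont_on_tail_kernel. }
assert (E := is_RInt_unique (V := R_CompleteNormedModule) _ _ _ _ HI).
assert (E' := is_RInt_unique (V := R_CompleteNormedModule) _ _ _ _ HD).
rewrite E in E'. rewrite E'. unfold minus, plus, opp; simpl.
replace (y * 0 / R1)%R with 0%R by (field; lra). replace (y * 0 / R2)%R with 0%R by (field; lra).
rewrite atan_0, Rmult_1_r.
assert (A1 := atan_bound (y / R1)). assert (A2 := atan_bound (y / R2)).
assert (B1 := atan_increasing 0 (y / R1) ltac:(now apply Rdiv_lt_0_compat)).
assert (B2 := atan_increasing 0 (y / R2) ltac:(now apply Rdiv_lt_0_compat)).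
rewrite atan_0 in B1, B2. lra.
Qed.

(* Along [sigma] the exponential of [Theta + tail] has the constant value [- R2 / R1], so
   [Theta + tail] is constant; far out [Theta] is small and [tail] is known on the imaginary axis. *)
Lemma winding_above (S : C -> Prop) (Theta : C -> C) (R1 R2 : R) (sigma : R -> C) :
  (0 < R1)%R -> (0 < R2)%R ->
  (forall p, ~ S p -> Ccont Theta p) ->
  (forall p, ~ S p -> Cexp (Theta p) = (R2 - p) / (- R1 - p)) ->
  (exists M, forall p, (M < Cmod p)%R -> ~ S p /\ (Cmod (Theta p) < 1)%R) ->
  (forall s, (0 <= s)%R -> continuous_C R_UniformSpace sigma s /\ ~ S (sigma s) /\ ~ slit R1 R2 (sigma s)) ->
  is_lim (fun s => Im (sigma s)) p_infty p_infty ->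
  Theta (sigma 0%R) + tail R1 R2 (sigma 0%R) = ln (R2 / R1) + PI * Ci.
Proof.
intros H1 H2 HC HE [M HM] Hs Hlim.
set (W := fun p => Theta p + tail R1 R2 p).
assert (WC : forall p, ~ S p -> ~ slit R1 R2 p -> Ccont W p).
{ intros p Hp Hq. apply continuous_Cplus; [now apply HC|now apply Ccont_tail]. }
assert (WE : forall p, ~ S p -> ~ slit R1 R2 p -> Cexp (W p) = - RtoC (R2 / R1)).
{ intros p Hp Hq. unfold W. rewrite Cexp_plus, HE, Cexp_tail by assumption.
  destruct (not_slit_line R1 R2 p 1 H1 H2 Hq ltac:(lra)) as [N1 N2]. rewrite Cmult_1_r in N1, N2.
  assert (R1n : RtoC R1 <> 0) by (intros Q; apply RtoC_inj in Q; lra).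
  assert (N3 : - R1 - p <> 0).
  { intros Q. apply N1. replace (p + R1) with (- (- R1 - p)) by ring. rewrite Q. ring. }
  rewrite RtoC_div by lra. field. repeat split; assumption. }
assert (Wpath : forall (g : R -> C) b, (0 <= b)%R ->
  (forall s, (0 <= s <= b)%R -> continuous_C R_UniformSpace g s /\ ~ S (g s) /\ ~ slit R1 R2 (g s)) ->
  W (g b) = W (g 0%R)).
{ intros g b Hb Hg. apply (Cexp_const_path (fun s => W (g s)) b Hb).
  - intros t Ht. rewrite Rmin_left, Rmax_right in Ht by lra. destruct (Hg t Ht) as [G1 [G2 G3]].
    apply (continuous_Ccomp _ g W); [exact G1|now apply WC].
  - intros t Ht. destruct (Hg t Ht) as [_ [G2 G3]]. destruct (Hg 0%R ltac:(lra)) as [_ [G4 G5]].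
    now rewrite !WE. }
assert (Hb : exists b, (0 <= b)%R /\ (Rmax M 1 < Im (sigma b))%R).
{ apply is_lim_spec in Hlim. destruct (Hlim (Rmax M 1)) as [N HN].
  exists (Rmax 0 (N + 1)). split; [apply Rmax_l|]. apply HN.
  eapply Rlt_le_trans; [|apply Rmax_r]. lra. }
destruct Hb as [b [Hb Hy]]. set (p1 := sigma b) in *. set (y := Im p1) in *.
assert (y1 : (M < y)%R) by (eapply Rle_lt_trans; [apply Rmax_l|exact Hy]).
assert (y2 : (1 < y)%R) by (eapply Rle_lt_trans; [apply Rmax_r|exact Hy]).
assert (E1 : W p1 = W (sigma 0%R)).
{ apply Wpath; [exact Hb|]. intros s Hs'. apply Hs. lra. }
assert (High : forall p, Im p = y -> ~ S p /\ (Cmod (Theta p) < 1)%R /\ ~ slit R1 R2 p).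
{ intros p Hp. assert (T := im_le_Cmod p). rewrite Hp, Rabs_pos_eq in T by lra.
  destruct (HM p ltac:(lra)) as [A1 A2]. split; [exact A1|]. split; [exact A2|]. intros [I _]. lra. }
(* From the end of [sigma] one moves horizontally to the imaginary axis; at the height [y > M] this
   segment meets neither [S] nor the slit. *)
assert (E2 : W (Ci * y) = W p1).
{ assert (Q := Wpath (seg p1 (Ci * y)) 1%R ltac:(lra)). rewrite seg_0, seg_1 in Q. apply Q.
  intros s Hs'. split; [apply continuous_seg|].
  assert (Is : Im (seg p1 (Ci * y) s) = y).
  { unfold seg, Cminus. rewrite im_plus, im_scal_l, im_plus, im_opp, im_scal_r. fold y.
    unfold Ci; simpl. ring. }
  destruct (High _ Is) as [A1 [_ A3]]. now split. }
change (Theta (sigma 0%R) + tail R1 R2 (sigma 0%R)) with (W (sigma 0%R)).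
rewrite <- E1, <- E2.
assert (Iy : Im (Ci * y) = y) by (rewrite im_scal_r; unfold Ci; simpl; ring).
destruct (High _ Iy) as [A1 [A2 A3]].
assert (EW := WE _ A1 A3). set (w := W (Ci * y)) in *.
(* [Theta] contributes less than 1 and [tail] a value in [[0, PI)]. So [Im w - PI] lies within
   [(- 2 PI, 2 PI)], and an integral multiple of [2 PI] in this range is 0. *)
assert (Iw : (-1 < Im w < PI + 1)%R).
{ unfold w, W. rewrite im_plus. assert (T := im_le_Cmod (Theta (Ci * y))).
  assert (T2 := Im_tail_imaginary R1 R2 y H1 H2 ltac:(lra)). apply Rabs_le_between in T. lra. }
assert (Q : Cexp (w - (ln (R2 / R1) + PI * Ci)) = 1).
{ assert (r0 : (0 < R2 / R1)%R) by now apply Rdiv_lt_0_compat.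
  unfold Cminus. rewrite Cexp_plus, EW, Cexp_opp, Cexp_plus, Cexp_RtoC, exp_ln by exact r0.
  assert (EP : Cexp (PI * Ci) = - (1)).
  { unfold Cexp. rewrite re_scal_l, im_scal_l. unfold Ci, Re, Im; simpl fst; simpl snd.
    rewrite Rmult_0_r, Rmult_1_r, exp_0, cos_PI, sin_PI. unfold Copp, RtoC; simpl. f_equal; ring. }
  rewrite EP. assert (RtoC (R2 / R1) <> 0) by (intros Q; apply RtoC_inj in Q; lra). field. assumption. }
destruct (Cexp_eq_1 _ Q) as [Q1 Q2]. unfold Cminus in Q1, Q2.
rewrite re_plus, re_opp, re_plus, re_RtoC, re_scal_l in Q1.
rewrite im_plus, im_opp, im_plus, im_RtoC, im_scal_l in Q2.
unfold Ci, Re at 2 in Q1. unfold Ci, Im at 2 in Q2. simpl fst in Q1. simpl snd in Q2.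
assert (P := PI_RGT_0). assert (P3 := PI2_1).
assert (Z := cos_eq_1_small _ Q2 ltac:(lra)).
unfold w in *. destruct (W (Ci * y)) as [u v]. unfold Re, Im in *. simpl in *.
unfold Cplus, Cmult, RtoC, Ci; simpl. f_equal; lra.
Qed.

Lemma Cconj_RtoC (x : R) : Cconj x = x.
Proof. unfold Cconj, RtoC; simpl. f_equal. ring. Qed.

Lemma Cconj_Ci : Cconj Ci = - Ci.
Proof. unfold Cconj, Ci, Copp; simpl. f_equal. ring. Qed.

Lemma Cinv_conj' (z : C) : Cconj (/ z) = / Cconj z.
Proof.
destruct z as [a b]. unfold Cconj, Cinv; cbn [fst snd].
replace ((- b) ^ 2)%R with (b ^ 2)%R by ring. f_equal. unfold Rdiv. ring.
Qed.

Lemma Cexp_conj (z : C) : Cexp (Cconj z) = Cconj (Cexp z).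
Proof. unfold Cexp, Cconj; simpl. rewrite cos_neg, sin_neg. unfold Re, Im. f_equal. ring. Qed.

Lemma continuous_Cconj (T : UniformSpace) (f : T -> C) (x : T) :
  continuous_C T f x -> continuous_C T (fun t => Cconj (f t)) x.
Proof.
intros H. apply continuous_pair_C; simpl.
- now apply (continuous_Re T f).
- apply (@continuous_opp T R_AbsRing R_NormedModule (fun t => snd (f t))).
  now apply (continuous_Im T f).
Qed.

Lemma CInt_conj (f : R -> C) (a b : R) : cont_on f a b ->
  CInt (fun t => Cconj (f t)) a b = Cconj (CInt f a b).
Proof.
intros H. apply CInt_unique. assert (HI := is_CInt f a b H). apply is_CInt_parts in HI.
destruct HI as [H1 H2]. apply is_CInt_parts. split; [exact H1|].
exact (@is_RInt_opp R_NormedModule _ _ _ _ H2).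
Qed.

Lemma tail_conj (R1 R2 : R) (p : C) : (0 < R1)%R -> (0 < R2)%R -> ~ slit R1 R2 p ->
  tail R1 R2 (Cconj p) = Cconj (tail R1 R2 p).
Proof.
intros H1 H2 Hp. unfold tail. rewrite <- CInt_conj by now apply cont_on_tail_kernel.
apply CInt_ext. intros t _. unfold tail_kernel, Cdiv.
rewrite Cminus_conj, !Cmult_conj, !Cinv_conj', Cplus_conj, Cminus_conj, !Cmult_conj, !Cconj_RtoC.
reflexivity.
Qed.

(** Complex conjugation preserves the slit and exchanges the two directions, so the case of
    [winding_above] applies to the conjugated data. *)
Lemma winding_below (S : C -> Prop) (Theta : C -> C) (R1 R2 : R) (sigma : R -> C) :
  (0 < R1)%R -> (0 < R2)%R ->
  (forall p, ~ S p -> Ccont Theta p) ->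
  (forall p, ~ S p -> Cexp (Theta p) = (R2 - p) / (- R1 - p)) ->
  (exists M, forall p, (M < Cmod p)%R -> ~ S p /\ (Cmod (Theta p) < 1)%R) ->
  (forall s, (0 <= s)%R -> continuous_C R_UniformSpace sigma s /\ ~ S (sigma s) /\ ~ slit R1 R2 (sigma s)) ->
  is_lim (fun s => Im (sigma s)) p_infty m_infty ->
  Theta (sigma 0%R) + tail R1 R2 (sigma 0%R) = ln (R2 / R1) - PI * Ci.
Proof.
intros H1 H2 HC HE [M HM] Hs Hlim.
assert (SC : forall p, slit R1 R2 (Cconj p) -> slit R1 R2 p).
{ intros p [I Q]. rewrite im_conj in I. rewrite re_conj in Q. split; [lra|exact Q]. }
assert (A := winding_above (fun p => S (Cconj p)) (fun p => Cconj (Theta (Cconj p))) R1 R2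
  (fun s => Cconj (sigma s)) H1 H2).
cbv beta in A. rewrite Cconj_conj in A.
rewrite tail_conj in A by (try assumption; apply (Hs 0%R); lra).
rewrite <- (Cconj_conj (Theta (sigma 0%R) + tail R1 R2 (sigma 0%R))), Cplus_conj, A.
- rewrite Cplus_conj, Cmult_conj, !Cconj_RtoC, Cconj_Ci. ring.
- intros p Hp. apply continuous_Cconj.
  apply (continuous_Ccomp C_UniformSpace (fun p => Cconj p) Theta); [|now apply HC].
  apply (continuous_Cconj C_UniformSpace (fun p => p)). apply continuous_id.
- intros p Hp. rewrite Cexp_conj, HE by exact Hp. unfold Cdiv.
  rewrite Cmult_conj, Cinv_conj', !Cminus_conj, Copp_conj, !Cconj_RtoC, Cconj_conj. reflexivity.
- exists M. intros p Hp. rewrite Cmod_conj. apply HM. now rewrite Cmod_conj.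
- intros s Hs'. destruct (Hs s Hs') as [B1 [B2 B3]]. rewrite Cconj_conj. split.
  + now apply continuous_Cconj.
  + split; [exact B2|]. intros Q. apply B3. now apply SC.
- apply (is_lim_ext (fun s => (- Im (sigma s))%R)); [intros s; symmetry; apply im_conj|].
  apply (is_lim_opp _ p_infty m_infty) in Hlim. exact Hlim.
Qed.

(** * Integrals of [1 / (z - p)] along chains *)

Fixpoint joined (z : C) (L : list arc) (w : C) : Prop :=
  match L with
  | nil => z = w
  | A :: L' => apath A (abeg A) = z /\ joined (apath A (aend A)) L' w
  end.

Definition forward (L : list arc) : Prop :=
  forall A, In A L -> arc_ok A /\ (abeg A <= aend A)%R.

Definition on_chain (L : list arc) (p : C) : Prop :=
  exists A, In A L /\ exists t, on_arc A t /\ apath A t = p.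

Definition chain_log (L : list arc) (p : C) : C := chain_int L (fun z => / (z - p)).

Lemma on_arc_forward (A : arc) (t : R) : (abeg A <= aend A)%R ->
  on_arc A t <-> (abeg A <= t <= aend A)%R.
Proof. intros H. unfold on_arc. rewrite Rmin_left, Rmax_right by lra. reflexivity. Qed.

Lemma Cexp_chain_log (L : list arc) (z w p : C) : forward L -> joined z L w -> z <> p ->
  ~ on_chain L p -> Cexp (chain_log L p) = (w - p) / (z - p).
Proof.
revert z. induction L as [|A L IH]; intros z HL HJ Hz Hp.
- simpl in HJ. subst w. unfold chain_log, chain_int; simpl. rewrite Cexp_0. field.
  now apply Cminus_eq_contra.
- destruct HJ as [HA HJ]. destruct (HL A (or_introl eq_refl)) as [OA FA].
  unfold chain_log, chain_int. simpl. rewrite Cexp_plus.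
  assert (E : Cexp (arc_int A (fun z0 => / (z0 - p))) = (apath A (aend A) - p) / (apath A (abeg A) - p)).
  { apply (Cexp_log_integral (apath A) (avel A)); [exact FA|]. intros t Ht.
    apply (on_arc_forward A t FA) in Ht. destruct (OA t Ht) as [O1 O2]. split; [exact O1|]. split; [exact O2|].
    intros Q. apply Hp. exists A. split; [now left|]. now exists t. }
  assert (Hz' : apath A (aend A) <> p).
  { intros Q. apply Hp. exists A. split; [now left|]. exists (aend A). split; [apply on_arc_end|exact Q]. }
  assert (I := IH (apath A (aend A)) (fun B HB => HL B (or_intror HB)) HJ Hz').
  rewrite E. unfold chain_log, chain_int in I. rewrite I.
  + rewrite HA. field. split; now apply Cminus_eq_contra.
  + intros [B [HB [t Ht]]]. apply Hp. exists B. split; [now right|]. now exists t.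
Qed.

Lemma arc_distance (A : arc) (p : C) : arc_ok A -> (abeg A <= aend A)%R ->
  (forall t, on_arc A t -> apath A t <> p) ->
  exists r : R, (0 < r)%R /\ forall t, on_arc A t -> (r <= Cmod (apath A t - p))%R.
Proof.
intros OA FA Hp.
destruct (continuity_ab_min (fun t => Cmod (apath A t - p)) (abeg A) (aend A) FA) as [m [Hm Im]].
- intros t Ht. apply (on_arc_forward A t FA) in Ht. apply continuity_pt_filterlim.
  apply (continuous_Cmod R_UniformSpace (fun t => apath A t - p)).
  apply continuous_Cminus; [|apply continuous_Cconst].
  destruct (OA t Ht) as [O1 _]. exact (is_Rderive_continuous _ _ _ O1).
- exists (Cmod (apath A m - p)). split.
  + apply Cmod_gt_0, Cminus_eq_contra, Hp. now apply on_arc_forward.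
  + intros t Ht. apply Hm. now apply on_arc_forward.
Qed.

Lemma Ccont_arc_log (A : arc) (p : C) : arc_ok A -> (abeg A <= aend A)%R ->
  (forall t, on_arc A t -> apath A t <> p) -> Ccont (fun p => arc_int A (fun z => / (z - p))) p.
Proof.
intros OA FA Hp. destruct (arc_distance A p OA FA Hp) as [r [Hr Hd]].
apply (Ccont_CInt_param (fun t p => / (apath A t - p) * avel A t) _ _ p r FA Hr).
intros t z Ht Hz. apply (on_arc_forward A t FA) in Ht. destruct (OA t Ht) as [O1 O2].
apply continuous_Cmult; [|now apply (continuous_RxC_fst (avel A))].
apply continuous_Cinv.
- apply continuous_Cminus; [|apply continuous_RxC_snd].
  apply (continuous_RxC_fst (apath A)). exact (is_Rderive_continuous _ _ _ O1).
- simpl. intros Q. specialize (Hd t Ht). apply Ceq_minus in Q. rewrite Q in Hd. lra.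
Qed.

Lemma Ccont_chain_log (L : list arc) (p : C) : forward L -> ~ on_chain L p -> Ccont (chain_log L) p.
Proof.
induction L as [|A L IH]; intros HL Hp.
- apply continuous_Cconst.
- destruct (HL A (or_introl eq_refl)) as [OA FA].
  apply (continuous_Cplus C_UniformSpace (fun p => arc_int A (fun z => / (z - p))) (chain_log L)).
  + apply Ccont_arc_log; try assumption. intros t Ht Q. apply Hp. exists A. split; [now left|]. now exists t.
  + apply IH; [intros B HB; apply HL; now right|]. intros [B [HB Ht]]. apply Hp. exists B. split; [now right|exact Ht].
Qed.

Lemma arc_log_decay (A : arc) (eps : R) : arc_ok A -> (abeg A <= aend A)%R -> (0 < eps)%R ->
  exists M, forall p, (M < Cmod p)%R -> (forall t, on_arc A t -> apath A t <> p) /\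
    (Cmod (arc_int A (fun z => / (z - p))%C) < eps)%R.
Proof.
intros OA FA Heps.
assert (Cp : cont_on (apath A) (abeg A) (aend A)).
{ intros t Ht. destruct (OA t Ht) as [O1 _]. exact (is_Rderive_continuous _ _ _ O1). }
assert (Cv : cont_on (avel A) (abeg A) (aend A)) by (intros t Ht; now apply OA).
destruct (bounded_on _ _ _ FA Cp) as [P [HP0 HP]]. destruct (bounded_on _ _ _ FA Cv) as [V [HV0 HV]].
set (l := (aend A - abeg A)%R). assert (l0 : (0 <= l)%R) by (unfold l; lra).
set (Q := ((l + 1) * V / eps)%R).
assert (Q0 : (0 < Q)%R) by (apply Rdiv_lt_0_compat; [apply Rmult_lt_0_compat|]; lra).
exists (P + Q)%R. intros p Hp.
assert (Dist : forall t, on_arc A t -> (Q < Cmod (apath A t - p))%R).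
{ intros t Ht. apply (on_arc_forward A t FA) in Ht. specialize (HP t Ht). rewrite Cmod_sub_sym.
  assert (T := Cmod_triangle_sub p (apath A t)). lra. }
assert (Hn : forall t, on_arc A t -> apath A t <> p).
{ intros t Ht E. specialize (Dist t Ht). apply Ceq_minus in E. rewrite E, Cmod_0 in Dist. lra. }
split; [exact Hn|].
apply Rle_lt_trans with (l * (/ Q * V))%R.
- apply Cmod_CInt_le_const; [exact FA| |].
  + apply (arc_cont A (fun z => / (z - p))); [exact OA|]. intros t Ht. apply continuous_Cinv.
    * apply continuous_Cminus; [apply continuous_id|apply continuous_Cconst].
    * apply Cminus_eq_contra. now apply Hn.
  + intros t Ht. assert (Ht' := proj2 (on_arc_forward A t FA) Ht).
    rewrite Cmod_mult, Cmod_inv by (apply Cminus_eq_contra; now apply Hn).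
    assert (D := Dist t Ht'). apply Rmult_le_compat; try apply Cmod_ge_0.
    * left. apply Rinv_0_lt_compat. lra.
    * apply Rinv_le_contravar; lra.
    * now apply HV.
- unfold Q. replace (l * (/ ((l + 1) * V / eps) * V))%R with (eps * (l / (l + 1)))%R by (field; lra).
  rewrite <- (Rmult_1_r eps) at 2. apply Rmult_lt_compat_l; [exact Heps|].
  apply (Rmult_lt_reg_r (l + 1)); [lra|]. unfold Rdiv. rewrite Rmult_assoc, Rinv_l by lra. lra.
Qed.

Lemma chain_log_decay (L : list arc) (eps : R) : forward L -> (0 < eps)%R ->
  exists M, forall p, (M < Cmod p)%R -> ~ on_chain L p /\ (Cmod (chain_log L p) < eps)%R.
Proof.
revert eps. induction L as [|A L IH]; intros eps HL Heps.
- exists 0%R. intros p _. split; [intros [A [[] _]]|]. unfold chain_log, chain_int; simpl. now rewrite Cmod_0.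
- destruct (HL A (or_introl eq_refl)) as [OA FA].
  destruct (arc_log_decay A (eps / 2) OA FA ltac:(lra)) as [M1 H1].
  destruct (IH (eps / 2)%R (fun B HB => HL B (or_intror HB)) ltac:(lra)) as [M2 H2].
  exists (Rmax M1 M2). intros p Hp.
  destruct (H1 p (Rle_lt_trans _ _ _ (Rmax_l _ _) Hp)) as [N1 B1].
  destruct (H2 p (Rle_lt_trans _ _ _ (Rmax_r _ _) Hp)) as [N2 B2]. split.
  + intros [B [[<-|HB] [t [Ht Q]]]]; [now apply (N1 t)|]. apply N2. exists B. split; [exact HB|]. now exists t.
  + unfold chain_log, chain_int. simpl. eapply Rle_lt_trans; [apply Cmod_triangle|].
    unfold chain_log, chain_int in B2. lra.
Qed.

Lemma chain_log_above (L : list arc) (R1 R2 : R) (sigma : R -> C) : (0 < R1)%R -> (0 < R2)%R ->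
  forward L -> joined (- R1) L R2 ->
  (forall s, (0 <= s)%R -> continuous_C R_UniformSpace sigma s /\ ~ on_chain L (sigma s) /\
     ~ slit R1 R2 (sigma s)) ->
  is_lim (fun s => Im (sigma s)) p_infty p_infty ->
  chain_log L (sigma 0%R) + tail R1 R2 (sigma 0%R) = ln (R2 / R1) + PI * Ci.
Proof.
intros H1 H2 HL HJ Hs Hlim.
assert (HR : forall p, ~ (on_chain L p \/ p = - R1) -> Cexp (chain_log L p) = (R2 - p) / (- R1 - p)).
{ intros p Hp. apply Cexp_chain_log; [exact HL|exact HJ| |].
  - intros Q. apply Hp. now right.
  - intros Q. apply Hp. now left. }
(* The end [- R1] joins the excluded set because the formula for the exponential divides by
   [- R1 - p]; the path avoids it, since it lies on the slit. *)
apply (winding_above (fun p => on_chain L p \/ p = - R1)); try assumption.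
- intros p Hp. apply Ccont_chain_log; [exact HL|]. intros Q. apply Hp. now left.
- destruct (chain_log_decay L 1 HL Rlt_0_1) as [M HM]. exists (Rmax M R1). intros p Hp.
  destruct (HM p (Rle_lt_trans _ _ _ (Rmax_l _ _) Hp)) as [N B]. split; [|exact B].
  intros [Q|Q]; [now apply N|]. rewrite Q, Cmod_opp, Cmod_RtoC_nonneg in Hp by lra.
  assert (T := Rmax_r M R1). lra.
- intros s Hs'. destruct (Hs s Hs') as [S1 [S2 S3]]. split; [exact S1|]. split; [|exact S3].
  intros [Q|Q]; [now apply S2|]. apply S3. rewrite Q. split.
  + rewrite im_opp, im_RtoC. ring.
  + left. rewrite re_opp, re_RtoC. lra.
Qed.

Lemma chain_log_below (L : list arc) (R1 R2 : R) (sigma : R -> C) : (0 < R1)%R -> (0 < R2)%R ->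
  forward L -> joined (- R1) L R2 ->
  (forall s, (0 <= s)%R -> continuous_C R_UniformSpace sigma s /\ ~ on_chain L (sigma s) /\
     ~ slit R1 R2 (sigma s)) ->
  is_lim (fun s => Im (sigma s)) p_infty m_infty ->
  chain_log L (sigma 0%R) + tail R1 R2 (sigma 0%R) = ln (R2 / R1) - PI * Ci.
Proof.
intros H1 H2 HL HJ Hs Hlim.
assert (HR : forall p, ~ (on_chain L p \/ p = - R1) -> Cexp (chain_log L p) = (R2 - p) / (- R1 - p)).
{ intros p Hp. apply Cexp_chain_log; [exact HL|exact HJ| |].
  - intros Q. apply Hp. now right.
  - intros Q. apply Hp. now left. }
apply (winding_below (fun p => on_chain L p \/ p = - R1)); try assumption.
- intros p Hp. apply Ccont_chain_log; [exact HL|]. intros Q. apply Hp. now left.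
- destruct (chain_log_decay L 1 HL Rlt_0_1) as [M HM]. exists (Rmax M R1). intros p Hp.
  destruct (HM p (Rle_lt_trans _ _ _ (Rmax_l _ _) Hp)) as [N B]. split; [|exact B].
  intros [Q|Q]; [now apply N|]. rewrite Q, Cmod_opp, Cmod_RtoC_nonneg in Hp by lra.
  assert (T := Rmax_r M R1). lra.
- intros s Hs'. destruct (Hs s Hs') as [S1 [S2 S3]]. split; [exact S1|]. split; [|exact S3].
  intros [Q|Q]; [now apply S2|]. apply S3. rewrite Q. split.
  + rewrite im_opp, im_RtoC. ring.
  + left. rewrite re_opp, re_RtoC. lra.
Qed.

(** * Contour deformation *)

Definition seg_arc (z w : C) : arc := Arc (seg z w) (fun _ => w - z) 0 1.
Definition rev_arc (A : arc) : arc := Arc (apath A) (avel A) (aend A) (abeg A).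
(* [nu = p + i eps] with [eps] on the circle of radius [r] about [0]. *)
Definition circ_arc (r : R) (p : C) : arc :=
  Arc (fun t => p + Ci * circle 0 r t) (fun t => Ci * circle' r t) 0 (2 * PI).
Definition gam_arc (gam : R -> C) (a b : R) : arc := Arc gam (velocity gam) a b.
(* From [- R1] to [R2] through the corners [- R1 - i Y] and [R2 - i Y]. *)
Definition low_chain (R1 R2 Y : R) : list arc :=
  [seg_arc (- R1) (- R1 - Ci * Y); seg_arc (- R1 - Ci * Y) (R2 - Ci * Y); seg_arc (R2 - Ci * Y) R2].

Lemma arc_ok_seg (z w : C) : arc_ok (seg_arc z w).
Proof. intros t _. split; [apply is_Rderive_seg|apply continuous_Cconst]. Qed.

Lemma on_arc_rev (A : arc) (t : R) : on_arc (rev_arc A) t <-> on_arc A t.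
Proof. unfold on_arc, rev_arc; simpl. now rewrite Rmin_comm, Rmax_comm. Qed.

Lemma arc_ok_rev (A : arc) : arc_ok A -> arc_ok (rev_arc A).
Proof. intros H t Ht. apply on_arc_rev in Ht. exact (H t Ht). Qed.

Lemma arc_in_rev (D : C -> Prop) (A : arc) : arc_in D A -> arc_in D (rev_arc A).
Proof. intros H t Ht. apply on_arc_rev in Ht. exact (H t Ht). Qed.

Lemma arc_int_rev (A : arc) (f : C -> C) : arc_ok A -> arc_in (fun z => Ccont f z) A ->
  arc_int (rev_arc A) f = - arc_int A f.
Proof.
intros HA Hf. unfold arc_int, rev_arc. simpl. apply CInt_swap. now apply (arc_cont A f).
Qed.

Lemma is_Rderive_circ (r : R) (p : C) (t : R) :
  is_Rderive (fun t => p + Ci * circle 0 r t) t (Ci * circle' r t).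
Proof.
apply (is_Cderive_comp_path (fun w => p + Ci * w) (circle 0 r)); [apply is_Cderive_affine|].
apply is_Rderive_circle.
Qed.

Lemma arc_ok_circ (r : R) (p : C) : arc_ok (circ_arc r p).
Proof.
intros t _. split; [apply is_Rderive_circ|].
apply continuous_Cmult; [apply continuous_Cconst|apply continuous_circle'].
Qed.

Lemma arc_bd_circ (r : R) (p : C) (F : C -> C) : arc_bd (circ_arc r p) F = 0.
Proof. unfold arc_bd, circ_arc. simpl. rewrite circle_closed. ring. Qed.

Lemma Cmod_circ (r : R) (p : C) (t : R) : (0 <= r)%R -> Cmod (p + Ci * circle 0 r t - p) = r.
Proof.
intros Hr. replace (p + Ci * circle 0 r t - p) with (Ci * (circle 0 r t - 0)) by ring.
rewrite Cmod_mult, Cmod_Ci, Cmod_circle_sub by exact Hr. ring.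
Qed.

Lemma circ_log_center (r : R) (p : C) : (0 < r)%R ->
  arc_int (circ_arc r p) (fun z => / (z - p)) = 2 * PI * Ci.
Proof.
intros Hr. rewrite <- (circle_winding 0 r 0 Hr (disc_center 0 r Hr)).
apply CInt_ext. intros t _. simpl.
assert (N := circle_neq 0 r t 0 ltac:(lra) (disc_center 0 r Hr)).
replace (p + Ci * circle 0 r t - p) with (Ci * (circle 0 r t - 0)) by ring.
rewrite Cmult_1_r. unfold Cminus in N. replace (circle 0 r t + - 0) with (circle 0 r t) in N by ring. field. split; [exact N|exact Ci_nz].
Qed.

Lemma circ_log_outside (r : R) (p q : C) : (0 < r)%R -> (r < Cmod (q - p))%R ->
  arc_int (circ_arc r p) (fun z => / (z - q)) = 0.
Proof.
intros Hr Hq.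
assert (E : chain_int [circ_arc r p] (fun z => / (z - q)) = 0).
{ apply (cycle_int_holomorphic (disc p (Cmod (q - p)))).
  - apply Copen_disc.
  - apply Cconvex_disc.
  - split; [intros A [<-|[]]; apply arc_ok_circ|]. intros F. simpl. rewrite arc_bd_circ. ring.
  - intros A [<-|[]] t _. unfold disc. simpl. rewrite Cmod_circ; lra.
  - apply (holomorphic_ext _ (fun z => / (- q + 1 * z))); [apply Copen_disc| |].
    + intros z _. f_equal. ring.
    + apply (holomorphic_inv _ (fun z => - q + 1 * z)); [apply holomorphic_affine|].
      intros z Hz E. unfold disc in Hz. assert (z = q) by (apply Ceq_minus; rewrite <- E; ring).
      subst z. lra. }
unfold chain_int in E. simpl in E. rewrite Cplus_0_r in E. exact E.
Qed.

Lemma chain_sum_app (phi : arc -> C) (L M : list arc) :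
  chain_sum phi (L ++ M) = chain_sum phi L + chain_sum phi M.
Proof. induction L as [|A L IH]; simpl; [ring|]. rewrite IH. ring. Qed.

Lemma circ_sum_outside (r : R) (lo : list C) (p : C) : (0 < r)%R ->
  (forall q, In q lo -> (r < Cmod (p - q))%R) ->
  chain_int (map (circ_arc r) lo) (fun z => / (z - p)) = 0.
Proof.
intros Hr. induction lo as [|q lo IH]; intros H; [reflexivity|].
unfold chain_int. simpl. rewrite circ_log_outside by (try exact Hr; apply H; now left).
unfold chain_int in IH. rewrite IH; [ring|]. intros q' Hq'. apply H. now right.
Qed.

Lemma circ_sum_inside (r : R) (lo : list C) (p : C) : (0 < r)%R -> NoDup lo -> In p lo ->
  (forall q, In q lo -> q <> p -> (r < Cmod (p - q))%R) ->
  chain_int (map (circ_arc r) lo) (fun z => / (z - p)) = 2 * PI * Ci.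
Proof.
intros Hr. induction lo as [|q lo IH]; intros HN Hp H; [destruct Hp|].
inversion HN as [|x l Hq HN']; subst. unfold chain_int. simpl.
destruct (Ceq_dec q p) as [->|Hqp].
- rewrite circ_log_center by exact Hr.
  assert (E := circ_sum_outside r lo p Hr). unfold chain_int in E. rewrite E; [ring|].
  intros q' Hq'. apply H; [now right|]. intros ->. contradiction.
- rewrite (circ_log_outside r q p Hr (H q (or_introl eq_refl) Hqp)).
  unfold chain_int in IH. rewrite IH; [ring|exact HN'| |].
  + destruct Hp as [->|Hp]; [now elim Hqp|exact Hp].
  + intros q' Hq' Hn. apply H; [now right|exact Hn].
Qed.

Lemma forward_low (R1 R2 Y : R) : forward (low_chain R1 R2 Y).
Proof.
intros A HA. assert (E : exists z w, A = seg_arc z w).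
{ destruct HA as [<-|[<-|[<-|[]]]]; eauto. }
destruct E as [z [w ->]]. split; [apply arc_ok_seg|simpl; lra].
Qed.

Lemma joined_low (R1 R2 Y : R) : joined (- R1) (low_chain R1 R2 Y) R2.
Proof. simpl. now rewrite !seg_0, !seg_1. Qed.

Lemma low_chain_points (R1 R2 Y : R) (p : C) : (0 < R1)%R -> (0 < R2)%R -> (0 < Y)%R ->
  on_chain (low_chain R1 R2 Y) p ->
  (- Y <= Im p <= 0)%R /\ (- R1 <= Re p <= R2)%R /\ (Re p = - R1 \/ Re p = R2 \/ Im p = - Y)%R.
Proof.
intros H1 H2 HY [A [HA [t [Ht E]]]]. subst p.
assert (Ht' : (0 <= t <= 1)%R).
{ assert (forall z w, on_arc (seg_arc z w) t -> (0 <= t <= 1)%R) as G.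
  { intros z w G. unfold on_arc in G; simpl in G. rewrite Rmin_left, Rmax_right in G by lra. exact G. }
  destruct HA as [<-|[<-|[<-|[]]]]; now apply G in Ht. }
assert (P1 : (0 <= t * Y <= 1 * Y)%R) by (split; [apply Rmult_le_pos|apply Rmult_le_compat_r]; lra).
assert (P2 : (0 <= t * (R1 + R2) <= 1 * (R1 + R2))%R) by (split; [apply Rmult_le_pos|apply Rmult_le_compat_r]; lra).
destruct HA as [<-|[<-|[<-|[]]]]; simpl apath; unfold seg, Cminus;
  rewrite ?re_plus, ?im_plus, ?re_scal_l, ?im_scal_l, ?re_plus, ?im_plus, ?re_opp, ?im_opp,
    ?re_plus, ?im_plus, ?re_opp, ?im_opp, ?re_scal_r, ?im_scal_r, ?re_RtoC, ?im_RtoC;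
  unfold Ci, Re, Im; simpl fst; simpl snd; repeat split; try lra.
all: first [left; lra | right; left; lra | right; right; lra].
Qed.

(** Unbounded upwards: the low chain, continued along the real axis, passes below all these points,
    wherever they lie relative to the contour. *)
Definition inside (R1 R2 Y : R) (p : C) : Prop := (- R1 < Re p < R2)%R /\ (- Y < Im p)%R.

Lemma inside_not_low (R1 R2 Y : R) (p : C) : (0 < R1)%R -> (0 < R2)%R -> (0 < Y)%R ->
  inside R1 R2 Y p -> ~ on_chain (low_chain R1 R2 Y) p.
Proof.
intros H1 H2 HY [I1 I2] Q. destruct (low_chain_points R1 R2 Y p H1 H2 HY Q) as [_ [_ E]]. lra.
Qed.

(** The vertical ray upwards from [p] meets neither the chain nor the slit, so every such point
    counts as lying above the chain. *)
Lemma low_log (R1 R2 Y : R) (p : C) : (0 < R1)%R -> (0 < R2)%R -> (0 < Y)%R -> inside R1 R2 Y p ->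
  chain_log (low_chain R1 R2 Y) p + tail R1 R2 p = ln (R2 / R1) + PI * Ci.
Proof.
intros H1 H2 HY Hp.
pose (sigma := fun s => p + RtoC s * Ci).
assert (Es : forall s, Im (sigma s) = (Im p + s)%R /\ Re (sigma s) = Re p).
{ intros s. unfold sigma. rewrite im_plus, im_scal_l, re_plus, re_scal_l. unfold Ci; simpl. split; ring. }
assert (E := chain_log_above (low_chain R1 R2 Y) R1 R2 sigma H1 H2 (forward_low _ _ _) (joined_low _ _ _)).
assert (S0 : sigma 0%R = p) by (unfold sigma; ring). rewrite S0 in E. apply E.
- intros s Hs. destruct (Es s) as [E1 E2]. destruct Hp as [I1 I2]. split.
  + exact (is_Rderive_continuous _ _ _ (is_Rderive_affine p Ci s)).
  + split; [|intros [_ Q]; lra]. apply inside_not_low; try assumption. split; lra.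
- apply (is_lim_ext (fun s => (Im p + s)%R)); [intros s; symmetry; apply Es|].
  apply (is_lim_plus _ _ _ (Finite (Im p)) p_infty p_infty); [apply is_lim_const|apply is_lim_id|reflexivity].
Qed.

Lemma arc_ok_gam (gam : R -> C) (a b : R) : C1_path gam -> arc_ok (gam_arc gam a b).
Proof.
intros H t _. destruct (H t) as [H1 [H2 H3]]. split; [|exact H3].
apply is_Rderive_pair; simpl.
- now apply (Derive_correct (fun s => Re (gam s))).
- now apply (Derive_correct (fun s => Im (gam s))).
Qed.

Section Gam.

Variables (gam : R -> C) (T R1 R2 : R).
Hypotheses (HC1 : C1_path gam) (HT : forall t, (T <= Rabs t)%R -> gam t = RtoC t)
  (H1 : (0 < R1)%R) (H2 : (0 < R2)%R) (HT1 : (T <= R1)%R) (HT2 : (T <= R2)%R).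

Lemma gam_left : gam (- R1) = - RtoC R1.
Proof. rewrite HT; [apply RtoC_opp|]. rewrite Rabs_Ropp, Rabs_pos_eq; lra. Qed.

Lemma gam_right : gam R2 = RtoC R2.
Proof. apply HT. rewrite Rabs_pos_eq; lra. Qed.

Lemma gam_slit (p : C) : slit R1 R2 p -> exists t, gam t = p.
Proof.
intros [I Q]. exists (Re p). rewrite HT.
- destruct p as [a b]. unfold Re, Im, RtoC in *; simpl in *. now rewrite I.
- destruct Q as [Q|Q].
  + rewrite Rabs_left1; lra.
  + rewrite Rabs_pos_eq; lra.
Qed.

Lemma forward_gam : forward [gam_arc gam (- R1) R2].
Proof. intros A [<-|[]]. split; [now apply arc_ok_gam|simpl; lra]. Qed.

Lemma joined_gam : joined (- R1) [gam_arc gam (- R1) R2] R2.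
Proof. simpl. split; [apply gam_left|apply gam_right]. Qed.

Lemma gam_log_above (p : C) : above gam p ->
  chain_log [gam_arc gam (- R1) R2] p + tail R1 R2 p = ln (R2 / R1) + PI * Ci.
Proof.
intros [sigma [S1 [S2 [S3 S4]]]]. rewrite <- S2.
apply chain_log_above; try assumption; [apply forward_gam|apply joined_gam|].
intros s Hs. split; [apply S1|]. split.
- intros [A [[<-|[]] [t [_ Q]]]]. simpl in Q. now apply (S3 s t Hs).
- intros Q. destruct (gam_slit _ Q) as [t Qt]. now apply (S3 s t Hs).
Qed.

Lemma gam_log_below (p : C) : below gam p ->
  chain_log [gam_arc gam (- R1) R2] p + tail R1 R2 p = ln (R2 / R1) - PI * Ci.
Proof.
intros [sigma [S1 [S2 [S3 S4]]]]. rewrite <- S2.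
apply chain_log_below; try assumption; [apply forward_gam|apply joined_gam|].
intros s Hs. split; [apply S1|]. split.
- intros [A [[<-|[]] [t [_ Q]]]]. simpl in Q. now apply (S3 s t Hs).
- intros Q. destruct (gam_slit _ Q) as [t Qt]. now apply (S3 s t Hs).
Qed.

Lemma above_neq (p : C) (t : R) : above gam p -> gam t <> p.
Proof. intros [sigma [S1 [S2 [S3 S4]]]] E. apply (S3 0%R t ltac:(lra)). now rewrite S2. Qed.

Lemma below_neq (p : C) (t : R) : below gam p -> gam t <> p.
Proof. intros [sigma [S1 [S2 [S3 S4]]]] E. apply (S3 0%R t ltac:(lra)). now rewrite S2. Qed.

(** The cycle consists of the contour, the reversed low chain and the small circles about the poles
    below the contour. It has winding number 0 about every pole in [l], so the integral of [f] over
    it vanishes. [l] lists poles with multiplicity, [lo] those below once each. *)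
Lemma contour_deformation (D : C -> Prop) (Y r : R) (l lo : list C) (H f : C -> C) :
  (0 < Y)%R -> (0 < r)%R -> Copen D -> Cconvex D ->
  (forall t, (- R1 <= t <= R2)%R -> D (gam t)) ->
  (forall p, on_chain (low_chain R1 R2 Y) p -> D p) ->
  (forall q t, In q lo -> D (q + Ci * circle 0 r t)) ->
  NoDup lo -> (forall q q', In q lo -> In q' lo -> q' <> q -> (r < Cmod (q - q'))%R) ->
  (forall p, In p l -> D p /\ inside R1 R2 Y p /\
     ((above gam p /\ forall q, In q lo -> (r < Cmod (p - q))%R) \/ (below gam p /\ In p lo))) ->
  holomorphic D H ->
  (forall nu, D nu -> ~ In nu l -> f nu = H nu * / prod_sub l nu) ->
  CInt (fun t => f (gam t) * velocity gam t) (- R1) R2 =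
    chain_int (low_chain R1 R2 Y) f - chain_int (map (circ_arc r) lo) f.
Proof.
intros HY Hr HD HDc Dg Dl Dc HN Hsep Hl HH Hf.
set (Lg := [gam_arc gam (- R1) R2]). set (Ll := low_chain R1 R2 Y). set (Lc := map (circ_arc r) lo).
assert (Ag : forall p, In p l -> forall t, gam t <> p).
{ intros p Hp t. destruct (Hl p Hp) as [_ [_ [[Q _]|[Q _]]]]; [now apply above_neq|now apply below_neq]. }
assert (Al : forall p, In p l -> ~ on_chain Ll p).
{ intros p Hp. apply inside_not_low; try assumption. now apply Hl. }
assert (Ac : forall p q t, In p l -> In q lo -> q + Ci * circle 0 r t <> p).
{ intros p q t Hp Hq E. assert (M := Cmod_circ r q t ltac:(lra)). rewrite E in M.
  destruct (Hl p Hp) as [_ [_ [[_ Q]|[_ Q]]]]; [specialize (Q q Hq); lra|].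
  destruct (Ceq_dec q p) as [->|Hqp].
  - replace (p - p) with (RtoC 0) in M by ring. rewrite Cmod_0 in M. lra.
  - assert (S := Hsep p q Q Hq Hqp). lra. }
set (L := Lg ++ map rev_arc Ll ++ Lc).
assert (Lin : forall P : C -> Prop, (forall t, (- R1 <= t <= R2)%R -> P (gam t)) ->
   (forall p, on_chain Ll p -> P p) -> (forall q t, In q lo -> P (q + Ci * circle 0 r t)) ->
   chain_in P Lg /\ chain_in P Ll /\ chain_in P (map rev_arc Ll) /\ chain_in P Lc).
{ intros P Pg Pl Pc. split; [|split; [|split]].
  - intros A [<-|[]] t Ht. unfold on_arc in Ht; simpl in Ht. rewrite Rmin_left, Rmax_right in Ht by lra.
    now apply Pg.
  - intros A HA t Ht. apply Pl. exists A. split; [exact HA|]. now exists t.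
  - intros A HA. apply in_map_iff in HA. destruct HA as [B [<- HB]]. apply arc_in_rev. intros t Ht.
    apply Pl. exists B. split; [exact HB|]. now exists t.
  - intros A HA. apply in_map_iff in HA. destruct HA as [q [<- Hq]]. intros t _. now apply Pc. }
assert (Lin2 : forall P : C -> Prop, (forall t, (- R1 <= t <= R2)%R -> P (gam t)) ->
   (forall p, on_chain Ll p -> P p) -> (forall q t, In q lo -> P (q + Ci * circle 0 r t)) -> chain_in P L).
{ intros P Pg Pl Pc. destruct (Lin P Pg Pl Pc) as [Q1 [_ [Q3 Q4]]]. intros A HA.
  unfold L in HA. apply in_app_or in HA. destruct HA as [HA|HA]; [now apply Q1|].
  apply in_app_or in HA. destruct HA as [HA|HA]; [now apply Q3|now apply Q4]. }
assert (OkL : forall A, In A L -> arc_ok A).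
{ intros A HA. unfold L in HA. apply in_app_or in HA. destruct HA as [HA|HA].
  - now apply forward_gam.
  - apply in_app_or in HA. destruct HA as [HA|HA]; apply in_map_iff in HA; destruct HA as [B [<- HB]].
    + apply arc_ok_rev. now apply (forward_low R1 R2 Y).
    + apply arc_ok_circ. }
assert (Csum : forall F, chain_sum (fun A => arc_bd A F) Lc = 0).
{ intros F. unfold Lc. clear. induction lo as [|q m IH]; [reflexivity|]. simpl. rewrite IH, arc_bd_circ. ring. }
assert (HL : cycle L).
{ split; [exact OkL|]. intros F. unfold L. rewrite !chain_sum_app, Csum. unfold Lg, Ll, low_chain. simpl.
  unfold arc_bd. simpl. rewrite !seg_0, !seg_1, gam_left, gam_right. ring. }
assert (Split : forall g : C -> C, chain_in (fun z => Ccont g z) Ll ->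
   chain_int L g = chain_int Lg g - chain_int Ll g + chain_int Lc g).
{ intros g Hg. unfold chain_int, L. rewrite !chain_sum_app.
  assert (E : chain_sum (fun A => arc_int A g) (map rev_arc Ll) = - chain_sum (fun A => arc_int A g) Ll).
  { assert (Q : forall A, In A Ll -> arc_ok A) by (intros A HA; now apply (forward_low R1 R2 Y)).
    revert Hg Q. generalize Ll. intros m0. induction m0 as [|A m IH]; intros Hg Q; [simpl; ring|].
    simpl. rewrite IH.
    - rewrite arc_int_rev; [ring|apply Q; now left|apply Hg; now left].
    - intros B HB. apply Hg. now right.
    - intros B HB. apply Q. now right. }
  rewrite E. ring. }
assert (Zero : chain_int L (fun z => H z * / prod_sub l z) = 0).
{ apply (cycle_int_meromorphic_zero D); try assumption.
  - now apply Lin2.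
  - intros p Hp. destruct (Hl p Hp) as [Dp [Ip Cp]]. split; [exact Dp|]. split.
    + apply Lin2.
      * intros t _. now apply Ag.
      * intros w Hw E. subst w. now apply (Al p Hp).
      * intros q t Hq. now apply Ac.
    + rewrite Split.
      2: { intros A HA t Ht. apply continuous_Cinv.
           - apply continuous_Cminus; [apply continuous_id|apply continuous_Cconst].
           - apply Cminus_eq_contra. intros E. apply (Al p Hp). exists A. split; [exact HA|]. now exists t. }
      (* Contour and low chain share [tail] and the logarithm, which drop out of the difference.
         There remains 0 for a pole above the contour and [- 2 PI Ci] for one below, which its own
         circle makes up for. *)
      assert (E1 := low_log R1 R2 Y p H1 H2 HY Ip). unfold chain_log in E1. fold Ll in E1.
      destruct Cp as [[Ca Cf]|[Cb Cf]].
      * assert (E2 := gam_log_above p Ca). unfold chain_log in E2. fold Lg in E2.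
        unfold Lc. rewrite circ_sum_outside by assumption.
        apply (f_equal2 Cminus E2) in E1.
        transitivity (chain_int Lg (fun z : C => / (z - p)) + tail R1 R2 p -
          (chain_int Ll (fun z : C => / (z - p)) + tail R1 R2 p)); [ring|]. rewrite E1. ring.
      * assert (E2 := gam_log_below p Cb). unfold chain_log in E2. fold Lg in E2.
        unfold Lc. rewrite circ_sum_inside; try assumption.
        2: { intros q Hq Hqp. now apply Hsep. }
        apply (f_equal2 Cminus E2) in E1.
        transitivity (chain_int Lg (fun z : C => / (z - p)) + tail R1 R2 p -
          (chain_int Ll (fun z : C => / (z - p)) + tail R1 R2 p) + 2 * PI * Ci); [ring|]. rewrite E1. ring. }
assert (Eq : forall nu, D nu -> ~ In nu l -> H nu * / prod_sub l nu = f nu).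
{ intros nu D1 D2. symmetry. now apply Hf. }
destruct (Lin (fun nu => H nu * / prod_sub l nu = f nu)) as [Q1 [Q2 [_ Q4]]].
{ intros t Ht. apply Eq; [now apply Dg|]. intros Q. now apply (Ag _ Q t). }
{ intros p Hp. apply Eq; [now apply Dl|]. intros Q. now apply (Al _ Q). }
{ intros q t Hq. apply Eq; [now apply Dc|]. intros Q. now apply (Ac _ q t Q Hq). }
rewrite Split in Zero.
- rewrite (chain_int_ext Lg _ f Q1), (chain_int_ext Ll _ f Q2), (chain_int_ext Lc _ f Q4) in Zero.
  assert (EL : chain_int Lg f = CInt (fun t => f (gam t) * velocity gam t) (- R1) R2).
  { unfold Lg, chain_int. simpl. apply Cplus_0_r. }
  rewrite EL in Zero. apply Ceq_minus. rewrite <- Zero. ring.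
- intros A HA t Ht.
  assert (Pt : on_chain Ll (apath A t)) by (exists A; split; [exact HA|now exists t]).
  apply continuous_Cmult; [apply (holomorphic_cont D); [exact HH|now apply Dl]|].
  apply continuous_Cinv; [apply Ccont_prod_sub|]. apply prod_sub_neq_0. intros Q. now apply (Al _ Q).
Qed.

End Gam.

(** * The integrands *)

Notation hs n := (half_succ (Z.of_nat n)).

Lemma half_succ_nat (n : nat) : hs n = RtoC ((INR n + 1) / 2).
Proof. unfold half_succ. now rewrite <- INR_IZR_INZ. Qed.

(* [4 ^ (beta (L + 1))] times the integrand of the ladder function. *)
Definition core (L : nat) (beta z : C) (n : nat) (nu : C) : C :=
  (rGamma (hs n + beta - Ci * nu) * rGamma (hs n + Ci * nu) *
   / (rGamma (hs n - beta + Ci * nu) * rGamma (hs n - Ci * nu))) ^ S L *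
  abs2_pow z (Ci * nu - RtoC (INR n / 2)).

Lemma Rcpow_pow (x : R) (a : C) (n : nat) : Rcpow x a ^ n = Rcpow x (a * INR n).
Proof. unfold Rcpow. rewrite Cexp_pow. apply f_equal. ring. Qed.

Lemma ladder_integrand_core (L : nat) (beta z : C) (n : nat) (nu : C) :
  ladder_integrand L beta z n nu = Rcpow 4 (- (beta * INR (S L))) * core L beta z n nu.
Proof.
unfold ladder_integrand, core, tau, Cdiv. rewrite !Gamma_rGamma, Cinv_pow.
rewrite !Cinv_mult, !Cinv_inv, !Cpow_mult_l, <- !Rcpow_opp, Rcpow_pow.
replace (- beta * INR (S L)) with (- (beta * INR (S L))) by ring. ring.
Qed.

Definition core_quotient (L : nat) (beta : C) (n : nat) (nu : C) : C :=
  (rGamma (hs n + beta - Ci * nu) * rGamma (hs n + Ci * nu) *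
   / (rGamma (hs n - beta + Ci * nu) * rGamma (hs n - Ci * nu))) ^ S L.

Lemma gamma_quotient_rGamma (L : nat) (beta : C) (n : Z) (nu : C) :
  gamma_quotient L beta n nu =
  (rGamma (half_succ n + beta - Ci * nu) * rGamma (half_succ n + Ci * nu) *
   / (rGamma (half_succ n - beta + Ci * nu) * rGamma (half_succ n - Ci * nu))) ^ S L.
Proof.
unfold gamma_quotient, Cdiv. rewrite !Gamma_rGamma. rewrite !Cinv_mult, !Cinv_pow, !Cinv_inv.
rewrite !Cpow_mult_l. ring.
Qed.

Lemma Ccont_core_quotient (L : nat) (beta : C) (n : nat) (nu : C) :
  rGamma (hs n - beta + Ci * nu) <> 0 -> rGamma (hs n - Ci * nu) <> 0 ->
  Ccont (core_quotient L beta n) nu.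
Proof.
intros H1 H2. unfold core_quotient. apply continuous_Cpow.
assert (Ca : forall c m : C, Ccont (fun w => rGamma (c + m * w)) nu).
{ intros c m. apply (continuous_Ccomp _ (fun w => c + m * w) rGamma); [|apply Ccont_rGamma].
  exact (is_Cderive_continuous _ _ _ (is_Cderive_affine c m nu)). }
assert (Cm : forall c : C, Ccont (fun w => rGamma (c - Ci * w)) nu).
{ intros c. apply (continuous_ext (fun w => rGamma (c + - Ci * w))); [|apply Ca].
  intros w. apply f_equal. ring. }
apply (continuous_Cmult _ (fun nu => rGamma (hs n + beta - Ci * nu) * rGamma (hs n + Ci * nu))
  (fun nu => / (rGamma (hs n - beta + Ci * nu) * rGamma (hs n - Ci * nu)))).
- apply (continuous_Cmult _ (fun nu => rGamma (hs n + beta - Ci * nu))); [apply Cm|apply Ca].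
- apply (continuous_Cinv _ (fun nu => rGamma (hs n - beta + Ci * nu) * rGamma (hs n - Ci * nu))).
  + apply (continuous_Cmult _ (fun nu => rGamma (hs n - beta + Ci * nu))); [apply Ca|apply Cm].
  + apply (Cmult_neq_0 _ _ H1 H2).
Qed.

(** * The symmetry between [n] and [- n] *)

Lemma far_from_integers (u : C) : exists d : R, (0 < d)%R /\
  forall m : Z, u <> IZR m -> (d <= Cmod (u - IZR m))%R.
Proof.
destruct (classic (exists m : Z, (Cmod (u - IZR m) < / 2)%R)) as [[m Hm]|H].
- assert (Far : forall m' : Z, m' <> m -> (/ 2 <= Cmod (u - IZR m'))%R).
  { intros m' Hm'. apply Rnot_lt_le. intros Q.
    assert (T := Cmod_triangle (u - IZR m) (- (u - IZR m'))). rewrite Cmod_opp in T.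
    replace (u - IZR m + - (u - IZR m')) with (RtoC (IZR (m' - m))) in T
      by (rewrite minus_IZR, RtoC_minus; ring).
    rewrite Cmod_R, <- abs_IZR in T. assert (1 <= Z.abs (m' - m))%Z by lia.
    apply IZR_le in H. lra. }
  destruct (Ceq_dec u (IZR m)) as [E|N].
  + exists (/ 2)%R. split; [lra|]. intros m' Hm'. apply Far. intros ->. contradiction.
  + assert (P : (0 < Cmod (u - IZR m))%R) by (apply Cmod_gt_0; now apply Cminus_eq_contra).
    exists (Cmod (u - IZR m)). split; [exact P|]. intros m' Hm'.
    destruct (Z.eq_dec m' m) as [->|Nm]; [lra|]. specialize (Far m' Nm). lra.
- exists (/ 2)%R. split; [lra|]. intros m _. apply Rnot_lt_le. intros Q. apply H. now exists m.
Qed.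

Lemma rising_integer_free (u : C) (m : nat) : (forall k : Z, u <> IZR k) -> rising u m <> 0.
Proof.
intros H E. apply rising_zero in E. destruct E as [k [_ E]]. apply (H (- Z.of_nat k)%Z).
rewrite E, opp_IZR, <- INR_IZR_INZ, RtoC_opp. reflexivity.
Qed.

(* The points [(1 - m) / 2 + j], [0 <= j < m], are symmetric about 0. *)
Lemma rising_symmetric (m : nat) (delta : C) :
  rising (RtoC ((1 - INR m) / 2) - delta) m = (- (1)) ^ m * rising (RtoC ((1 - INR m) / 2) + delta) m.
Proof.
assert (G : forall (c : C) k, rising (c - delta) k = (- (1)) ^ k * rising (- c - INR k + 1 + delta) k).
{ intros c k. revert c. induction k as [|k IH]; intros c; [simpl; ring|].
  change (rising (c - delta) (S k)) with (rising (c - delta) k * (c - delta + INR k)).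
  rewrite rising_shift, IH. rewrite S_INR, RtoC_plus, Cpow_S.
  replace (- c - (INR k + 1) + 1 + delta + 1) with (- c - INR k + 1 + delta) by ring. ring. }
rewrite G. do 2 f_equal. rewrite RtoC_div, RtoC_minus by lra. field.
Qed.

(** [half_succ (- m) + m = half_succ m]: shifting all four arguments by [m] costs four rising
    factors, whose quotient is 1 by [rising_symmetric], the two signs [(-1)^m] cancelling. The
    hypotheses keep the factors in the denominator from vanishing. *)
Lemma gamma_quotient_neg (L : nat) (beta : C) (m : nat) (nu : C) :
  (forall k : Z, RtoC ((1 - INR m) / 2) - beta + Ci * nu <> IZR k) ->
  (forall k : Z, RtoC ((1 - INR m) / 2) - Ci * nu <> IZR k) ->
  gamma_quotient L beta (- Z.of_nat m) nu = core_quotient L beta m nu.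
Proof.
intros H1 H2. rewrite gamma_quotient_rGamma. unfold core_quotient. apply (f_equal (fun w => w ^ S L)).
assert (E : half_succ (- Z.of_nat m) = RtoC ((1 - INR m) / 2)).
{ unfold half_succ. rewrite opp_IZR, <- INR_IZR_INZ. apply f_equal. field. }
rewrite E. set (c := RtoC ((1 - INR m) / 2)) in *.
assert (Ec : hs m = c + INR m).
{ rewrite half_succ_nat. unfold c. rewrite <- RtoC_plus. apply f_equal. field. }
rewrite Ec.
rewrite (rGamma_rising (c + beta - Ci * nu) m), (rGamma_rising (c + Ci * nu) m),
  (rGamma_rising (c - beta + Ci * nu) m), (rGamma_rising (c - Ci * nu) m).
replace (c + beta - Ci * nu + INR m) with (c + INR m + beta - Ci * nu) by ring.
replace (c + Ci * nu + INR m) with (c + INR m + Ci * nu) by ring.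
replace (c - beta + Ci * nu + INR m) with (c + INR m - beta + Ci * nu) by ring.
replace (c - Ci * nu + INR m) with (c + INR m - Ci * nu) by ring.
assert (N1 := rising_integer_free _ m H1). assert (N2 := rising_integer_free _ m H2).
assert (S1 := rising_symmetric m (beta - Ci * nu)). fold c in S1.
replace (c - (beta - Ci * nu)) with (c - beta + Ci * nu) in S1 by ring.
replace (c + (beta - Ci * nu)) with (c + beta - Ci * nu) in S1 by ring.
assert (S2 := rising_symmetric m (Ci * nu)). fold c in S2.
rewrite !Cinv_mult.
set (r1 := rising (c + beta - Ci * nu) m) in *. set (r2 := rising (c + Ci * nu) m) in *.
set (r3 := rising (c - beta + Ci * nu) m) in *. set (r4 := rising (c - Ci * nu) m) in *.
assert (Sg : (- (1)) ^ m * (- (1)) ^ m = 1).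
{ rewrite <- Cpow_mult_l. replace (- (1) * - (1)) with (RtoC 1) by ring. apply Cpow_1_l. }
assert (Q : r1 * r2 * (/ r3 * / r4) = 1).
{ assert (r3 * r4 = r1 * r2).
  { rewrite S1, S2. transitivity ((- (1)) ^ m * (- (1)) ^ m * (r1 * r2)); [ring|]. rewrite Sg. ring. }
  rewrite <- H. field. now split. }
transitivity (r1 * r2 * (/ r3 * / r4) *
  (rGamma (c + INR m + beta - Ci * nu) * rGamma (c + INR m + Ci * nu) *
   (/ rGamma (c + INR m - beta + Ci * nu) * / rGamma (c + INR m - Ci * nu)))); [ring|].
rewrite Q. ring.
Qed.

Lemma affine_punctured_integer_free (c mm nu : C) : Cmod mm = 1%R -> exists d : R, (0 < d)%R /\
  forall y, y <> nu -> (Cmod (y - nu) < d)%R -> forall k : Z, c + mm * y <> IZR k.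
Proof.
intros Hm. destruct (far_from_integers (c + mm * nu)) as [d [Hd H]].
exists d. split; [exact Hd|]. intros y Hy Hyd k E.
assert (Em : (Cmod (c + mm * nu - IZR k) = Cmod (y - nu))%R).
{ rewrite <- E. replace (c + mm * nu - (c + mm * y)) with (- mm * (y - nu)) by ring.
  rewrite Cmod_mult, Cmod_opp, Hm. ring. }
destruct (Ceq_dec (c + mm * nu) (IZR k)) as [E'|N].
- rewrite <- E' in Em. replace (c + mm * nu - (c + mm * nu)) with (RtoC 0) in Em by ring.
  rewrite Cmod_0 in Em. symmetry in Em. apply Cmod_eq_0 in Em. apply Hy. now apply Ceq_minus.
- specialize (H k N). lra.
Qed.

Lemma C_lim_of_punctured (f g : C -> C) (z : C) (d : R) : (0 < d)%R ->
  (forall y, y <> z -> (Cmod (y - z) < d)%R -> f y = g y) -> Ccont g z -> C_lim f z = g z.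
Proof.
intros Hd E Hg. apply is_C_lim_unique.
intros P HP. assert (H := Hg P HP).
assert (Hl : @locally C_UniformSpace z (fun y => (Cmod (y - z) < d)%R)).
{ apply locally_C. exists (mkposreal d Hd). intros y Hy. exact Hy. }
unfold filtermap, locally', within in *.
apply (filter_imp (fun y => P (g y) /\ (Cmod (y - z) < d)%R)); [|now apply filter_and].
intros y [Hy1 Hy2] Hyz. rewrite E; assumption.
Qed.

(** For negative [n] the quotient equals the one for [|n|] on a punctured neighbourhood. The latter
    is continuous at [nu], hence gives the limit. *)
Lemma C_lim_gamma_quotient (L : nat) (beta : C) (n : Z) (nu : C) :
  rGamma (hs (Z.abs_nat n) - beta + Ci * nu) <> 0 -> rGamma (hs (Z.abs_nat n) - Ci * nu) <> 0 ->
  C_lim (gamma_quotient L beta n) nu = core_quotient L beta (Z.abs_nat n) nu.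
Proof.
intros H1 H2. set (m := Z.abs_nat n) in *.
assert (Hc := Ccont_core_quotient L beta m nu H1 H2).
destruct (Z_le_gt_dec 0 n) as [Hn|Hn].
- apply (C_lim_of_punctured _ _ _ 1 Rlt_0_1); [|exact Hc]. intros y _ _.
  rewrite gamma_quotient_rGamma. unfold core_quotient, m. now rewrite Zabs2Nat.id_abs, Z.abs_eq by lia.
- destruct (affine_punctured_integer_free (RtoC ((1 - INR m) / 2) - beta) Ci nu Cmod_Ci) as [d1 [Hd1 E1]].
  destruct (affine_punctured_integer_free (RtoC ((1 - INR m) / 2)) (- Ci) nu) as [d2 [Hd2 E2]].
  { rewrite Cmod_opp. apply Cmod_Ci. }
  apply (C_lim_of_punctured _ _ _ (Rmin d1 d2)); [now apply Rmin_pos| |exact Hc].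
  intros y Hy Hyd. replace n with (- Z.of_nat m)%Z by (unfold m; lia).
  apply gamma_quotient_neg.
  + apply E1; [exact Hy|]. eapply Rlt_le_trans; [exact Hyd|apply Rmin_l].
  + intros k. replace (RtoC ((1 - INR m) / 2) - Ci * y) with (RtoC ((1 - INR m) / 2) + - Ci * y) by ring.
    apply E2; [exact Hy|]. eapply Rlt_le_trans; [exact Hyd|apply Rmin_r].
Qed.

Lemma abs2_pow_plus (z a b : C) : abs2_pow z (a + b) = abs2_pow z a * abs2_pow z b.
Proof. apply Rcpow_plus. Qed.

Lemma abs2_pow_nat (z : C) (n : nat) : z <> 0 -> abs2_pow z (INR n) = (z * Cconj z) ^ n.
Proof.
intros Hz. assert (P : (0 < Cmod z ^ 2)%R) by (apply pow_lt; now apply Cmod_gt_0).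
rewrite <- Cmod2_conj. unfold abs2_pow. rewrite <- (Cmult_1_l (INR n)), <- Rcpow_pow, Rcpow_1 by exact P.
reflexivity.
Qed.

Definition twist (z : C) (n : Z) : C :=
  if Z_le_gt_dec 0 n then z ^ Z.abs_nat n else Cconj z ^ Z.abs_nat n.

Lemma mellin_integrand_core (L : nat) (beta z : C) (n : Z) (nu : C) : z <> 0 ->
  rGamma (hs (Z.abs_nat n) - beta + Ci * nu) <> 0 -> rGamma (hs (Z.abs_nat n) - Ci * nu) <> 0 ->
  mellin_integrand L beta z n nu = twist z n * core L beta z (Z.abs_nat n) nu.
Proof.
intros Hz H1 H2. unfold mellin_integrand. rewrite C_lim_gamma_quotient by assumption.
unfold core, conj_pow, twist. fold (core_quotient L beta (Z.abs_nat n) nu).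
destruct (Z_le_gt_dec 0 n) as [Hn|Hn].
- assert (E : Cpow_Z z n = z ^ Z.abs_nat n).
  { destruct n as [|p|p]; [reflexivity|reflexivity|]. elim Hn. reflexivity. }
  rewrite E, INR_IZR_INZ, Zabs2Nat.id_abs, Z.abs_eq by lia. ring.
- assert (E : Cpow_Z z n = / z ^ Z.abs_nat n).
  { destruct n as [|p|p]; [lia|lia|]. reflexivity. }
  assert (En : (IZR n = - INR (Z.abs_nat n))%R).
  { rewrite INR_IZR_INZ, Zabs2Nat.id_abs, Z.abs_neq, opp_IZR by lia. ring. }
  rewrite E, En. set (m := Z.abs_nat n).
  (* For [n = - m] the additional power [(z zbar)^m] turns [z^(-m)] into [zbar^m]. *)
  replace (Ci * nu - RtoC (- INR m / 2)) with (Ci * nu - RtoC (INR m / 2) + INR m).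
  2: { rewrite !RtoC_div, RtoC_opp by lra. field. }
  rewrite abs2_pow_plus, abs2_pow_nat, Cpow_mult_l by exact Hz.
  assert (Nz := Cpow_nz z m Hz). field. exact Nz.
Qed.

(** * The closed form of the integrand and its poles *)

Lemma Csin_opp (z : C) : Csin (- z) = - Csin z.
Proof.
unfold Csin. replace (- (Ci * - z)) with (Ci * z) by ring. replace (Ci * - z) with (- (Ci * z)) by ring.
field. exact Ci_nz.
Qed.

Lemma Cexp_i_PI_nat (k : nat) : Cexp (Ci * (PI * INR k)) = (- (1)) ^ k.
Proof.
assert (EP : Cexp (Ci * PI) = - (1)).
{ unfold Cexp. rewrite re_scal_r, im_scal_r. unfold Ci, Re, Im; simpl fst; simpl snd.
  rewrite Rmult_0_l, Rmult_1_l, exp_0, cos_PI, sin_PI. unfold Copp, RtoC; simpl. f_equal; ring. }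
rewrite <- EP, Cexp_pow. apply f_equal. ring.
Qed.

Lemma Csin_shift_nat (x : C) (k : nat) : Csin (PI * (x + INR k)) = (- (1)) ^ k * Csin (PI * x).
Proof.
unfold Csin. replace (Ci * (PI * (x + INR k))) with (Ci * (PI * x) + Ci * (PI * INR k)) by ring.
rewrite Copp_plus_distr, !Cexp_plus, (Cexp_opp (Ci * (PI * INR k))), Cexp_i_PI_nat.
assert (Sg : (- (1)) ^ k * (- (1)) ^ k = 1).
{ rewrite <- Cpow_mult_l. replace (- (1) * - (1)) with (RtoC 1) by ring. apply Cpow_1_l. }
assert (N : (- (1)) ^ k <> 0) by (intros Q; rewrite Q in Sg; apply C1_nz; rewrite <- Sg; ring).
assert (I : / (- (1)) ^ k = (- (1)) ^ k) .
{ transitivity ((- (1)) ^ k * (- (1)) ^ k * / (- (1)) ^ k); [rewrite Sg; ring|field; exact N]. }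
rewrite I. field. exact Ci_nz.
Qed.

(** [Gamma (s - beta) / Gamma s], the quantity of the ratio bound and, at [s = 1 + k - eps], of the
    coefficients of [F]. *)
Definition gratio (beta s : C) : C := rGamma s * / rGamma (s - beta).

Definition sin_ratio (beta s : C) : C := Csin (PI * (s - beta)) * / Csin (PI * s).

(** Here [Re s = (1 - n)/2 - Im nu], which grows as [nu] goes down. Reflection moves the two Gamma
    functions with falling arguments to the right half-plane; far down, the lower poles then sit
    only in the denominator [sin (pi s)]. *)
Lemma core_closed_form (L : nat) (beta z : C) (n : nat) (nu s : C) :
  s = hs n + Ci * nu - INR n -> rGamma s <> 0 -> rGamma (s - beta) <> 0 ->
  core L beta z n nu =
  (gratio beta (s + INR n) * gratio beta s * sin_ratio beta s) ^ S L * abs2_pow z (s - / 2).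
Proof.
intros Hs N1 N2. unfold core.
assert (Eh : 2 * hs n = INR n + 1) by (rewrite half_succ_nat, RtoC_div, RtoC_plus by lra; field).
replace (hs n + Ci * nu) with (s + INR n) by (rewrite Hs; ring).
replace (hs n + beta - Ci * nu) with (1 - (s - beta)).
2: { rewrite Hs. replace (1 - (hs n + Ci * nu - INR n - beta)) with
     (INR n + 1 - 2 * hs n + (hs n + beta - Ci * nu)) by ring. rewrite Eh. ring. }
replace (hs n - beta + Ci * nu) with (s + INR n - beta) by (rewrite Hs; ring).
replace (hs n - Ci * nu) with (1 - s).
2: { rewrite Hs. replace (1 - (hs n + Ci * nu - INR n)) with
     (INR n + 1 - 2 * hs n + (hs n - Ci * nu)) by ring. rewrite Eh. ring. }
replace (Ci * nu - RtoC (INR n / 2)) with (s - / 2).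
2: { rewrite Hs, half_succ_nat, !RtoC_div, RtoC_plus by lra. field. }
f_equal. apply (f_equal (fun w => w ^ S L)).
unfold gratio, sin_ratio. rewrite <- !rGamma_reflection, !Cinv_mult.
assert (NP : RtoC PI <> 0) by (intros Q; apply RtoC_inj in Q; generalize PI_RGT_0; lra).
transitivity (rGamma (1 - (s - beta)) * rGamma (s + INR n) *
  (/ rGamma (s + INR n - beta) * / rGamma (1 - s)) * ((rGamma s * / rGamma s) *
   (rGamma (s - beta) * / rGamma (s - beta)) * (PI * / PI))).
- rewrite !Cinv_r by assumption. ring.
- ring.
Qed.

Definition lower_pole (n k : nat) : C := - (Ci * hs n) - Ci * INR k.
Definition upper_pole (beta : C) (n k : nat) : C := Ci * (hs n - beta) + Ci * INR k.
Definition points (f : nat -> C) (K : nat) : list C := map f (seq 0 K).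
(* A pole of order [m] is listed [m] times. *)
Definition rep (l : list C) (m : nat) : list C := concat (repeat l m).

Lemma prod_sub_rep (l : list C) (m : nat) (z : C) : prod_sub (rep l m) z = prod_sub l z ^ m.
Proof.
induction m as [|m IH]; [reflexivity|]. unfold rep in *. simpl. now rewrite prod_sub_app, IH.
Qed.

Lemma In_rep (l : list C) (m : nat) (p : C) : In p (rep l m) -> In p l.
Proof.
induction m as [|m IH]; [intros []|]. unfold rep in *. simpl. intros H. apply in_app_or in H.
destruct H as [H|H]; [exact H|now apply IH].
Qed.

Lemma In_points (f : nat -> C) (K : nat) (p : C) : In p (points f K) <-> exists k, (k < K)%nat /\ p = f k.
Proof.
unfold points. rewrite in_map_iff. split.
- intros [k [E H]]. apply in_seq in H. exists k. split; [lia|now symmetry].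
- intros [k [H E]]. exists k. split; [now symmetry|]. apply in_seq. lia.
Qed.

Lemma prod_sub_points (f : nat -> C) (K : nat) (z : C) :
  prod_sub (points f (S K)) z = prod_sub (points f K) z * (z - f K).
Proof.
unfold points. rewrite seq_S, map_app, prod_sub_app. simpl. ring.
Qed.

Lemma rising_lower_poles (n K : nat) (nu : C) :
  rising (hs n - Ci * nu) K = (- Ci) ^ K * prod_sub (points (lower_pole n) K) nu.
Proof.
induction K as [|K IH]; [simpl; ring|].
rewrite prod_sub_points. change (rising (hs n - Ci * nu) (S K))
  with (rising (hs n - Ci * nu) K * (hs n - Ci * nu + INR K)). rewrite IH, Cpow_S.
replace (hs n - Ci * nu + INR K) with (- Ci * (nu - lower_pole n K)); [ring|].
unfold lower_pole. transitivity (- Ci * nu - (Ci * Ci) * (hs n + INR K)); [ring|]. rewrite Ci_sq. ring.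
Qed.

Lemma rising_upper_poles (beta : C) (n K : nat) (nu : C) :
  rising (hs n - beta + Ci * nu) K = Ci ^ K * prod_sub (points (upper_pole beta n) K) nu.
Proof.
induction K as [|K IH]; [simpl; ring|].
rewrite prod_sub_points. change (rising (hs n - beta + Ci * nu) (S K))
  with (rising (hs n - beta + Ci * nu) K * (hs n - beta + Ci * nu + INR K)). rewrite IH, Cpow_S.
replace (hs n - beta + Ci * nu + INR K) with (Ci * (nu - upper_pole beta n K)); [ring|].
unfold upper_pole. transitivity (Ci * nu - (Ci * Ci) * (hs n - beta + INR K)); [ring|]. rewrite Ci_sq. ring.
Qed.

(** The integrand after splitting off the first [K] lower and [N] upper poles. The powers of [Ci]
    arise when rising factors in [s] are rewritten as products of differences in [nu]. *)
Definition core_regular (L : nat) (beta z : C) (n K N : nat) (nu : C) : C :=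
  (rGamma (hs n + beta - Ci * nu) * rGamma (hs n + Ci * nu) *
   / ((- Ci) ^ K * Ci ^ N * (rGamma (hs n - beta + Ci * nu + INR N) * rGamma (hs n - Ci * nu + INR K)))) ^ S L *
  abs2_pow z (Ci * nu - RtoC (INR n / 2)).

Definition core_poles (L : nat) (beta : C) (n K N : nat) : list C :=
  rep (points (lower_pole n) K ++ points (upper_pole beta n) N) (S L).

Lemma core_factor (L : nat) (beta z : C) (n K N : nat) (nu : C) :
  core L beta z n nu = core_regular L beta z n K N nu * / prod_sub (core_poles L beta n K N) nu.
Proof.
unfold core, core_regular, core_poles. rewrite prod_sub_rep, prod_sub_app.
rewrite (rGamma_rising (hs n - beta + Ci * nu) N), (rGamma_rising (hs n - Ci * nu) K).
rewrite rising_lower_poles, rising_upper_poles, Cinv_pow.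
rewrite !Cinv_mult, !Cpow_mult_l. ring.
Qed.

Lemma holomorphic_rGamma_affine (D : C -> Prop) (c m : C) : holomorphic D (fun w => rGamma (c + m * w)).
Proof.
apply (holomorphic_comp_affine (fun _ => True)); [apply holomorphic_rGamma|trivial].
Qed.

Lemma holomorphic_core_regular (D : C -> Prop) (L : nat) (beta z : C) (n K N : nat) : Copen D ->
  (forall nu, D nu -> rGamma (hs n - beta + Ci * nu + INR N) <> 0 /\ rGamma (hs n - Ci * nu + INR K) <> 0) ->
  holomorphic D (core_regular L beta z n K N).
Proof.
intros HD H.
assert (Nc : (- Ci) ^ K * Ci ^ N <> 0).
{ apply Cmult_neq_0; apply Cpow_nz; [|exact Ci_nz]. intros Q. apply Ci_nz.
  replace Ci with (- - Ci) by ring. rewrite Q. ring. }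
apply (holomorphic_ext D (fun nu => (rGamma ((hs n + beta) + - Ci * nu) * rGamma (hs n + Ci * nu) *
   / ((- Ci) ^ K * Ci ^ N * (rGamma ((hs n - beta + INR N) + Ci * nu) * rGamma ((hs n + INR K) + - Ci * nu)))) ^ S L *
  Cexp ((- RtoC (INR n / 2) * RtoC (ln (Cmod z ^ 2))) + (Ci * RtoC (ln (Cmod z ^ 2))) * nu)) _ HD).
{ intros nu _. unfold core_regular, abs2_pow, Rcpow.
  replace (hs n + beta + - Ci * nu) with (hs n + beta - Ci * nu) by ring.
  replace (hs n - beta + INR N + Ci * nu) with (hs n - beta + Ci * nu + INR N) by ring.
  replace (hs n + INR K + - Ci * nu) with (hs n - Ci * nu + INR K) by ring.
  f_equal. apply f_equal. ring. }
apply (holomorphic_mult D (fun nu => _ ^ S L)).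
- apply (holomorphic_pow D (fun nu => rGamma ((hs n + beta) + - Ci * nu) * rGamma (hs n + Ci * nu) *
   / ((- Ci) ^ K * Ci ^ N * (rGamma ((hs n - beta + INR N) + Ci * nu) * rGamma ((hs n + INR K) + - Ci * nu))))).
  apply (holomorphic_mult D (fun nu => rGamma ((hs n + beta) + - Ci * nu) * rGamma (hs n + Ci * nu))).
  + apply (holomorphic_mult D (fun nu => rGamma ((hs n + beta) + - Ci * nu)));
      apply holomorphic_rGamma_affine.
  + apply (holomorphic_inv D (fun nu => (- Ci) ^ K * Ci ^ N *
      (rGamma ((hs n - beta + INR N) + Ci * nu) * rGamma ((hs n + INR K) + - Ci * nu)))).
    * apply (holomorphic_mult D (fun _ => (- Ci) ^ K * Ci ^ N)); [apply holomorphic_const|].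
      apply (holomorphic_mult D (fun nu => rGamma ((hs n - beta + INR N) + Ci * nu)));
        apply holomorphic_rGamma_affine.
    * intros nu Hnu. destruct (H nu Hnu) as [H1 H2]. apply Cmult_neq_0; [exact Nc|].
      replace (hs n - beta + INR N + Ci * nu) with (hs n - beta + Ci * nu + INR N) by ring.
      replace (hs n + INR K + - Ci * nu) with (hs n - Ci * nu + INR K) by ring.
      now apply Cmult_neq_0.
- apply (holomorphic_comp_affine (fun _ => True)); [apply holomorphic_Cexp|trivial].
Qed.

Lemma rGamma_neq_0_Re (s : C) : (0 < Re s)%R -> rGamma s <> 0.
Proof.
intros H. apply rGamma_neq_0. intros k E. rewrite E, re_opp, re_RtoC in H. generalize (pos_INR k). lra.
Qed.

Lemma rGamma_neq_0_Im (s : C) : Im s <> 0%R -> rGamma s <> 0.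
Proof.
intros H. apply rGamma_neq_0. intros k E. apply H. rewrite E, im_opp, im_RtoC. ring.
Qed.

Lemma Cmod_Csin_le (u : C) : (Cmod (Csin u) <= exp (Rabs (Im u)))%R.
Proof.
unfold Csin. assert (N2 : 2 * Ci <> 0) by (apply Cmult_neq_0; [intros Q; apply RtoC_inj in Q; lra|exact Ci_nz]).
rewrite Cmod_div, Cmod_mult, Cmod_Ci, Cmod_RtoC_nonneg by (try exact N2; lra).
assert (T := Cmod_triangle (Cexp (Ci * u)) (- Cexp (- (Ci * u)))). rewrite Cmod_opp, !Cmod_Cexp in T.
assert (R1 : Re (Ci * u) = (- Im u)%R) by (rewrite re_mult; unfold Ci; simpl; ring).
rewrite re_opp, R1 in T.
assert (E1 : (exp (- Im u) <= exp (Rabs (Im u)))%R).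
{ apply exp_le_mono. rewrite <- Rabs_Ropp. apply Rle_abs. }
assert (E2 : (exp (- - Im u) <= exp (Rabs (Im u)))%R).
{ apply exp_le_mono. rewrite Ropp_involutive. apply Rle_abs. }
unfold Cminus. lra.
Qed.

Lemma Cmod_Csin_ge (u : C) : ((exp (Rabs (Im u)) - exp (- Rabs (Im u))) / 2 <= Cmod (Csin u))%R.
Proof.
unfold Csin. assert (N2 : 2 * Ci <> 0) by (apply Cmult_neq_0; [intros Q; apply RtoC_inj in Q; lra|exact Ci_nz]).
rewrite Cmod_div, Cmod_mult, Cmod_Ci, Cmod_RtoC_nonneg by (try exact N2; lra).
assert (T1 := Cmod_triangle_sub (Cexp (Ci * u)) (Cexp (- (Ci * u)))).
assert (T2 := Cmod_triangle_sub (Cexp (- (Ci * u))) (Cexp (Ci * u))).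
rewrite (Cmod_sub_sym (Cexp (- (Ci * u)))) in T2.
rewrite !Cmod_Cexp in T1, T2.
assert (R1 : Re (Ci * u) = (- Im u)%R) by (rewrite re_mult; unfold Ci; simpl; ring).
rewrite re_opp, R1, Ropp_involutive in T1, T2.
unfold Rabs. destruct (Rcase_abs (Im u)); rewrite ?Ropp_involutive; lra.
Qed.

(** Both sines grow like [exp (pi |Im s|)], up to [exp (pi |beta|)] for the shift. At distance 1
    from the real axis the denominator is at least a quarter of this exponential. *)
Lemma sin_ratio_bound_Im (beta s : C) : (1 <= Rabs (Im s))%R ->
  (Cmod (sin_ratio beta s) <= 4 * exp (PI * Cmod beta))%R.
Proof.
intros Hs. unfold sin_ratio. assert (P := PI_RGT_0). assert (P3 := PI2_1).
assert (Ey : forall w, Rabs (Im (PI * w)) = (PI * Rabs (Im w))%R).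
{ intros w. rewrite im_scal_l, Rabs_mult, (Rabs_pos_eq PI) by lra. reflexivity. }
assert (G := Cmod_Csin_ge (PI * s)). assert (U := Cmod_Csin_le (PI * (s - beta))).
rewrite Ey in G, U. set (y := (PI * Rabs (Im s))%R) in *.
assert (Hy : (1 <= y)%R).
{ unfold y. assert (PI * 1 <= PI * Rabs (Im s))%R by (apply Rmult_le_compat_l; lra). lra. }
assert (Hu : (PI * Rabs (Im (s - beta)) <= y + PI * Cmod beta)%R).
{ unfold y. rewrite <- Rmult_plus_distr_l. apply Rmult_le_compat_l; [lra|].
  unfold Cminus. rewrite im_plus, im_opp. eapply Rle_trans; [apply Rabs_triang|]. rewrite Rabs_Ropp.
  apply Rplus_le_compat_l. apply im_le_Cmod. }
assert (Hl : (exp y / 4 <= Cmod (Csin (PI * s)))%R).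
{ assert (E1 := exp_ge_1 y ltac:(lra)). assert (E2 := exp_ineq1_le y).
  rewrite exp_Ropp in G. assert (I : (/ exp y <= / 2)%R) by (apply Rinv_le_contravar; lra). lra. }
assert (E0 := exp_pos y).
assert (Nz : Csin (PI * s) <> 0) by (apply Cmod_gt_0; lra).
rewrite Cmod_mult, Cmod_inv by exact Nz.
apply (Rmult_le_reg_r (Cmod (Csin (PI * s)))); [lra|].
rewrite Rmult_assoc, Rinv_l, Rmult_1_r by lra.
apply Rle_trans with (4 * exp (PI * Cmod beta) * (exp y / 4))%R.
- replace (4 * exp (PI * Cmod beta) * (exp y / 4))%R with (exp y * exp (PI * Cmod beta))%R by field.
  rewrite <- exp_plus. eapply Rle_trans; [exact U|]. now apply exp_le_mono.
- apply Rmult_le_compat_l; [|exact Hl]. assert (Q := exp_pos (PI * Cmod beta)). lra.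
Qed.

(** Halfway between two zeros the modulus is [cosh (pi x)], which is why the bottom of the rectangle
    is placed there. *)
Lemma Cmod_Csin_half (k : nat) (x : R) :
  (exp (PI * Rabs x) / 2 <= Cmod (Csin (PI * (/ 2 + Ci * x + INR k))))%R.
Proof.
replace (/ 2 + Ci * x + INR k) with ((/ 2 + Ci * x) + INR k) by ring.
rewrite Csin_shift_nat, Cmod_mult, Cmod_pow, Cmod_opp, Cmod_1, pow1, Rmult_1_l.
assert (Eh : Csin (PI * (/ 2 + Ci * x)) = RtoC ((exp (- (PI * x)) + exp (PI * x)) / 2)).
{ unfold Csin.
  assert (EH : Cexp (Ci * (PI * / 2)) = Ci).
  { replace (Ci * (PI * / 2)) with (RtoC (PI / 2) * Ci) by (rewrite RtoC_div by lra; field).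
    unfold Cexp. rewrite re_scal_l, im_scal_l. unfold Ci, Re, Im; simpl fst; simpl snd.
    rewrite Rmult_0_r, Rmult_1_r, exp_0, cos_PI2, sin_PI2. f_equal; ring. }
  replace (Ci * (PI * (/ 2 + Ci * x))) with (Ci * (PI * / 2) + (Ci * Ci) * (PI * x)) by ring.
  rewrite Ci_sq. replace (- (1) * (PI * x)) with (RtoC (- (PI * x))) by (rewrite RtoC_opp, RtoC_mult; ring).
  rewrite Copp_plus_distr, !Cexp_plus, <- RtoC_opp, !Cexp_RtoC, Ropp_involutive, Cexp_opp, EH.
  rewrite RtoC_div, RtoC_plus by lra.
  rewrite Ci_inv. field. exact Ci_nz. }
rewrite Eh. assert (E1 := exp_pos (PI * x)). assert (E2 := exp_pos (- (PI * x))).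
rewrite Cmod_RtoC_nonneg by lra.
unfold Rabs. destruct (Rcase_abs x).
- replace (PI * - x)%R with (- (PI * x))%R by ring. lra.
- lra.
Qed.

(** * Estimates on the closing rectangle *)

Lemma gratio_bound (beta s : C) (N : nat) (d : R) : (0 < Re beta)%R -> (0 < d)%R ->
  rGamma (s - beta) <> 0 ->
  (forall j, (j < N)%nat -> (d <= Cmod (s + INR j - beta))%R) ->
  (8 * Cmod beta + 8 <= Re s + INR N)%R ->
  (Cmod (gratio beta s) <=
   ratio_const beta * (1 + Cmod beta / d) ^ N * exp (- (Re beta * ln (Cmod (s + INR N)))))%R.
Proof.
intros Hb Hd Hn Hj Hs. assert (M := rGamma_ratio_shift beta s N d Hb Hd Hj Hs).
unfold gratio. rewrite Cmod_mult, Cmod_inv by exact Hn.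
assert (P : (0 < Cmod (rGamma (s - beta)))%R) by now apply Cmod_gt_0.
set (e := (Re beta * ln (Cmod (s + INR N)))%R) in *.
apply (Rmult_le_reg_r (Cmod (rGamma (s - beta)))); [exact P|].
rewrite Rmult_assoc, Rinv_l, Rmult_1_r by lra.
apply (Rmult_le_reg_r (exp e)); [apply exp_pos|].
eapply Rle_trans; [exact M|]. right. rewrite exp_Ropp. field. generalize (exp_pos e). lra.
Qed.

Lemma ratio_const_pos (beta : C) : (0 < ratio_const beta)%R.
Proof. apply Rmult_lt_0_compat; apply exp_pos. Qed.

Lemma exp_neg_ln_le (b r x : R) : (0 < b)%R -> (1 <= r)%R -> (r <= x)%R ->
  (exp (- (b * ln x)) <= exp (- (b * ln r)) <= 1)%R.
Proof.
intros Hb HR Hx. assert (L0 : (0 <= ln r)%R) by (rewrite <- ln_1; apply ln_le; lra).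
assert (L1 : (ln r <= ln x)%R) by (apply ln_le; lra). split.
- apply exp_le_mono. apply Ropp_le_contravar. apply Rmult_le_compat_l; lra.
- rewrite <- exp_0. apply exp_le_mono. assert (0 <= b * ln r)%R by (apply Rmult_le_pos; lra). lra.
Qed.

Lemma Cmod_abs2_pow (z a : C) : Cmod (abs2_pow z a) = exp (Re a * ln (Cmod z ^ 2)).
Proof. apply Cmod_Rcpow. Qed.

Lemma Re_shift_pole (n : nat) (nu : C) :
  Re (hs n + Ci * nu - INR n) = ((1 - INR n) / 2 - Im nu)%R /\ Im (hs n + Ci * nu - INR n) = Re nu.
Proof.
unfold Cminus. rewrite half_succ_nat, !re_plus, !im_plus, re_opp, im_opp, !re_RtoC, !im_RtoC, re_mult, im_mult.
unfold Ci; simpl. split; field.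
Qed.

Lemma C_Re_Im (w : C) : w = RtoC (Re w) + RtoC (Im w) * Ci.
Proof. destruct w as [a b]. unfold RtoC, Ci, Cplus, Cmult, Re, Im; simpl. f_equal; ring. Qed.

Section Estimates.

Variables (L : nat) (beta z : C) (n : nat).
Hypotheses (Hb : (0 < Re beta)%R) (Hz : (0 < Cmod z < 1)%R).

Let lam : R := ln (Cmod z ^ 2).

Lemma lam_neg : (lam < 0)%R.
Proof.
unfold lam. rewrite <- ln_1. apply ln_increasing; [apply pow_lt; lra|].
simpl. rewrite Rmult_1_r. assert (Cmod z * Cmod z < 1 * 1)%R by (apply Rmult_le_0_lt_compat; lra). lra.
Qed.

(** In each of the [L + 1] factors one Gamma ratio provides the decay [|Re nu|^(- Re beta)], while
    the other one and the sine ratio are bounded. The power of [z zbar] supplies the exponential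
    decay in the depth. *)
Lemma core_vertical_bound : exists V R0 : R, (0 < V)%R /\ (1 <= R0)%R /\ (Cmod beta + 1 <= R0)%R /\
  forall nu, (R0 <= Rabs (Re nu))%R -> (Im nu <= 0)%R ->
    (Cmod (core L beta z n nu) <=
     V * exp (- (Re beta * ln (Rabs (Re nu)))) ^ S L * exp (lam * - Im nu))%R.
Proof.
assert (B0 := Cmod_ge_0 beta).
(* [Re s >= (1 - n)/2] in the lower half-plane, so [N] shifts reach the half-plane of the ratio
   bound. The distance [d = 1] from the poles is guaranteed by [|Re nu| >= |beta| + 1]. *)
destruct (nfloor_ex (8 * Cmod beta + 8 + INR n)) as [N0 [_ HN0]].
{ generalize (pos_INR n). lra. }
set (N := S N0). assert (HN : (8 * Cmod beta + 8 + INR n <= INR N)%R) by (unfold N; rewrite S_INR; lra).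
set (Q := (ratio_const beta * (1 + Cmod beta / 1) ^ N)%R).
assert (Q0 : (0 < Q)%R).
{ apply Rmult_lt_0_compat; [apply ratio_const_pos|]. apply pow_lt. unfold Rdiv. rewrite Rinv_1. lra. }
set (S0 := (4 * exp (PI * Cmod beta))%R).
assert (S0p : (0 < S0)%R) by (unfold S0; generalize (exp_pos (PI * Cmod beta)); lra).
exists ((Q * Q * S0) ^ S L * exp (lam * (- INR n / 2)))%R, (Cmod beta + 1)%R.
assert (P0 : (0 < Q * Q * S0)%R) by (apply Rmult_lt_0_compat; [now apply Rmult_lt_0_compat|exact S0p]).
split; [apply Rmult_lt_0_compat; [now apply pow_lt|apply exp_pos]|].
split; [lra|]. split; [lra|]. intros nu HR HI.
set (s := hs n + Ci * nu - INR n). destruct (Re_shift_pole n nu) as [Rs Is]. fold s in Rs, Is.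
set (rho := Rabs (Re nu)) in *.
assert (n0 := pos_INR n).
assert (Im1 : forall x : R, (1 <= Rabs (Im (s + x - beta)))%R).
{ intros x. unfold Cminus. rewrite !im_plus, im_opp, im_RtoC, Is.
  replace (Re nu + 0 + - Im beta)%R with (Re nu - Im beta)%R by ring.
  assert (T := Rabs_triang_inv (Re nu) (Im beta)). fold rho in T. assert (T2 := im_le_Cmod beta). lra. }
assert (Nsb : forall x : R, rGamma (s + x - beta) <> 0).
{ intros x. apply rGamma_neq_0_Im. intros E. specialize (Im1 x). rewrite E, Rabs_R0 in Im1. lra. }
assert (Ns : rGamma s <> 0).
{ apply rGamma_neq_0_Im. intros E. rewrite Is in E. unfold rho in HR. rewrite E, Rabs_R0 in HR. lra. }
assert (Nsb0 : rGamma (s - beta) <> 0).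
{ replace (s - beta) with (s + 0 - beta) by ring. apply Nsb. }
assert (Gb : forall x : R, (0 <= x)%R ->
   (Cmod (gratio beta (s + x)) <= Q * exp (- (Re beta * ln rho)))%R).
{ intros x Hx. eapply Rle_trans.
  - apply (gratio_bound beta (s + x) N 1 Hb Rlt_0_1); [apply Nsb| |].
    + intros j _. replace (s + x + INR j - beta) with (s + RtoC (x + INR j) - beta) by (rewrite RtoC_plus; ring).
      eapply Rle_trans; [apply Im1|apply im_le_Cmod].
    + rewrite re_plus, re_RtoC, Rs. lra.
  - fold Q. apply Rmult_le_compat_l; [lra|]. apply exp_neg_ln_le; [exact Hb|lra|].
    eapply Rle_trans; [|apply im_le_Cmod]. rewrite !im_plus, !im_RtoC, Is, !Rplus_0_r. unfold rho. lra. }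
rewrite (core_closed_form L beta z n nu s) by (try reflexivity; assumption).
rewrite Cmod_mult, Cmod_pow, !Cmod_mult, Cmod_abs2_pow. fold lam.
assert (E2 := Gb 0%R ltac:(lra)). rewrite Cplus_0_r in E2.
assert (E1 := Gb (INR n) n0).
destruct (exp_neg_ln_le (Re beta) rho rho Hb ltac:(lra) ltac:(lra)) as [_ e1].
set (e := exp (- (Re beta * ln rho))) in *. assert (e0 : (0 < e)%R) by apply exp_pos.
assert (E1' : (Cmod (gratio beta (s + INR n)) <= Q)%R).
{ assert (Q * e <= Q * 1)%R by (apply Rmult_le_compat_l; lra). lra. }
assert (E3 := sin_ratio_bound_Im beta s ltac:(rewrite Is; fold rho; lra)). fold S0 in E3.
assert (X : (Cmod (gratio beta (s + INR n)) * Cmod (gratio beta s) * Cmod (sin_ratio beta s) <= Q * Q * S0 * e)%R).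
{ replace (Q * Q * S0 * e)%R with (Q * (Q * e) * S0)%R by ring.
  apply Rmult_le_compat; try apply Cmod_ge_0; [apply Rmult_le_pos; apply Cmod_ge_0| |exact E3].
  apply Rmult_le_compat; try apply Cmod_ge_0; assumption. }
apply Rle_trans with ((Q * Q * S0 * e) ^ S L * exp (Re (s - / 2) * lam))%R.
- apply Rmult_le_compat_r; [left; apply exp_pos|]. apply pow_incr. split; [|exact X].
  apply Rmult_le_pos; [apply Rmult_le_pos|]; apply Cmod_ge_0.
- right. rewrite Rpow_mult_distr.
  replace (exp (Re (s - / 2) * lam)) with (exp (lam * (- INR n / 2)) * exp (lam * - Im nu))%R; [ring|].
  rewrite <- exp_plus. f_equal. unfold Cminus. rewrite re_plus, re_opp, Rs, <- RtoC_inv, re_RtoC by lra. field.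
Qed.

(** Halfway between the lower poles of index [K - 1] and [K], so that exactly [K] of them lie above
    the bottom; there [Re s = K + 1/2]. *)
Definition depth (K : nat) : R := ((INR n + 1) / 2 + INR K - / 2)%R.

Lemma depth_nonneg (K : nat) : (0 <= depth K)%R.
Proof. unfold depth. generalize (pos_INR n) (pos_INR K). lra. Qed.

(** On this line the Gamma ratios are bounded because [|s| >= 1], the sine ratio because of
    [Cmod_Csin_half]; neither bound depends on [K]. The remaining factor is
    [exp (lam K) = |z|^(2K)]. *)
Lemma core_bottom_bound : exists B : R, (0 < B)%R /\
  forall K nu, (8 * Cmod beta + 8 <= INR K)%R -> Im nu = (- depth K)%R ->
    (Cmod (core L beta z n nu) <= B * exp (lam * INR K))%R.
Proof.
set (Q := ratio_const beta). assert (Q0 : (0 < Q)%R) by apply ratio_const_pos.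
set (S0 := (4 * exp (PI * Cmod beta))%R).
assert (S0p : (0 < S0)%R) by (unfold S0; generalize (exp_pos (PI * Cmod beta)); lra).
exists ((Q * Q * S0) ^ S L)%R.
assert (P0 : (0 < Q * Q * S0)%R) by (apply Rmult_lt_0_compat; [now apply Rmult_lt_0_compat|exact S0p]).
split; [now apply pow_lt|]. intros K nu HK HI.
set (s := hs n + Ci * nu - INR n). destruct (Re_shift_pole n nu) as [Rs Is]. fold s in Rs, Is.
assert (B0 := Cmod_ge_0 beta). assert (Bb := Re_le_Cmod beta). assert (n0 := pos_INR n).
assert (Rs' : Re s = (/ 2 + INR K)%R) by (rewrite Rs, HI; unfold depth; field).
assert (Es : s = / 2 + Ci * Re nu + INR K).
{ transitivity (RtoC (Re s) + RtoC (Im s) * Ci); [apply C_Re_Im|].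
  rewrite Rs', Is, RtoC_plus, RtoC_inv by lra. ring. }
assert (Gb : forall x : R, (0 <= x)%R -> (Cmod (gratio beta (s + x)) <= Q)%R).
{ intros x Hx.
  assert (Rx : (8 * Cmod beta + 8 <= Re (s + x))%R) by (rewrite re_plus, re_RtoC, Rs'; lra).
  assert (N1 : rGamma (s + x - beta) <> 0).
  { apply rGamma_neq_0_Re. unfold Cminus. rewrite re_plus, re_opp. lra. }
  eapply Rle_trans.
  - apply (gratio_bound beta (s + x) 0 1 Hb Rlt_0_1 N1); [intros j Hj; lia|]. change (INR 0) with 0%R. lra.
  - fold Q. simpl pow. rewrite Rmult_1_r. rewrite <- (Rmult_1_r Q) at 2. apply Rmult_le_compat_l; [lra|].
    assert (M := Re_le_Cmod (s + x)). simpl INR. rewrite Cplus_0_r.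
    destruct (exp_neg_ln_le (Re beta) 1 (Cmod (s + x)) Hb ltac:(lra) ltac:(lra)) as [A1 A2]. lra. }
assert (Ns : rGamma s <> 0) by (apply rGamma_neq_0_Re; lra).
assert (Nsb : rGamma (s - beta) <> 0).
{ apply rGamma_neq_0_Re. unfold Cminus. rewrite re_plus, re_opp. lra. }
rewrite (core_closed_form L beta z n nu s) by (try reflexivity; assumption).
rewrite Cmod_mult, Cmod_pow, !Cmod_mult, Cmod_abs2_pow. fold lam.
assert (E2 := Gb 0%R ltac:(lra)). rewrite Cplus_0_r in E2.
assert (E1 := Gb (INR n) n0).
assert (E3 : (Cmod (sin_ratio beta s) <= S0)%R).
{ unfold sin_ratio. assert (H := Cmod_Csin_half K (Re nu)). rewrite <- Es in H.
  assert (U := Cmod_Csin_le (PI * (s - beta))). assert (P := PI_RGT_0).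
  rewrite im_scal_l, Rabs_mult, (Rabs_pos_eq PI) in U by lra.
  assert (E0 := exp_pos (PI * Rabs (Re nu))).
  assert (Nz : Csin (PI * s) <> 0) by (apply Cmod_gt_0; lra).
  rewrite Cmod_mult, Cmod_inv by exact Nz.
  apply (Rmult_le_reg_r (Cmod (Csin (PI * s)))); [lra|].
  rewrite Rmult_assoc, Rinv_l, Rmult_1_r by lra.
  apply Rle_trans with (S0 * (exp (PI * Rabs (Re nu)) / 2))%R; [|apply Rmult_le_compat_l; lra].
  eapply Rle_trans; [exact U|].
  apply Rle_trans with (exp (PI * Cmod beta) * exp (PI * Rabs (Re nu)))%R.
  - rewrite <- exp_plus. apply exp_le_mono. rewrite <- Rmult_plus_distr_l. apply Rmult_le_compat_l; [lra|].
    unfold Cminus. rewrite im_plus, im_opp, Is. eapply Rle_trans; [apply Rabs_triang|]. rewrite Rabs_Ropp.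
    assert (T := im_le_Cmod beta). lra.
  - unfold S0. assert (E4 := exp_pos (PI * Cmod beta)).
    assert (0 <= exp (PI * Cmod beta) * exp (PI * Rabs (Re nu)))%R by (apply Rmult_le_pos; lra). lra. }
replace (Re (s - / 2)) with (INR K).
2: { unfold Cminus. rewrite re_plus, re_opp, Rs', <- RtoC_inv, re_RtoC by lra. ring. }
rewrite (Rmult_comm lam). apply Rmult_le_compat_r; [left; apply exp_pos|]. apply pow_incr. split.
- apply Rmult_le_pos; [apply Rmult_le_pos|]; apply Cmod_ge_0.
- apply Rmult_le_compat; try apply Cmod_ge_0; [apply Rmult_le_pos; apply Cmod_ge_0| |exact E3].
  apply Rmult_le_compat; try apply Cmod_ge_0; assumption.
Qed.

Lemma Ccont_core (nu : C) :
  rGamma (hs n - beta + Ci * nu) <> 0 -> rGamma (hs n - Ci * nu) <> 0 -> Ccont (core L beta z n) nu.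
Proof.
intros H1 H2. unfold core. apply (continuous_Cmult _ (core_quotient L beta n)).
- now apply Ccont_core_quotient.
- unfold abs2_pow, Rcpow. apply continuous_Cexp. apply continuous_Cmult; [|apply continuous_Cconst].
  apply continuous_Cminus; [|apply continuous_Cconst].
  apply continuous_Cmult; [apply continuous_Cconst|apply continuous_id].
Qed.

Lemma Ccont_core_vertical (nu : C) : (Cmod beta + 1 <= Rabs (Re nu))%R -> Ccont (core L beta z n) nu.
Proof.
intros H. assert (B0 := Cmod_ge_0 beta). apply Ccont_core; apply rGamma_neq_0_Im; intros E.
- unfold Cminus in E. rewrite half_succ_nat, !im_plus, im_opp, im_RtoC, im_mult in E.
  unfold Ci in E; simpl in E. assert (T := im_le_Cmod beta).
  replace (Re nu) with (Im beta) in H by lra. lra.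
- unfold Cminus in E. rewrite half_succ_nat, im_plus, im_opp, im_RtoC, im_mult in E.
  unfold Ci in E; simpl in E. replace (Re nu) with 0%R in H by lra. rewrite Rabs_R0 in H. lra.
Qed.

Lemma Ccont_core_bottom (K : nat) (nu : C) : (8 * Cmod beta + 8 <= INR K)%R -> Im nu = (- depth K)%R ->
  Ccont (core L beta z n) nu.
Proof.
intros HK HI. assert (B0 := Cmod_ge_0 beta). assert (Bb := Re_le_Cmod beta). assert (n0 := pos_INR n).
apply Ccont_core.
- apply rGamma_neq_0_Re. unfold Cminus. rewrite half_succ_nat, !re_plus, re_opp, re_RtoC, re_mult.
  unfold Ci; simpl. rewrite HI. unfold depth. lra.
- apply rGamma_neq_0. intros k E. apply (f_equal Re) in E.
  unfold Cminus in E. rewrite half_succ_nat, re_plus, !re_opp, !re_RtoC, re_mult in E.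
  unfold Ci in E; simpl in E. rewrite HI in E. unfold depth in E.
  assert (E' : (2 * INR k = 2 * INR K - 1)%R) by lra.
  rewrite !INR_IZR_INZ, <- !mult_IZR, <- minus_IZR in E'. apply eq_IZR in E'. lia.
Qed.

(** The bound does not contain [Y], so the sides of the rectangle stay under control while its depth
    tends to infinity. *)
Lemma exp_segment_integral (W Y : R) : (0 <= W)%R -> (0 <= Y)%R ->
  exists I, is_RInt (fun t => (W * exp (lam * (t * Y)) * Y)%R) 0 1 I /\ (I <= W / - lam)%R.
Proof.
intros HW HY. assert (ln0 := lam_neg).
exists (minus (W * exp (lam * (1 * Y)) / lam)%R (W * exp (lam * (0 * Y)) / lam)%R). split.
- apply (is_RInt_derive (V := R_CompleteNormedModule) (fun t => (W * exp (lam * (t * Y)) / lam)%R)).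
  + intros t _. auto_derive; [trivial|]. field. lra.
  + intros t _. apply (ex_derive_continuous (V := R_NormedModule)). auto_derive. trivial.
- unfold minus, plus, opp; simpl. rewrite Rmult_0_l, Rmult_0_r, exp_0.
  assert (E := exp_pos (lam * (1 * Y))).
  assert (0 <= W * exp (lam * (1 * Y)) / - lam)%R.
  { apply Rdiv_le_0_compat; [apply Rmult_le_pos|]; lra. }
  replace (W * exp (lam * (1 * Y)) / lam)%R with (- (W * exp (lam * (1 * Y)) / - lam))%R by (field; lra).
  replace (W * 1 / lam)%R with (- (W / - lam))%R by (field; lra). lra.
Qed.

Lemma low_chain_core_bound : exists V B R0 : R, (0 < V)%R /\ (0 < B)%R /\ (1 <= R0)%R /\
  forall R1 R2 K, (R0 <= R1)%R -> (R0 <= R2)%R -> (8 * Cmod beta + 8 <= INR K)%R ->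
  (Cmod (chain_int (low_chain R1 R2 (depth K)) (core L beta z n)) <=
   V * exp (- (Re beta * ln R1)) ^ S L + V * exp (- (Re beta * ln R2)) ^ S L +
   (R1 + R2) * (B * exp (lam * INR K)))%R.
Proof.
destruct core_vertical_bound as [V [R0 [HV [HR1 [HR0 HVb]]]]].
destruct core_bottom_bound as [B [HB HBb]]. assert (ln0 := lam_neg).
exists (V / - lam)%R, B, R0. split; [apply Rdiv_lt_0_compat; lra|]. split; [exact HB|]. split; [exact HR1|].
intros R1 R2 K H1 H2 HK. set (Y := depth K). assert (Y0 : (0 <= Y)%R) by apply depth_nonneg.
assert (Ex : forall r, (R0 <= r)%R -> (0 <= V * exp (- (Re beta * ln r)) ^ S L)%R).
{ intros r Hr. apply Rmult_le_pos; [lra|]. apply pow_le. left. apply exp_pos. }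
assert (Pt : forall (x y : R), Re (x - Ci * y) = x /\ Im (x - Ci * y) = (- y)%R).
{ intros x y. unfold Cminus. rewrite re_plus, im_plus, re_opp, im_opp, re_scal_r, im_scal_r, re_RtoC, im_RtoC.
  unfold Ci; simpl. split; ring. }
assert (Left : (Cmod (arc_int (seg_arc (- R1) (- R1 - Ci * Y)) (core L beta z n)) <=
   V / - lam * exp (- (Re beta * ln R1)) ^ S L)%R).
{ destruct (exp_segment_integral (V * exp (- (Re beta * ln R1)) ^ S L) Y (Ex R1 H1) Y0) as [I [HI1 HI2]].
  assert (Es : forall t : R, seg (- R1) (- R1 - Ci * Y) t = RtoC (- R1) - Ci * RtoC (t * Y)).
  { intros t. unfold seg. rewrite RtoC_opp, RtoC_mult. ring. }
  assert (Ab : Rabs (- R1) = R1) by (rewrite Rabs_Ropp; apply Rabs_pos_eq; lra).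
  eapply Rle_trans.
  - apply (Cmod_CInt_le _ (fun t => (V * exp (- (Re beta * ln R1)) ^ S L * exp (lam * (t * Y)) * Y)%R) 0 1 I);
      [lra| | |exact HI1].
    + apply (arc_cont (seg_arc (- R1) (- R1 - Ci * Y)) (core L beta z n)); [apply arc_ok_seg|].
      intros t _. simpl. rewrite Es. apply Ccont_core_vertical. destruct (Pt (- R1)%R (t * Y)%R) as [-> _].
      rewrite Ab. lra.
    + intros t Ht. simpl. rewrite Es, Cmod_mult. destruct (Pt (- R1)%R (t * Y)%R) as [P1 P2].
      apply Rmult_le_compat; try apply Cmod_ge_0.
      * assert (Q := HVb (RtoC (- R1) - Ci * RtoC (t * Y))). rewrite P1, P2, Ab, Ropp_involutive in Q.
        apply Q; [exact H1|]. assert (0 <= t * Y)%R by (apply Rmult_le_pos; lra). lra.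
      * replace (- R1 - Ci * Y - - R1) with (- Ci * Y) by ring.
        rewrite Cmod_mult, Cmod_opp, Cmod_Ci, Cmod_RtoC_nonneg by exact Y0. lra.
  - eapply Rle_trans; [exact HI2|]. right. field. lra. }
assert (Right : (Cmod (arc_int (seg_arc (R2 - Ci * Y) R2) (core L beta z n)) <=
   V / - lam * exp (- (Re beta * ln R2)) ^ S L)%R).
{ destruct (exp_segment_integral (V * exp (- (Re beta * ln R2)) ^ S L) Y (Ex R2 H2) Y0) as [I [HI1 HI2]].
  assert (Es : forall t : R, seg (R2 - Ci * Y) R2 t = RtoC R2 - Ci * RtoC ((1 - t) * Y)).
  { intros t. unfold seg. rewrite RtoC_mult, RtoC_minus. ring. }
  assert (Ab : Rabs R2 = R2) by (apply Rabs_pos_eq; lra).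
  eapply Rle_trans.
  - apply (Cmod_CInt_le _ (fun t => (V * exp (- (Re beta * ln R2)) ^ S L * exp (lam * ((1 - t) * Y)) * Y)%R) 0 1 I); [lra| | |].
    + apply (arc_cont (seg_arc (R2 - Ci * Y) R2) (core L beta z n)); [apply arc_ok_seg|].
      intros t _. simpl. rewrite Es. apply Ccont_core_vertical. destruct (Pt R2 ((1 - t) * Y)%R) as [-> _].
      rewrite Ab. lra.
    + intros t Ht. simpl. rewrite Es, Cmod_mult. destruct (Pt R2 ((1 - t) * Y)%R) as [P1 P2].
      apply Rmult_le_compat; try apply Cmod_ge_0.
      * assert (Q := HVb (RtoC R2 - Ci * RtoC ((1 - t) * Y))). rewrite P1, P2, Ab, Ropp_involutive in Q.
        apply Q; [exact H2|]. assert (0 <= (1 - t) * Y)%R by (apply Rmult_le_pos; lra). lra.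
      * replace (R2 - (R2 - Ci * Y)) with (Ci * Y) by ring.
        rewrite Cmod_mult, Cmod_Ci, Cmod_RtoC_nonneg by exact Y0. lra.
    (* The right side is traversed upwards, so its majorant is the previous one under the
       substitution [t -> 1 - t]. *)
    + apply is_RInt_swap in HI1. rewrite <- (Ropp_involutive I).
      set (W := (V * exp (- (Re beta * ln R2)) ^ S L)%R) in *.
      assert (HC := is_RInt_comp_lin (V := R_NormedModule) (fun t => (W * exp (lam * (t * Y)) * Y)%R) (-1) 1 0 1 (opp I)).
      replace (-1 * 0 + 1)%R with 1%R in HC by ring. replace (-1 * 1 + 1)%R with 0%R in HC by ring.
      specialize (HC HI1). apply (is_RInt_opp (V := R_NormedModule)) in HC.
      eapply is_RInt_ext; [|exact HC]. intros t _. unfold opp, scal; simpl. unfold mult; simpl.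
      replace (-1 * t + 1)%R with (1 - t)%R by ring. ring.
  - eapply Rle_trans; [exact HI2|]. right. field. lra. }
assert (Bot : (Cmod (arc_int (seg_arc (- R1 - Ci * Y) (R2 - Ci * Y)) (core L beta z n)) <=
   (R1 + R2) * (B * exp (lam * INR K)))%R).
{ assert (Es : forall t : R, Im (seg (- R1 - Ci * Y) (R2 - Ci * Y) t) = (- depth K)%R).
  { intros t. replace (seg (- R1 - Ci * Y) (R2 - Ci * Y) t) with (RtoC (- R1 + t * (R2 + R1)) - Ci * RtoC Y).
    - apply Pt.
    - unfold seg. rewrite RtoC_plus, RtoC_opp, RtoC_mult, RtoC_plus. ring. }
  replace ((R1 + R2) * (B * exp (lam * INR K)))%R with ((1 - 0) * ((R1 + R2) * (B * exp (lam * INR K))))%R by ring.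
  apply Cmod_CInt_le_const; [lra| |].
  - apply (arc_cont (seg_arc (- R1 - Ci * Y) (R2 - Ci * Y)) (core L beta z n)); [apply arc_ok_seg|].
    intros t _. apply (Ccont_core_bottom K); [exact HK|apply Es].
  - intros t _. simpl. rewrite Cmod_mult, (Rmult_comm (R1 + R2)).
    apply Rmult_le_compat; try apply Cmod_ge_0; [apply HBb; [exact HK|apply Es]|].
    replace (R2 - Ci * Y - (- R1 - Ci * Y)) with (RtoC (R1 + R2)) by (rewrite RtoC_plus; ring).
    rewrite Cmod_RtoC_nonneg; lra. }
unfold chain_int. simpl chain_sum.
eapply Rle_trans; [apply Cmod_triangle|].
eapply Rle_trans; [apply Rplus_le_compat_l, Cmod_triangle|]. rewrite Cplus_0_r. lra.
Qed.

End Estimates.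

(** * Series and integrals over small circles *)

Notation is_Cseries a l := (@is_series C_AbsRing C_NormedModule a l).

(** Sums over [k < K], which start from the empty sum and match the lists of [K] poles; [sum_n] also
    includes the index [K]. *)
Fixpoint Csum (a : nat -> C) (K : nat) : C :=
  match K with O => 0 | S k => Csum a k + a k end.

Lemma sum_n_Csum (a : nat -> C) (K : nat) : @sum_n C_NormedModule a K = Csum a (S K).
Proof.
induction K as [|K IH].
- rewrite sum_O. simpl. symmetry. apply Cplus_0_l.
- rewrite sum_Sn, IH. reflexivity.
Qed.

Lemma is_Cseries_Clim (a : nat -> C) (l : C) : is_Cseries a l <-> Clim (Csum a) l.
Proof.
split.
- intros H. assert (H' : Clim (fun n => @sum_n C_NormedModule a n) l) by now apply Clim_filterlim.
  intros eps Heps. destruct (H' eps Heps) as [N HN]. exists (S N). intros n Hn.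
  destruct n as [|n]; [lia|]. rewrite <- sum_n_Csum. apply HN. lia.
- intros H. apply Clim_filterlim. intros eps Heps. destruct (H eps Heps) as [N HN]. exists N. intros n Hn.
  rewrite sum_n_Csum. apply HN. lia.
Qed.

Lemma CSeries_unique (a : nat -> C) (l : C) : is_Cseries a l -> CSeries a = l.
Proof.
intros H. unfold CSeries. apply (@iota_unique C_AbsRing C_CompleteNormedModule); [|exact H].
intros y Hy. apply is_Cseries_Clim in H. apply is_Cseries_Clim in Hy. exact (Clim_is_unique _ _ _ Hy H).
Qed.

Lemma pow_small (rho eps : R) : (0 <= rho < 1)%R -> (0 < eps)%R ->
  exists N, forall n, (N <= n)%nat -> (rho ^ n < eps)%R.
Proof.
intros Hr He. destruct (pow_lt_1_zero rho ltac:(rewrite Rabs_pos_eq; lra) eps He) as [N HN].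
exists N. intros n Hn. specialize (HN n Hn). rewrite Rabs_pos_eq in HN; [exact HN|]. apply pow_le. lra.
Qed.

Lemma Csum_tail (a : nat -> C) (c rho : R) (m n : nat) : (0 <= c)%R -> (0 <= rho < 1)%R ->
  (forall k, (Cmod (a k) <= c * rho ^ k)%R) -> (m <= n)%nat ->
  (Cmod (Csum a n - Csum a m) <= c * (rho ^ m - rho ^ n) / (1 - rho))%R.
Proof.
intros Hc Hr Ha Hmn. induction Hmn as [|n Hmn IH].
- replace (Csum a m - Csum a m) with (RtoC 0) by ring. rewrite Cmod_0. right. field. lra.
- simpl Csum. replace (Csum a n + a n - Csum a m) with ((Csum a n - Csum a m) + a n) by ring.
  eapply Rle_trans; [apply Cmod_triangle|]. specialize (Ha n). simpl pow.
  replace (c * (rho ^ m - rho * rho ^ n) / (1 - rho))%R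
    with (c * (rho ^ m - rho ^ n) / (1 - rho) + c * rho ^ n)%R by (field; lra). lra.
Qed.

Lemma Cseries_geom (a : nat -> C) (c rho : R) : (0 <= c)%R -> (0 <= rho < 1)%R ->
  (forall k, (Cmod (a k) <= c * rho ^ k)%R) ->
  is_Cseries a (CSeries a) /\ forall K, (Cmod (Csum a K - CSeries a) <= c * rho ^ K / (1 - rho))%R.
Proof.
intros Hc Hr Ha.
destruct (C_complete_rate (Csum a) (fun K => c * rho ^ K / (1 - rho))%R 0) as [l [Hl1 Hl2]].
- intros n m [_ Hmn]. eapply Rle_trans; [apply (Csum_tail a c rho m n); assumption|].
  unfold Rdiv. apply Rmult_le_compat_r; [left; apply Rinv_0_lt_compat; lra|].
  apply Rmult_le_compat_l; [exact Hc|]. assert (0 <= rho ^ n)%R by (apply pow_le; lra). lra.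
- intros eps Heps. destruct (pow_small rho (eps * (1 - rho) / (c + 1)) Hr) as [N HN].
  { apply Rdiv_lt_0_compat; [apply Rmult_lt_0_compat|]; lra. }
  exists N. intros n Hn. specialize (HN n Hn).
  apply (Rmult_lt_reg_r (1 - rho)); [lra|]. unfold Rdiv at 1. rewrite Rmult_assoc, Rinv_l, Rmult_1_r by lra.
  assert (P : (0 <= rho ^ n)%R) by (apply pow_le; lra).
  apply Rle_lt_trans with ((c + 1) * rho ^ n)%R; [lra|].
  apply (Rmult_lt_compat_l (c + 1)) in HN; [|lra].
  replace ((c + 1) * (eps * (1 - rho) / (c + 1)))%R with (eps * (1 - rho))%R in HN by (field; lra). exact HN.
- assert (Hs : is_Cseries a l) by now apply is_Cseries_Clim.
  rewrite (CSeries_unique a l Hs). split; [exact Hs|]. intros K. apply Hl2. lia.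
Qed.

Lemma Cmod_CSeries_le (a : nat -> C) (c rho : R) : (0 <= c)%R -> (0 <= rho < 1)%R ->
  (forall k, (Cmod (a k) <= c * rho ^ k)%R) -> (Cmod (CSeries a) <= c / (1 - rho))%R.
Proof.
intros Hc Hr Ha. destruct (Cseries_geom a c rho Hc Hr Ha) as [_ H]. specialize (H 0%nat). simpl in H.
rewrite Rmult_1_r in H. replace (0 - CSeries a) with (- CSeries a) in H by ring. now rewrite Cmod_opp in H.
Qed.

Lemma Csum_ext (a b : nat -> C) (K : nat) : (forall k, a k = b k) -> Csum a K = Csum b K.
Proof. intros H. induction K as [|K IH]; simpl; [reflexivity|]. now rewrite IH, H. Qed.

Lemma CSeries_ext (a b : nat -> C) : (forall k, a k = b k) -> CSeries a = CSeries b.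
Proof.
intros H. apply (f_equal CSeries). apply functional_extensionality. exact H.
Qed.

Lemma Csum_scal (c : C) (a : nat -> C) (K : nat) : Csum (fun k => c * a k) K = c * Csum a K.
Proof. induction K as [|K IH]; simpl; [ring|]. rewrite IH. ring. Qed.

Lemma Csum_plus (a b : nat -> C) (K : nat) : Csum (fun k => a k + b k) K = Csum a K + Csum b K.
Proof. induction K as [|K IH]; simpl; [ring|]. rewrite IH. ring. Qed.

Lemma is_Cseries_scal (c : C) (a : nat -> C) (l : C) :
  is_Cseries a l -> is_Cseries (fun k => c * a k) (c * l).
Proof.
intros H. apply is_Cseries_Clim in H. apply is_Cseries_Clim.
apply (Clim_ext_from 0 (fun K => c * Csum a K)); [intros K _; symmetry; apply Csum_scal|].
now apply Clim_scal.
Qed.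

Lemma is_Cseries_plus (a b : nat -> C) (l m : C) :
  is_Cseries a l -> is_Cseries b m -> is_Cseries (fun k => a k + b k) (l + m).
Proof.
intros H H'. apply is_Cseries_Clim in H. apply is_Cseries_Clim in H'. apply is_Cseries_Clim.
apply (Clim_ext_from 0 (fun K => Csum a K + Csum b K)); [intros K _; symmetry; apply Csum_plus|].
now apply Clim_plus.
Qed.

Lemma Csum_shift (a : nat -> C) (K : nat) : Csum a (S K) = a 0%nat + Csum (fun k => a (S k)) K.
Proof. induction K as [|K IH]; [simpl; ring|]. simpl in *. rewrite IH. ring. Qed.

Lemma is_Cseries_shift (a : nat -> C) (l : C) :
  is_Cseries a l <-> is_Cseries (fun k => a (S k)) (l - a 0%nat).
Proof.
rewrite !is_Cseries_Clim. split; intros H eps Heps; destruct (H eps Heps) as [N HN].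
- exists N. intros n Hn. assert (Q := HN (S n) ltac:(lia)). rewrite Csum_shift in Q.
  replace (Csum (fun k => a (S k)) n - (l - a 0%nat)) with (a 0%nat + Csum (fun k => a (S k)) n - l) by ring.
  exact Q.
- exists (S N). intros n Hn. destruct n as [|n]; [lia|]. rewrite Csum_shift.
  replace (a 0%nat + Csum (fun k => a (S k)) n - l) with (Csum (fun k => a (S k)) n - (l - a 0%nat)) by ring.
  apply HN. lia.
Qed.

(** * Integrals over a circle about 0 and termwise integration *)

Definition Jint (r : R) (h : C -> C) : C := CInt (fun t => h (circle 0 r t) * circle' r t) 0 (2 * PI).

Lemma circle_in_disc (r r' t : R) : (0 <= r < r')%R -> disc 0 r' (circle 0 r t).
Proof. intros H. unfold disc. rewrite Cmod_circle_sub; lra. Qed.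

Lemma circle_neq_0 (r t : R) : (0 < r)%R -> circle 0 r t <> 0.
Proof.
intros Hr E. assert (N := circle_neq 0 r t 0 ltac:(lra) (disc_center 0 r Hr)). apply N. rewrite E. ring.
Qed.

Definition punctured (r : R) (e : C) : Prop := disc 0 r e /\ e <> 0.

Lemma circle_punctured (r r' t : R) : (0 < r < r')%R -> punctured r' (circle 0 r t).
Proof. intros H. split; [apply circle_in_disc; lra|apply circle_neq_0; lra]. Qed.

Lemma cont_on_Jint (r r' : R) (h : C -> C) (a b : R) : (0 < r < r')%R ->
  (forall e, punctured r' e -> Ccont h e) -> cont_on (fun t => h (circle 0 r t) * circle' r t) a b.
Proof.
intros Hr Hh t _. apply continuous_Cmult; [|apply continuous_circle'].
apply (continuous_Ccomp _ (circle 0 r) h); [apply continuous_circle|]. apply Hh. now apply circle_punctured.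
Qed.

Lemma Cmod_circle' (r t : R) : (0 <= r)%R -> Cmod (circle' r t) = r.
Proof. intros Hr. unfold circle'. rewrite !Cmod_mult, Cmod_Ci, Cmod_cir, Cmod_RtoC_nonneg by exact Hr. ring. Qed.

Lemma Cmod_Jint_le (r r' : R) (h : C -> C) (M : R) : (0 < r < r')%R ->
  (forall e, punctured r' e -> Ccont h e) -> (forall t, (0 <= t <= 2 * PI)%R -> (Cmod (h (circle 0 r t)) <= M)%R) ->
  (Cmod (Jint r h) <= 2 * PI * r * M)%R.
Proof.
intros Hr Hh HM. replace (2 * PI * r * M)%R with ((2 * PI - 0) * (M * r))%R by ring.
apply Cmod_CInt_le_const; [apply zero_le_2PI|now apply (cont_on_Jint r r')|].
intros t Ht. rewrite Cmod_mult, Cmod_circle' by lra. apply Rmult_le_compat_r; [lra|now apply HM].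
Qed.

Lemma Jint_ext (r r' : R) (g h : C -> C) : (0 < r < r')%R -> (forall e, punctured r' e -> g e = h e) ->
  Jint r g = Jint r h.
Proof.
intros Hr H. apply CInt_ext. intros t _. rewrite H; [reflexivity|]. now apply circle_punctured.
Qed.

Lemma Jint_plus (r r' : R) (g h : C -> C) : (0 < r < r')%R ->
  (forall e, punctured r' e -> Ccont g e) -> (forall e, punctured r' e -> Ccont h e) ->
  Jint r (fun e => g e + h e) = Jint r g + Jint r h.
Proof.
intros Hr Hg Hh. unfold Jint. rewrite <- CInt_plus by now apply (cont_on_Jint r r').
apply CInt_ext. intros t _. ring.
Qed.

Lemma Jint_minus (r r' : R) (g h : C -> C) : (0 < r < r')%R ->
  (forall e, punctured r' e -> Ccont g e) -> (forall e, punctured r' e -> Ccont h e) ->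
  Jint r (fun e => g e - h e) = Jint r g - Jint r h.
Proof.
intros Hr Hg Hh. unfold Jint. rewrite <- CInt_minus by now apply (cont_on_Jint r r').
apply CInt_ext. intros t _. ring.
Qed.

Lemma Jint_scal (r r' : R) (c : C) (h : C -> C) : (0 < r < r')%R ->
  (forall e, punctured r' e -> Ccont h e) -> Jint r (fun e => c * h e) = c * Jint r h.
Proof.
intros Hr Hh. unfold Jint. rewrite <- CInt_scal by now apply (cont_on_Jint r r').
apply CInt_ext. intros t _. ring.
Qed.

Lemma Ccont_Csum (u : nat -> C -> C) (K : nat) (e : C) : (forall k, Ccont (u k) e) ->
  Ccont (fun e => Csum (fun k => u k e) K) e.
Proof.
intros H. induction K as [|K IH]; [apply continuous_Cconst|].
apply (continuous_Cplus _ (fun e => Csum (fun k => u k e) K) (u K)); [exact IH|apply H].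
Qed.

Lemma Jint_Csum (r r' : R) (u : nat -> C -> C) (K : nat) : (0 < r < r')%R ->
  (forall k e, punctured r' e -> Ccont (u k) e) ->
  Jint r (fun e => Csum (fun k => u k e) K) = Csum (fun k => Jint r (u k)) K.
Proof.
intros Hr Hu. induction K as [|K IH].
- simpl. unfold Jint. rewrite (CInt_ext _ (fun _ => RtoC 0 * RtoC 0)) by (intros; ring).
  rewrite (CInt_scal (fun _ => RtoC 0)); [ring|]. intros t _. apply continuous_Cconst.
- simpl. rewrite <- IH. apply (Jint_plus r r' (fun e => Csum (fun k => u k e) K) (u K)).
  + exact Hr.
  + intros e He. apply Ccont_Csum. intros k. now apply Hu.
  + intros e He. now apply Hu.
Qed.

Definition geometric (r' : R) (u : nat -> C -> C) (c rho : R) : Prop :=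
  (forall k e, disc 0 r' e -> Ccont (u k) e) /\
  (forall k e, disc 0 r' e -> (Cmod (u k e) <= c * rho ^ k)%R).

Lemma unif_lim_Csum (r' : R) (u : nat -> C -> C) (c rho : R) : (0 <= c)%R -> (0 <= rho < 1)%R ->
  geometric r' u c rho ->
  unif_lim (disc 0 r') (fun K e => Csum (fun k => u k e) K) (fun e => CSeries (fun k => u k e)).
Proof.
intros Hc Hr [_ Hu] eps Heps.
destruct (pow_small rho (eps * (1 - rho) / (c + 1)) Hr) as [N HN].
{ apply Rdiv_lt_0_compat; [apply Rmult_lt_0_compat|]; lra. }
exists N. intros n e Hn He.
destruct (Cseries_geom (fun k => u k e) c rho Hc Hr (fun k => Hu k e He)) as [_ H].
eapply Rle_trans; [apply H|]. specialize (HN n Hn).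
apply (Rmult_le_reg_r (1 - rho)); [lra|]. unfold Rdiv at 1. rewrite Rmult_assoc, Rinv_l, Rmult_1_r by lra.
assert (P : (0 <= rho ^ n)%R) by (apply pow_le; lra).
apply Rle_trans with ((c + 1) * rho ^ n)%R; [lra|].
apply (Rmult_lt_compat_l (c + 1)) in HN; [|lra].
replace ((c + 1) * (eps * (1 - rho) / (c + 1)))%R with (eps * (1 - rho))%R in HN by (field; lra). lra.
Qed.

Lemma Ccont_geometric (r' : R) (u : nat -> C -> C) (c rho : R) (e : C) : (0 <= c)%R -> (0 <= rho < 1)%R ->
  geometric r' u c rho -> disc 0 r' e -> Ccont (fun e => CSeries (fun k => u k e)) e.
Proof.
intros Hc Hr Hu He.
apply (unif_lim_cont (disc 0 r') (fun K e => Csum (fun k => u k e) K) _ e (Copen_disc 0 r') He).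
- now apply (unif_lim_Csum r' u c rho).
- intros n. apply Ccont_Csum. intros k. now apply Hu.
Qed.

(** Termwise integration under a geometric majorant. The explicit rate is kept because the contour
    estimate has to choose the depth [K] with it. *)
Lemma Jint_series (r r' : R) (phi : C -> C) (M : R) (u : nat -> C -> C) (c rho : R) :
  (0 < r < r')%R -> (0 <= c)%R -> (0 <= rho < 1)%R -> geometric r' u c rho ->
  (forall e, punctured r' e -> Ccont phi e) -> (forall t, (0 <= t <= 2 * PI)%R -> (Cmod (phi (circle 0 r t)) <= M)%R) ->
  is_Cseries (fun k => Jint r (fun e => phi e * u k e)) (Jint r (fun e => phi e * CSeries (fun k => u k e))) /\
  forall K, (Cmod (Csum (fun k => Jint r (fun e => phi e * u k e)) K -
    Jint r (fun e => phi e * CSeries (fun k => u k e)))%C <= 2 * PI * r * (M * (c / (1 - rho))) * rho ^ K)%R.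
Proof.
intros Hr Hc Hrho Hu Hphi HM.
assert (M0 : (0 <= M)%R) by (eapply Rle_trans; [apply Cmod_ge_0|apply (HM 0%R); generalize PI_RGT_0; lra]).
assert (Cu : forall k e, punctured r' e -> Ccont (fun e => phi e * u k e) e).
{ intros k e He. apply continuous_Cmult; [now apply Hphi|]. apply Hu. apply He. }
assert (CS : forall e, punctured r' e -> Ccont (fun e => phi e * CSeries (fun k => u k e)) e).
{ intros e He. apply continuous_Cmult; [now apply Hphi|].
  apply (Ccont_geometric r' u c rho); try assumption. apply He. }
assert (CK : forall K e, punctured r' e -> Ccont (fun e => Csum (fun k => phi e * u k e) K) e).
{ intros K e He. apply (Ccont_Csum (fun k e => phi e * u k e)). intros k. now apply Cu. }
assert (Rate : forall K, (Cmod (Csum (fun k => Jint r (fun e => phi e * u k e)) K -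
    Jint r (fun e => phi e * CSeries (fun k => u k e)))%C <= 2 * PI * r * (M * (c / (1 - rho))) * rho ^ K)%R).
{ intros K. rewrite <- (Jint_Csum r r' (fun k e => phi e * u k e)) by assumption.
  rewrite <- (Jint_minus r r') by (try assumption; apply CK).
  replace (2 * PI * r * (M * (c / (1 - rho))) * rho ^ K)%R
    with (2 * PI * r * (M * (c * rho ^ K / (1 - rho))))%R by (field; lra).
  apply (Cmod_Jint_le r r'); [exact Hr| |].
  - intros e He. apply continuous_Cminus; [now apply CK|now apply CS].
  - intros t Ht. set (e := circle 0 r t). assert (He : disc 0 r' e) by (apply circle_in_disc; lra).
    rewrite Csum_scal. replace (phi e * Csum (fun k => u k e) K - phi e * CSeries (fun k => u k e))
      with (phi e * (Csum (fun k => u k e) K - CSeries (fun k => u k e))) by ring.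
    rewrite Cmod_mult. apply Rmult_le_compat; try apply Cmod_ge_0; [now apply HM|].
    destruct (Cseries_geom (fun k => u k e) c rho Hc Hrho (fun k => proj2 Hu k e He)) as [_ H]. apply H. }
split; [|exact Rate].
apply is_Cseries_Clim. intros eps Heps. set (B := (2 * PI * r * (M * (c / (1 - rho))))%R) in *.
assert (B0 : (0 <= B)%R).
{ unfold B. assert (P := PI_RGT_0). apply Rmult_le_pos; [apply Rmult_le_pos; lra|].
  apply Rmult_le_pos; [exact M0|]. apply Rdiv_le_0_compat; lra. }
destruct (pow_small rho (eps / (B + 1)) Hrho) as [N HN]; [apply Rdiv_lt_0_compat; lra|].
exists N. intros n Hn. eapply Rle_lt_trans; [apply Rate|]. specialize (HN n Hn).
assert (P : (0 <= rho ^ n)%R) by (apply pow_le; lra).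
apply Rle_lt_trans with ((B + 1) * rho ^ n)%R; [lra|].
apply (Rmult_lt_compat_l (B + 1)) in HN; [|lra].
replace ((B + 1) * (eps / (B + 1)))%R with eps in HN by (field; lra). exact HN.
Qed.

(** * The contour integrals as residue sums *)

Definition coef (L : nat) (beta : C) (k : nat) (e : C) : C := gratio beta (1 + INR k - e) ^ S L.

Definition Phi (L : nat) (beta z e : C) : C :=
  (Csin (PI * (beta + e)) * / Csin (PI * e)) ^ S L * abs2_pow z (1 / 2 - e).

(* [radius beta r']: discs of radius [r'] about distinct poles are disjoint, and the
   coefficients of [F_L (beta, eps | z)] are regular for [|eps| < r']. *)
Definition radius (beta : C) (r' : R) : Prop :=
  (0 < r' <= / 4)%R /\ forall m : Z, (2 * r' <= Cmod (beta - IZR m))%R.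

Lemma radius_exists (beta : C) : (forall m : Z, beta <> RtoC (IZR m)) -> exists r', radius beta r'.
Proof.
intros H. destruct (far_from_integers beta) as [d [Hd Hf]]. exists (Rmin (/ 4) (d / 2)). split.
- split; [apply Rmin_pos; lra|apply Rmin_l].
- intros m. specialize (Hf m (H m)). assert (T := Rmin_r (/ 4) (d / 2)). lra.
Qed.

Lemma integer_sub_far (beta e : C) (r' : R) (m : Z) : radius beta r' -> disc 0 r' e ->
  (r' <= Cmod (IZR m - e - beta))%R.
Proof.
intros [_ H] He. specialize (H m). unfold disc in He. replace (e - 0) with e in He by ring.
assert (T := Cmod_triangle (IZR m - e - beta) e).
replace (IZR m - e - beta + e) with (- (beta - IZR m)) in T by ring. rewrite Cmod_opp in T. lra.
Qed.

Lemma rGamma_shift_neq_0 (beta e : C) (r' : R) (k : nat) : radius beta r' -> disc 0 r' e ->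
  rGamma (1 + INR k - e - beta) <> 0.
Proof.
intros Hr He. apply rGamma_neq_0. intros i E.
assert (H := integer_sub_far beta e r' (1 + Z.of_nat k + Z.of_nat i) Hr He).
rewrite !plus_IZR, <- !INR_IZR_INZ, !RtoC_plus in H.
replace (1 + INR k + INR i - e - beta) with (1 + INR k - e - beta + INR i) in H by ring.
rewrite E in H. replace (- INR i + INR i) with (RtoC 0) in H by ring. rewrite Cmod_0 in H.
destruct Hr. lra.
Qed.

Lemma disc0_Re (e : C) (r' : R) : disc 0 r' e -> (Rabs (Re e) < r')%R /\ (Rabs (Im e) < r')%R.
Proof.
intros H. unfold disc in H. replace (e - 0) with e in H by ring.
split; [eapply Rle_lt_trans; [apply re_le_Cmod|exact H]|eapply Rle_lt_trans; [apply im_le_Cmod|exact H]].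
Qed.

Lemma Re_shift_pos (e : C) (r' : R) (k : nat) : (r' <= / 4)%R -> disc 0 r' e ->
  (/ 2 <= Re (1 + INR k - e))%R.
Proof.
intros Hr He. destruct (disc0_Re e r' He) as [H _].
unfold Cminus. rewrite !re_plus, re_opp, !re_RtoC. apply Rabs_lt_between in H. generalize (pos_INR k). lra.
Qed.

Lemma holomorphic_coef (L : nat) (beta : C) (r' : R) (k : nat) : radius beta r' ->
  holomorphic (disc 0 r') (coef L beta k).
Proof.
intros Hr. unfold coef. apply (holomorphic_pow (disc 0 r') (fun e => gratio beta (1 + INR k - e))).
apply (holomorphic_ext _ (fun e => rGamma ((1 + INR k) + - (1) * e) * / rGamma ((1 + INR k - beta) + - (1) * e))).
- apply Copen_disc.
- intros e _. unfold gratio. replace (1 + INR k + - (1) * e) with (1 + INR k - e) by ring.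
  replace (1 + INR k - beta + - (1) * e) with (1 + INR k - e - beta) by ring. reflexivity.
- apply (holomorphic_mult _ (fun e => rGamma ((1 + INR k) + - (1) * e))); [apply holomorphic_rGamma_affine|].
  apply (holomorphic_inv _ (fun e => rGamma ((1 + INR k - beta) + - (1) * e))); [apply holomorphic_rGamma_affine|].
  intros e He. replace (1 + INR k - beta + - (1) * e) with (1 + INR k - e - beta) by ring.
  now apply (rGamma_shift_neq_0 beta e r').
Qed.

(** A fixed number [N] of shifts, each at distance at least [r'] from the poles, brings every
    argument into the half-plane of the ratio bound. Uniform boundedness in [k] is enough, since the
    powers of [z] provide convergence. *)
Lemma coef_bound (L : nat) (beta : C) (r' : R) : (0 < Re beta)%R -> radius beta r' ->
  exists M : R, (0 < M)%R /\ forall k e, disc 0 r' e -> (Cmod (coef L beta k e) <= M)%R.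
Proof.
intros Hb Hr. assert (B0 := Cmod_ge_0 beta).
destruct (nfloor_ex (8 * Cmod beta + 8)) as [N0 [_ HN0]]; [lra|].
set (N := S N0). assert (HN : (8 * Cmod beta + 8 <= INR N)%R) by (unfold N; rewrite S_INR; lra).
destruct Hr as [[Hr0 Hr1] Hr2]. assert (Hr : radius beta r') by now repeat split.
set (Q := (ratio_const beta * (1 + Cmod beta / r') ^ N)%R).
assert (Q0 : (0 < Q)%R).
{ apply Rmult_lt_0_compat; [apply ratio_const_pos|]. apply pow_lt.
  assert (0 <= Cmod beta / r')%R by (apply Rdiv_le_0_compat; lra). lra. }
exists (Q ^ S L)%R. split; [now apply pow_lt|]. intros k e He. unfold coef. rewrite Cmod_pow.
apply pow_incr. split; [apply Cmod_ge_0|].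
assert (Rp := Re_shift_pos e r' k Hr1 He).
eapply Rle_trans.
- apply (gratio_bound beta (1 + INR k - e) N r' Hb Hr0).
  + now apply (rGamma_shift_neq_0 beta e r').
  + intros j _. assert (H := integer_sub_far beta e r' (1 + Z.of_nat k + Z.of_nat j) Hr He).
    rewrite !plus_IZR, <- !INR_IZR_INZ, !RtoC_plus in H.
    replace (1 + INR k - e + INR j - beta) with (1 + INR k + INR j - e - beta) by ring. exact H.
  + lra.
- fold Q. rewrite <- (Rmult_1_r Q) at 2. apply Rmult_le_compat_l; [lra|].
  assert (T := Re_le_Cmod (1 + INR k - e + INR N)). rewrite re_plus, re_RtoC in T.
  destruct (exp_neg_ln_le (Re beta) 1 (Cmod (1 + INR k - e + INR N)) Hb ltac:(lra) ltac:(lra)) as [A1 A2]. lra.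
Qed.

(** The zeros of the sine are read off from the reflection formula and the zeros of [rGamma]. *)
Lemma Csin_PI_neq_0 (e : C) : (forall m : Z, e <> IZR m) -> Csin (PI * e) <> 0.
Proof.
intros H. rewrite <- rGamma_reflection.
apply Cmult_neq_0; [intros Q; apply RtoC_inj in Q; generalize PI_RGT_0; lra|].
apply Cmult_neq_0; apply rGamma_neq_0; intros k E.
- apply (H (- Z.of_nat k)%Z). now rewrite opp_IZR, <- INR_IZR_INZ, RtoC_opp.
- apply (H (1 + Z.of_nat k)%Z). rewrite plus_IZR, <- INR_IZR_INZ, RtoC_plus.
  replace e with (1 - (1 - e)) by ring. rewrite E. ring.
Qed.

Lemma punctured_not_integer (r' : R) (e : C) (m : Z) : (r' <= / 4)%R -> punctured r' e -> e <> IZR m.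
Proof.
intros Hr [He N] E. unfold disc in He. replace (e - 0) with e in He by ring.
rewrite E, Cmod_R, <- abs_IZR in He. apply N. rewrite E. apply (f_equal RtoC), (f_equal IZR).
assert (IZR (Z.abs m) < 1)%R by lra. apply lt_IZR in H. lia.
Qed.

Lemma Ccont_Phi (L : nat) (beta z e : C) (r' : R) : (r' <= / 4)%R -> punctured r' e ->
  Ccont (Phi L beta z) e.
Proof.
intros Hr He. unfold Phi.
assert (Cs : forall c : C, Ccont (fun e => Csin (PI * (c + e))) e).
{ intros c. apply (continuous_Ccomp _ (fun e => PI * (c + e)) Csin).
  - apply continuous_Cmult; [apply continuous_Cconst|].
    apply continuous_Cplus; [apply continuous_Cconst|apply continuous_id].
  - exact (is_Cderive_continuous _ _ _ (is_Cderive_Csin _)). }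
apply continuous_Cmult.
- apply continuous_Cpow. apply continuous_Cmult; [apply Cs|]. apply continuous_Cinv.
  + apply (continuous_ext (fun e => Csin (PI * (0 + e)))); [intros w; apply f_equal; ring|apply Cs].
  + apply Csin_PI_neq_0. intros m. now apply (punctured_not_integer r').
- unfold abs2_pow, Rcpow. apply continuous_Cexp. apply continuous_Cmult; [|apply continuous_Cconst].
  apply continuous_Cminus; [apply continuous_Cconst|apply continuous_id].
Qed.

Lemma Phi_bound (L : nat) (beta z : C) (r r' : R) : (0 < r < r')%R -> (r' <= / 4)%R ->
  exists M : R, (0 < M)%R /\ forall t, (0 <= t <= 2 * PI)%R -> (Cmod (Phi L beta z (circle 0 r t)) <= M)%R.
Proof.
intros Hr Hr'. apply (bounded_on (fun t => Phi L beta z (circle 0 r t)) 0 (2 * PI) zero_le_2PI).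
intros t _. apply (continuous_Ccomp _ (circle 0 r) (Phi L beta z)); [apply continuous_circle|].
apply (Ccont_Phi L beta z _ r' Hr'). now apply circle_punctured.
Qed.

(* The coefficient of [(z \bar z) ^ k] in the residue sum of the [n]-th integral. *)
Definition pair_coef (L : nat) (beta z : C) (n k : nat) (e : C) : C :=
  coef L beta (n + k) e * coef L beta k e * (z * Cconj z) ^ k.

Definition pair_series (L : nat) (beta z : C) (n : nat) (e : C) : C :=
  CSeries (fun k => pair_coef L beta z n k e).

Definition core_value (L : nat) (beta z : C) (r : R) (n : nat) : C :=
  - Ci * Jint r (fun e => Phi L beta z e * pair_series L beta z n e).

Lemma core_near_pole (L : nat) (beta z e : C) (n k : nat) (r' : R) : z <> 0 -> radius beta r' ->
  disc 0 r' e ->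
  core L beta z n (lower_pole n k + Ci * e) = Phi L beta z e * pair_coef L beta z n k e.
Proof.
intros Hz Hr He. set (s := 1 + INR k - e).
assert (Rp := Re_shift_pos e r' k (proj2 (proj1 Hr)) He).
rewrite (core_closed_form L beta z n _ s).
- assert (Es : s + INR n = 1 + INR (n + k) - e) by (unfold s; rewrite plus_INR, RtoC_plus; ring).
  (* Numerator and denominator are shifted by the same integer [k + 1] and are both odd, so all
     signs cancel and the result is independent of [k]. *)
  assert (Sr : sin_ratio beta s = Csin (PI * (beta + e)) * / Csin (PI * e)).
  { unfold sin_ratio, s.
    replace (1 + INR k - e - beta) with (- (beta + e) + INR (S k)) by (rewrite S_INR, RtoC_plus; ring).
    replace (1 + INR k - e) with (- e + INR (S k)) by (rewrite S_INR, RtoC_plus; ring).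
    rewrite !Csin_shift_nat.
    replace (PI * - (beta + e)) with (- (PI * (beta + e))) by ring.
    replace (PI * - e) with (- (PI * e)) by ring. rewrite !Csin_opp, Cinv_mult.
    assert (N : (- (1)) ^ S k <> 0).
    { apply Cpow_nz. intros Q. apply C1_nz. replace (RtoC 1) with (- - (1)) by ring. rewrite Q. ring. }
    assert (I : / - Csin (PI * e) = - / Csin (PI * e)).
    { replace (- Csin (PI * e)) with (- (1) * Csin (PI * e)) by ring. rewrite Cinv_mult.
      replace (/ - (1)) with (- (1)); [ring|]. field. }
    rewrite I. transitivity ((- (1)) ^ S k * / (- (1)) ^ S k * (Csin (PI * (beta + e)) * / Csin (PI * e))); [ring|].
    rewrite Cinv_r by exact N. ring. }
  rewrite Es, Sr. unfold Phi, pair_coef, coef. fold s.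
  replace (s - / 2) with ((1 / 2 - e) + INR k) by (unfold s; field).
  rewrite abs2_pow_plus, abs2_pow_nat, !Cpow_mult_l by exact Hz. ring.
- unfold s, lower_pole. replace (hs n + Ci * (- (Ci * hs n) - Ci * INR k + Ci * e) - INR n)
    with (hs n - (Ci * Ci) * (hs n + INR k - e) - INR n) by ring.
  rewrite Ci_sq, half_succ_nat, RtoC_div, RtoC_plus by lra. field.
- apply rGamma_neq_0_Re. unfold s. lra.
- now apply (rGamma_shift_neq_0 beta e r').
Qed.

Lemma arc_int_near_pole (L : nat) (beta z : C) (n k : nat) (r r' : R) : z <> 0 -> radius beta r' ->
  (0 < r < r')%R ->
  arc_int (circ_arc r (lower_pole n k)) (core L beta z n) =
  Ci * Jint r (fun e => Phi L beta z e * pair_coef L beta z n k e).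
Proof.
intros Hz Hrad Hr.
assert (Hc : forall t, core L beta z n (lower_pole n k + Ci * circle 0 r t) =
   Phi L beta z (circle 0 r t) * pair_coef L beta z n k (circle 0 r t)).
{ intros t. apply (core_near_pole L beta z _ n k r' Hz Hrad). apply circle_in_disc. lra. }
unfold Jint. rewrite <- CInt_scal.
- apply CInt_ext. intros t _. simpl. rewrite Hc. ring.
- apply (cont_on_Jint r r' (fun e => Phi L beta z e * pair_coef L beta z n k e) _ _ Hr).
  intros e He. assert (Hcf : forall j, Ccont (coef L beta j) e).
  { intros j. apply (holomorphic_cont (disc 0 r')); [now apply holomorphic_coef|apply He]. }
  apply continuous_Cmult.
  + apply (Ccont_Phi L beta z e r'); [apply Hrad|exact He].
  + apply continuous_Cmult; [|apply continuous_Cconst]. apply continuous_Cmult; apply Hcf.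
Qed.

Lemma Cmod_mult_conj (z : C) : Cmod (z * Cconj z) = (Cmod z * Cmod z)%R.
Proof. now rewrite Cmod_mult, Cmod_conj. Qed.

Lemma Cmod_sq_lt_1 (z : C) : (0 < Cmod z < 1)%R -> (0 <= Cmod z * Cmod z < 1)%R.
Proof.
intros H. split; [apply Rmult_le_pos; lra|].
assert (Cmod z * Cmod z < 1 * 1)%R by (apply Rmult_le_0_lt_compat; lra). lra.
Qed.

Lemma geometric_pair_coef (L : nat) (beta z : C) (r' M : R) (n : nat) : radius beta r' ->
  (forall k e, disc 0 r' e -> (Cmod (coef L beta k e) <= M)%R) ->
  geometric r' (fun k e => pair_coef L beta z n k e) (M * M) (Cmod z * Cmod z).
Proof.
intros Hr HM. split.
- intros k e He. assert (Hcf : forall j, Ccont (coef L beta j) e).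
  { intros j. apply (holomorphic_cont (disc 0 r')); [now apply holomorphic_coef|exact He]. }
  apply continuous_Cmult; [|apply continuous_Cconst]. apply continuous_Cmult; apply Hcf.
- intros k e He. unfold pair_coef. rewrite !Cmod_mult, Cmod_pow, Cmod_mult_conj.
  apply Rmult_le_compat_r; [apply pow_le, Rmult_le_pos; apply Cmod_ge_0|].
  apply Rmult_le_compat; try apply Cmod_ge_0; now apply HM.
Qed.

Lemma lower_pole_parts (n k : nat) :
  Re (lower_pole n k) = 0%R /\ Im (lower_pole n k) = (- ((INR n + 1) / 2) - INR k)%R.
Proof.
unfold lower_pole, Cminus. rewrite half_succ_nat, re_plus, im_plus, !re_opp, !im_opp, !re_mult, !im_mult, !re_RtoC, !im_RtoC.
unfold Ci; simpl. split; ring.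
Qed.

Lemma upper_pole_parts (beta : C) (n k : nat) :
  Re (upper_pole beta n k) = Im beta /\ Im (upper_pole beta n k) = ((INR n + 1) / 2 - Re beta + INR k)%R.
Proof.
unfold upper_pole, Cminus. rewrite half_succ_nat, re_plus, im_plus, !re_mult, !im_mult, !re_plus, !im_plus,
  !re_opp, !im_opp, !re_RtoC, !im_RtoC.
unfold Ci; simpl. split; ring.
Qed.

Lemma chain_sum_circles (phi : arc -> C) (r : R) (f : nat -> C) (K : nat) :
  chain_sum phi (map (circ_arc r) (points f K)) = Csum (fun k => phi (circ_arc r (f k))) K.
Proof.
induction K as [|K IH]; [reflexivity|].
unfold points in *. rewrite seq_S, !map_app, chain_sum_app, IH. simpl. ring.
Qed.

Section Contour.

Variables (L : nat) (beta z : C) (n : nat) (gam : R -> C) (r r' : R).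
Hypotheses (Hb : (0 < Re beta)%R) (Hz : (0 < Cmod z < 1)%R) (Hrad : radius beta r') (Hr : (0 < r < r')%R)
  (Hgam : is_ladder_contour beta n gam).

Lemma z_neq_0 : z <> 0.
Proof. apply Cmod_gt_0. lra. Qed.

Lemma gam_regular (t : R) :
  rGamma (hs n - beta + Ci * gam t) <> 0 /\ rGamma (hs n - Ci * gam t) <> 0.
Proof.
destruct Hgam as [_ [_ [Ha Hbl]]]. split; apply rGamma_neq_0; intros k E.
- apply (above_neq gam (upper_pole beta n k) t); [apply Ha|]. unfold upper_pole.
  transitivity (- (Ci * Ci) * gam t); [rewrite Ci_sq; ring|].
  replace (- (Ci * Ci) * gam t) with (- Ci * (hs n - beta + Ci * gam t) + Ci * (hs n - beta)) by ring.
  rewrite E. ring.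
- apply (below_neq gam (lower_pole n k) t); [apply Hbl|]. unfold lower_pole.
  transitivity (- (Ci * Ci) * gam t); [rewrite Ci_sq; ring|].
  replace (- (Ci * Ci) * gam t) with (Ci * (hs n - Ci * gam t) - Ci * hs n) by ring.
  rewrite E. ring.
Qed.

Lemma continuous_core_gam (t : R) :
  continuous_C R_UniformSpace (fun t => core L beta z n (gam t) * velocity gam t) t.
Proof.
destruct (arc_ok_gam gam t t (proj1 Hgam) t) as [G1 G2].
{ unfold on_arc; simpl. rewrite Rmin_left, Rmax_left; lra. }
apply continuous_Cmult; [|exact G2].
apply (continuous_Ccomp _ gam (core L beta z n)); [exact (is_Rderive_continuous _ _ _ G1)|].
destruct (gam_regular t) as [G3 G4]. exact (Ccont_core L beta z n (gam t) G3 G4).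
Qed.

(** The deformation takes place in a horizontal strip with finitely many poles: the [K] lower ones
    are encircled, while [N] upper ones are included because the contour may rise above some of
    them. *)
Lemma core_finite_deformation : exists T : R, forall R1 R2 : R, (T <= R1)%R -> (T <= R2)%R ->
  exists K0 : nat, forall K, (K0 <= K)%nat ->
  CInt (fun t => core L beta z n (gam t) * velocity gam t) (- R1) R2 =
    chain_int (low_chain R1 R2 (depth n K)) (core L beta z n)
    - Ci * Csum (fun k => Jint r (fun e => Phi L beta z e * pair_coef L beta z n k e)) K.
Proof.
destruct Hgam as [HC1 [[T0 HT0] [Ha Hbl]]].
assert (B0 := Cmod_ge_0 beta). assert (n0 := pos_INR n). assert (Bb := Re_le_Cmod beta).
assert (Bi := im_le_Cmod beta).
(* All upper poles have real part [Im beta], so the second bound puts them between the vertical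
   sides. *)
exists (Rmax T0 (Cmod beta + 1)). intros R1 R2 H1 H2.
assert (H1a := Rle_trans _ _ _ (Rmax_l _ _) H1). assert (H1b := Rle_trans _ _ _ (Rmax_r _ _) H1).
assert (H2a := Rle_trans _ _ _ (Rmax_l _ _) H2). assert (H2b := Rle_trans _ _ _ (Rmax_r _ _) H2).
assert (Cg : cont_on gam (- R1) R2).
{ intros t _. destruct (arc_ok_gam gam t t HC1 t) as [G1 _].
  - unfold on_arc; simpl. rewrite Rmin_left, Rmax_left; lra.
  - exact (is_Rderive_continuous _ _ _ G1). }
destruct (bounded_on gam (- R1) R2 ltac:(lra) Cg) as [Bg [HBg0 HBg]].
destruct (nfloor_ex (Bg + Cmod beta + 2)) as [N0 [_ HN0]]; [lra|].
set (N := S N0). assert (HN : (Bg + Cmod beta + 2 <= INR N)%R) by (unfold N; rewrite S_INR; lra).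
destruct (nfloor_ex (Bg + Cmod beta + 2)) as [K0 [_ HK0]]; [lra|].
exists (S K0). intros K HK. assert (HKr := le_INR _ _ HK). rewrite S_INR in HKr.
set (Y := depth n K). assert (HY : Y = ((INR n + 1) / 2 + INR K - / 2)%R) by reflexivity.
set (a := ((INR n + 1) / 2)%R) in *.
(* The top of the strip is halfway between the upper poles of index [N - 1] and [N], and above the
   whole compact part of the contour by the choice of [N]. *)
set (Y' := (a - Re beta + INR N - / 2)%R).
(* The margin 1/4 makes the open strip contain the bottom segment at depth [Y], while the next lower
   pole, at depth [Y + 1/2], stays outside. *)
pose (D := fun nu : C => (- (Y + / 4) < Im nu < Y')%R).
assert (HY' : (Bg < Y')%R) by (unfold Y', a; lra).
assert (HYg : (Bg < Y)%R) by (rewrite HY; unfold a; lra).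
destruct Hrad as [[Hr0 Hr1] Hr2].
assert (Imsub : forall w v : C, Im (w - v) = (Im w - Im v)%R).
{ intros w v. unfold Cminus. rewrite im_plus, im_opp. ring. }
assert (E := contour_deformation gam T0 R1 R2 HC1 HT0 ltac:(lra) ltac:(lra) H1a H2a D Y r
  (core_poles L beta n K N) (points (lower_pole n) K) (core_regular L beta z n K N) (core L beta z n)).
rewrite E; clear E.
- f_equal. unfold chain_int. rewrite chain_sum_circles.
  rewrite (Csum_ext _ (fun k => Ci * Jint r (fun e => Phi L beta z e * pair_coef L beta z n k e))).
  + apply (Csum_scal Ci (fun k => Jint r (fun e => Phi L beta z e * pair_coef L beta z n k e))).
  + intros k. apply (arc_int_near_pole L beta z n k r r' z_neq_0); [now repeat split|exact Hr].
- lra.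
- lra.
- intros w [W1 W2]. exists (Rmin (Im w + (Y + / 4)) (Y' - Im w)). split; [apply Rmin_pos; lra|].
  intros v Hv. assert (V1 := Rlt_le_trans _ _ _ Hv (Rmin_l _ _)). assert (V2 := Rlt_le_trans _ _ _ Hv (Rmin_r _ _)).
  assert (V := im_le_Cmod (v - w)). rewrite Imsub in V. apply Rabs_le_between in V. unfold D. lra.
- intros w v s [W1 W2] [V1 V2] Hs. unfold D, seg. rewrite im_plus, im_scal_l, Imsub.
  destruct (Req_dec s 0) as [->|Hs0]; [lra|].
  assert (s * (- (Y + / 4)) < s * Im v)%R by (apply Rmult_lt_compat_l; lra).
  assert (s * Im v < s * Y')%R by (apply Rmult_lt_compat_l; lra).
  assert ((1 - s) * (- (Y + / 4)) <= (1 - s) * Im w)%R by (apply Rmult_le_compat_l; lra).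
  assert ((1 - s) * Im w <= (1 - s) * Y')%R by (apply Rmult_le_compat_l; lra). lra.
- intros t Ht. assert (V := im_le_Cmod (gam t)). specialize (HBg t Ht). apply Rabs_le_between in V. unfold D. lra.
- intros p Hp. destruct (low_chain_points R1 R2 Y p ltac:(lra) ltac:(lra) ltac:(lra) Hp) as [P1 _]. unfold D. lra.
- intros q t Hq. apply In_points in Hq. destruct Hq as [k [Hk ->]].
  assert (Hk' : (INR k + 1 <= INR K)%R) by (rewrite <- S_INR; apply le_INR; lia).
  destruct (lower_pole_parts n k) as [_ LI]. fold a in LI. assert (k0 := pos_INR k).
  unfold D. rewrite im_plus, LI.
  assert (V := im_le_Cmod (Ci * circle 0 r t)). rewrite Cmod_mult, Cmod_Ci in V.
  replace (circle 0 r t) with (circle 0 r t - 0) in V at 2 by ring.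
  rewrite Cmod_circle_sub in V by lra. apply Rabs_le_between in V.
  unfold a in *. lra.
- apply FinFun.Injective_map_NoDup; [|apply seq_NoDup]. intros k k' Ek.
  destruct (lower_pole_parts n k) as [_ L1]. destruct (lower_pole_parts n k') as [_ L2].
  rewrite Ek, L2 in L1. apply INR_eq. lra.
- intros q q' Hq Hq' Hn. apply In_points in Hq. destruct Hq as [k [_ ->]].
  apply In_points in Hq'. destruct Hq' as [k' [_ ->]].
  assert (V := im_le_Cmod (lower_pole n k - lower_pole n k')). rewrite Imsub in V.
  destruct (lower_pole_parts n k) as [_ L1]. destruct (lower_pole_parts n k') as [_ L2]. rewrite L1, L2 in V.
  replace (- ((INR n + 1) / 2) - INR k - (- ((INR n + 1) / 2) - INR k'))%R with (INR k' - INR k)%R in V by ring.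
  rewrite !INR_IZR_INZ, <- minus_IZR, <- abs_IZR in V.
  assert (Hkk : k' <> k) by (intros ->; now apply Hn).
  assert (1 <= IZR (Z.abs (Z.of_nat k' - Z.of_nat k)))%R by (apply IZR_le; lia). lra.
- intros p Hp. apply In_rep in Hp. apply in_app_or in Hp. destruct Hp as [Hp|Hp].
  + assert (Hp' := Hp). apply In_points in Hp. destruct Hp as [k [Hk ->]].
    assert (Hk' : (INR k + 1 <= INR K)%R) by (rewrite <- S_INR; apply le_INR; lia).
    destruct (lower_pole_parts n k) as [LR LI]. fold a in LI. assert (k0 := pos_INR k).
    split; [unfold D; rewrite LI; unfold a in *; lra|].
    split; [unfold inside; rewrite LR, LI; unfold a in *; lra|].
    right. split; [apply Hbl|exact Hp'].
  + apply In_points in Hp. destruct Hp as [k [Hk ->]].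
    assert (Hk' : (INR k + 1 <= INR N)%R) by (rewrite <- S_INR; apply le_INR; lia).
    destruct (upper_pole_parts beta n k) as [UR UI]. fold a in UI. assert (k0 := pos_INR k).
    apply Rabs_le_between in Bi.
    split; [unfold D; rewrite UI; unfold Y', a in *; lra|].
    split; [unfold inside; rewrite UR, UI; unfold a in *; lra|].
    left. split; [apply Ha|]. intros q Hq. apply In_points in Hq. destruct Hq as [k' [_ ->]].
    (* An upper and a lower pole differ by [- Ci] times [beta] minus this integer. Here it matters
       that [beta] is not an integer: no upper pole falls into a circle about a lower one. *)
    specialize (Hr2 (Z.of_nat n + 1 + Z.of_nat k + Z.of_nat k')%Z).
    replace (upper_pole beta n k - lower_pole n k')
      with (- Ci * (beta - IZR (Z.of_nat n + 1 + Z.of_nat k + Z.of_nat k'))).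
    { rewrite Cmod_mult, Cmod_opp, Cmod_Ci. lra. }
    unfold upper_pole, lower_pole. rewrite half_succ_nat, !plus_IZR, <- !INR_IZR_INZ, !RtoC_plus, RtoC_div, RtoC_plus by lra.
    field.
- apply holomorphic_core_regular.
  + intros w [W1 W2]. exists (Rmin (Im w + (Y + / 4)) (Y' - Im w)). split; [apply Rmin_pos; lra|].
    intros v Hv. assert (V1 := Rlt_le_trans _ _ _ Hv (Rmin_l _ _)). assert (V2 := Rlt_le_trans _ _ _ Hv (Rmin_r _ _)).
    assert (V := im_le_Cmod (v - w)). rewrite Imsub in V. apply Rabs_le_between in V. unfold D. lra.
  + intros nu [W1 W2]. split; apply rGamma_neq_0_Re; unfold Cminus; rewrite half_succ_nat, !re_plus, ?re_opp, !re_RtoC, re_mult;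
      change (Re Ci) with 0%R; change (Im Ci) with 1%R; fold a.
    * unfold Y' in W2. lra.
    * lra.
- intros nu _ _. apply core_factor.
Qed.

Lemma exp_lam_pow (K : nat) : exp (ln (Cmod z ^ 2) * INR K) = ((Cmod z * Cmod z) ^ K)%R.
Proof.
assert (P : (0 < Cmod z ^ 2)%R) by (apply pow_lt; lra).
rewrite Rmult_comm, <- ln_pow, exp_ln by (try exact P; now apply pow_lt).
simpl. now rewrite Rmult_1_r.
Qed.

(** The ends are fixed while [K] grows: the bottom of the rectangle and the tail of the residue
    series both decay like [|z|^(2K)], and what remains is the contribution of the two sides. *)
Lemma core_integral_rate : exists V T : R, (0 < V)%R /\ (1 <= T)%R /\
  forall R1 R2, (T <= R1)%R -> (T <= R2)%R ->
  (Cmod (CInt (fun t => core L beta z n (gam t) * velocity gam t)%C (- R1) R2 - core_value L beta z r n) <=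
   V * exp (- (Re beta * ln R1)) ^ S L + V * exp (- (Re beta * ln R2)) ^ S L)%R.
Proof.
destruct (low_chain_core_bound L beta z n Hb Hz) as [V [B [R0 [HV [HB [HR0 Hlow]]]]]].
destruct core_finite_deformation as [T HT].
destruct (coef_bound L beta r' Hb Hrad) as [M [HM HMb]].
destruct (Phi_bound L beta z r r' Hr (proj2 (proj1 Hrad))) as [P [HP HPb]].
assert (q1 := Cmod_sq_lt_1 z Hz). set (q := (Cmod z * Cmod z)%R) in *.
assert (MM : (0 <= M * M)%R) by (apply Rmult_le_pos; lra).
destruct (Jint_series r r' (Phi L beta z) P (fun k e => pair_coef L beta z n k e) (M * M) q Hr MM q1
  (geometric_pair_coef L beta z r' M n Hrad HMb)
  (fun e He => Ccont_Phi L beta z e r' (proj2 (proj1 Hrad)) He) HPb) as [_ Hrate].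
set (C2 := (2 * PI * r * (P * (M * M / (1 - q))))%R) in *.
assert (HC2 : (0 <= C2)%R).
{ unfold C2. assert (Pi0 := PI_RGT_0). apply Rmult_le_pos; [apply Rmult_le_pos; lra|].
  apply Rmult_le_pos; [lra|]. apply Rdiv_le_0_compat; lra. }
exists V, (Rmax T R0). split; [exact HV|]. split; [eapply Rle_trans; [exact HR0|apply Rmax_r]|].
intros R1 R2 H1 H2.
assert (H1a := Rle_trans _ _ _ (Rmax_l _ _) H1). assert (H1b := Rle_trans _ _ _ (Rmax_r _ _) H1).
assert (H2a := Rle_trans _ _ _ (Rmax_l _ _) H2). assert (H2b := Rle_trans _ _ _ (Rmax_r _ _) H2).
destruct (HT R1 R2 H1a H2a) as [K0 HK0].
apply le_epsilon. intros eps Heps.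
destruct (nfloor_ex (8 * Cmod beta + 8)) as [K1 [_ HK1]]; [generalize (Cmod_ge_0 beta); lra|].
(* The total coefficient of [q^K]: the width times the bottom bound, plus the constant of the series
   tail. *)
set (W := ((R1 + R2) * B + C2)%R).
assert (HW : (0 <= W)%R) by (unfold W; assert (0 <= (R1 + R2) * B)%R by (apply Rmult_le_pos; lra); lra).
destruct (pow_small q (eps / (W + 1)) q1) as [K2 HK2]; [apply Rdiv_lt_0_compat; lra|].
set (K := max (max K0 (S K1)) K2).
assert (HKb : (8 * Cmod beta + 8 <= INR K)%R).
{ apply Rle_trans with (INR (S K1)); [rewrite S_INR; lra|]. apply le_INR. unfold K. lia. }
specialize (HK0 K ltac:(unfold K; lia)). specialize (HK2 K ltac:(unfold K; lia)).
specialize (Hlow R1 R2 K H1b H2b HKb). specialize (Hrate K).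
rewrite exp_lam_pow in Hlow. fold q in Hlow.
rewrite HK0. unfold core_value, pair_series.
set (low := chain_int _ _) in *. set (cs := Csum _ K) in *. set (J := Jint r _) in *.
replace (low - Ci * cs - - Ci * J) with (low + - (Ci * (cs - J))) by ring.
eapply Rle_trans; [apply Cmod_triangle|]. rewrite Cmod_opp, Cmod_mult, Cmod_Ci, Rmult_1_l.
assert (Q : ((W + 1) * q ^ K <= eps)%R).
{ apply Rle_trans with ((W + 1) * (eps / (W + 1)))%R; [apply Rmult_le_compat_l; lra|right; field; lra]. }
assert (q0 : (0 <= q ^ K)%R) by (apply pow_le; lra).
assert (E : ((W + 1) * q ^ K = (R1 + R2) * (B * q ^ K) + C2 * q ^ K + q ^ K)%R) by (unfold W; ring).
lra.
Qed.

(** The two ends tend to infinity independently, as the product filter requires, because the rate is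
    a sum of a term in [R1] and a term in [R2]. *)
Lemma core_integral : @is_RInt_gen C_R_NormedModule (fun t => core L beta z n (gam t) * velocity gam t)
  (Rbar_locally m_infty) (Rbar_locally p_infty) (core_value L beta z r n).
Proof.
destruct core_integral_rate as [V [T [HV [HT H]]]].
intros Q HQ. apply locally_C in HQ. destruct HQ as [eps HQ].
(* For [x >= exp (k / Re beta)] one has [x^(- Re beta) <= eps / (4 V)]; as this power is at most 1,
   its [(L+1)]-st power is no larger. *)
set (k := (- ln (eps / (4 * V)))%R). set (Rb := Rmax T (exp (k / Re beta))).
assert (Heps := cond_pos eps).
assert (Small : forall x, (Rb <= x)%R -> (V * exp (- (Re beta * ln x)) ^ S L <= eps / 4)%R).
{ intros x Hx. assert (X1 := Rle_trans _ _ _ (Rmax_l _ _) Hx). assert (X2 := Rle_trans _ _ _ (Rmax_r _ _) Hx).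
  assert (Lx : (k / Re beta <= ln x)%R).
  { rewrite <- (ln_exp (k / Re beta)). apply ln_le; [apply exp_pos|exact X2]. }
  apply (Rmult_le_compat_l (Re beta)) in Lx; [|lra].
  replace (Re beta * (k / Re beta))%R with k in Lx by (field; lra).
  destruct (exp_neg_ln_le (Re beta) x x Hb ltac:(lra) ltac:(lra)) as [_ e1].
  assert (e2 : (exp (- (Re beta * ln x)) <= eps / (4 * V))%R).
  { rewrite <- (exp_ln (eps / (4 * V))) by (apply Rdiv_lt_0_compat; lra). apply exp_le_mono. unfold k in Lx. lra. }
  set (e := exp (- (Re beta * ln x))) in *. assert (e0 : (0 < e)%R) by apply exp_pos.
  apply Rle_trans with (V * e)%R.
  - apply Rmult_le_compat_l; [lra|].
    assert (eL : (e ^ L <= 1)%R) by (rewrite <- (pow1 L); apply pow_incr; lra).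
    assert (e * e ^ L <= e * 1)%R by (apply Rmult_le_compat_l; lra). simpl pow. lra.
  - apply Rle_trans with (V * (eps / (4 * V)))%R; [apply Rmult_le_compat_l; lra|right; field; lra]. }
apply (Filter_prod _ _ _ (fun x => (x < - Rb)%R) (fun x => (Rb < x)%R)).
- now exists (- Rb)%R.
- now exists Rb.
- intros x y Hx Hy. exists (CInt (fun t => core L beta z n (gam t) * velocity gam t) x y). split.
  + apply is_CInt. intros t _. apply continuous_core_gam.
  + apply HQ. assert (Tb : (T <= Rb)%R) by apply Rmax_l.
    assert (G := H (- x)%R y ltac:(lra) ltac:(lra)). rewrite Ropp_involutive in G.
    assert (S1 := Small (- x)%R ltac:(lra)). assert (S2 := Small y ltac:(lra)).
    change (Cmod (CInt (fun t => core L beta z n (gam t) * velocity gam t)%C x y - core_value L beta z r n) < eps)%R.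
    lra.
Qed.

End Contour.

(** * Summation over n *)

Lemma Csum_swap (x : nat -> nat -> C) (N K : nat) :
  Csum (fun n => Csum (x n) K) N = Csum (fun k => Csum (fun n => x n k) N) K.
Proof.
induction N as [|N IH].
- simpl. induction K as [|K IHK]; simpl; [reflexivity|]. rewrite <- IHK. ring.
- simpl Csum at 1. rewrite IH. symmetry. apply (Csum_plus (fun k => Csum (fun n => x n k) N) (x N)).
Qed.

Lemma Cmod_Csum_le (a : nat -> C) (c rho : R) (K : nat) : (0 <= c)%R -> (0 <= rho < 1)%R ->
  (forall k, (Cmod (a k) <= c * rho ^ k)%R) -> (Cmod (Csum a K) <= c / (1 - rho))%R.
Proof.
intros Hc Hr Ha. assert (H := Csum_tail a c rho 0 K Hc Hr Ha ltac:(lia)). simpl in H.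
replace (Csum a K - 0) with (Csum a K) in H by ring. eapply Rle_trans; [exact H|].
unfold Rdiv. apply Rmult_le_compat_r; [left; apply Rinv_0_lt_compat; lra|].
assert (0 <= c * rho ^ K)%R by (apply Rmult_le_pos; [lra|apply pow_le; lra]). lra.
Qed.

Lemma Clim_of_geometric_bound (u : nat -> C) (l : C) (B rho : R) : (0 <= B)%R -> (0 <= rho < 1)%R ->
  (forall n, (Cmod (u n - l) <= B * rho ^ n)%R) -> Clim u l.
Proof.
intros HB Hr H eps Heps. destruct (pow_small rho (eps / (B + 1)) Hr) as [N HN]; [apply Rdiv_lt_0_compat; lra|].
exists N. intros n Hn. eapply Rle_lt_trans; [apply H|]. specialize (HN n Hn).
assert (P : (0 <= rho ^ n)%R) by (apply pow_le; lra).
apply (Rmult_lt_compat_l (B + 1)) in HN; [|lra].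
replace ((B + 1) * (eps / (B + 1)))%R with eps in HN by (field; lra). lra.
Qed.

(** The square partial sums are symmetric in the two indices, so this limit yields the exchange of
    summations. The error splits into the row tails beyond [N] and the tail of the series of row
    sums. *)
Lemma double_sum_square (x : nat -> nat -> C) (c rho : R) : (0 <= c)%R -> (0 <= rho < 1)%R ->
  (forall n k, (Cmod (x n k) <= c * rho ^ n * rho ^ k)%R) ->
  Clim (fun N => Csum (fun n => Csum (x n) N) N) (CSeries (fun n => CSeries (x n))).
Proof.
intros Hc Hr Hx.
assert (P : forall n, (0 <= c * rho ^ n)%R) by (intros n; apply Rmult_le_pos; [lra|apply pow_le; lra]).
assert (c' : (0 <= c / (1 - rho))%R) by (apply Rdiv_le_0_compat; lra).
assert (S1 : forall n, (Cmod (CSeries (x n)) <= c / (1 - rho) * rho ^ n)%R).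
{ intros n. eapply Rle_trans; [apply (Cmod_CSeries_le (x n) (c * rho ^ n) rho (P n) Hr (Hx n))|].
  right. field. lra. }
destruct (Cseries_geom (fun n => CSeries (x n)) _ rho c' Hr S1) as [_ S2].
apply (Clim_of_geometric_bound _ _ (2 * (c / (1 - rho) / (1 - rho))) rho); [|exact Hr|].
{ apply Rmult_le_pos; [lra|]. apply Rdiv_le_0_compat; lra. }
intros N.
replace (Csum (fun n => Csum (x n) N) N - CSeries (fun n => CSeries (x n)))
  with (Csum (fun n => Csum (x n) N - CSeries (x n)) N +
    (Csum (fun n => CSeries (x n)) N - CSeries (fun n => CSeries (x n)))).
2: { transitivity (Csum (fun n => Csum (x n) N - CSeries (x n) + CSeries (x n)) N - CSeries (fun n => CSeries (x n))).
     - rewrite (Csum_plus (fun n => Csum (x n) N - CSeries (x n)) (fun n => CSeries (x n))). ring.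
     - f_equal. apply Csum_ext. intros k. ring. }
eapply Rle_trans; [apply Cmod_triangle|].
assert (T1 : (Cmod (Csum (fun n => Csum (x n) N - CSeries (x n))%C N) <= c / (1 - rho) * rho ^ N / (1 - rho))%R).
{ apply Cmod_Csum_le; [apply Rmult_le_pos; [exact c'|apply pow_le; lra]|exact Hr|]. intros n.
  destruct (Cseries_geom (x n) (c * rho ^ n) rho (P n) Hr (Hx n)) as [_ H].
  eapply Rle_trans; [apply H|]. right. field. lra. }
specialize (S2 N).
replace (2 * (c / (1 - rho) / (1 - rho)) * rho ^ N)%R
  with (c / (1 - rho) * rho ^ N / (1 - rho) + c / (1 - rho) * rho ^ N / (1 - rho))%R by (field; lra).
lra.
Qed.

Lemma CSeries_swap (x : nat -> nat -> C) (c rho : R) : (0 <= c)%R -> (0 <= rho < 1)%R ->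
  (forall n k, (Cmod (x n k) <= c * rho ^ n * rho ^ k)%R) ->
  CSeries (fun n => CSeries (x n)) = CSeries (fun k => CSeries (fun n => x n k)).
Proof.
intros Hc Hr Hx. apply (Clim_is_unique (fun N => Csum (fun n => Csum (x n) N) N)).
- now apply (double_sum_square x c rho).
- apply (Clim_ext_from 0 (fun N => Csum (fun k => Csum (fun n => x n k) N) N)).
  + intros N _. symmetry. apply Csum_swap.
  + apply (double_sum_square (fun k n => x n k) c rho Hc Hr). intros k n.
    eapply Rle_trans; [apply Hx|]. right. ring.
Qed.

Lemma CSeries_scal (c : C) (a : nat -> C) (m rho : R) : (0 <= m)%R -> (0 <= rho < 1)%R ->
  (forall k, (Cmod (a k) <= m * rho ^ k)%R) -> CSeries (fun k => c * a k) = c * CSeries a.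
Proof.
intros Hm Hr Ha. apply CSeries_unique, is_Cseries_scal. now apply (Cseries_geom a m rho).
Qed.

(* With the tails [A k] of [sum a] and [B k] of [sum b],
   [a k * B (k + 1) + b k * A k = A k * B k - A (k + 1) * B (k + 1)] telescopes. *)
Lemma CSeries_product_diagonals (a b : nat -> C) (m rho : R) : (0 <= m)%R -> (0 <= rho < 1)%R ->
  (forall k, (Cmod (a k) <= m * rho ^ k)%R) -> (forall k, (Cmod (b k) <= m * rho ^ k)%R) ->
  CSeries (fun n => CSeries (fun k => a (n + k)%nat * b k)) +
  CSeries (fun n => CSeries (fun k => b (S n + k)%nat * a k)) = CSeries a * CSeries b.
Proof.
intros Hm Hr Ha Hb.
assert (Pw : forall n, (0 <= rho ^ n <= 1)%R).
{ intros n. split; [apply pow_le; lra|]. rewrite <- (pow1 n). apply pow_incr. lra. }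
assert (mm : (0 <= m * m)%R) by (apply Rmult_le_pos; lra).
assert (Dom : forall u v : nat -> C, (forall k, (Cmod (u k) <= m * rho ^ k)%R) -> (forall k, (Cmod (v k) <= m * rho ^ k)%R) ->
  forall j n k, (Cmod (u (j + (n + k))%nat * v k)%C <= m * m * rho ^ n * rho ^ k)%R).
{ intros u v Hu Hv j n k. rewrite Cmod_mult.
  apply Rle_trans with ((m * (rho ^ n * rho ^ k)) * (m * 1))%R; [|right; ring].
  apply Rmult_le_compat; try apply Cmod_ge_0.
  - eapply Rle_trans; [apply Hu|]. apply Rmult_le_compat_l; [lra|]. rewrite !pow_add.
    rewrite <- (Rmult_1_l (rho ^ n * rho ^ k)) at 2. apply Rmult_le_compat_r; [|apply Pw].
    apply Rmult_le_pos; apply Pw.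
  - eapply Rle_trans; [apply Hv|]. apply Rmult_le_compat_l; [lra|apply Pw]. }
set (tl := fun (u : nat -> C) k => CSeries (fun n => u (n + k)%nat)).
assert (Ub : forall u : nat -> C, (forall k, (Cmod (u k) <= m * rho ^ k)%R) -> forall k n,
  (Cmod (u (n + k)%nat) <= m * rho ^ k * rho ^ n)%R).
{ intros u Hu k n. eapply Rle_trans; [apply Hu|]. rewrite pow_add. right. ring. }
assert (mk : forall k, (0 <= m * rho ^ k)%R) by (intros k; apply Rmult_le_pos; [lra|apply Pw]).
assert (Tstep : forall u : nat -> C, (forall k, (Cmod (u k) <= m * rho ^ k)%R) -> forall k,
  tl u k = u k + tl u (S k)).
{ intros u Hu k. destruct (Cseries_geom _ _ rho (mk k) Hr (Ub u Hu k)) as [S1 _].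
  apply (proj1 (is_Cseries_shift (fun n => u (n + k)%nat) (tl u k))) in S1. simpl in S1.
  assert (E : tl u (S k) = tl u k - u k).
  { apply CSeries_unique. 
    replace (fun n => u (n + S k)%nat) with (fun n => u (S (n + k))%nat); [exact S1|].
    apply functional_extensionality. intros n. f_equal. lia. }
  rewrite E. ring. }
assert (Tb : forall u : nat -> C, (forall k, (Cmod (u k) <= m * rho ^ k)%R) -> forall k,
  (Cmod (tl u k) <= m / (1 - rho) * rho ^ k)%R).
{ intros u Hu k. eapply Rle_trans; [apply (Cmod_CSeries_le _ _ rho (mk k) Hr (Ub u Hu k))|]. right. field. lra. }
(* After the exchange the inner sum over [n] is a tail of the series of [a], respectively of [b]
   from index [k + 1] on. *)
rewrite (CSeries_swap (fun n k => a (n + k)%nat * b k) (m * m) rho mm Hr (Dom a b Ha Hb 0%nat)).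
rewrite (CSeries_swap (fun n k => b (S n + k)%nat * a k) (m * m) rho mm Hr (Dom b a Hb Ha 1%nat)).
rewrite (CSeries_ext _ (fun k => b k * tl a k)).
2: { intros k. rewrite (CSeries_ext _ (fun n => b k * a (n + k)%nat)) by (intros n; ring).
     apply (CSeries_scal _ _ _ rho (mk k) Hr (Ub a Ha k)). }
rewrite (CSeries_ext (fun k => CSeries (fun n => b (S n + k)%nat * a k)) (fun k => a k * tl b (S k))).
2: { intros k. rewrite (CSeries_ext _ (fun n => a k * b (n + S k)%nat)).
     - apply (CSeries_scal _ _ _ rho (mk (S k)) Hr (Ub b Hb (S k))).
     - intros n. replace (S n + k)%nat with (n + S k)%nat by lia. ring. }
set (m' := (m / (1 - rho))%R) in *.
assert (m'0 : (0 <= m')%R) by (unfold m'; apply Rdiv_le_0_compat; lra).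
assert (mm' : (0 <= m * m')%R) by (apply Rmult_le_pos; lra).
destruct (Cseries_geom (fun k => b k * tl a k) (m * m') rho mm' Hr) as [S1 _].
{ intros k. rewrite Cmod_mult. apply Rle_trans with ((m * rho ^ k) * (m' * 1))%R; [|right; ring].
  apply Rmult_le_compat; try apply Cmod_ge_0; [apply Hb|].
  eapply Rle_trans; [apply (Tb a Ha)|]. apply Rmult_le_compat_l; [lra|apply Pw]. }
destruct (Cseries_geom (fun k => a k * tl b (S k)) (m * m') rho mm' Hr) as [S2 _].
{ intros k. rewrite Cmod_mult. apply Rle_trans with ((m * rho ^ k) * (m' * 1))%R; [|right; ring].
  apply Rmult_le_compat; try apply Cmod_ge_0; [apply Ha|].
  eapply Rle_trans; [apply (Tb b Hb)|]. apply Rmult_le_compat_l; [lra|apply Pw]. }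
assert (S3 := is_Cseries_plus _ _ _ _ S1 S2). apply CSeries_unique in S3. rewrite <- S3.
assert (A0 : forall u, tl u 0%nat = CSeries u).
{ intros u. apply CSeries_ext. intros n. f_equal. lia. }
apply CSeries_unique, is_Cseries_Clim.
apply (Clim_of_geometric_bound _ _ (m' * m') rho); [now apply Rmult_le_pos|exact Hr|].
intros K.
assert (E : Csum (fun k => b k * tl a k + a k * tl b (S k)) K = CSeries a * CSeries b - tl a K * tl b K).
{ induction K as [|K IH].
  - simpl. rewrite !A0. ring.
  - simpl. rewrite IH, (Tstep a Ha K), (Tstep b Hb K). ring. }
rewrite E. replace (CSeries a * CSeries b - tl a K * tl b K - CSeries a * CSeries b) with (- (tl a K * tl b K)) by ring.
rewrite Cmod_opp, Cmod_mult.
apply Rle_trans with ((m' * rho ^ K) * (m' * 1))%R; [|right; ring].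
apply Rmult_le_compat; try apply Cmod_ge_0; [apply (Tb a Ha)|].
eapply Rle_trans; [apply (Tb b Hb)|]. apply Rmult_le_compat_l; [lra|apply Pw].
Qed.

Lemma F_coef_coef (L : nat) (beta e z : C) (k : nat) : F_coef L beta e z k = coef L beta k e * z ^ k.
Proof.
unfold F_coef, coef, gratio, Cdiv. rewrite !Gamma_rGamma, !Cinv_pow, !Cinv_inv, Cpow_mult_l.
replace (1 - beta + INR k - e) with (1 + INR k - e - beta) by ring. ring.
Qed.

Section Sums.

Variables (L : nat) (beta z : C) (r r' M : R).
Hypotheses (Hb : (0 < Re beta)%R) (Hz : (0 < Cmod z < 1)%R) (Hrad : radius beta r') (Hr : (0 < r < r')%R)
  (HM : (0 < M)%R) (HMb : forall k e, disc 0 r' e -> (Cmod (coef L beta k e) <= M)%R).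

Lemma geometric_F (y : C) : Cmod y = Cmod z ->
  geometric r' (fun k e => F_coef L beta e y k) M (Cmod z).
Proof.
intros Hy. split.
- intros k e He. apply (continuous_ext (fun e => coef L beta k e * y ^ k)).
  { intros w. symmetry. apply F_coef_coef. }
  apply continuous_Cmult; [|apply continuous_Cconst].
  apply (holomorphic_cont (disc 0 r')); [now apply holomorphic_coef|exact He].
- intros k e He. rewrite F_coef_coef, Cmod_mult, Cmod_pow, Hy. apply Rmult_le_compat_r; [apply pow_le; lra|].
  now apply HMb.
Qed.

Lemma F_series (y e : C) : Cmod y = Cmod z -> disc 0 r' e ->
  is_Cseries (F_coef L beta e y) (F L beta e y).
Proof.
intros Hy He. apply (Cseries_geom _ M (Cmod z)); [lra|lra|]. intros k. now apply (geometric_F y Hy).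
Qed.

Lemma holomorphic_F (y : C) : Cmod y = Cmod z -> holomorphic (disc 0 r') (fun e => F L beta e y).
Proof.
intros Hy.
apply (holomorphic_limit (disc 0 r') (fun K e => Csum (fun k => F_coef L beta e y k) K)).
intros e He. destruct (Copen_disc 0 r' e He) as [d [Hd Hin]]. exists d. split; [exact Hd|]. split.
- intros K. induction K as [|K IH]; [apply (holomorphic_const _ (RtoC 0))|].
  apply (holomorphic_plus _ (fun e => Csum (fun k => F_coef L beta e y k) K)); [exact IH|].
  apply (holomorphic_ext _ (fun e => coef L beta K e * y ^ K)); [apply Copen_disc| |].
  + intros w _. symmetry. apply F_coef_coef.
  + apply (holomorphic_mult _ (coef L beta K)); [|apply holomorphic_const].
    apply (holomorphic_sub (disc 0 r')); [exact Hin|now apply holomorphic_coef].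
- intros eps Heps.
  destruct (unif_lim_Csum r' (fun k e => F_coef L beta e y k) M (Cmod z) ltac:(lra) ltac:(lra) (geometric_F y Hy) eps Heps)
    as [N HN].
  exists N. intros n w Hn Hw. apply HN; [exact Hn|now apply Hin].
Qed.

Let q1 := Cmod_sq_lt_1 z Hz.
Let MM : (0 <= M * M)%R.
Proof. apply Rmult_le_pos; lra. Qed.

Lemma geometric_diagonals (y : C) (j : nat) : Cmod y = Cmod z ->
  geometric r' (fun n e => y ^ (j + n) * pair_series L beta z (j + n) e) (M * M / (1 - Cmod z * Cmod z)) (Cmod z).
Proof.
intros Hy. split.
- intros n e He. apply continuous_Cmult; [apply continuous_Cconst|].
  apply (Ccont_geometric r' (fun k e => pair_coef L beta z (j + n) k e) (M * M) (Cmod z * Cmod z)); try assumption.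
  now apply geometric_pair_coef.
- intros n e He. rewrite Cmod_mult, Cmod_pow, Hy, Rmult_comm. apply Rmult_le_compat.
  + apply Cmod_ge_0.
  + apply pow_le. lra.
  + apply Cmod_CSeries_le; try assumption. intros k.
    now apply (geometric_pair_coef L beta z r' M (j + n) Hrad HMb).
  + rewrite pow_add. rewrite <- (Rmult_1_l (Cmod z ^ n)) at 2. apply Rmult_le_compat_r; [apply pow_le; lra|].
    rewrite <- (pow1 j). apply pow_incr. lra.
Qed.

(** [z^n (z zbar)^k = z^(n+k) zbar^k], so the [n]-th pair series runs along the [n]-th diagonal of
    the product. The first sum includes the main diagonal; hence the offset 1 in the second. *)
Lemma diagonals_sum (e : C) : disc 0 r' e ->
  CSeries (fun n => z ^ (0 + n) * pair_series L beta z (0 + n) e) +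
  CSeries (fun n => Cconj z ^ (1 + n) * pair_series L beta z (1 + n) e) =
  F L beta e z * F L beta e (Cconj z).
Proof.
intros He. unfold F.
rewrite <- (CSeries_product_diagonals (F_coef L beta e z) (F_coef L beta e (Cconj z)) M (Cmod z)).
- f_equal; apply CSeries_ext; intros n; unfold pair_series;
    rewrite <- (CSeries_scal _ _ (M * M) (Cmod z * Cmod z) MM q1) by
      (intros k; now apply (geometric_pair_coef L beta z r' M _ Hrad HMb));
    apply CSeries_ext; intros k; rewrite !F_coef_coef; unfold pair_coef; rewrite Cpow_mult_l.
  + rewrite (Cpow_add_r z n k). simpl (0 + n)%nat. ring.
  + change (S n + k)%nat with (1 + n + k)%nat. rewrite (Cpow_add_r (Cconj z) (1 + n) k). ring.
- lra.
- lra.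
- intros k. now apply (geometric_F z eq_refl).
- intros k. now apply (geometric_F (Cconj z) (Cmod_conj z)).
Qed.

(** Stated for [y] and [j] to cover both [z] with [n >= 0] and the conjugate of [z] with [n >= 1].
    All terms are integrals over the same circle with the same [Phi], so the sum moves inside. *)
Lemma core_value_series (y : C) (j : nat) : Cmod y = Cmod z ->
  is_Cseries (fun n => y ^ (j + n) * core_value L beta z r (j + n))
    (- Ci * Jint r (fun e => Phi L beta z e * CSeries (fun n => y ^ (j + n) * pair_series L beta z (j + n) e))).
Proof.
intros Hy. assert (Hr4 := proj2 (proj1 Hrad)).
destruct (Phi_bound L beta z r r' Hr Hr4) as [P [HP HPb]].
assert (c0 : (0 <= M * M / (1 - Cmod z * Cmod z))%R).
{ apply Rdiv_le_0_compat; [exact MM|]. destruct q1. lra. }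
destruct (Jint_series r r' (Phi L beta z) P (fun n e => y ^ (j + n) * pair_series L beta z (j + n) e) _ (Cmod z) Hr
  c0 ltac:(lra) (geometric_diagonals y j Hy)
  (fun e He => Ccont_Phi L beta z e r' Hr4 He) HPb) as [S1 _].
apply (is_Cseries_scal (- Ci)) in S1.
match goal with |- is_Cseries ?f ?l => match type of S1 with is_Cseries ?g _ => replace f with g; [exact S1|] end end.
apply functional_extensionality. intros n. unfold core_value.
rewrite (Jint_ext r r' _ (fun e => y ^ (j + n) * (Phi L beta z e * pair_series L beta z (j + n) e)) Hr)
  by (intros e _; ring).
rewrite (Jint_scal r r' _ (fun e => Phi L beta z e * pair_series L beta z (j + n) e) Hr); [ring|].
intros e He. apply continuous_Cmult; [now apply (Ccont_Phi L beta z e r')|].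
apply (Ccont_geometric r' (fun k e => pair_coef L beta z (j + n) k e) (M * M) (Cmod z * Cmod z)); try assumption.
- now apply geometric_pair_coef.
- apply He.
Qed.

(** Removes the case distinction at 0: reflection and one step of the functional equation give an
    expression that is visibly holomorphic near 0. *)
Lemma div_sin_rGamma (e : C) : disc 0 r' e -> div_sin e = / (PI * (rGamma (1 + e) * rGamma (1 - e))).
Proof.
intros He. unfold div_sin. destruct (Ceq_dec e 0) as [->|N].
- replace (1 + 0) with (RtoC 1) by ring. replace (1 - 0) with (RtoC 1) by ring.
  rewrite rGamma_1, !Cmult_1_r. reflexivity.
- rewrite <- rGamma_reflection, (rGamma_succ e). replace (e + 1) with (1 + e) by ring.
  unfold Cdiv. rewrite !Cinv_mult.
  transitivity ((e * / e) * (/ PI * (/ rGamma (1 + e) * / rGamma (1 - e)))); [ring|].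
  rewrite Cinv_r by exact N. ring.
Qed.

Lemma holomorphic_residue_function : holomorphic (disc 0 r') (residue_function L beta z).
Proof.
assert (Hr4 := proj2 (proj1 Hrad)).
assert (HS : forall c m : C, holomorphic (disc 0 r') (fun e => Csin (c + m * e))).
{ intros c m. apply (holomorphic_comp_affine (fun _ => True)); [|trivial].
  exists Ccos. intros w _. split; [apply is_Cderive_Csin|exact (is_Cderive_continuous _ _ _ (is_Cderive_Ccos w))]. }
unfold residue_function.
apply (holomorphic_mult _ (fun e => div_sin e ^ S L * abs2_pow z (1 / 2 - e) * Csin (PI * (beta + e)) ^ S L * F L beta e z));
  [|apply holomorphic_F, Cmod_conj].
apply (holomorphic_mult _ (fun e => div_sin e ^ S L * abs2_pow z (1 / 2 - e) * Csin (PI * (beta + e)) ^ S L));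
  [|now apply holomorphic_F].
apply (holomorphic_mult _ (fun e => div_sin e ^ S L * abs2_pow z (1 / 2 - e))).
- apply (holomorphic_mult _ (fun e => div_sin e ^ S L)).
  + apply (holomorphic_pow _ div_sin).
    apply (holomorphic_ext _ (fun e => / (PI * (rGamma (1 + 1 * e) * rGamma (1 + - (1) * e))))).
    * apply Copen_disc.
    * intros e He. rewrite (div_sin_rGamma e He).
      replace (1 + 1 * e) with (1 + e) by ring. replace (1 + - (1) * e) with (1 - e) by ring. reflexivity.
    * apply (holomorphic_inv _ (fun e => PI * (rGamma (1 + 1 * e) * rGamma (1 + - (1) * e)))).
      { apply (holomorphic_mult _ (fun _ => RtoC PI)); [apply holomorphic_const|].
        apply (holomorphic_mult _ (fun e => rGamma (1 + 1 * e))); apply holomorphic_rGamma_affine. }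
      intros e He. destruct (disc0_Re e r' He) as [H1 _]. apply Rabs_lt_between in H1.
      apply Cmult_neq_0; [intros Q; apply RtoC_inj in Q; generalize PI_RGT_0; lra|].
      apply Cmult_neq_0; apply rGamma_neq_0_Re.
      { replace (1 + 1 * e) with (1 + e) by ring. rewrite re_plus, re_RtoC. lra. }
      { replace (1 + - (1) * e) with (1 + - e) by ring. rewrite re_plus, re_opp, re_RtoC. lra. }
  + apply (holomorphic_ext _ (fun e => Cexp (1 / 2 * RtoC (ln (Cmod z ^ 2)) + - RtoC (ln (Cmod z ^ 2)) * e))).
    * apply Copen_disc.
    * intros e _. unfold abs2_pow, Rcpow. apply f_equal. ring.
    * apply (holomorphic_comp_affine (fun _ => True)); [apply holomorphic_Cexp|trivial].
- apply (holomorphic_pow _ (fun e => Csin (PI * (beta + e)))).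
  apply (holomorphic_ext _ (fun e => Csin (PI * beta + PI * e))); [apply Copen_disc| |apply HS].
  intros e _. apply f_equal. ring.
Qed.

(** On the circle [Phi] contains [(1 / sin (pi eps))^(L+1)], that is [div_sin^(L+1) / eps^(L+1)].
    The left side is thus the Cauchy integral for the [L]-th derivative of [residue_function] at
    0. *)
Lemma residue_derivative :
  Jint r (fun e => Phi L beta z e * (F L beta e z * F L beta e (Cconj z))) =
  2 * PI * Ci * / INR (fact L) * C_derive_n (residue_function L beta z) L 0.
Proof.
destruct (Cauchy_derive_n (residue_function L beta z) 0 r r' Hr holomorphic_residue_function L 0
  (disc_center 0 r ltac:(lra))) as [E _].
rewrite E. assert (N1 := fact_C_neq_0 L). assert (N2 := two_PI_Ci_neq_0).
transitivity (Cauchy_int (fun t => residue_function L beta z (circle 0 r t) * circle' r t) 0 r (S L) 0).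
- apply CInt_ext. intros t _. set (e := circle 0 r t).
  assert (He : e <> 0) by (apply circle_neq_0; lra).
  replace (e - 0) with e by ring. unfold residue_function, Phi, div_sin.
  destruct (Ceq_dec e 0) as [Q|_]; [contradiction|].
  unfold Cdiv. rewrite !Cpow_mult_l.
  transitivity (Csin (PI * (beta + e)) ^ S L * (/ Csin (PI * e)) ^ S L * abs2_pow z (1 * / 2 - e) *
    (F L beta e z * F L beta e (Cconj z)) * circle' r t * (e ^ S L * / e ^ S L)).
  + rewrite Cinv_r by now apply Cpow_nz. ring.
  + ring.
- set (f := RtoC (INR (fact L))) in *. set (I := Cauchy_int _ _ _ _ _). clearbody I f. assert (N3 : Ci <> 0) by apply Ci_nz. assert (N4 : RtoC PI <> 0) by (intros Q; apply N2; rewrite Q; ring). field. exact (conj N3 (conj N4 N1)).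
Qed.

End Sums.

(** * Both sides of the identity as circle integrals *)

Lemma is_RInt_gen_Cscal (f : R -> C) (c l : C) :
  @is_RInt_gen C_R_NormedModule f (Rbar_locally m_infty) (Rbar_locally p_infty) l ->
  @is_RInt_gen C_R_NormedModule (fun t => c * f t) (Rbar_locally m_infty) (Rbar_locally p_infty) (c * l).
Proof.
intros H P HP.
assert (HQ : @locally C_UniformSpace l (fun y => P (c * y))).
{ assert (Hc : Ccont (fun y => c * y) l) by (apply continuous_Cmult; [apply continuous_Cconst|apply continuous_id]).
  exact (Hc P HP). }
specialize (H _ HQ). unfold filtermapi in *. revert H. apply filter_imp.
intros ab [y [Hy1 Hy2]]. exists (c * y). split; [now apply is_CInt_scal|exact Hy2].
Qed.

Lemma contour_integral_unique (gam : R -> C) (f : C -> C) (l : C) :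
  @is_RInt_gen C_R_NormedModule (fun t => f (gam t) * velocity gam t)
    (Rbar_locally m_infty) (Rbar_locally p_infty) l ->
  contour_integrable gam f /\ contour_integral gam f = l.
Proof.
intros H. split; [now exists l|]. unfold contour_integral.
set (g := fun t => f (gam t) * velocity gam t) in *. clearbody g.
refine (@is_RInt_gen_unique C_R_CompleteNormedModule (Rbar_locally m_infty) (Rbar_locally p_infty) _ _ g l _).
exact H.
Qed.

Section Main.

Variables (L : nat) (beta z : C) (gam : nat -> R -> C) (r r' M : R).
Hypotheses (Hb : (0 < Re beta)%R) (Hz : (0 < Cmod z < 1)%R) (Hrad : radius beta r') (Hr : (0 < r < r')%R)
  (HM : (0 < M)%R) (HMb : forall k e, disc 0 r' e -> (Cmod (coef L beta k e) <= M)%R)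
  (Hgam : forall n : nat, is_ladder_contour beta n (gam n)).

Lemma ladder_contour_integral (n : nat) :
  contour_integrable (gam n) (ladder_integrand L beta z n) /\
  contour_integral (gam n) (ladder_integrand L beta z n) =
    Rcpow 4 (- (beta * INR (S L))) * core_value L beta z r n.
Proof.
apply contour_integral_unique.
replace (fun t => ladder_integrand L beta z n (gam n t) * velocity (gam n) t)
  with (fun t => Rcpow 4 (- (beta * INR (S L))) * (core L beta z n (gam n t) * velocity (gam n) t)).
- apply is_RInt_gen_Cscal. exact (core_integral L beta z n (gam n) r r' Hb Hz Hrad Hr (Hgam n)).
- apply functional_extensionality. intros t. rewrite ladder_integrand_core. ring.
Qed.

Lemma mellin_contour_integral (n : Z) :
  contour_integrable (gam (Z.abs_nat n)) (mellin_integrand L beta z n) /\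
  mellin_term L beta gam z n = twist z n * core_value L beta z r (Z.abs_nat n).
Proof.
apply contour_integral_unique. set (m := Z.abs_nat n).
replace (fun t => mellin_integrand L beta z n (gam m t) * velocity (gam m) t)
  with (fun t => twist z n * (core L beta z m (gam m t) * velocity (gam m) t)).
- apply is_RInt_gen_Cscal. exact (core_integral L beta z m (gam m) r r' Hb Hz Hrad Hr (Hgam m)).
- apply functional_extensionality. intros t.
  destruct (gam_regular beta m (gam m) (Hgam m) t) as [N1 N2].
  rewrite (mellin_integrand_core L beta z n (gam m t)); [fold m; ring| |exact N1|exact N2].
  apply Cmod_gt_0. apply Hz.
Qed.

Lemma mellin_term_nonneg (n : nat) : mellin_term L beta gam z (Z.of_nat n) = z ^ n * core_value L beta z r n.
Proof.
destruct (mellin_contour_integral (Z.of_nat n)) as [_ E]. rewrite E, Zabs2Nat.id. unfold twist.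
destruct (Z_le_gt_dec 0 (Z.of_nat n)); [rewrite Zabs2Nat.id; reflexivity|exfalso; lia].
Qed.

Lemma mellin_term_neg (n : nat) :
  mellin_term L beta gam z (- Z.of_nat (S n)) = Cconj z ^ (S n) * core_value L beta z r (S n).
Proof.
destruct (mellin_contour_integral (- Z.of_nat (S n))) as [_ E]. rewrite E.
unfold twist. replace (Z.abs_nat (- Z.of_nat (S n))) with (S n) by lia.
destruct (Z_le_gt_dec 0 (- Z.of_nat (S n))); [exfalso; lia|reflexivity].
Qed.

Let diagonal (y : C) (j : nat) (e : C) :=
  Phi L beta z e * CSeries (fun n => y ^ (j + n) * pair_series L beta z (j + n) e).

Lemma mellin_series_nonneg :
  is_Cseries (fun n => mellin_term L beta gam z (Z.of_nat n)) (- Ci * Jint r (diagonal z 0)).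
Proof.
assert (H := core_value_series L beta z r r' M Hz Hrad Hr HM HMb z 0 eq_refl).
replace (fun n => mellin_term L beta gam z (Z.of_nat n)) with
  (fun n => z ^ (0 + n) * core_value L beta z r (0 + n)); [exact H|].
apply functional_extensionality. intros n. now rewrite mellin_term_nonneg.
Qed.

Lemma mellin_series_neg :
  is_Cseries (fun n => mellin_term L beta gam z (- Z.of_nat (S n))) (- Ci * Jint r (diagonal (Cconj z) 1)).
Proof.
assert (H := core_value_series L beta z r r' M Hz Hrad Hr HM HMb (Cconj z) 1 (Cmod_conj z)).
replace (fun n => mellin_term L beta gam z (- Z.of_nat (S n))) with
  (fun n => Cconj z ^ (1 + n) * core_value L beta z r (1 + n)); [exact H|].
apply functional_extensionality. intros n. now rewrite mellin_term_neg.
Qed.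

Lemma mellin_sum_series :
  CSeries_Z (mellin_term L beta gam z) = - Ci * Jint r (diagonal z 0) + - Ci * Jint r (diagonal (Cconj z) 1).
Proof.
unfold CSeries_Z. f_equal; apply CSeries_unique; [apply mellin_series_nonneg|apply mellin_series_neg].
Qed.

(** The ladder term of index [n + 1] unites the Mellin terms of [n + 1] and [- (n + 1)], which have
    the same core value. The term 0 occurs only once and is therefore subtracted. *)
Lemma ladder_series :
  is_Cseries (fun n => ladder_term L beta gam z (S n))
    (Rcpow 4 (- (beta * INR (S L))) * (CSeries_Z (mellin_term L beta gam z) - core_value L beta z r 0)).
Proof.
assert (S1 := proj1 (is_Cseries_shift (fun n => mellin_term L beta gam z (Z.of_nat n)) _) mellin_series_nonneg).
assert (S2 := is_Cseries_plus _ _ _ _ S1 mellin_series_neg).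
apply (is_Cseries_scal (Rcpow 4 (- (beta * INR (S L))))) in S2.
assert (E0 := mellin_term_nonneg 0). cbn [Cpow] in E0. rewrite Cmult_1_l in E0.
rewrite mellin_sum_series, <- E0.
match goal with |- is_Cseries ?f ?l => match type of S2 with is_Cseries ?g ?l' =>
  replace f with g; [replace l with l'; [exact S2|]|] end end.
- change (Z.of_nat 0) with 0%Z. ring.
- apply functional_extensionality. intros n. unfold ladder_term.
  destruct (ladder_contour_integral (S n)) as [_ ->]. rewrite mellin_term_nonneg, mellin_term_neg. ring.
Qed.

Lemma ladder_mellin_sum :
  ladder L beta gam z = Rcpow 4 (- (beta * INR (S L))) * CSeries_Z (mellin_term L beta gam z).
Proof.
unfold ladder. rewrite (CSeries_unique _ _ ladder_series).
destruct (ladder_contour_integral 0) as [_ ->]. ring.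
Qed.

Lemma mellin_sum_derivative :
  CSeries_Z (mellin_term L beta gam z) =
  RtoC (2 * PI / INR (fact L)) * C_derive_n (residue_function L beta z) L 0.
Proof.
assert (Hr4 := proj2 (proj1 Hrad)).
assert (c0 : (0 <= M * M / (1 - Cmod z * Cmod z))%R).
{ assert (q1 := Cmod_sq_lt_1 z Hz). apply Rdiv_le_0_compat; [apply Rmult_le_pos|]; lra. }
assert (Cd : forall y j, Cmod y = Cmod z -> forall e, punctured r' e -> Ccont (diagonal y j) e).
{ intros y j Hy e He. unfold diagonal. apply continuous_Cmult; [now apply (Ccont_Phi L beta z e r')|].
  apply (Ccont_geometric r' (fun n e => y ^ (j + n) * pair_series L beta z (j + n) e) _ (Cmod z) e c0 ltac:(lra)).
  - exact (geometric_diagonals L beta z r' M Hz Hrad HM HMb y j Hy).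
  - apply He. }
rewrite mellin_sum_series.
transitivity (- Ci * (Jint r (diagonal z 0) + Jint r (diagonal (Cconj z) 1))); [ring|].
rewrite <- (Jint_plus r r' _ _ Hr (Cd z 0%nat eq_refl) (Cd (Cconj z) 1%nat (Cmod_conj z))).
rewrite (Jint_ext r r' _ (fun e => Phi L beta z e * (F L beta e z * F L beta e (Cconj z))) Hr).
2: { intros e He. rewrite <- (diagonals_sum L beta z r' M Hz Hrad HM HMb e (proj1 He)). unfold diagonal. ring. }
rewrite (residue_derivative L beta z r r' M Hz Hrad Hr HM HMb).
rewrite RtoC_div, RtoC_mult by (apply not_0_INR, fact_neq_0).
set (D := C_derive_n _ _ _). unfold Cdiv.
transitivity (- (Ci * Ci) * (2 * PI * / INR (fact L) * D)); [ring|].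
replace (Ci * Ci) with (- RtoC 1).
- ring.
- unfold Ci, Cmult, Copp, RtoC. simpl. f_equal; ring.
Qed.

Lemma F_series_near_0 : locally (RtoC 0) (fun eps =>
  ex_series (F_coef L beta eps z) /\ ex_series (F_coef L beta eps (Cconj z))).
Proof.
apply locally_C. exists (mkposreal r (proj1 Hr)). intros e He.
assert (He' : disc 0 r' e).
{ unfold disc. apply Rlt_trans with r; [|lra]. exact He. }
split; eexists.
- exact (F_series L beta z r' M Hz Hrad HM HMb z e eq_refl He').
- exact (F_series L beta z r' M Hz Hrad HM HMb (Cconj z) e (Cmod_conj z) He').
Qed.

Lemma residue_function_differentiable : C_differentiable_n (residue_function L beta z) L 0.
Proof.
intros k _. apply locally_C. exists (mkposreal r (proj1 Hr)). intros e He.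
destruct (Cauchy_derive_n (residue_function L beta z) 0 r r' Hr
  (holomorphic_residue_function L beta z r r' M Hz Hrad Hr HM HMb) k e He) as [_ [l Hl]].
exists l. exact Hl.
Qed.

End Main.

(* The convergence and differentiability clauses assert that every integral,
   sum and derivative in the two equalities exists. *)
Theorem proposition6 (L : nat) (beta : C)
  (hbeta : (0 < Re beta)%R) (hbetaZ : forall m : Z, beta <> RtoC (IZR m))
  (gam : nat -> R -> C) (hgam : forall n : nat, is_ladder_contour beta n (gam n))
  (z : C) (hz : (0 < Cmod z < 1)%R) :
  ladder_converges L beta gam z /\
  (forall n : Z,
     contour_integrable (gam (Z.abs_nat n)) (mellin_integrand L beta z n)) /\
  ex_CSeries_Z (mellin_term L beta gam z) /\
  locally (RtoC 0) (fun eps =>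
    ex_series (F_coef L beta eps z) /\ ex_series (F_coef L beta eps (Cconj z))) /\
  C_differentiable_n (residue_function L beta z) L 0 /\
  ladder L beta gam z =
    Rcpow 4 (- (beta * INR (S L))) * CSeries_Z (mellin_term L beta gam z) /\
  Rcpow 4 (- (beta * INR (S L))) * CSeries_Z (mellin_term L beta gam z) =
    RtoC (2 * PI / INR (fact L)) * Rcpow 4 (- (beta * INR (S L))) *
    C_derive_n (residue_function L beta z) L 0.
Proof.
destruct (radius_exists beta hbetaZ) as [r' Hrad].
destruct (coef_bound L beta r' hbeta Hrad) as [M [HM HMb]].
assert (r0 := proj1 (proj1 Hrad)).
(* Any radius strictly below [r'] serves: the integrands have to be regular in a larger disc than
   the one bounded by the circle. *)
set (r := (r' / 2)%R). assert (Hr : (0 < r < r')%R) by (unfold r; lra).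
split; [|split; [|split; [|split; [|split; [|split]]]]].
- split.
  + intros n. apply (ladder_contour_integral L beta z gam r r' hbeta hz Hrad Hr hgam n).
  + eexists. apply (ladder_series L beta z gam r r' M hbeta hz Hrad Hr HM HMb hgam).
- intros n. apply (mellin_contour_integral L beta z gam r r' hbeta hz Hrad Hr hgam n).
- split; eexists.
  + apply (mellin_series_nonneg L beta z gam r r' M hbeta hz Hrad Hr HM HMb hgam).
  + apply (mellin_series_neg L beta z gam r r' M hbeta hz Hrad Hr HM HMb hgam).
- exact (F_series_near_0 L beta z r r' M hz Hrad Hr HM HMb).
- exact (residue_function_differentiable L beta z r r' M hz Hrad Hr HM HMb).
- exact (ladder_mellin_sum L beta z gam r r' M hbeta hz Hrad Hr HM HMb hgam).
- rewrite (mellin_sum_derivative L beta z gam r r' M hbeta hz Hrad Hr HM HMb hgam). ring.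
Qed.
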